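(* Let $n\in\mathbb{N}$, $n\geq 1$, let $\Omega\subset\mathbb{R}^n$ be bounded and open, and let $E:\mathbb{R}^n\times\mathbb{R}\times\mathbb{R}^n\to\mathbb{R}$ satisfy, for any $x\in\mathbb{R}^n$, $\tau\in\mathbb{R}$ and $\xi\in\mathbb{R}^n$, $$\lambda_\star\big(|\xi|^p+|1-\tau^2|^m\big)\leq E(x,\tau,\xi)\leq\Lambda_\star\big(|\xi|^p+|1-\tau^2|^m\big),$$ for some $\lambda_\star\in(0,1]$, $\Lambda_\star\in[1,+\infty)$, $p\in(1,+\infty)$ and $m\in(p,+\infty)$. Suppose that $$\frac{pm}{m-p}>n.$$ Let $Q\in[1,+\infty)$. Consider an infinitesimal sequence of positive numbers $\varepsilon$ and let $u_\varepsilon\in W^{1,\infty}(\Omega,[-1,1])$ be a sequence of $Q$-minima in $\Omega$ for the functional $$\mathcal{E}^{\varepsilon}_{\Omega}(v):=\frac1\varepsilon\int_\Omega E\big(x,v(x),\varepsilon\nabla v(x)\big)\,dx,$$ with $$\sup_{\varepsilon}\,\varepsilon\|\nabla u_\varepsilon\|_{L^\infty(\Omega)}<+\infty\qquad\text{and}\qquad\sup_\varepsilon\,\mathcal{E}^{\varepsilon}_{\Omega}(u_\varepsilon)<+\infty.$$ Then there exists $E_0\subseteq\Omega$ such that, up to a subsequence, $u_\varepsilon$ converges to $\chi_{E_0}-\chi_{\mathbb{R}^n\setminus E_0}$ in $L^1_{\rm loc}(\Omega)$. Furthermore, given any $\Theta\in(0,1)$, the set $\{|u_\varepsilon|\leq\Theta\}$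 converges (along this subsequence) to $\partial E_0$ in the Hausdorff distance locally uniformly in $\Omega$, in the following sense: for any $\delta,R>0$ for which $B_R\Subset\Omega$, there exists $\varepsilon_0(\delta,R,\Theta)>0$ such that if $\varepsilon\in\big(0,\varepsilon_0(\delta,R,\Theta)\big)$ (with $\varepsilon$ in the subsequence) then $$\{|u_\varepsilon|\leq\Theta\}\cap B_R\subseteq\bigcup_{x\in\partial E_0}B_\delta(x).$$
   Context: $\chi_A$ is the characteristic function of the set $A$, $B_\delta(x)$ is the ball of radius $\delta$ centered at $x$, and $B_R$ is the ball of radius $R$ centered at the origin of $\mathbb{R}^n$. $W^{1,\infty}(\Omega,[-1,1])$ denotes the functions in $W^{1,\infty}(\Omega)$ with values in $[-1,1]$. It is understood that $E$ is such that the energy integrals are well defined. For an open set $\Omega'$, $\mathcal{E}^{\varepsilon}_{\Omega'}$ is defined as $\mathcal{E}^{\varepsilon}_{\Omega}$ with integration over $\Omega'$. Given $Q\in[1,+\infty)$, a function $u\in W^{1,p}(\Omega)$ is a $Q$-minimum in $\Omega$ for $\mathcal{E}^{\varepsilon}$ if, for any open and bounded set $\Omega'\Subset\Omega$, one has $\mathcal{E}^{\varepsilon}_{\Omega'}(u)<+\infty$ and $\mathcal{E}^{\varepsilon}_{\Omega'}(u)\leq Q\,\mathcal{E}^{\varepsilon}_{\Omega'}(v)$ for any $v\in W^{1,p}(\Omega')$ with $u-v\in W^{1,p}_0(\Omega')$. The constant $Q$ is the same for all $\varepsilon$ in the sequence. *)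

(* Defs.v *)
From HB Require Import structures.
From mathcomp Require Import all_boot all_order all_algebra.
From mathcomp Require Import all_classical all_reals all_analysis.

Set Implicit Arguments.
Unset Strict Implicit.
Unset Printing Implicit Defensive.

Import Order.TTheory GRing.Theory Num.Theory.
Import numFieldNormedType.Exports.

Local Open Scope classical_set_scope.
Local Open Scope ring_scope.

(* ['rV[R]_n] carries the sigma-algebra generated by the coordinates, which is
   the Borel sigma-algebra of its topology. *)
Section borel_rV.
Context (R : realType) (n : nat).

Let coor (i : 'I_n) (x : 'rV[R]_n) : measurableTypeR R := x ord0 i.

Let rV_set0 : g_sigma_preimage coor set0.
Proof. exact: sigma_algebra0. Qed.

Let rV_setC A : g_sigma_preimage coor A -> g_sigma_preimage coor (~` A).
Proof. exact: sigma_algebraC. Qed.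

Let rV_bigcup (F : _^nat) : (forall i, g_sigma_preimage coor (F i)) ->
  g_sigma_preimage coor (\bigcup_i (F i)).
Proof. exact: sigma_algebra_bigcup. Qed.

HB.instance Definition _ := @isMeasurable.Build default_measure_display
  'rV[R]_n (g_sigma_preimage coor) rV_set0 rV_setC rV_bigcup.

Lemma measurable_coor (i : 'I_n) :
  measurable_fun [set: 'rV[R]_n] (fun x => x ord0 i : measurableTypeR R).
Proof.
move=> _ Y mY; rewrite setTI; apply: sub_sigma_algebra => /=.
rewrite -bigcup_seq/=; exists i => /=; first by rewrite mem_index_enum.
by exists Y => //; rewrite setTI.
Qed.

Lemma measurable_fun_coorP d (T : measurableType d) (f : T -> 'rV[R]_n) :
  (forall i, measurable_fun [set: T] (fun x => f x ord0 i : measurableTypeR R)) ->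
  measurable_fun [set: T] f.
Proof.
move=> mf _ A; rewrite setTI; move: A.
apply: (@smallest_sub _ _ _ [set A | measurable (f @^-1` A)]).
  split=> [|A /= mA|F /= mF].
  - by rewrite /= preimage_set0.
  - by rewrite setTD -preimage_setC; exact: measurableC.
  - by rewrite preimage_bigcup; exact: bigcupT_measurable.
rewrite -bigcup_seq; apply: bigcup_sub => i _ _ [B mB <-] /=.
by rewrite setTI -comp_preimage -[X in measurable X]setTI; exact: mf.
Qed.

End borel_rV.

(* Lebesgue measure on R^n, by recursion on n: [leb 0] is the unit mass on the
   point of R^0, and [leb n.+1] is the product of the Lebesgue measure of R
   with [leb n], transported by (t, x) |-> (t, x_0, ..., x_{n-1}). *)
Section lebesgue_rV.
Context (R : realType).

Definition cons_rV n (p : measurableTypeR R * 'rV[R]_n) : 'rV[R]_n.+1 :=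
  row_mx (p.1%:M : 'rV[R]_1) p.2.

Definition uncons_rV n (x : 'rV[R]_n.+1) : measurableTypeR R * 'rV[R]_n :=
  (x ord0 ord0, rsubmx (x : 'rV[R]_(1 + n))).

Lemma cons_rV0 n p : @cons_rV n p ord0 ord0 = p.1.
Proof.
have -> : ord0 = lshift n (ord0 : 'I_1) by exact: val_inj.
by rewrite (row_mxEl (p.1%:M : 'rV[R]_1) p.2) mxE eqxx mulr1n.
Qed.

Lemma cons_rVS n p (j : 'I_n) : @cons_rV n p ord0 (rshift 1 j) = p.2 ord0 j.
Proof. exact: (row_mxEr (p.1%:M : 'rV[R]_1) p.2). Qed.

Lemma cons_rVK n : cancel (@cons_rV n) (@uncons_rV n).
Proof. by move=> [t x]; rewrite /uncons_rV cons_rV0 row_mxKr. Qed.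

Lemma measurable_cons_rV n : measurable_fun [set: _] (@cons_rV n).
Proof.
apply: measurable_fun_coorP => i.
case: (split_ordP (i : 'I_(1 + n))) => j ->.
  have -> : lshift n j = ord0 by rewrite (ord1 j); exact: val_inj.
  by under eq_fun do rewrite cons_rV0; exact: measurable_fst.
under eq_fun do rewrite cons_rVS.
exact: (measurableT_comp (@measurable_coor R n j) measurable_snd).
Qed.

Lemma measurable_uncons_rV n : measurable_fun [set: _] (@uncons_rV n).
Proof.
apply/measurable_fun_pairP; split; first exact: measurable_coor.
apply: measurable_fun_coorP => i.
rewrite (_ : (fun _ => _) = (fun x : 'rV[R]_n.+1 => x ord0 (rshift 1 i))).
  exact: measurable_coor.
by apply/funext => x; rewrite /= mxE.
Qed.

Section step.
Variables (n : nat) (mu : {sigma_finite_measure set 'rV[R]_n -> \bar R}).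

Definition leb_step : set 'rV[R]_n.+1 -> \bar R :=
  pushforward (@lebesgue_measure R \x mu)%E (@cons_rV n).

HB.instance Definition _ := Measure.copy leb_step
  (measure_function_pushforward__canonical__measure_function_Measure
    (@lebesgue_measure R \x mu)%E (@measurable_cons_rV n)).

Let leb_step_sigma_finite : sigma_finite setT leb_step.
Proof.
have /sigma_finiteP[F [TF ndF Foo]] := sigma_finiteT (@lebesgue_measure R).
have /sigma_finiteP[G [TG ndG Goo]] := sigma_finiteT mu.
exists (fun i => @uncons_rV n @^-1` (F i `*` G i)).
  rewrite -preimage_bigcup -[LHS](preimage_setT (@uncons_rV n)); congr (_ @^-1` _).
  rewrite -setXTT TF TG predeqE => -[x y]; split.
    move=> [/= [i _ Fix] [k _ Gky]]; exists (maxn i k) => //; split.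
    - by move: x Fix; exact/subsetPset/ndF/leq_maxl.
    - by move: y Gky; exact/subsetPset/ndG/leq_maxr.
  by move=> [i _ []/= ? ?]; split; exists i.
move=> i; have [mF Fioo] := Foo i; have [mG Gioo] := Goo i.
have mFG : measurable (F i `*` G i) by exact: measurableX.
split.
  by rewrite -[X in measurable X]setTI; exact: measurable_uncons_rV.
rewrite /leb_step /pushforward -comp_preimage.
rewrite (_ : _ \o _ = id); last by apply/funext; exact: cons_rVK.
by rewrite preimage_id product_measure1E// lte_mul_pinfty// ge0_fin_numE.
Qed.

HB.instance Definition _ :=
  @Measure_isSigmaFinite.Build _ _ _ leb_step leb_step_sigma_finite.

End step.

Fixpoint leb (n : nat) : {sigma_finite_measure set 'rV[R]_n -> \bar R} :=
  match n with
  | 0 => \d_(0 : 'rV[R]_0)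
  | n'.+1 => leb_step (leb n')
  end.

End lebesgue_rV.

Section euclidean.
Context (R : realType) (n : nat).
Implicit Types (x y : 'rV[R]_n) (A B : set 'rV[R]_n).

(* The library norm of ['rV[R]_n] is the sup norm; it defines the topology,
   while balls and gradients are measured with the Euclidean norm. *)
Definition enorm x : R := Num.sqrt (\sum_(i < n) x ord0 i ^+ 2).

Definition eball x (r : R) : set 'rV[R]_n := [set y | enorm (y - x) < r].

Definition boundary A : set 'rV[R]_n := closure A `\` interior A.

Definition compactly_contained A B : Prop :=
  compact (closure A) /\ closure A `<=` B.

(* [E] is normalised in [D]: its topological boundary inside [D] consists of
   the points all of whose neighbourhoods meet both [E] and its complement in
   positive measure. Every measurable set has such a representative up to a
   null set. *)
Definition normalized_in (D E : set 'rV[R]_n) : Prop :=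
  forall x, D x ->
    (boundary E x <-> forall r : R, 0 < r ->
       (0 < leb R n (E `&` eball x r) < leb R n (eball x r))%E).

End euclidean.

Section sobolev.
Context (R : realType) (n : nat).
Implicit Types (D : set 'rV[R]_n) (u v f : 'rV[R]_n -> R)
  (g du dv : 'rV[R]_n -> 'rV[R]_n) (p : \bar R).

Definition pderiv (i : 'I_n) f (x : 'rV[R]_n) : R := 'D_(delta_mx ord0 i) f x.

Fixpoint Ck (k : nat) f : Prop :=
  continuous f /\
  match k with
  | 0 => True
  | k'.+1 => forall i : 'I_n,
      (forall x, derivable f x (delta_mx ord0 i)) /\ Ck k' (pderiv i f)
  end.

Definition test_function D f : Prop :=
  (forall k, Ck k f) /\ compactly_contained [set x | f x != 0] D.

Definition Lp_norm D p f : \bar R := 'N[leb R n]_p[EFin \o (f \_ D)].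

Definition in_Lp D p f : Prop :=
  measurable_fun D f /\ (Lp_norm D p f < +oo)%E.

Definition weak_gradient D u g : Prop :=
  forall (i : 'I_n) phi, test_function D phi ->
    (\int[leb R n]_(x in D) (u x * pderiv i phi x)%:E =
     - \int[leb R n]_(x in D) (g x ord0 i * phi x)%:E)%E.

(* u belongs to W^{1,p}(D) and du is (a Borel version of) its weak gradient. *)
Definition W1p D p u du : Prop :=
  [/\ in_Lp D p u, forall i, in_Lp D p (fun x => du x ord0 i) &
      weak_gradient D u du].

(* W^{1,p}_0(D) is the closure of the test functions in W^{1,p}(D). *)
Definition W1p0 D p u du : Prop :=
  W1p D p u du /\
  exists phi : nat -> 'rV[R]_n -> R,
    [/\ forall k, test_function D (phi k),
        (fun k => Lp_norm D p (fun x => u x - phi k x)) @ \oo --> 0%E &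
        forall i : 'I_n,
          (fun k => Lp_norm D p (fun x => du x ord0 i - pderiv i (phi k) x))
            @ \oo --> 0%E].

(* Measurability with respect to the Lebesgue (completed) sigma-algebra. *)
Definition lebesgue_measurable_fun D f : Prop :=
  exists2 h : 'rV[R]_n -> R, measurable_fun D h &
    {ae leb R n, forall x, D x -> f x = h x}.

End sobolev.

Section energy.
Context (R : realType) (n : nat).
Variables (p : R) (E : 'rV[R]_n -> R -> 'rV[R]_n -> R).
Implicit Types (eps Q : R) (D Om : set 'rV[R]_n) (u v : 'rV[R]_n -> R)
  (du dv : 'rV[R]_n -> 'rV[R]_n).

Definition energy eps D v dv : \bar R :=
  ((eps^-1)%:E * \int[leb R n]_(x in D) (E x (v x) (eps *: dv x))%:E)%E.

(* The integrands being nonnegative, the energies are well defined in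
   [[0, +oo]] as soon as the integrands are Lebesgue measurable. *)
Definition energy_well_defined eps Om : Prop :=
  forall D v dv, open D -> D `<=` Om -> W1p D p%:E v dv ->
    lebesgue_measurable_fun D (fun x => E x (v x) (eps *: dv x)).

Definition Q_minimum Q eps Om u du : Prop :=
  W1p Om p%:E u du /\
  forall D, open D -> bounded_set D -> compactly_contained D Om ->
    (energy eps D u du < +oo)%E /\
    forall v dv, W1p D p%:E v dv ->
      W1p0 D p%:E (fun x => u x - v x) (fun x => du x - dv x) ->
      (energy eps D u du <= Q%:E * energy eps D v dv)%E.

End energy.

(* Convergence of f to g in L^1_loc(Om). *)
Definition cvg_L1loc (R : realType) (n : nat) (Om : set 'rV[R]_n)
    (f : nat -> 'rV[R]_n -> R) (g : 'rV[R]_n -> R) : Prop :=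
  forall K : set 'rV[R]_n, compact K -> K `<=` Om ->
    (fun k => \int[leb R n]_(x in K) `|f k x - g x|%:E)%E @ \oo --> 0%E.

(* Main.v *)
From HB Require Import structures.
Require Import Defs.
From mathcomp Require Import all_boot all_order all_algebra.
From mathcomp Require Import all_classical all_reals all_analysis.
From mathcomp Require Import measurable_realfun ess_sup_inf.
From mathcomp Require Import ring lra.

Set Implicit Arguments.
Unset Strict Implicit.
Unset Printing Implicit Defensive.

Import Order.TTheory GRing.Theory Num.Theory.
Import numFieldNormedType.Exports.

Local Open Scope classical_set_scope.
Local Open Scope ring_scope.

(* Let F be the energy density |eps grad u|^p + |1 - u^2|^m, and V the indicator
   of {s u > 0}, s = 1 or -1.
   - Caccioppoli: testing the minimality of u against u - eta (u + s), with eta a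
     cutoff between two concentric boxes, bounds the energy in the inner box by
     the integral of F + V + (eps / width)^q over the shell, q = p m / (m - p).
     The exponent q comes from Young's inequality (w t)^p <= w^m + t^q.
   - Separation: the Poincare inequality on a cube of side l, applied to a
     truncation of the mollified phase, shows that one of the phases occupies at
     most C (l / eps) times the energy in the cube.
   - Density: if |u x| <= Theta, then u is away from 1 and -1 in a box of size
     eps around x, by the Lipschitz bound. The two inequalities above, applied
     on the boxes of radius j K eps, then make the integral of F + V grow at
     least like (j eps)^n; the error term is negligible for K large since q > n.
     As the total energy is O(eps), {s u > 0} has volume bounded below in every
     box of fixed radius around x, for both signs s.
   - Compactness: by separation, two phases agreeing on the majority sign of each
     dyadic cell of side l differ by O(l + eps) in L^1. An ultrafilter selects
     the majority signs of a convergent subsequence.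
   - If x stays away from the boundary of the normalised limit set, one of the
     phases has measure 0 in the limit in a box of uniform radius around x, which
     contradicts the density estimate. *)

(** * Topology and Lebesgue measure of R^n *)

(** Balls are replaced by boxes throughout: the topology is that of the sup norm, and cubes fit both
    the product construction of the measure and exact subdivisions.

    The competitor pulls [u] towards the pure phase [- s]; its gradient costs about [(w t)^p] with
    [w = |u + s|] and [t] of order [e / width]. Where [s u <= 0] the potential dominates [w^m] and
    absorbs this term; where [s u > 0] it gives no control, whence the term [V]. The separation
    inequality converts [V] back into [F], but loses a factor [l / e]. On cells of side about
    [j e / T] the loss is affordable: the growth [j^n] has increments of order [j^(n-1)], so the
    recursion tolerates a factor [j / T] once [T] is large. The order of choice is [T], then [c0],
    then [K], the last one making [K^(n-q)] smaller than [c0].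

    Constants are quantified before [e] and [u], since uniformity along the sequence is the whole
    point. Weak derivatives are handled by mollifying [u eta], which is continuous on the whole
    space with a bounded weak gradient, so that closeness is uniform for the function and in L^1 for
    the gradient. *)

Section rV_topology.
Context (R : realType) (n : nat).
Implicit Types (x y c : 'rV[R]_n) (A D : set 'rV[R]_n).

Lemma rV_ballE x (e : R) y : ball x e y <->
  0 < e /\ forall i, `|x ord0 i - y ord0 i| < e.
Proof.
split=> [[e0 H]|[e0 H]]; split=> //.
  by move=> i; have := H ord0 i.
by move=> i j; rewrite (ord1 i); exact: H.
Qed.

Lemma rV_nbhsP x A : nbhs x A <-> exists2 e : R, 0 < e &
  forall y, (forall i, `|y ord0 i - x ord0 i| < e) -> A y.
Proof.
rewrite -nbhs_ballE; split=> [[e /= e0 eA]|[e e0 eA]].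
  by exists e => // y H; apply: eA; apply/rV_ballE; split=> // i; rewrite distrC.
by exists e => // y /rV_ballE[_ H]; apply: eA => i; rewrite distrC.
Qed.

Lemma rV_norm_le x (e : R) : 0 <= e -> (`|x| <= e) <-> forall i, `|x ord0 i| <= e.
Proof.
move=> e0; rewrite {1}/Num.norm/= mx_normrE; split.
  by move=> /bigmax_leP[_ H] i; exact: (H (ord0, i)).
by move=> H; apply/bigmax_leP; split=> // -[i j] _ /=; rewrite (ord1 i).
Qed.

Lemma rV_coord_norm x i : `|x ord0 i| <= `|x|.
Proof. by have /(_ i) := (rV_norm_le x (normr_ge0 x)).1 (lexx _). Qed.

(** An open set is the union of the boxes with rational centre and radius that it contains. The
    containment is part of the set [F qr], so that the union runs over all rational pairs. *)
Lemma open_measurable_rV A : open A -> measurable A.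
Proof.
move=> oA.
pose F (qr : 'rV[rat]_n * rat) : set 'rV[R]_n :=
  [set x | (forall i, `|x ord0 i - ratr (qr.1 ord0 i)| < ratr qr.2) /\
    forall y, (forall i, `|y ord0 i - ratr (qr.1 ord0 i)| < ratr qr.2) -> A y].
have -> : A = \bigcup_qr F qr.
  apply/seteqP; split=> [x Ax|x [qr _ [H1 H2]]]; last exact: H2.
  have /rV_nbhsP[e e0 eA] : nbhs x A by move: oA; rewrite openE; apply.
  have [r /=] := rat_in_itvoo (divr_gt0 e0 (ltr0n R 2)).
  rewrite in_itv/= => /andP[r0 re].
  have q_ i : {q : rat | `|x ord0 i - ratr q| < ratr r}.
    apply: cid; have [q] : exists q : rat, ratr q \in `](x ord0 i - ratr r), (x ord0 i)[.
      by apply: rat_in_itvoo; rewrite ltrBlDr ltrDl.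
    rewrite in_itv/= => /andP[q1 q2]; exists q.
    by rewrite ltr_norml; apply/andP; split; lra.
  exists (\row_i sval (q_ i), r) => //; split=> /=.
    by move=> i; rewrite mxE; exact: (svalP (q_ i)).
  move=> y yq; apply: eA => i; have := yq i; rewrite mxE.
  have := svalP (q_ i); rewrite (distrC (x _ _)).
  move: (sval _) => q h1 h2.
  rewrite (_ : _ - _ = (y ord0 i - ratr q) + (ratr q - x ord0 i)); last by ring.
  by rewrite (le_lt_trans (ler_normD _ _))//; lra.
apply: countable_bigcupT_measurable => // qr.
have [H|H] := pselect (forall y, (forall i, `|y ord0 i - ratr (qr.1 ord0 i)| < ratr qr.2) -> A y); last first.
  rewrite (_ : F qr = set0)//; apply/seteqP; split=> // x [].
  by [].
rewrite (_ : F qr = \bigcap_(i in [set: 'I_n]) [set x | `|x ord0 i - ratr (qr.1 ord0 i)| < ratr qr.2]).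
  have mI i : measurable [set x : 'rV[R]_n | `|x ord0 i - ratr (qr.1 ord0 i)| < ratr qr.2].
    rewrite (_ : [set x | _] = setT `&` (fun x => `|x ord0 i - ratr (qr.1 ord0 i)|) @^-1` `]-oo, ratr qr.2[).
      have mf : measurable_fun [set: 'rV[R]_n] (fun x => `|x ord0 i - ratr (qr.1 ord0 i)|).
        apply: (@measurableT_comp _ _ _ _ _ _ (@Num.norm R R)) => //.
        by apply: measurable_funB => //; exact: measurable_coor.
      by apply: mf => //; exact: measurable_itv.
    by rewrite setTI; apply/seteqP; split=> x /=; rewrite in_itv.
  by apply: fin_bigcap_measurable => // i _; exact: mI.
apply/seteqP; split=> [x [Hx _] i _|x Hx]; [exact: Hx|split=> // i; exact: (Hx i I)].
Qed.

Lemma closed_measurable_rV A : closed A -> measurable A.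
Proof.
by move=> cA; rewrite -(setCK A); apply: measurableC; apply: open_measurable_rV;
  rewrite openC.
Qed.

Lemma continuous_measurable_rV D (f : 'rV[R]_n -> R) : open D ->
  (forall x, D x -> {for x, continuous f}) ->
  measurable_fun D f.
Proof.
move=> oD cf; apply: (measurability _ (RGenOpens.measurableE R)).
move=> _ [_ [a [b ->] <-]]; apply: open_measurable_rV.
rewrite openE => x [Dx fx]; rewrite /interior; apply: filterI.
  by move: oD; rewrite openE; apply.
by apply: (cf x Dx); apply: open_nbhs_nbhs; split => //; exact: interval_open.
Qed.

End rV_topology.

Section leb_basics.
Context (R : realType).
Local Open Scope ereal_scope.

(** The recursive definition makes [leb] the image of a product measure, so Tonelli's theorem peels
    off the first coordinate. The later inductions on the dimension rest on this. *)
Lemma leb_tonelli n (f : 'rV[R]_n.+1 -> \bar R) : measurable_fun setT f ->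
  (forall x, 0 <= f x) ->
  \int[leb R n.+1]_x f x =
  \int[@lebesgue_measure R]_t \int[leb R n]_x f (cons_rV (t, x)).
Proof.
move=> mf f0.
rewrite (@ge0_integral_pushforward _ _ _ _ _ _ (@measurable_cons_rV R n) (@lebesgue_measure R \x leb R n) setT f)//.
rewrite preimage_setT fubini_tonelli1//.
  exact: (measurableT_comp mf (@measurable_cons_rV R n)).
by move=> x; exact: f0.
Qed.

Lemma measurable_leb_slice n (f : 'rV[R]_n.+1 -> \bar R) : measurable_fun setT f ->
  (forall x, 0 <= f x) ->
  measurable_fun setT (fun t : measurableTypeR R => \int[leb R n]_x f (cons_rV (t, x))).
Proof.
move=> mf f0.
apply: (@measurable_fun_fubini_tonelli_F _ _ _ _ _ (leb R n) (fun p => f (cons_rV p))) => //.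
exact: (measurableT_comp mf (@measurable_cons_rV R n)).
Qed.

Lemma measurable_cons_slice n d (T : measurableType d) (f : 'rV[R]_n.+1 -> T) (t : R) :
  measurable_fun setT f -> measurable_fun setT (fun x => f (cons_rV (t, x))).
Proof.
move=> mf; apply: (measurableT_comp mf).
apply: (measurableT_comp (@measurable_cons_rV R n)).
exact: (@pair1_measurable _ _ (measurableTypeR R) _ t).
Qed.

Lemma prod_cons_rV n (f : 'I_n.+1 -> R -> R) t (x : 'rV[R]_n) :
  (\prod_(i < n.+1) f i ((cons_rV (t, x)) ord0 i) =
   f ord0 t * \prod_(i < n) f (lift ord0 i) (x ord0 i))%R.
Proof.
rewrite big_ord_recl cons_rV0; congr (_ * _)%R; apply: eq_bigr => i _.
have -> : lift ord0 i = rshift 1 i :> 'I_n.+1 by exact: val_inj.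
by rewrite cons_rVS.
Qed.

Lemma measurable_prod_coor n (f : 'I_n -> R -> R) :
  (forall i, measurable_fun setT (f i : measurableTypeR R -> R)) ->
  measurable_fun setT (fun x : 'rV[R]_n => (\prod_(i < n) f i (x ord0 i))%R).
Proof.
move=> mf; apply: measurable_prod => i _.
exact: (measurableT_comp (mf i) (@measurable_coor R n i)).
Qed.

(** Serves both for the volume of a cube and for the mass of the mollifier, which are integrals of
    products of functions of one coordinate. *)
Lemma leb_prod n (f : 'I_n -> R -> R) (c : 'I_n -> R) :
  (forall i, measurable_fun setT (f i : measurableTypeR R -> R)) ->
  (forall i t, 0 <= f i t)%R ->
  (forall i, \int[@lebesgue_measure R]_t (f i t)%:E = (c i)%:E) ->
  \int[leb R n]_x (\prod_(i < n) f i (x ord0 i))%:E = (\prod_(i < n) c i)%:E.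
Proof.
elim: n f c => [|n IH] f c mf f0 fc.
  rewrite /= (eq_integral (cst 1)); last by move=> x _; rewrite big_ord0.
  by rewrite integral_cst//= diracT mule1 big_ord0.
have mF m (g : 'I_m -> R -> R) : (forall i, measurable_fun setT (g i : measurableTypeR R -> R)) ->
    measurable_fun setT (fun x : 'rV[R]_m => (\prod_(i < m) g i (x ord0 i))%:E).
  by move=> mg; apply/measurable_EFinP; exact: measurable_prod_coor.
have c0 i : (0 <= c i)%R by rewrite -lee_fin -fc integral_ge0// => t _; rewrite lee_fin.
rewrite leb_tonelli; last 2 first.
- exact: mF.
- by move=> x; rewrite lee_fin; apply: prodr_ge0 => i _.
under eq_integral => t _.
  under eq_integral => x _ do rewrite prod_cons_rV EFinM.
  rewrite ge0_integralZl//; last 3 first.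
  - exact: (mF _ (fun i => f (lift ord0 i))).
  - by move=> x _; rewrite lee_fin; apply: prodr_ge0 => i _.
  - by rewrite lee_fin.
  rewrite (IH (fun i => f (lift ord0 i)) (fun i => c (lift ord0 i)))//.
  over.
rewrite ge0_integralZr//; last 3 first.
- by apply/measurable_EFinP; exact: mf.
- by move=> t _; rewrite lee_fin.
- by rewrite lee_fin; apply: prodr_ge0.
by rewrite fc -EFinM big_ord_recl.
Qed.

(** Half-open, so that a cube is exactly the disjoint union of the cubes of a subdivision. *)
Definition hcube n (c : 'rV[R]_n) (l : R) : set 'rV[R]_n :=
  [set x | forall i, (c ord0 i <= x ord0 i < c ord0 i + l)%R].

Lemma hcubeE n (c : 'rV[R]_n) l x : (\1_(hcube c l) x =
  \prod_(i < n) \1_(`[c ord0 i, (c ord0 i + l)%R[%classic : set R) (x ord0 i) :> R)%R.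
Proof.
rewrite indicE; case: (boolP (x \in _)) => [/set_mem H|/negP H].
  rewrite big1// => i _; rewrite indicE mem_set//=; have := H i.
  by rewrite in_itv.
have [i Hi] : exists i, ~~ (c ord0 i <= x ord0 i < c ord0 i + l)%R.
  apply/existsP; rewrite -negb_forall; apply/negP => /forallP K; apply: H.
  by rewrite inE => i; exact: K.
rewrite (bigD1 i)//= indicE memNset ?mul0r//= in_itv/=; exact/negP.
Qed.

Lemma measurable_hcube n (c : 'rV[R]_n) l : measurable (hcube c l).
Proof.
apply/(measurable_indicP R); rewrite (_ : \1_ _ = fun x : 'rV[R]_n => (\prod_(i < n) \1_(`[c ord0 i, (c ord0 i + l)%R[%classic : set R) (x ord0 i) :> R)%R); last first.
  by apply/funext => x; rewrite hcubeE.
apply: (@measurable_prod_coor n (fun i => \1_(`[c ord0 i, (c ord0 i + l)%R[%classic : set R) : R -> R)) => i.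
apply: measurable_indic; exact: measurable_itv.
Qed.

Lemma leb_hcube n (c : 'rV[R]_n) l : (0 <= l)%R -> leb R n (hcube c l) = (l ^+ n)%:E.
Proof.
move=> l0; rewrite -[hcube c l]setIT -integral_indic//; last exact: measurable_hcube.
under eq_integral do rewrite hcubeE.
rewrite (@leb_prod n (fun i => \1_(`[c ord0 i, (c ord0 i + l)%R[%classic : set R) : R -> R) (fun=> l)).
- by rewrite prodr_const card_ord.
- by move=> i; apply: measurable_indic; exact: measurable_itv.
- by move=> i t; rewrite indicE.
- move=> i; rewrite integral_indic//= setIT lebesgue_measure_itv/= lte_fin.
  rewrite ltrDl; case: ltgtP l0 => // [l0 _|<- _]//; rewrite -EFinD; congr EFin; by ring.
Qed.

Lemma hcube_cons n (c : 'rV[R]_n.+1) l t (x : 'rV[R]_n) :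
  hcube c l (cons_rV (t, x)) <->
  (c ord0 ord0 <= t < c ord0 ord0 + l)%R /\ hcube (rsubmx (c : 'rV[R]_(1 + n))) l x.
Proof.
split=> [H|[H0 H] i].
  split; first by have := H ord0; rewrite cons_rV0.
  by move=> i; have := H (rshift 1 i); rewrite cons_rVS mxE.
case: (split_ordP (i : 'I_(1 + n))) => j ->.
  have -> : lshift n j = ord0 by rewrite (ord1 j); exact: val_inj.
  by rewrite cons_rV0.
by rewrite cons_rVS; have := H j; rewrite mxE.
Qed.

End leb_basics.

(** * Smooth cutoff functions *)

Section derive_line.
Context (R : realType) (V : normedModType R).

(** The two difference quotients are the same function, so one-variable results transfer to
    directional derivatives. *)
Lemma is_derive_lineP (f : V -> R) x v (s d : R) :
  is_derive s 1 (fun t : R => f (t *: v + x)) d <-> is_derive (s *: v + x) v f d.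
Proof.
have E : (fun h : R => h^-1 *: (((fun t : R => f (t *: v + x)) \o shift s) (h *: (1 : R)) - f (s *: v + x))) =
    (fun h : R => h^-1 *: ((f \o shift (s *: v + x)) (h *: v) - f (s *: v + x))).
  by apply/funext => h /=; rewrite [h *: 1]mulr1 scalerDl -addrA.
by split=> -[H1 H2]; split; move: H1 H2; rewrite /derivable/= /derive ?E// -?E.
Qed.

End derive_line.

Section derive_fun.
Context (R : realType) (V : normedModType R).
Implicit Types (f g : V -> R) (x v : V).

Lemma is_derive_fD f g x v df dg : is_derive x v f df -> is_derive x v g dg ->
  is_derive x v (fun y => f y + g y) (df + dg).
Proof. by move=> ? ?; exact: is_deriveD. Qed.

Lemma is_derive_fB f g x v df dg : is_derive x v f df -> is_derive x v g dg ->
  is_derive x v (fun y => f y - g y) (df - dg).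
Proof. by move=> ? ?; exact: is_deriveB. Qed.

Lemma is_derive_fM f g x v df dg : is_derive x v f df -> is_derive x v g dg ->
  is_derive x v (fun y => f y * g y) (df * g x + f x * dg).
Proof.
move=> Df Dg; apply: (is_derive_eq (is_deriveM Df Dg)).
by rewrite /GRing.scale/= addrC mulrC.
Qed.

(** Only a directional derivative of [f] is assumed; restriction to the line through [x] reduces the
    claim to the one-variable chain rule. *)
Lemma is_derive_fcomp (h : R -> R) f x v dh df :
  is_derive (f x) 1 h dh -> is_derive x v f df ->
  is_derive x v (fun y => h (f y)) (dh * df).
Proof.
move=> Dh Df.
have E : x = 0 *: v + x by rewrite scale0r add0r.
rewrite E; apply/is_derive_lineP.
apply: (@is_derive1_comp _ h (fun t : R => f (t *: v + x))).
  by rewrite -E.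
by apply/is_derive_lineP; rewrite -E.
Qed.

End derive_fun.

Section smooth_step.
Context (R : realType).
Implicit Types (t a b : R) (k : nat).

(** The derivatives of [exp (- 1 / t)] are linear combinations of these functions, which turns
    smoothness at 0 into algebra. *)
Definition expinv k t : R := if 0 < t then t ^- k * expR (- t^-1) else 0.

Lemma expinv_ge0 k t : 0 <= expinv k t.
Proof.
by rewrite /expinv; case: ifPn => // t0; rewrite mulr_ge0 ?expR_ge0// invr_ge0 exprn_ge0// ltW.
Qed.

Lemma expinv_le0 k t : t <= 0 -> expinv k t = 0.
Proof. by move=> t0; rewrite /expinv ltNge t0. Qed.

(** With [x = 1 / t], raise [x / k <= exp (x / k)] to the power [k]. *)
Lemma expinv_bound k t : expinv k t <= (k ^ k)%:R.
Proof.
rewrite /expinv; case: ifPn => // t0.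
have x0 : 0 < t^-1 by rewrite invr_gt0.
rewrite expRN -exprVn ler_pdivrMr ?expR_gt0//.
case: k => [|k].
  by rewrite expr0 expn0 mul1r -expR0 ler_expR ltW.
have k0 : 0 < (k.+1%:R : R) by rewrite ltr0n.
have : (t^-1 / k.+1%:R) ^+ k.+1 <= expR (t^-1 / k.+1%:R) ^+ k.+1.
  rewrite ler_pXn2r ?nnegrE ?expR_ge0// ?divr_ge0 ?ltW//.
  by rewrite (lt_le_trans _ (expR_ge1Dx _))// ltrDr.
rewrite -expRM_natl -mulr_natl mulrCA divff ?mulr1 ?gt_eqF// expr_div_n ler_pdivrMr ?exprn_gt0//.
by rewrite natrX mulrC.
Qed.

Lemma expinvS k t : expinv k t = t * expinv k.+1 t.
Proof.
rewrite /expinv; case: ifPn => t0; last by rewrite mulr0.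
by rewrite mulrA exprS invfM mulrA divff ?mul1r// gt_eqF.
Qed.

Lemma is_derive_expinv k t :
  is_derive t 1 (expinv k) (expinv k.+2 t - k%:R * expinv k.+1 t).
Proof.
have [t0|t0|->] := ltgtP t 0.
- rewrite !expinv_le0 ?ltW// mulr0 subrr.
  apply: (@near_eq_is_derive _ _ _ (cst 0)).
  near=> y; rewrite expinv_le0//= ltW//; near: y; exact: lt_nbhsl.
- apply: (@near_eq_is_derive _ R R (fun y : R => (y ^+ k)^-1 * expR (- y^-1))).
    by near=> y; rewrite /expinv ifT//; near: y; exact: lt_nbhsr.
  have t1 : t != 0 by rewrite gt_eqF.
  have tk : t ^+ k != 0 by rewrite expf_neq0.
  have D1 : is_derive t 1 (fun y : R => y^-1) (- t ^- 2 *: 1) by exact: is_deriveV.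
  have D2 : is_derive t 1 (fun y : R => (y ^+ k)^-1) (- (t ^+ k) ^- 2 *: (k%:R * t ^+ k.-1 * 1)).
    apply: is_deriveV => //.
    by have := is_deriveX k (is_derive_id t (1 : R)); rewrite exprfctE.
  have D3 : is_derive t 1 (fun y => expR (- y^-1)) (expR (- t^-1) * - (- t ^- 2 *: 1)).
    apply: (@is_derive_fcomp R R expR (fun y => - y^-1)).
  apply: (is_derive_eq (is_derive_fM D2 D3)).
  rewrite /expinv t0 /GRing.scale/=.
  have -> : k%:R * t ^+ k.-1 * 1 = k%:R * t ^+ k * t^-1.
    by case: (k) => [|k']; rewrite ?mul0r// mulr1 exprSr -!mulrA divff ?mulr1.
  by rewrite !exprS; field; apply/andP.
- rewrite !(expinv_le0 _ (lexx 0)) mulr0 subrr.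
  (* At 0 the slope function is [expinv k.+1], by [expinvS]; it is continuous there because it is
     [t] times the bounded function [expinv k.+2]. *)
  apply/is_derive1_caratheodory; exists (expinv k.+1); split=> //.
  + by move=> z; rewrite (expinv_le0 _ (lexx 0)) !subr0 mulrC -expinvS.
  + apply/cvgrPdist_le => /= e e0.
    rewrite (expinv_le0 _ (lexx 0)); near=> z.
    rewrite sub0r normrN expinvS normrM (ger0_norm (expinv_ge0 _ _)).
    rewrite (le_trans (ler_wpM2l _ (expinv_bound _ _)))//.
    rewrite -ler_pdivlMr ?ltr0n ?expn_gt0//; near: z.
    have := @nbhs0_le R R (e / (k.+2 ^ k.+2)%:R).
    by apply; rewrite divr_gt0// ltr0n expn_gt0.
  + exact: expinv_le0.
Unshelve. all: by end_near. Qed.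

(** The classical smooth transition [f t / (f t + f (1 - t))] with [f = expinv 0]. The reciprocal is
    a function of its own because its derivative is a polynomial in [expinv] and [step_inv]; the
    class [smooth] below then needs no division. *)
Definition step_den t := expinv 0 t + expinv 0 (1 - t).
Definition step_inv t := (step_den t)^-1.
Definition step t := expinv 0 t * step_inv t.
Definition step' t := expinv 2 t * step_inv t -
  expinv 0 t * (expinv 2 t - expinv 2 (1 - t)) * (step_inv t * step_inv t).

Lemma expinv0_gt t : 2^-1 <= t -> expR (- 2) <= expinv 0 t.
Proof.
move=> t2; have t0 : 0 < t by apply: lt_le_trans t2.
rewrite /expinv t0 expr0 invr1 mul1r ler_expR lerN2 -[leRHS]invrK.
by rewrite lef_pV2// posrE.
Qed.

(** One of [t] and [1 - t] is at least 1/2. *)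
Lemma step_den_gt t : expR (- 2) <= step_den t.
Proof.
have [t2|t2] := leP (2^-1) t.
  by rewrite ler_wpDr ?expinv_ge0// expinv0_gt.
by rewrite ler_wpDl ?expinv_ge0// expinv0_gt//; lra.
Qed.

Lemma step_den_gt0 t : 0 < step_den t.
Proof. exact: lt_le_trans (expR_gt0 _) (step_den_gt t). Qed.

Lemma step_inv_ge0 t : 0 <= step_inv t.
Proof. by rewrite invr_ge0 ltW// step_den_gt0. Qed.

Lemma step_inv_bound t : step_inv t <= expR 2.
Proof.
rewrite /step_inv -[leRHS]invrK lef_pV2 ?posrE ?step_den_gt0 ?invr_gt0 ?expR_gt0//.
by rewrite -expRN step_den_gt.
Qed.

Lemma is_derive_step_inv t :
  is_derive t 1 step_inv (- ((expinv 2 t - expinv 2 (1 - t)) * (step_inv t * step_inv t))).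
Proof.
have D1 := is_derive_expinv 0 t.
have D0 := is_derive_expinv 0 (1 - t).
have D2 : is_derive t 1 (fun y => expinv 0 (1 - y)) ((expinv 2 (1 - t) - 0%:R * expinv 1 (1 - t)) * (0 - 1)).
  apply: (@is_derive_fcomp R R (expinv 0) (fun y => 1 - y) t 1 _ _ D0).
have D3 : is_derive t 1 step_den (expinv 2 t - expinv 2 (1 - t)).
  by apply: (is_derive_eq (is_derive_fD D1 D2)); ring.
have H : is_derive t 1 step_inv (- (step_den t) ^- 2 *: (expinv 2 t - expinv 2 (1 - t))).
  by apply: is_deriveV => //; rewrite gt_eqF// step_den_gt0.
apply: (is_derive_eq H); rewrite /GRing.scale/= /step_inv; field.
by rewrite gt_eqF// step_den_gt0.
Qed.

Lemma is_derive_step t : is_derive t 1 step (step' t).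
Proof.
have D1 := is_derive_expinv 0 t.
have D2 := is_derive_step_inv t.
by apply: (is_derive_eq (is_derive_fM D1 D2)); rewrite /step'; ring.
Qed.

Lemma step_le0 t : t <= 0 -> step t = 0.
Proof. by move=> t0; rewrite /step expinv_le0// mul0r. Qed.

Lemma step_ge1 t : 1 <= t -> step t = 1.
Proof.
move=> t1; have E : step_den t = expinv 0 t.
  by rewrite /step_den (@expinv_le0 _ (1 - t)) ?addr0//; lra.
by rewrite /step /step_inv -E divff// gt_eqF// step_den_gt0.
Qed.

(** In this form the sign, the support in [0, 1] and the bound of the derivative can be read off. *)
Lemma step'E t : step' t =
  (expinv 2 t * expinv 0 (1 - t) + expinv 0 t * expinv 2 (1 - t)) * (step_inv t * step_inv t).
Proof.
rewrite /step' -[X in _ * X - _]mulr1 -[in X in X - _](@divff _ (step_den t)) ?gt_eqF ?step_den_gt0//.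
by rewrite -/(step_inv t) {1}/step_den; ring.
Qed.

Lemma step'_ge0 t : 0 <= step' t.
Proof.
by rewrite step'E; rewrite mulr_ge0 ?addr_ge0 ?mulr_ge0 ?expinv_ge0 ?step_inv_ge0.
Qed.

Lemma step'_out t : t <= 0 \/ 1 <= t -> step' t = 0.
Proof.
rewrite step'E => -[t0|t1].
  by rewrite !(expinv_le0 _ t0) !mul0r addr0 mul0r.
have t1' : 1 - t <= 0 by lra.
by rewrite !(expinv_le0 _ t1') !mulr0 addr0 mul0r.
Qed.

Lemma step_01 t : 0 <= step t <= 1.
Proof.
rewrite /step mulr_ge0 ?expinv_ge0 ?step_inv_ge0//= ler_pdivrMr ?step_den_gt0//.
by rewrite mul1r lerDl expinv_ge0.
Qed.

Lemma step'_bound : exists2 M, 0 < M & forall t, step' t <= M.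
Proof.
exists (((2 ^ 2)%:R * (0 ^ 0)%:R + (0 ^ 0)%:R * (2 ^ 2)%:R) * (expR 2 * expR 2)).
  by rewrite mulr_gt0 ?mulr_gt0 ?expR_gt0//; lra.
move=> t; rewrite step'E; apply: ler_pM.
- by rewrite addr_ge0 ?mulr_ge0 ?expinv_ge0.
- by rewrite mulr_ge0 ?step_inv_ge0.
- by apply: lerD; apply: ler_pM; rewrite ?expinv_ge0 ?expinv_bound.
- by apply: ler_pM; rewrite ?step_inv_ge0 ?step_inv_bound.
Qed.

End smooth_step.

Section partial_lipschitz.
Context (R : realType).

Lemma lipschitz_derive (f g : R -> R) (M a b : R) :
  (forall t : R, is_derive t 1 f (g t)) ->
  (forall t, Num.min a b <= t <= Num.max a b -> `|g t| <= M) ->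
  `|f a - f b| <= M * `|a - b|.
Proof.
move=> df; wlog ab : a b / a <= b.
  move=> H gM; have [/H|/ltW/H] := leP a b; first exact.
  by rewrite distrC (distrC b); apply=> t; rewrite minC maxC; exact: gM.
rewrite (min_idPl ab) (max_idPr ab) => gM.
have cf : {within `[a, b], continuous f}.
  apply: continuous_subspaceT => x; apply: differentiable_continuous.
  by apply/derivable1_diffP; exact: (@ex_derive _ _ _ _ _ _ _ (df x)).
have [c cab E] := MVT_segment ab (fun x _ => df x) cf.
by rewrite distrC E normrM (distrC a) ler_wpM2r// gM.
Qed.

Context (n : nat).
Implicit Types (f : 'rV[R]_n -> R) (g : 'I_n -> 'rV[R]_n -> R).

(** Pass from [y] to [x] one coordinate at a time: [z k] has the first [k] coordinates of [x] and
    the others of [y], and each increment of the telescoping sum involves one partial derivative. *)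
Lemma partial_lipschitz f g (M : R) :
  (forall i x, is_derive x (delta_mx ord0 i) f (g i x)) ->
  (forall i x, `|g i x| <= M) ->
  forall x y, `|f x - f y| <= M * \sum_(i < n) `|x ord0 i - y ord0 i|.
Proof.
move=> df gM x y.
pose z (k : nat) : 'rV[R]_n := \row_j (if (j < k)%N then x ord0 j else y ord0 j).
have zn : z n = x by apply/rowP => j; rewrite mxE ltn_ord.
have z0 : z 0%N = y by apply/rowP => j; rewrite mxE.
have zS (k : 'I_n) : z k.+1 = (x ord0 k - y ord0 k) *: delta_mx ord0 k + z k.
  apply/rowP => j; rewrite !mxE eqxx/= ltnS.
  have [->|jk] := eqVneq j k; first by rewrite leqnn ltnn mulr1 subrK.
  rewrite mulr0 add0r leq_eqVlt; congr (if _ then _ else _).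
  by rewrite -[(nat_of_ord j == _)%N]/(j == k) (negbTE jk).
have -> : f x - f y = \sum_(k < n) (f (z k.+1) - f (z k)).
  by rewrite -(big_mkord xpredT (fun k => f (z k.+1) - f (z k))) telescope_sumr// zn z0.
rewrite (le_trans (ler_norm_sum _ _ _))// mulr_sumr ler_sum// => k _.
rewrite zS.
have := @lipschitz_derive (fun t => f (t *: delta_mx ord0 k + z k))
  (fun t => g k (t *: delta_mx ord0 k + z k)) M (x ord0 k - y ord0 k) 0.
rewrite scale0r add0r subr0; apply=> // t.
by apply/is_derive_lineP.
Qed.

Lemma sum_lipschitz_continuous f (M : R) :
  (forall x y, `|f x - f y| <= M * \sum_(i < n) `|x ord0 i - y ord0 i|) ->
  continuous f.
Proof.
move=> fM x; apply/(@cvgrPdist_lt R R _ (nbhs x) _ f (f x)) => e e0.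
pose d := e / (`|M| * n%:R + 1).
have D0 : 0 < `|M| * n%:R + 1 by rewrite ltr_pwDr// mulr_ge0.
have d0 : 0 < d by rewrite divr_gt0.
apply/rV_nbhsP; exists d => // y xy /=.
rewrite (le_lt_trans (fM _ _))//.
apply: (@le_lt_trans _ _ (`|M| * (n%:R * d))).
  apply: (@le_trans _ _ (`|M| * \sum_(i < n) `|x ord0 i - y ord0 i|)).
    by rewrite ler_wpM2r ?ler_norm// sumr_ge0.
  rewrite ler_wpM2l// (_ : n%:R * d = \sum_(i < n) d); last first.
    by rewrite sumr_const card_ord mulr_natl.
  by apply: ler_sum => i _; rewrite distrC ltW.
by rewrite mulrA /d mulrCA gtr_pMr// ltr_pdivrMr// mul1r ltrDl.
Qed.

End partial_lipschitz.

Section smooth_algebra.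
Context (R : realType) (n : nat).
Implicit Types (f g : 'rV[R]_n -> R) (x y : 'rV[R]_n).

(* An algebra of bounded functions, stable under partial derivatives, that
   contains the plateau functions and mollifiers. *)
Inductive smooth : ('rV[R]_n -> R) -> Prop :=
| smooth_cst c : smooth (fun=> c)
| smooth_expinv k i a b : smooth (fun x => expinv k (a * x ord0 i + b))
| smooth_step_inv i a b : smooth (fun x => step_inv (a * x ord0 i + b))
| smooth_add f g : smooth f -> smooth g -> smooth (fun x => f x + g x)
| smooth_mul f g : smooth f -> smooth g -> smooth (fun x => f x * g x).

Lemma smooth_bounded f : smooth f -> exists M, 0 <= M /\ forall x, `|f x| <= M.
Proof.
elim=> {f}[c|k i a b|i a b|f g _ [M [M0 fM]] _ [N [N0 gN]]|f g _ [M [M0 fM]] _ [N [N0 gN]]].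
- by exists `|c|.
- exists (k ^ k)%:R; split=> // x.
  by rewrite ger0_norm ?expinv_ge0 ?expinv_bound.
- exists (expR 2); split=> [|x]; first exact: expR_ge0.
  by rewrite ger0_norm ?step_inv_ge0 ?step_inv_bound.
- exists (M + N); split=> [|x]; first exact: addr_ge0.
  by rewrite (le_trans (ler_normD _ _))// lerD.
- exists (M * N); split=> [|x]; first exact: mulr_ge0.
  by rewrite normrM ler_pM.
Qed.

Lemma is_derive_affine (h : R -> R) (dh : R) x i j (a b : R) :
  is_derive (a * x ord0 i + b) 1 h dh ->
  is_derive x (delta_mx ord0 j) (fun y : 'rV[R]_n => h (a * y ord0 i + b))
    (a * (i == j)%:R * dh).
Proof.
move=> dhx; have E : x = 0 *: delta_mx ord0 j + x by rewrite scale0r add0r.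
rewrite {1}E; apply/is_derive_lineP => /=.
rewrite mulrC.
apply: (@is_derive_fcomp R R h (fun t : R => a * (t *: delta_mx ord0 j + x) ord0 i + b)).
  by rewrite scale0r add0r.
have -> : (fun t : R => a * (t *: delta_mx ord0 j + x) ord0 i + b) =
    (fun t : R => a * (i == j)%:R * t + (a * x ord0 i + b)).
  by apply/funext => t; rewrite !mxE eqxx/= mulrDr addrA mulrA (mulrAC a).
rewrite -[X in is_derive _ _ _ X]addr0.
apply: is_derive_fD.
have := @is_derive_fM R R (cst (a * (i == j)%:R)) id 0 1 0 1.
by rewrite mul0r add0r mulr1; apply.
Qed.

Lemma smooth_derive f : smooth f -> forall i, exists2 g, smooth g &
  forall x, is_derive x (delta_mx ord0 i) f (g x).
Proof.
elim=> {f}[c|k i a b|i a b|f g Sf If Sg Ig|f g Sf If Sg Ig] j.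
- by exists (fun=> 0); [exact: smooth_cst|move=> x; exact: is_derive_cst].
- exists (fun x => a * (i == j)%:R * (expinv k.+2 (a * x ord0 i + b) + (- k%:R) * expinv k.+1 (a * x ord0 i + b))).
    apply: (@smooth_mul (fun=> _)); first exact: smooth_cst.
    apply: smooth_add; first exact: smooth_expinv.
    apply: (@smooth_mul (fun=> _)); first exact: smooth_cst.
    exact: smooth_expinv.
  move=> x; apply: is_derive_affine; rewrite mulNr; exact: is_derive_expinv.
- exists (fun x => a * (i == j)%:R * ((-1) * ((expinv 2 (a * x ord0 i + b) + (-1) * expinv 2 ((- a) * x ord0 i + (1 - b))) *
    (step_inv (a * x ord0 i + b) * step_inv (a * x ord0 i + b))))).
    apply: (@smooth_mul (fun=> _)); first exact: smooth_cst.
    apply: (@smooth_mul (fun=> _)); first exact: smooth_cst.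
    apply: smooth_mul.
      apply: smooth_add; first exact: smooth_expinv.
      apply: (@smooth_mul (fun=> _)); first exact: smooth_cst.
      exact: smooth_expinv.
    by apply: smooth_mul; exact: smooth_step_inv.
  move=> x; apply: is_derive_affine; rewrite !mulN1r.
  rewrite (_ : - a * x ord0 i + (1 - b) = 1 - (a * x ord0 i + b)); last by ring.
  exact: is_derive_step_inv.
- have [f' Sf' Df] := If j; have [g' Sg' Dg] := Ig j.
  exists (fun x => f' x + g' x); first exact: smooth_add.
  by move=> x; exact: is_derive_fD.
- have [f' Sf' Df] := If j; have [g' Sg' Dg] := Ig j.
  exists (fun x => f' x * g x + f x * g' x).
    by apply: smooth_add; exact: smooth_mul.
  by move=> x; exact: is_derive_fM.
Qed.

Lemma smooth_is_derive f i x : smooth f ->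
  is_derive x (delta_mx ord0 i) f (pderiv i f x).
Proof.
move=> /smooth_derive/(_ i)[g _ Dg].
by rewrite /pderiv (@derive_val _ _ _ _ _ _ _ (Dg x)); exact: Dg.
Qed.

Lemma smooth_pderiv f i : smooth f -> smooth (pderiv i f).
Proof.
move=> /smooth_derive/(_ i)[g Sg Dg].
rewrite (_ : pderiv i f = g)//; apply/funext => x.
by rewrite /pderiv (@derive_val _ _ _ _ _ _ _ (Dg x)).
Qed.

Lemma smooth_lipschitz f : smooth f -> exists2 M, 0 <= M &
  forall x y, `|f x - f y| <= M * \sum_(i < n) `|x ord0 i - y ord0 i|.
Proof.
move=> Sf; have H i : {M | 0 <= M /\ forall x, `|pderiv i f x| <= M}.
  by apply/cid/smooth_bounded/smooth_pderiv.
exists (\sum_i sval (H i)).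
  by apply: sumr_ge0 => i _; have [] := svalP (H i).
apply: (@partial_lipschitz R n f (fun i => pderiv i f)) => i x.
  exact: smooth_is_derive.
have [_ /(_ x) Hi] := svalP (H i); rewrite (le_trans Hi)// (bigD1 i)//= lerDl.
by apply: sumr_ge0 => j _; have [] := svalP (H j).
Qed.

Lemma smooth_continuous f : smooth f -> continuous f.
Proof. by move=> /smooth_lipschitz[M _]; exact: sum_lipschitz_continuous. Qed.

Lemma smooth_Ck f k : smooth f -> Ck k f.
Proof.
elim: k f => [|k IH] f Sf; split=> //; try exact: smooth_continuous.
move=> i; split; last exact/IH/smooth_pderiv.
by move=> x; exact: (@ex_derive _ _ _ _ _ _ _ (smooth_is_derive i x Sf)).
Qed.

Lemma smooth_prod m (f : 'I_m -> 'rV[R]_n -> R) : (forall i, smooth (f i)) ->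
  smooth (fun x => \prod_(i < m) f i x).
Proof.
move=> Sf; elim: (index_enum _) => [|i s IH].
  by under eq_fun do rewrite big_nil; exact: smooth_cst.
by under eq_fun do rewrite big_cons; exact: smooth_mul.
Qed.

Lemma smooth_step i a b : smooth (fun x => step (a * x ord0 i + b)).
Proof. by apply: smooth_mul; [exact: smooth_expinv|exact: smooth_step_inv]. Qed.

Lemma smooth_step' i a b : smooth (fun x => step' (a * x ord0 i + b)).
Proof.
rewrite (_ : (fun _ => _) = fun x => (expinv 2 (a * x ord0 i + b) * expinv 0 ((- a) * x ord0 i + (1 - b))
  + expinv 0 (a * x ord0 i + b) * expinv 2 ((- a) * x ord0 i + (1 - b))) * (step_inv (a * x ord0 i + b) * step_inv (a * x ord0 i + b))).
  apply: smooth_mul.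
    by apply: smooth_add; apply: smooth_mul; exact: smooth_expinv.
  by apply: smooth_mul; exact: smooth_step_inv.
apply/funext => x; rewrite step'E.
by rewrite (_ : - a * x ord0 i + (1 - b) = 1 - (a * x ord0 i + b)); last ring.
Qed.

Lemma smooth_reflect f y : smooth f -> smooth (fun x => f (y - x)).
Proof.
elim=> {f}[c|k i a b|i a b|f g _ If _ Ig|f g _ If _ Ig].
- exact: smooth_cst.
- rewrite (_ : (fun _ => _) = fun x : 'rV[R]_n => expinv k ((- a) * x ord0 i + (a * y ord0 i + b))).
    exact: smooth_expinv.
  by apply/funext => x; rewrite !mxE; congr expinv; ring.
- rewrite (_ : (fun _ => _) = fun x : 'rV[R]_n => step_inv ((- a) * x ord0 i + (a * y ord0 i + b))).
    exact: smooth_step_inv.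
  by apply/funext => x; rewrite !mxE; congr step_inv; ring.
- exact: (smooth_add If Ig).
- exact: (smooth_mul If Ig).
Qed.

Lemma pderiv_reflect f i y x : smooth f ->
  pderiv i (fun z => f (y - z)) x = - pderiv i f (y - x).
Proof.
move=> Sf; apply: derive_val.
have E : x = 0 *: delta_mx ord0 i + x by rewrite scale0r add0r.
rewrite {1}E; apply/is_derive_lineP.
rewrite (_ : (fun t => _) = (fun t : R => f ((- t) *: delta_mx ord0 i + (y - x)))); last first.
  by apply/funext => t; rewrite opprD scaleNr addrCA.
rewrite -mulrN1.
apply: (@is_derive_fcomp R R (fun t : R => f (t *: delta_mx ord0 i + (y - x))) (fun t => - t)).
by apply/is_derive_lineP; rewrite oppr0 scale0r add0r; exact: smooth_is_derive.
Qed.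

End smooth_algebra.

(** * Mollification *)

Section bounded_support.
Context (R : realType) (n : nat).
Implicit Types (f g : 'rV[R]_n -> R) (x y : 'rV[R]_n).

(** Bounded, measurable, with bounded support, one constant [M] bounding both the values and the
    support. On this class the real-valued integral is linear and monotone without further
    integrability conditions. *)
Definition bms f := measurable_fun setT f /\
  exists M : R, 0 <= M /\ forall x, `|f x| <= M /\ (M < `|x| -> f x = 0).

Lemma norm_hcube (M : R) x : 0 <= M -> `|x| <= M -> hcube (const_mx (- M)) (M *+ 2 + 1) x.
Proof.
move=> M0 /(rV_norm_le _ M0) H i; have := H i; rewrite mxE ler_norml => /andP[h1 h2].
by apply/andP; split=> //; rewrite mulr2n; lra.
Qed.

Lemma bms_integrable f : bms f -> (leb R n).-integrable setT (EFin \o f).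
Proof.
move=> [mf [M [M0 fM]]]; apply/integrableP; split; first exact/measurable_EFinP.
pose Q := hcube (const_mx (- M) : 'rV[R]_n) (M *+ 2 + 1).
have mQ : measurable Q by exact: measurable_hcube.
apply: (@le_lt_trans _ _ (\int[leb R n]_x (M * \1_Q x)%:E)%E).
  apply: ge0_le_integral => //=.
  - by apply/measurable_EFinP; exact: measurableT_comp.
  - by apply/measurable_EFinP; apply: measurable_funM => //; exact: measurable_indic.
  - move=> x _; rewrite lee_fin; have [xM|xM] := leP `|x| M.
      by rewrite indicE mem_set ?mulr1//; [have [] := fM x|exact: norm_hcube].
    by have [_ ->//] := fM x; rewrite normr0 mulr_ge0.
under eq_integral do rewrite EFinM.
rewrite ge0_integralZl//; last first.
  by apply/measurable_EFinP; exact: measurable_indic.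
rewrite integral_indic//= setIT leb_hcube; last by rewrite mulr2n; lra.
by rewrite -EFinM ltry.
Qed.

Lemma bmsD f g : bms f -> bms g -> bms (fun x => f x + g x).
Proof.
move=> [mf [M [M0 fM]]] [mg [N [N0 gN]]]; split; first exact: measurable_funD.
exists (M + N); split=> [|x]; first exact: addr_ge0.
have [h1 h2] := fM x; have [h3 h4] := gN x; split.
  by rewrite (le_trans (ler_normD _ _))// lerD.
by move=> xMN; rewrite h2 ?h4 ?addr0//; lra.
Qed.

Lemma bmsM f g : bms f -> measurable_fun setT g -> (exists M : R, forall x, `|g x| <= M) ->
  bms (fun x => f x * g x).
Proof.
move=> [mf [M [M0 fM]]] mg [N gN]; split; first exact: measurable_funM.
have N0 : 0 <= N by apply: le_trans (gN 0).
exists (M * N + M); split=> [|x]; first by rewrite addr_ge0 ?mulr_ge0.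
have [h1 h2] := fM x; split.
  by rewrite normrM (@le_trans _ _ (M * N)) ?ler_pM// lerDl.
move=> H; rewrite h2 ?mul0r//; apply: le_lt_trans H.
by rewrite lerDr mulr_ge0.
Qed.

Lemma bms_bounded f : bms f -> exists M : R, forall x, `|f x| <= M.
Proof. by move=> [_ [M [_ H]]]; exists M => x; have [] := H x. Qed.

Lemma bmsZ (a : R) f : bms f -> bms (fun x => a * f x).
Proof.
move=> bf; rewrite (_ : (fun _ => _) = fun x => f x * a); last first.
  by apply/funext => x; rewrite mulrC.
by apply: bmsM => //; exists `|a|.
Qed.

Lemma bmsB f g : bms f -> bms g -> bms (fun x => f x - g x).
Proof.
move=> bf bg; rewrite (_ : (fun _ => _) = fun x => f x + (-1) * g x).
  by apply: bmsD => //; exact: bmsZ.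
by apply/funext => x; rewrite mulN1r.
Qed.

Lemma bms_norm f : bms f -> bms (fun x => `|f x|).
Proof.
move=> [mf [M [M0 fM]]]; split; first exact: measurableT_comp.
exists M; split=> // x; have [h1 h2] := fM x; rewrite normr_id; split=> // /h2 ->.
exact: normr0.
Qed.

Lemma smooth_measurable f : smooth f -> measurable_fun setT f.
Proof.
move=> Sf; apply: continuous_measurable_rV; first exact: openT.
by move=> x _; exact: smooth_continuous.
Qed.

Lemma smooth_abs_bounded f : smooth f -> exists M : R, forall x, `|f x| <= M.
Proof. by move=> /smooth_bounded[M [_ H]]; exists M. Qed.

Lemma bmsM_smooth f g : bms f -> smooth g -> bms (fun x => f x * g x).
Proof.
by move=> bf Sg; apply: bmsM => //; [exact: smooth_measurable|exact: smooth_abs_bounded].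
Qed.

Lemma Rint_le_norm f g : bms f -> bms g -> (forall x, `|f x| <= g x) ->
  `|\int[leb R n]_x f x| <= \int[leb R n]_x g x.
Proof.
move=> bf bg fg; rewrite (le_trans (le_normr_Rintegral _ _))//; first exact: bms_integrable.
by apply: le_Rintegral => //; [exact: (bms_integrable (bms_norm bf))|exact: bms_integrable].
Qed.

Lemma RintD f g : bms f -> bms g ->
  \int[leb R n]_x (f x + g x) = \int[leb R n]_x f x + \int[leb R n]_x g x.
Proof. by move=> bf bg; apply: RintegralD => //; exact: bms_integrable. Qed.

Lemma RintB f g : bms f -> bms g ->
  \int[leb R n]_x (f x - g x) = \int[leb R n]_x f x - \int[leb R n]_x g x.
Proof. by move=> bf bg; apply: RintegralB => //; exact: bms_integrable. Qed.

Lemma RintZ (a : R) f : bms f ->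
  \int[leb R n]_x (a * f x) = a * \int[leb R n]_x f x.
Proof. by move=> bf; apply: RintegralZl => //; exact: bms_integrable. Qed.

End bounded_support.

Section convolution.
Context (R : realType) (n : nat).
Implicit Types (F Phi : 'rV[R]_n -> R) (x y : 'rV[R]_n).

Definition convol F Phi x : R := \int[leb R n]_y (F y * Phi (x - y)).

Lemma bms_conv F Phi x : bms F -> smooth Phi -> bms (fun y => F y * Phi (x - y)).
Proof. by move=> bF SPhi; apply: bmsM_smooth => //; exact: smooth_reflect. Qed.

Lemma conv_lipschitz F Phi : bms F -> smooth Phi -> exists2 M : R, 0 <= M &
  forall x y, `|convol F Phi x - convol F Phi y| <= M * \sum_(i < n) `|x ord0 i - y ord0 i|.
Proof.
move=> bF SPhi; have [L L0 HL] := smooth_lipschitz SPhi.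
have bn := bms_norm bF.
exists (\int[leb R n]_z `|F z| * L).
  by rewrite mulr_ge0// Rintegral_ge0.
move=> x y; rewrite /convol -RintB; [|exact: bms_conv..].
rewrite -mulrA mulrC -RintZ//.
apply: Rint_le_norm => [||z].
- by apply: bmsB; exact: bms_conv.
- exact: bmsZ.
- rewrite -mulrBr normrM [leRHS]mulrC ler_wpM2l// (le_trans (HL _ _))// ler_wpM2l//.
  apply: ler_sum => i _; rewrite !mxE.
  by rewrite (_ : _ - _ = x ord0 i - y ord0 i)//; ring.
Qed.

Lemma conv_continuous F Phi : bms F -> smooth Phi -> continuous (convol F Phi).
Proof. by move=> bF /(conv_lipschitz bF)[M _]; exact: sum_lipschitz_continuous. Qed.

(** The derivative is Lipschitz, so the quadratic remainder is uniform in [z]; a convolution can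
    then be differentiated under the integral by a direct estimate. *)
Lemma smooth_taylor1 Phi i : smooth Phi -> exists2 L : R, 0 <= L &
  forall z (h : R), `|Phi (h *: delta_mx ord0 i + z) - Phi z - h * pderiv i Phi z| <= L * `|h| * `|h|.
Proof.
move=> SPhi; have [L L0 HL] := smooth_lipschitz (smooth_pderiv i SPhi).
exists L => // z h.
have := @lipschitz_derive R (fun t => Phi (t *: delta_mx ord0 i + z) - t * pderiv i Phi z)
  (fun t => pderiv i Phi (t *: delta_mx ord0 i + z) - pderiv i Phi z) (L * `|h|) h 0.
rewrite scale0r add0r subr0 mul0r subr0 (addrAC (Phi _)); apply.
- move=> t; apply: is_derive_fB; last first.
    have := @is_derive_fM R R id (cst (pderiv i Phi z)) t 1 1 0.
    by rewrite mul1r mulr0 addr0; apply.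
  by apply/is_derive_lineP; exact: smooth_is_derive.
- move=> t ht; rewrite (le_trans (HL _ _))// ler_wpM2l//.
  rewrite (bigD1 i)//= big1 ?addr0; last first.
    by move=> j ji; rewrite !mxE (negbTE ji) andbF mulr0 add0r subrr normr0.
  rewrite !mxE !eqxx mulr1 addrK ler_norml.
  move: ht; rewrite ge_min le_max => /andP[/orP h1 /orP h2].
  by have := ler_norm h; have := ler_norm (- h); rewrite normrN; case: h1; case: h2 => *; lra.
Qed.

Lemma conv_is_derive F Phi i x : bms F -> smooth Phi ->
  is_derive x (delta_mx ord0 i) (convol F Phi) (convol F (pderiv i Phi) x).
Proof.
move=> bF SPhi; have [L L0 HL] := smooth_taylor1 i SPhi.
have bn := bms_norm bF.
have SP := smooth_pderiv i SPhi.
have K : (fun h : R => h^-1 *: ((convol F Phi \o shift x) (h *: delta_mx ord0 i) - convol F Phi x)) @ 0^' --> convol F (pderiv i Phi) x.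
  apply/cvgrPdist_le => e e0.
  pose C := \int[leb R n]_z `|F z| * L.
  have C0 : 0 <= C by rewrite mulr_ge0// Rintegral_ge0.
  have eC : 0 < e / (C + 1) by rewrite divr_gt0// ltr_pwDr.
  near=> h.
  have h0 : h != 0 by near: h; exact: nbhs_dnbhs_neq.
  have hh : `|h| <= e / (C + 1) by near: h; exact: dnbhs0_le.
  rewrite /= /convol -[X in `|X - _|](mulKf h0) -mulrBr -RintZ; last exact: bms_conv.
  rewrite -RintB; [|exact: bms_conv..].
  rewrite -RintB; [|by apply: bmsZ; exact: bms_conv|by apply: bmsB; exact: bms_conv].
  rewrite normrM normfV ler_pdivrMl ?normr_gt0//.
  apply: (@le_trans _ _ (\int[leb R n]_z ((L * `|h| * `|h|) * `|F z|))).
    apply: Rint_le_norm => [||z].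
    - by apply: bmsB; [apply: bmsZ; exact: bms_conv|apply: bmsB; exact: bms_conv].
    - exact: bmsZ.
    - rewrite -mulrBr mulrCA -mulrBr normrM mulrC ler_wpM2r// distrC.
      by have := HL (x - z) h; rewrite addrA.
  rewrite RintZ// (_ : _ * _ = `|h| * (`|h| * C)); last by rewrite /C; ring.
  rewrite ler_wpM2l// (le_trans (ler_wpM2r C0 hh))//.
  by rewrite mulrAC -mulrA ger_pMr// ler_pdivrMr ?ltr_pwDr// mul1r lerDl.
split; first by apply/cvg_ex; exists (convol F (pderiv i Phi) x).
by apply/cvg_lim.
Unshelve. all: by end_near. Qed.

Lemma conv_pderiv F Phi i : bms F -> smooth Phi ->
  pderiv i (convol F Phi) = convol F (pderiv i Phi).
Proof.
move=> bF SPhi; apply/funext => x.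
exact: (@derive_val _ _ _ _ _ _ _ (conv_is_derive i x bF SPhi)).
Qed.

Lemma conv_Ck F Phi k : bms F -> smooth Phi -> Ck k (convol F Phi).
Proof.
move=> bF; elim: k Phi => [|k IH] Phi SPhi; split=> //; try exact: conv_continuous.
move=> i; split; first by move=> x; exact: (@ex_derive _ _ _ _ _ _ _ (conv_is_derive i x bF SPhi)).
by rewrite conv_pderiv//; apply: IH; exact: smooth_pderiv.
Qed.

End convolution.

Section mollifier.
Context (R : realType).

Lemma is_derive1_continuous (f df : R -> R) :
  (forall t : R, is_derive t 1 f (df t)) -> continuous f.
Proof.
move=> H x; apply: differentiable_continuous; apply/derivable1_diffP.
exact: (@ex_derive _ _ _ _ _ _ _ (H x)).
Qed.

Lemma integral_derive (F f : R -> R) (lo hi : R) : lo < hi ->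
  (forall t : R, is_derive t 1 F (f t)) -> continuous f ->
  (forall t, t <= lo \/ hi <= t -> f t = 0) ->
  (\int[@lebesgue_measure R]_t (f t)%:E = (F hi - F lo)%:E)%E.
Proof.
move=> lohi dF cf f0.
have cF := is_derive1_continuous dF.
transitivity (\int[@lebesgue_measure R]_(t in `[lo, hi]) (f t)%:E)%E.
  rewrite [RHS]integral_mkcond; apply: eq_integral => t _.
  rewrite patchE; case: ifPn => //; rewrite notin_setE/= in_itv/= => /negP.
  rewrite negb_and -!ltNge => /orP[|] h; rewrite f0//; first by left; exact: ltW.
  by right; exact: ltW.
rewrite (@continuous_FTC2 R f F)//; first exact: continuous_subspaceT.
- split; first by move=> t _; exact: (@ex_derive _ _ _ _ _ _ _ (dF t)).
  + by apply: cvg_at_right_filter; exact: cF.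
  + by apply: cvg_at_left_filter; exact: cF.
- by move=> t _; rewrite derive1E (@derive_val _ _ _ _ _ _ _ (dF t)).
Qed.

Lemma step'_continuous : continuous (@step' R).
Proof.
have ce k : continuous (@expinv R k).
  exact: is_derive1_continuous (@is_derive_expinv R k).
have ci : continuous (@step_inv R).
  exact: is_derive1_continuous (@is_derive_step_inv R).
have c1 : continuous (fun t : R => 1 - t).
  by move=> t; apply: cvgB; [exact: cvg_cst|exact: cvg_id].
have ce1 k : continuous (fun t : R => @expinv R k (1 - t)).
  by move=> t; apply: (@continuous_comp R R R (fun t : R => 1 - t)); [exact: c1|exact: ce].
rewrite (_ : @step' R = fun t : R => (expinv 2 t * expinv 0 (1 - t) + expinv 0 t * expinv 2 (1 - t)) *
  (step_inv t * step_inv t)); last by apply/funext => t; rewrite step'E.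
move=> t; apply: cvgM; last by apply: cvgM; exact: ci.
by apply: cvgD; apply: cvgM; (exact: ce || exact: ce1).
Qed.

(** The two signs cover the integral of a kernel in [x - y] with respect to [x] and with respect to
    [y]. *)
Lemma integral_step' (s d b : R) : 0 < d -> s = 1 \/ s = -1 ->
  (\int[@lebesgue_measure R]_t (d^-1 * step' (s * d^-1 * t + b))%:E = 1)%E.
Proof.
move=> d0 hs; have d1 : d != 0 by rewrite gt_eqF.
have daff (t : R) : is_derive t 1 (fun t : R => s * d^-1 * t + b) (s * d^-1).
  rewrite -[X in is_derive _ _ _ X]addr0; apply: is_derive_fD.
  have := @is_derive_fM R R (cst (s * d^-1)) id t 1 0 1.
  by rewrite mul0r add0r mulr1; apply.
have dF (t : R) : is_derive t 1 (fun t : R => s * step (s * d^-1 * t + b)) (d^-1 * step' (s * d^-1 * t + b)).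
  have H : is_derive t 1 (fun t : R => step (s * d^-1 * t + b)) (step' (s * d^-1 * t + b) * (s * d^-1)).
    apply: (@is_derive_fcomp R R (@step R) (fun t : R => s * d^-1 * t + b)).
    exact: is_derive_step.
  have H2 := @is_derive_fM R R (cst s) _ t 1 0 _ (is_derive_cst _ _ _) H.
  apply: (is_derive_eq H2); rewrite mul0r add0r /cst.
  by case: hs => ->; ring.
have cf : continuous (fun t : R => d^-1 * step' (s * d^-1 * t + b)).
  move=> t; apply: cvgM; first exact: cvg_cst.
  apply: (@continuous_comp R R R (fun t : R => s * d^-1 * t + b)); last exact: step'_continuous.
  exact: (@is_derive1_continuous _ (fun=> s * d^-1) daff).
case: hs => hs.
- rewrite (integral_derive (lo := - (b * d)) (hi := (1 - b) * d) _ dF cf).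
  + rewrite hs !mul1r (_ : d^-1 * - (b * d) + b = 0); last by field.
    rewrite (_ : d^-1 * ((1 - b) * d) + b = 1); last by field.
    by rewrite (@step_le0 _ 0)// (@step_ge1 _ 1)// subr0.
  + by rewrite mulrBl mul1r ltrDr.
  + move=> t ht; rewrite step'_out ?mulr0// hs mul1r.
    case: ht => ht; [left|right].
      rewrite -lerBrDr sub0r ler_pdivrMl//; lra.
    rewrite -lerBlDr ler_pdivlMl//; lra.
- rewrite (integral_derive (lo := (b - 1) * d) (hi := b * d) _ dF cf).
  + rewrite hs !mulN1r (_ : - d^-1 * (b * d) + b = 0); last by field.
    rewrite (_ : - d^-1 * ((b - 1) * d) + b = 1); last by field.
    by rewrite (@step_le0 _ 0)// (@step_ge1 _ 1)// oppr0 sub0r opprK.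
  + by rewrite mulrBl mul1r ltrBlDr ltrDl.
  + move=> t ht; rewrite step'_out ?mulr0// hs mulN1r.
    case: ht => ht; [right|left].
      rewrite mulNr -lerBlDr lerNr ler_pdivrMl//; lra.
    rewrite mulNr -lerBrDr sub0r lerN2 ler_pdivlMl//; lra.
Qed.

Context (n : nat).
Implicit Types (x y : 'rV[R]_n).

(** Each factor is the derivative of [step (t / d)], hence has mass 1 and support in [0, d]. The
    summand 0 keeps the argument in the affine form of [smooth_step']. *)
Definition moll (d : R) x : R := \prod_(i < n) (d^-1 * step' (d^-1 * x ord0 i + 0)).

Lemma smooth_moll d : smooth (moll d).
Proof.
apply: smooth_prod => i; apply: (@smooth_mul _ _ (fun=> _)); first exact: smooth_cst.
exact: smooth_step'.
Qed.

Lemma moll_ge0 d x : 0 < d -> 0 <= moll d x.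
Proof.
by move=> d0; apply: prodr_ge0 => i _; rewrite mulr_ge0 ?step'_ge0// invr_ge0 ltW.
Qed.

Lemma moll_out d x i : 0 < d -> d < `|x ord0 i| -> moll d x = 0.
Proof.
move=> d0 dx; rewrite /moll (bigD1 i)//= step'_out ?mulr0 ?mul0r// addr0.
rewrite ler_pdivrMl// mulr0 ler_pdivlMl// mulr1.
by move: dx; rewrite lter_normr => /orP[h|h]; [right|left]; lra.
Qed.

Lemma measurable_step' : measurable_fun setT (@step' R : measurableTypeR R -> R).
Proof. exact: continuous_measurable_fun step'_continuous. Qed.

Lemma integral_moll d (s : R) (c : 'rV[R]_n) : 0 < d -> s = 1 \/ s = -1 ->
  (\int[leb R n]_y (moll d (s *: y + c))%:E = 1)%E.
Proof.
move=> d0 hs.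
pose f i t := d^-1 * step' (s * d^-1 * t + d^-1 * c ord0 i).
rewrite (eq_integral (fun y : 'rV[R]_n => (\prod_(i < n) f i (y ord0 i))%:E)); last first.
  move=> y _; congr EFin; apply: eq_bigr => i _; rewrite /f !mxE addr0.
  by congr (_ * step' _); ring.
rewrite (@leb_prod R n f (fun=> 1)) ?big1//.
- move=> i; apply: measurable_funM => //.
  apply: (measurableT_comp measurable_step').
  by apply: measurable_funD => //; exact: measurable_funM.
- by move=> i t; rewrite mulr_ge0 ?step'_ge0// invr_ge0 ltW.
- by move=> i; exact: integral_step'.
Qed.

End mollifier.

(** * The L^1 norm and the density of Lipschitz functions *)

Section L1_norm.
Context (R : realType) (n : nat).
Implicit Types (f g : 'rV[R]_n -> R) (D A : set 'rV[R]_n).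

Lemma cvge0_lt (u : nat -> \bar R) : u @ \oo --> 0%E -> forall e : R, 0 < e ->
  exists N, forall k, (N <= k)%N -> (u k < e%:E)%E.
Proof.
move=> u0 e e0; have e0' : (0 < e%:E)%E by rewrite lte_fin.
by have [N _ H] := u0 _ (open_ereal_lt' e0'); exists N => k; exact: H.
Qed.

Definition L1norm D f : \bar R := (\int[leb R n]_(x in D) `|f x|%:E)%E.

Lemma measurable_norm_fin D f : measurable_fun setT f -> measurable_fun D (fun x => `|f x|%:E).
Proof.
by move=> mf; apply: measurable_funTS; apply/measurable_EFinP; exact: measurableT_comp.
Qed.

Lemma L1norm_ge0 D f : (0 <= L1norm D f)%E.
Proof. by apply: integral_ge0 => x _; rewrite lee_fin. Qed.

Lemma L1norm_le D f g : measurable D -> measurable_fun setT f -> measurable_fun setT g ->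
  (forall x, D x -> `|f x| <= `|g x|) -> (L1norm D f <= L1norm D g)%E.
Proof.
move=> mD mf mg fg; apply: ge0_le_integral => //.
- exact: measurable_norm_fin.
- exact: measurable_norm_fin.
Qed.

Lemma L1norm_triangle D f g : measurable D -> measurable_fun setT f -> measurable_fun setT g ->
  (L1norm D (fun x => f x + g x)%R <= L1norm D f + L1norm D g)%E.
Proof.
move=> mD mf mg; rewrite /L1norm -ge0_integralD//; last 2 first.
- exact: measurable_norm_fin.
- exact: measurable_norm_fin.
apply: ge0_le_integral => //.
- by apply: measurable_norm_fin; exact: measurable_funD.
- by apply: emeasurable_funD; exact: measurable_norm_fin.
- by move=> x _; rewrite lee_fin ler_normD.
Qed.

Lemma L1normZ D (a : R) f : measurable D -> measurable_fun setT f ->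
  (L1norm D (fun x => a * f x)%R = `|a|%:E * L1norm D f)%E.
Proof.
move=> mD mf; rewrite /L1norm -ge0_integralZl//.
- by apply: eq_integral => x _; rewrite normrM EFinM.
- exact: measurable_norm_fin.
Qed.

Lemma L1norm_subset D A f : measurable D -> measurable A -> measurable_fun setT f ->
  A `<=` D -> (L1norm A f <= L1norm D f)%E.
Proof.
move=> mD mA mf AD; apply: ge0_subset_integral => //.
by apply: measurable_norm_fin.
Qed.

Lemma L1norm_bound D f (M : R) : measurable D -> measurable_fun setT f -> 0 <= M ->
  (forall x, D x -> `|f x| <= M) -> (L1norm D f <= M%:E * leb R n D)%E.
Proof.
move=> mD mf M0 fM; rewrite -integral_cst//; apply: ge0_le_integral => //.
- exact: measurable_norm_fin.
Qed.

Lemma L1norm_indic D A : measurable D -> measurable A ->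
  L1norm D (\1_A) = leb R n (A `&` D).
Proof.
move=> mD mA; rewrite -integral_indic//; apply: eq_integral => x _.
by rewrite ger0_norm.
Qed.

End L1_norm.

Section lipschitz_density.
Context (R : realType) (n : nat) (c : 'rV[R]_n) (l : R).
Hypothesis l0 : 0 <= l.
Let Q := hcube c l.
Implicit Types (f g k : 'rV[R]_n -> R) (A : set 'rV[R]_n).

Let mQ : measurable Q. Proof. exact: measurable_hcube. Qed.

Lemma leb_increasing_tail (F : nat -> set 'rV[R]_n) : (forall i, measurable (F i)) ->
  (forall i j, (i <= j)%N -> F i `<=` F j) -> forall e : R, 0 < e ->
  exists N, (leb R n ((\bigcup_i F i `\` F N) `&` Q) < e%:E)%E.
Proof.
move=> mF ndF e e0.
pose H N := (\bigcup_i F i `\` F N) `&` Q.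
have mU : measurable (\bigcup_i F i) by exact: bigcupT_measurable.
have mH N : measurable (H N) by apply: measurableI => //; exact: measurableD.
have cvH : leb R n \o H @ \oo --> leb R n (\bigcap_k H k).
  apply: nonincreasing_cvg_mu => //.
  - apply: (@le_lt_trans _ _ (leb R n Q)); last by rewrite leb_hcube// ltry.
    by apply: le_measure; rewrite ?inE//; exact: subIsetr.
  - exact: bigcapT_measurable.
  - move=> i j ij; apply/subsetPset; apply: setSI; apply: setDS; exact: ndF.
have E : \bigcap_k H k = set0.
  rewrite -subset0 => x Hx; have [[[i _ Fx] _] _] := Hx 0%N I.
  by have [[_ /(_ Fx)]] := Hx i I.
rewrite E measure0 in cvH.
by have [N HN] := cvge0_lt cvH e0; exists N; exact: HN.
Qed.

Definition lip_bounded k := (exists M : R, forall x, `|k x| <= M) /\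
  exists2 L : R, 0 <= L &
    forall x y, `|k x - k y| <= L * \sum_(i < n) `|x ord0 i - y ord0 i|.

Lemma lip_bounded_measurable k : lip_bounded k -> measurable_fun setT k.
Proof.
move=> [_ [L _ kL]]; apply: continuous_measurable_rV; first exact: openT.
by move=> x _; exact: (sum_lipschitz_continuous kL).
Qed.

Lemma lip_boundedD k1 k2 : lip_bounded k1 -> lip_bounded k2 -> lip_bounded (fun x => k1 x + k2 x).
Proof.
move=> [[M1 H1] [L1 L10 K1]] [[M2 H2] [L2 L20 K2]]; split.
  by exists (M1 + M2) => x; rewrite (le_trans (ler_normD _ _))// lerD.
exists (L1 + L2); first exact: addr_ge0.
move=> x y; rewrite (_ : _ - _ = (k1 x - k1 y) + (k2 x - k2 y)); last by ring.
by rewrite (le_trans (ler_normD _ _))// mulrDl lerD.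
Qed.

Lemma lip_boundedM k1 k2 : lip_bounded k1 -> lip_bounded k2 -> lip_bounded (fun x => k1 x * k2 x).
Proof.
move=> [[M1 H1] [L1 L10 K1]] [[M2 H2] [L2 L20 K2]].
have M10 : 0 <= M1 by exact: le_trans (H1 0).
have M20 : 0 <= M2 by exact: le_trans (H2 0).
split.
  by exists (M1 * M2) => x; rewrite normrM ler_pM.
exists (M1 * L2 + M2 * L1); first by rewrite addr_ge0 ?mulr_ge0.
move=> x y; rewrite (_ : _ - _ = k1 x * (k2 x - k2 y) + k2 y * (k1 x - k1 y)); last by ring.
rewrite (le_trans (ler_normD _ _))// mulrDl lerD// normrM -mulrA ler_pM//.
Qed.

Lemma lip_bounded_cst (a : R) : lip_bounded (fun=> a).
Proof.
split; first by exists `|a|.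
by exists 0 => // x y; rewrite subrr normr0 mul0r.
Qed.

(** Approximability in L^1 of a cube by bounded Lipschitz functions. The sets whose indicator has
    this property form a sigma-algebra containing the coordinate half-spaces, hence all measurable
    sets. *)
Definition lip_approx g := measurable_fun setT g /\ forall e : R, 0 < e ->
  exists2 k, lip_bounded k & (L1norm Q (fun x => g x - k x)%R <= e%:E)%E.

Lemma lip_approxD g1 g2 : lip_approx g1 -> lip_approx g2 -> lip_approx (fun x => g1 x + g2 x).
Proof.
move=> [m1 H1] [m2 H2]; split; first exact: measurable_funD.
move=> e e0; have e2 : 0 < e / 2 by rewrite divr_gt0.
have [k1 L1 K1] := H1 _ e2; have [k2 L2 K2] := H2 _ e2.
exists (fun x => k1 x + k2 x); first exact: lip_boundedD.
rewrite (_ : (fun x => _) = fun x => (g1 x - k1 x) + (g2 x - k2 x)); last first.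
  by apply/funext => x; ring.
have mk1 := lip_bounded_measurable L1; have mk2 := lip_bounded_measurable L2.
rewrite (le_trans (L1norm_triangle _ _ _))//; try exact: measurable_funB.
by rewrite (splitr e) EFinD leeD.
Qed.

Lemma lip_approxZ (a : R) g : lip_approx g -> lip_approx (fun x => a * g x).
Proof.
move=> [m1 H1]; split; first exact: measurable_funM.
move=> e e0; have e2 : 0 < e / (`|a| + 1) by rewrite divr_gt0// ltr_pwDr.
have [k1 L1 K1] := H1 _ e2; exists (fun x => a * k1 x).
  by apply: lip_boundedM => //; exact: lip_bounded_cst.
rewrite (_ : (fun x => _) = fun x => a * (g x - k1 x)); last first.
  by apply/funext => x; ring.
have mk1 := lip_bounded_measurable L1.
rewrite L1normZ//; last exact: measurable_funB.
apply: (@le_trans _ _ (`|a|%:E * (e / (`|a| + 1))%:E)%E).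
  by rewrite lee_wpmul2l// lee_fin.
rewrite -EFinM lee_fin mulrCA ger_pMr// ler_pdivrMr ?ltr_pwDr//.
by rewrite mul1r lerDl.
Qed.

Lemma lip_approx_cst (a : R) : lip_approx (fun=> a).
Proof.
split=> // e e0; exists (fun=> a); first exact: lip_bounded_cst.
rewrite /L1norm integral0_eq ?lee_fin ?ltW// => x _.
by rewrite subrr normr0.
Qed.

Lemma lip_approx_setI A B : lip_approx \1_A -> lip_approx \1_B -> lip_approx \1_(A `&` B).
Proof.
move=> [m1 H1] [m2 H2].
rewrite (_ : \1_(A `&` B) = fun x => \1_A x * \1_B x); last first.
  by apply/funext => x; rewrite indicI.
split; first exact: measurable_funM.
move=> e e0; have e2 : 0 < e / 2 by rewrite divr_gt0.
have [k1 L1 K1] := H1 _ e2; have [[M1 B1] _] := L1.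
have M0 : 0 <= M1 by exact: le_trans (B1 0).
have e3 : 0 < e / 2 / (M1 + 1) by rewrite divr_gt0// ltr_pwDr.
have [k2 L2 K2] := H2 _ e3.
have mk1 := lip_bounded_measurable L1; have mk2 := lip_bounded_measurable L2.
exists (fun x => k1 x * k2 x); first exact: lip_boundedM.
rewrite (_ : (fun x => _) = fun x => \1_B x * (\1_A x - k1 x) + k1 x * (\1_B x - k2 x)); last first.
  by apply/funext => x; ring.
rewrite (le_trans (L1norm_triangle _ _ _))//; try by apply: measurable_funM => //; exact: measurable_funB.
rewrite (splitr e) EFinD leeD//.
  apply: le_trans K1; apply: L1norm_le => //.
  - by apply: measurable_funM => //; exact: measurable_funB.
  - exact: measurable_funB.
  - move=> x _; rewrite normrM ger0_norm// ler_piMl//.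
apply: (@le_trans _ _ (L1norm Q (fun x => (M1 + 1) * (\1_B x - k2 x))%R)).
  apply: L1norm_le => //.
  - by apply: measurable_funM => //; exact: measurable_funB.
  - by apply: measurable_funM => //; exact: measurable_funB.
  - move=> x _; rewrite !normrM ler_wpM2r// (ger0_norm (_ : 0 <= M1 + 1)) ?addr_ge0//.
    by rewrite (le_trans (B1 x))// lerDl.
rewrite L1normZ//; last exact: measurable_funB.
rewrite ger0_norm ?addr_ge0//.
apply: (@le_trans _ _ ((M1 + 1)%:E * (e / 2 / (M1 + 1))%:E)%E).
  by rewrite lee_wpmul2l// lee_fin addr_ge0.
by rewrite -EFinM mulrCA divff ?mulr1// gt_eqF// ltr_pwDr.
Qed.

Lemma lip_approx_setC A : lip_approx \1_A -> lip_approx \1_(~` A).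
Proof.
move=> H; rewrite (_ : \1_(~` A) = fun x => 1 + (-1) * \1_A x).
  by apply: lip_approxD; [exact: lip_approx_cst|exact: lip_approxZ].
by apply/funext => x; rewrite !indicE in_setC; case: (x \in A); rewrite ?mulr1 ?mulr0 ?addr0 ?subrr.
Qed.

Lemma lip_approx_setU A B : lip_approx \1_A -> lip_approx \1_B -> lip_approx \1_(A `|` B).
Proof.
move=> HA HB; rewrite -(setCK (A `|` B)) setCU.
by apply: lip_approx_setC; apply: lip_approx_setI; exact: lip_approx_setC.
Qed.

Lemma lip_approx_bigcup (F : nat -> set 'rV[R]_n) : (forall i, lip_approx \1_(F i)) ->
  lip_approx \1_(\bigcup_i F i).
Proof.
move=> HF; have mF i : measurable (F i) by apply/(measurable_indicP R); have [] := HF i.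
pose G N := \big[setU/set0]_(i < N) F i.
have HG N : lip_approx \1_(G N).
  rewrite /G; elim: N => [|N IH].
    by rewrite big_ord0 indic0; exact: lip_approx_cst.
  by rewrite big_ord_recr/=; exact: lip_approx_setU.
have mG N : measurable (G N) by apply/(measurable_indicP R); have [] := HG N.
have UG : \bigcup_i F i = \bigcup_i G i.
  apply/seteqP; split=> [x [i _ Fx]|x [i _]].
    by exists i.+1 => //; rewrite /G big_ord_recr/=; right.
  by rewrite /G -bigcup_mkord => -[j _ Fx]; exists j.
split; first by apply: measurable_indic; exact: bigcupT_measurable.
move=> e e0; have e2 : 0 < e / 2 by rewrite divr_gt0.
have [|N HN] := leb_increasing_tail mG _ e2.
  move=> i j ij x; rewrite /G -!bigcup_mkord => -[k /= ki Fk].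
  by exists k => //=; exact: leq_trans ij.
have [k Lk K] := (HG N).2 _ e2; exists k => //.
have mk := lip_bounded_measurable Lk.
have mU : measurable (\bigcup_i F i `\` G N).
  by apply: measurableD => //; exact: bigcupT_measurable.
rewrite (_ : (fun x => _) = fun x => \1_(\bigcup_i F i `\` G N) x + (\1_(G N) x - k x)).
  rewrite (le_trans (L1norm_triangle _ _ _))//; first exact: measurable_funB.
  by rewrite (splitr e) EFinD leeD// L1norm_indic// UG ltW.
apply/funext => x; rewrite addrA; congr (_ - _).
rewrite !indicE in_setD; case: (boolP (x \in G N)) => xG.
  by rewrite andbF add0r mem_set// UG; exists N => //; exact: set_mem.
by rewrite andbT addr0.
Qed.

(** The ramp of slope [N + 1] starting at [a] differs from the indicator only for [x_i] between [a]
    and [a + 1 / (N + 1)]; within the cube these strips decrease to the empty set, so their measure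
    tends to 0. *)
Lemma lip_approx_ray (i : 'I_n) (a : R) : lip_approx \1_[set x : 'rV[R]_n | a < x ord0 i].
Proof.
pose F (N : nat) := [set x : 'rV[R]_n | a + N.+1%:R^-1 <= x ord0 i].
have mF N : measurable (F N).
  have := @measurable_coor R n i measurableT `[a + N.+1%:R^-1, +oo[%classic (measurable_itv _).
  by rewrite setTI; congr measurable; apply/seteqP; split=> x /=; rewrite in_itv/= andbT.
have E : [set x : 'rV[R]_n | a < x ord0 i] = \bigcup_N F N.
  apply/seteqP; split=> [x /= ax|x [N _]]; last first.
    by apply: lt_le_trans; rewrite ltrDl.
  by have [N HN] := ltr_add_invr ax; exists N => //; exact: ltW.
split.
  by apply: measurable_indic; rewrite E; exact: bigcupT_measurable.
move=> e e0; have [|N HN] := leb_increasing_tail mF _ e0.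
  move=> j k jk x; apply: le_trans; rewrite lerD2l lef_pV2 ?posrE// ler_nat ltnS.
  exact: jk.
have clip_lip (s t : R) : `|Num.min 1 (Num.max 0 s) - Num.min 1 (Num.max 0 t)| <= `|s - t|.
  rewrite ler_norml; have := ler_norm (s - t); have := ler_norm (- (s - t)).
  rewrite normrN /Num.min /Num.max.
  case: (ltP 0 s) => ?; case: (ltP 0 t) => ?; rewrite ?ltr10; case: (ltP 1 s) => ?;
    case: (ltP 1 t) => ? ? ?; apply/andP; split; lra.
pose k (x : 'rV[R]_n) := Num.min 1 (Num.max 0 (N.+1%:R * (x ord0 i - a))).
have Lk : lip_bounded k.
  split.
    exists 1 => x; rewrite ger0_norm; first by rewrite ge_min lexx.
    by rewrite le_min ler01 le_max lexx.
  exists N.+1%:R => // x y; rewrite (le_trans (clip_lip _ _))//.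
  rewrite -mulrBr opprB addrA subrK normrM ger0_norm// ler_wpM2l//.
  by rewrite (bigD1 i)//= lerDl sumr_ge0.
have mk := lip_bounded_measurable Lk.
have mU : measurable (\bigcup_i F i `\` F N).
  by apply: measurableD => //; exact: bigcupT_measurable.
exists k => //; apply: (@le_trans _ _ (L1norm Q \1_(\bigcup_i F i `\` F N))); last first.
  by rewrite L1norm_indic// ltW.
rewrite E; apply: L1norm_le => //.
- by apply: measurable_funB => //; apply: measurable_indic; exact: bigcupT_measurable.
move=> x _; rewrite -E !indicE in_setD; case: (boolP (x \in F N)) => [/set_mem xF|xF].
  rewrite mem_set /=; last by apply: lt_le_trans xF; rewrite ltrDl.
  have h1 : 1 <= N.+1%:R * (x ord0 i - a).
    by rewrite -ler_pdivrMl// mulr1 lerBrDl; exact: xF.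
  by rewrite /k (max_idPr _) ?(min_idPl _) ?subrr ?normr0// (le_trans _ h1).
case: (boolP (x \in [set x : 'rV[R]_n | a < x ord0 i])) => [_|/negP]/=.
  rewrite ger0_norm; last by rewrite subr_ge0 ge_min lexx.
  by rewrite normr1 gerBl le_min ler01 le_max lexx.
rewrite inE/= => /negP; rewrite -leNgt => xa.
rewrite /k (max_idPl _) ?(min_idPr _) ?subrr//.
by rewrite mulr_ge0_le0// subr_le0.
Qed.

Lemma lip_approx_measurable A : measurable A -> lip_approx \1_A.
Proof.
apply: (@smallest_sub _ _ _ [set A | lip_approx \1_A]).
  split=> [|B /= HB|F /= HF].
  - by rewrite /= indic0; exact: lip_approx_cst.
  - by rewrite setTD; exact: lip_approx_setC.
  - exact: lip_approx_bigcup.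
rewrite -bigcup_seq; apply: bigcup_sub => i _ _ [Y mY <-] /=.
rewrite setTI; move: Y mY.
have -> : @measurable _ (measurableTypeR R) = <<s (@RGenOInfty.G R) >>.
  exact: RGenOInfty.measurableE.
apply: (@smallest_sub _ _ _ [set Y | lip_approx \1_((fun x : 'rV[R]_n => x ord0 i) @^-1` Y)]).
  split=> [|B /= HB|F /= HF].
  - by rewrite /= preimage_set0 indic0; exact: lip_approx_cst.
  - by rewrite setTD -preimage_setC; exact: lip_approx_setC.
  - by rewrite preimage_bigcup; exact: lip_approx_bigcup.
move=> _ [a ->] /=.
rewrite (_ : _ @^-1` _ = [set x : 'rV[R]_n | a < x ord0 i]); first exact: lip_approx_ray.
by apply/seteqP; split=> x /=; rewrite in_itv/= andbT.
Qed.

(** Each step removes one binary digit of [g / M]: subtracting [M / 2] on the set where [g >= M / 2]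
    halves the range. After [m] steps the rest is approximated by 0. *)
Lemma lip_approx_dyadic (m : nat) (M : R) g : measurable_fun setT g ->
  (forall x, 0 <= g x <= M) -> forall e : R, 0 < e ->
  exists2 k, lip_bounded k &
    (L1norm Q (fun x => g x - k x)%R <= (M / 2 ^+ m * l ^+ n + e)%:E)%E.
Proof.
elim: m M g => [|m IH] M g mg gM e e0.
  have M0 : 0 <= M by have /andP[/le_trans H /H] := gM 0.
  exists (fun=> 0); first exact: lip_bounded_cst.
  rewrite expr0 divr1; apply: (@le_trans _ _ (M%:E * leb R n Q)%E).
    apply: L1norm_bound => //; first exact: measurable_funB.
    by move=> x _; rewrite subr0; have /andP[? ?] := gM x; rewrite ger0_norm.
  by rewrite leb_hcube// -EFinM lee_fin lerDl ltW.
pose A := [set x : 'rV[R]_n | M / 2 <= g x].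
have mA : measurable A.
  have := mg measurableT `[M / 2, +oo[%classic (measurable_itv _).
  rewrite setTI; congr measurable; apply/seteqP; split=> x /=; by rewrite in_itv/= andbT.
have M0 : 0 <= M by have /andP[/le_trans H /H] := gM 0.
have HA := lip_approxZ (M / 2) (lip_approx_measurable mA).
have [|x||k1 Lk1 K1] := IH (M / 2) (fun x => g x - (M / 2) * \1_A x) _ _ (e / 2).
- apply: measurable_funB => //; apply: measurable_funM => //; exact: measurable_indic.
- have /andP[g0 gx] := gM x; rewrite indicE; case: (boolP (x \in A)) => [/set_mem|/negP].
    by rewrite /A/= mulr1 => h; apply/andP; split; lra.
  by rewrite inE /A/= mulr0 subr0 => /negP; rewrite -ltNge => h; apply/andP; split; lra.
- by rewrite divr_gt0.
have e2 : 0 < e / 2 by rewrite divr_gt0.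
have [k2 Lk2 K2] := HA.2 _ e2.
have mk1 := lip_bounded_measurable Lk1; have mk2 := lip_bounded_measurable Lk2.
exists (fun x => k1 x + k2 x); first exact: lip_boundedD.
rewrite (_ : (fun x => _) = fun x => (g x - M / 2 * \1_A x - k1 x) + (M / 2 * \1_A x - k2 x)); last first.
  by apply/funext => x; ring.
have m3 : measurable_fun setT (fun x => M / 2 * \1_A x) by exact: HA.1.
rewrite (le_trans (L1norm_triangle _ _ _))//; try by repeat apply: measurable_funB.
apply: (le_trans (leeD K1 K2)); rewrite -EFinD lee_fin exprS invfM.
by rewrite [X in _ + X <= _]splitr !mulrA; lra.
Qed.

Lemma lip_approx_bounded (M : R) g : measurable_fun setT g ->
  (forall x, `|g x| <= M) -> lip_approx g.
Proof.
move=> mg gM; have M0 : 0 <= M by exact: le_trans (gM 0).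
rewrite (_ : g = fun x => (g x + M) + (- M)); last by apply/funext => x; rewrite addrK.
apply: lip_approxD; last exact: lip_approx_cst.
split; first exact: measurable_funD.
move=> e e0; have e2 : 0 < e / 2 by rewrite divr_gt0.
have C0 : 0 <= (M + M) * l ^+ n by rewrite mulr_ge0 ?addr_ge0// exprn_ge0.
have [m Hm] : exists m : nat, (M + M) / 2 ^+ m * l ^+ n <= e / 2.
  have [m Hm] := ltr_add_invr (divr_gt0 e2 (ltr_pwDr ltr01 C0)).
  exists m.+1; rewrite mulrAC ler_pdivrMr ?exprn_gt0// -ler_pdivrMl//.
  move: Hm; rewrite add0r invf_plt ?posrE ?divr_gt0 ?ltr_pwDr//.
  rewrite invf_div => Hm.
  apply: (@le_trans _ _ m.+1%:R).
    apply: le_trans (ltW Hm); rewrite mulrC; apply: ler_wpM2r; [by rewrite invr_ge0 ltW|by rewrite lerDl].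
  by rewrite -natrX ler_nat ltnW// ltn_expl//.
have [|x|k Lk K] := @lip_approx_dyadic m (M + M) (fun x => g x + M) _ _ _ e2.
- exact: measurable_funD.
- by have := gM x; rewrite ler_norml => /andP[? ?]; apply/andP; split; lra.
exists k => //; apply: (le_trans K); rewrite lee_fin; lra.
Qed.

End lipschitz_density.

(** * Convergence of mollifications *)

Section mollification.
Context (R : realType) (n : nat).
Implicit Types (F f g : 'rV[R]_n -> R) (x y : 'rV[R]_n) (d e : R).

Lemma L1norm_support D f : measurable D -> measurable_fun setT f ->
  (forall x, ~ D x -> f x = 0) -> L1norm setT f = L1norm D f.
Proof.
move=> mD mf f0; rewrite /L1norm [RHS]integral_mkcond; apply: eq_integral => x _.
rewrite patchE; case: ifPn => // xD; rewrite f0 ?normr0// => Dx.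
by move: xD; rewrite mem_set.
Qed.

Lemma bms_measurable f : bms f -> measurable_fun setT f.
Proof. by case. Qed.

Lemma conv_measurable f d : bms f -> measurable_fun setT (convol f (@moll R n d)).
Proof.
move=> bf; apply: continuous_measurable_rV; first exact: openT.
by move=> x _; apply: conv_continuous => //; exact: smooth_moll.
Qed.

(** By Tonelli's theorem, since the kernel has integral 1 in [x] for every [y]. *)
Lemma conv_moll_L1 f d : bms f -> 0 < d ->
  (L1norm setT (convol f (moll d)) <= L1norm setT f)%E.
Proof.
move=> bf d0; have mf := bms_measurable bf.
pose K (p : 'rV[R]_n * 'rV[R]_n) := (`|f p.2| * moll d (p.1 - p.2))%:E.
have msub : measurable_fun setT (fun p : 'rV[R]_n * 'rV[R]_n => p.1 - p.2).
  apply: measurable_fun_coorP => i.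
  rewrite (_ : (fun _ => _) = (fun p : 'rV[R]_n * 'rV[R]_n => p.1 ord0 i - p.2 ord0 i)); last first.
    by apply/funext => p; rewrite !mxE.
  apply: measurable_funB.
    exact: (measurableT_comp (@measurable_coor R n i) measurable_fst).
  exact: (measurableT_comp (@measurable_coor R n i) measurable_snd).
have mK : measurable_fun setT K.
  apply/measurable_EFinP; apply: measurable_funM.
    apply: (measurableT_comp (@normr_measurable R setT)).
    exact: (measurableT_comp mf measurable_snd).
  exact: (measurableT_comp (smooth_measurable (smooth_moll n d)) msub).
have K0 p : (0 <= K p)%E by rewrite lee_fin mulr_ge0// moll_ge0.
apply: (@le_trans _ _ (\int[leb R n]_x \int[leb R n]_y K (x, y))%E).
  apply: ge0_le_integral => //.
  - by apply: measurable_norm_fin; exact: conv_measurable.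
  - exact: (measurable_fun_fubini_tonelli_F (m2 := leb R n) K).
  - move=> x _; have bc := bms_conv x bf (smooth_moll n d).
    rewrite (EFin_normr_Rintegral measurableT (bms_integrable bc)).
    have := le_abse_integral (leb R n) measurableT (measurable_int _ (bms_integrable bc)).
    move=> /le_trans; apply; rewrite le_eqVlt; apply/orP; left; apply/eqP.
    apply: eq_integral => y _.
    by rewrite /K/= normrM (ger0_norm (moll_ge0 _ d0)).
rewrite (fubini_tonelli K)// le_eqVlt; apply/orP; left; apply/eqP.
apply: eq_integral => y _; rewrite /K/=.
under eq_integral do rewrite EFinM.
rewrite ge0_integralZl//; last 2 first.
- apply/measurable_EFinP; apply: (measurableT_comp (smooth_measurable (smooth_moll n d))).
  have := (measurableT_comp msub (@pair2_measurable _ _ 'rV[R]_n 'rV[R]_n y)).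
  exact.
- by move=> x _; rewrite lee_fin moll_ge0.
under eq_integral do rewrite -[X in X - y]scale1r.
by rewrite integral_moll ?mule1//; left.
Qed.

Lemma bms_moll d x : 0 < d -> bms (fun y => moll d (x - y)).
Proof.
move=> d0; split; first exact: (smooth_measurable (smooth_reflect x (@smooth_moll R n d))).
have [M [M0 HM]] := smooth_bounded (@smooth_moll R n d).
exists (M + (`|x| + d)); split=> [|y]; first by rewrite !addr_ge0// ltW.
split; first by rewrite (le_trans (HM _))// lerDl addr_ge0// ltW.
move=> yM; have : ~ (forall i, `|y ord0 i| <= `|x| + d).
  move/(rV_norm_le y) => H; have : `|y| <= `|x| + d by apply: H; rewrite addr_ge0// ltW.
  by lra.
move=> /existsNP[i /negP]; rewrite -ltNge => yi.
apply: (@moll_out R n d _ i) => //; rewrite !mxE distrC.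
have := rV_coord_norm x i; have := ler_normB (y ord0 i - x ord0 i) (- x ord0 i).
by rewrite opprK subrK normrN; lra.
Qed.

Lemma integral_moll_reflect d x : 0 < d -> \int[leb R n]_y moll d (x - y) = 1.
Proof.
move=> d0; rewrite /Rintegral.
rewrite (eq_integral (fun y => (moll d ((-1) *: y + x))%:E)); last first.
  by move=> y _; rewrite scaleN1r addrC.
by rewrite (integral_moll x d0 (or_intror erefl)).
Qed.

Lemma conv_close F d x e : bms F -> 0 < d ->
  (forall y, (forall i, `|x ord0 i - y ord0 i| <= d) -> `|F y - F x| <= e) ->
  `|convol F (moll d) x - F x| <= e.
Proof.
move=> bF d0 He; have bm := bms_moll x d0.
have -> : F x = \int[leb R n]_y (F x * moll d (x - y)).
  by rewrite RintZ// integral_moll_reflect// mulr1.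
rewrite /convol -RintB; [|exact: bms_conv (smooth_moll n d)|exact: bmsZ].
apply: (@le_trans _ _ (\int[leb R n]_y (e * moll d (x - y)))).
  apply: Rint_le_norm => [||y].
  - by apply: bmsB; [exact: bms_conv (smooth_moll n d)|exact: bmsZ].
  - exact: bmsZ.
  - rewrite -mulrBl normrM (ger0_norm (moll_ge0 _ d0)).
    have [H|/existsNP[i /negP]] := pselect (forall i, `|x ord0 i - y ord0 i| <= d).
      by rewrite ler_wpM2r ?moll_ge0// He.
    by rewrite -ltNge => H; rewrite (@moll_out R n d _ i)// ?mulr0// !mxE.
by rewrite RintZ// integral_moll_reflect// mulr1.
Qed.

Lemma conv_bounded F d x M : bms F -> 0 < d -> (forall y, `|F y| <= M) ->
  `|convol F (moll d) x| <= M.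
Proof.
move=> bF d0 HM; have bm := bms_moll x d0.
apply: (@le_trans _ _ (\int[leb R n]_y (M * moll d (x - y)))).
  apply: Rint_le_norm => [||y].
  - exact: bms_conv (smooth_moll n d).
  - exact: bmsZ.
  - by rewrite normrM (ger0_norm (moll_ge0 _ d0)) ler_wpM2r ?moll_ge0.
by rewrite RintZ// integral_moll_reflect// mulr1.
Qed.

Lemma conv_support F d x : 0 < d ->
  (forall y, (forall i, `|x ord0 i - y ord0 i| <= d) -> F y = 0) ->
  convol F (moll d) x = 0.
Proof.
move=> d0 HF; rewrite /convol /Rintegral integral0_eq// => y _.
have [H|/existsNP[i /negP]] := pselect (forall i, `|x ord0 i - y ord0 i| <= d).
  by rewrite HF// mul0r.
by rewrite -ltNge => H; rewrite (@moll_out R n d _ i)// ?mulr0// !mxE.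
Qed.

Lemma convB f g d x : bms f -> bms g ->
  convol (fun y => f y - g y) (moll d) x = convol f (moll d) x - convol g (moll d) x.
Proof.
move=> bf bg; rewrite /convol -RintB; [|exact: bms_conv (smooth_moll n d)..].
by apply: eq_Rintegral => y _; rewrite mulrBl.
Qed.

Lemma norm_gt_coord x (M : R) : 0 <= M -> M < `|x| -> exists i, M < `|x ord0 i|.
Proof.
move=> M0 xM; apply: contrapT => /forallNP H.
have : `|x| <= M by apply/rV_norm_le => // i; rewrite leNgt; apply/negP.
by lra.
Qed.

(** Compare [g] with [k'], a Lipschitz approximation restricted to [Q2]. For [d <= 1] the difference
    [convol g (moll d) - g] lives in [Q1], and every point within [d] of [Q1] is in [Q2], where [k']
    is Lipschitz; so [k'] is uniformly close to its mollification on [Q1]. The two remaining errors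
    are the L^1 distance of [g] and [k'], once after mollification. *)
Lemma moll_L1_cvg g : bms g -> forall e, 0 < e -> exists2 d0 : R, 0 < d0 &
  forall d, 0 < d <= d0 ->
    (L1norm setT (fun x => convol g (moll d) x - g x)%R <= e%:E)%E.
Proof.
move=> bg e e0; have [mg [M [M0 gM]]] := bg.
pose Q1 := hcube (const_mx (- (M + 1)) : 'rV[R]_n) ((M + 1) *+ 2 + 1).
pose Q2 := hcube (const_mx (- (M + 2)) : 'rV[R]_n) ((M + 2) *+ 2 + 1).
have l1 : 0 <= (M + 1) *+ 2 + 1 by rewrite mulr2n; lra.
have l2 : 0 <= (M + 2) *+ 2 + 1 by rewrite mulr2n; lra.
have mQ1 : measurable Q1 by exact: measurable_hcube.
have mQ2 : measurable Q2 by exact: measurable_hcube.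
have e3 : 0 < e / 3 by rewrite divr_gt0.
have [_ Hg] := @lip_approx_bounded R n (const_mx (- (M + 2))) _ l2 M g mg (fun x => (gM x).1).
have [k Lk Kk] := Hg _ e3.
have mk := lip_bounded_measurable Lk.
have [[Mk kM] [L L0 kL]] := Lk.
pose k' x := k x * \1_Q2 x.
have Q2norm x : Q2 x -> `|x| <= M + 3.
  move=> Hx; apply/rV_norm_le => [|i]; first lra.
  by have := Hx i; rewrite mxE mulr2n ler_norml => /andP[? ?]; apply/andP; split; lra.
have b1 : bms (\1_Q2 : _ -> R).
  split; first exact: measurable_indic.
  exists (M + 3); split=> [|x]; first lra.
  split; first by rewrite indicE ger0_norm// (@le_trans _ _ 1)// ?lern1 ?leq_b1//; lra.
  move=> H; rewrite indicE memNset// => /Q2norm; lra.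
have bk : bms k'.
  rewrite (_ : k' = fun x => \1_Q2 x * k x); last by apply/funext => x; rewrite mulrC.
  by apply: bmsM => //; exists Mk.
have bgk : bms (fun x => g x - k' x) by exact: bmsB.
have g0 x : M < `|x| -> g x = 0 by exact: (gM x).2.
have N1 : (L1norm setT (fun x => g x - k' x)%R <= (e / 3)%:E)%E.
  rewrite (@L1norm_support Q2)//; last first.
  - move=> x xQ; rewrite /k' indicE memNset// mulr0 subr0 g0// ltNge; apply/negP => xM.
    apply: xQ; apply: norm_hcube; lra.
  - exact: bms_measurable.
  apply: le_trans Kk; apply: L1norm_le => //.
  - exact: bms_measurable.
  - exact: measurable_funB.
  - by move=> x xQ; rewrite /k' indicE mem_set// mulr1.
pose V := ((M + 1) *+ 2 + 1) ^+ n.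
have V0 : 0 <= V by rewrite exprn_ge0.
have C0 : 0 <= L * n%:R * V by rewrite !mulr_ge0.
pose d0 := Num.min 1 (e / 3 / (L * n%:R * V + 1)).
have d00 : 0 < d0 by rewrite lt_min ltr01 divr_gt0// ltr_pwDr.
exists d0 => // d /andP[dpos dd0].
have d1 : d <= 1 by rewrite (le_trans dd0)// ge_min lexx.
have d2 : d <= e / 3 / (L * n%:R * V + 1) by rewrite (le_trans dd0)// ge_min lexx orbT.
have mc f : bms f -> measurable_fun setT (convol f (moll d)) by exact: conv_measurable.
have mk' := bms_measurable bk.
rewrite (@L1norm_support Q1)//; last first.
- move=> x xQ; have xM : M + 1 < `|x|.
    by rewrite ltNge; apply/negP => H; apply: xQ; apply: norm_hcube => //; lra.
  rewrite g0 ?subr0; last by lra.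
  apply: conv_support => // y yx; apply: g0.
  have [i xi] := norm_gt_coord (addr_ge0 M0 ler01) xM.
  have := yx i; have := rV_coord_norm y i.
  have := ler_normB (x ord0 i - y ord0 i) (- y ord0 i).
  by rewrite opprK subrK normrN; lra.
- by apply: measurable_funB => //; exact: mc.
rewrite (_ : (fun x => _) = (fun x => convol (fun y => g y - k' y) (moll d) x + ((convol k' (moll d) x - k' x) + (k' x - g x)))); last first.
  by apply/funext => x; rewrite convB//; ring.
have me : measurable_fun setT (fun x => convol k' (moll d) x - k' x).
  by apply: measurable_funB => //; exact: mc.
have me2 : measurable_fun setT (fun x => k' x - g x) by exact: measurable_funB.
rewrite (le_trans (L1norm_triangle _ _ _))//; [exact: mc|exact: measurable_funD|].
rewrite (_ : e = e / 3 + (e / 3 + e / 3)); last by field.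
rewrite 2!EFinD leeD//.
  apply: (le_trans (@L1norm_subset R n setT Q1 _ measurableT mQ1 (mc _ bgk) _)) => //.
  exact: (le_trans (conv_moll_L1 bgk dpos)).
rewrite (le_trans (L1norm_triangle _ _ _))// leeD//.
  rewrite (@le_trans _ _ ((L * n%:R * d)%:E * leb R n Q1)%E)//.
    apply: L1norm_bound => //; first by rewrite !mulr_ge0// ltW.
    move=> x xQ1; apply: conv_close => // y yx.
    have xQ2 : Q2 x.
      move=> i; have := xQ1 i; rewrite !mxE !mulr2n => /andP[? ?].
      by apply/andP; split; lra.
    have yQ2 : Q2 y.
      move=> i; have := xQ1 i; rewrite !mxE !mulr2n => /andP[? ?].
      have := yx i; rewrite ler_norml => /andP[? ?].
      by apply/andP; split; lra.
    rewrite /k' !indicE !mem_set// !mulr1 (le_trans (kL _ _))// -mulrA ler_wpM2l//.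
    rewrite (_ : n%:R * d = \sum_(i < n) d); last by rewrite sumr_const card_ord mulr_natl.
    by apply: ler_sum => i _; rewrite distrC.
  rewrite leb_hcube// -EFinM lee_fin -/V mulrAC.
  rewrite (le_trans (ler_wpM2l C0 d2))// mulrCA ger_pMr//.
  by rewrite ler_pdivrMr ?ltr_pwDr// mul1r lerDl.
have mkg : measurable_fun setT (fun x => k' x - g x) by exact: measurable_funB.
apply: (le_trans (@L1norm_subset R n setT Q1 _ measurableT mQ1 mkg _)) => //.
apply: le_trans N1; apply: L1norm_le => //; first exact: bms_measurable.
by move=> x _; rewrite distrC.
Qed.

Lemma bms_uniform_continuous F : bms F -> continuous F -> forall e, 0 < e ->
  exists2 d, 0 < d & forall x y, (forall i, `|x ord0 i - y ord0 i| <= d) -> `|F y - F x| <= e.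
Proof.
move=> [_ [M [M0 FM]]] cF e e0.
pose K := [set x : 'rV[R]_n | forall i, x ord0 i \in `[- (M + 1), M + 1]].
have cK : compact K.
  apply: (@rV_compact R n (fun=> `[- (M + 1), M + 1]%classic)) => i.
  exact: segment_compact.
pose P (d : R) (x : 'rV[R]_n) := forall y, (forall i, `|x ord0 i - y ord0 i| <= d) -> `|F y - F x| <= e.
have H : \forall d \near 0^'+, K `<=` P d.
  move/compact_near_coveringP : cK; apply => x _.
  have e2 : 0 < e / 2 by rewrite divr_gt0.
  have [r r0 Hr] : exists2 r, 0 < r & forall y, (forall i, `|y ord0 i - x ord0 i| < r) -> `|F x - F y| < e / 2.
    have /cvgrPdist_lt/(_ _ e2) := cF x; move=> /rV_nbhsP[r r0 H]; exists r => //.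
  have r2 : 0 < r / 2 by rewrite divr_gt0.
  exists ([set y : 'rV[R]_n | forall i, `|y ord0 i - x ord0 i| < r / 2], [set d : R | d < r / 2]).
    split; first by apply/rV_nbhsP; exists (r / 2).
    exact: nbhs_right_lt.
  move=> [x' d] /= [Hx' Hd] y Hy.
  have h1 := Hr x' (fun i => lt_trans (Hx' i) _).
  have h2 : `|F x - F y| < e / 2.
    apply: Hr => i; have := Hx' i; have := Hy i => hy hx.
    have := ler_normB (x' ord0 i - x ord0 i) (x' ord0 i - y ord0 i).
    by rewrite (_ : _ - _ - _ = y ord0 i - x ord0 i); [lra|ring].
  have := ler_normB (F x - F x') (F x - F y).
  rewrite (_ : _ - _ - _ = F y - F x'); last by ring.
  have : `|F x - F x'| < e / 2 by apply: h1; lra.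
  by lra.
have /filter_ex[d [/andP[d0 d1] Hd]] : \forall d \near 0^'+, 0 < d <= 1 /\ K `<=` P d.
  near=> d; split; last by near: d.
  by apply/andP; split; near: d; [exact: nbhs_right_gt|exact: nbhs_right_le].
exists d => // x y xy.
have [xK|xM] := leP `|x| (M + 1).
  apply: Hd => // i; rewrite in_itv/= -ler_norml.
  by move: xK => /(rV_norm_le x (addr_ge0 M0 ler01)).
rewrite (FM x).2; last by lra.
rewrite (FM y).2 ?subrr ?normr0 ?ltW//.
have [i xi] := norm_gt_coord (addr_ge0 M0 ler01) xM.
have := xy i; have := rV_coord_norm y i.
have := ler_normB (x ord0 i - y ord0 i) (- y ord0 i).
by rewrite opprK subrK normrN; lra.
Unshelve. all: by end_near. Qed.

(** The hypothesis on [F] and [G] is a weak gradient identity on the whole space; tested with the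
    reflected kernel it says that the gradient of the mollified [F] is the mollified [G]. Continuity
    of [F] gives uniform closeness, while [G], only bounded and measurable, keeps its bounds and
    converges in L^1. *)
Lemma mollify F (G : 'I_n -> 'rV[R]_n -> R) : bms F -> continuous F ->
  (forall i, bms (G i)) ->
  (forall i Phi, smooth Phi ->
    \int[leb R n]_x (F x * pderiv i Phi x) = - \int[leb R n]_x (G i x * Phi x)) ->
  forall e, 0 < e -> exists f : 'rV[R]_n -> R,
  [/\ forall k, Ck k f,
      forall x, `|f x - F x| <= e,
      forall i M, (forall x, `|G i x| <= M) -> forall x, `|pderiv i f x| <= M,
      forall i, (L1norm setT (fun x => pderiv i f x - G i x)%R <= e%:E)%E &
      forall x, (forall y, (forall i, `|x ord0 i - y ord0 i| <= e) -> F y = 0) -> f x = 0].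
Proof.
move=> bF cF bG FG e e0.
have [d1 d10 Hd1] := bms_uniform_continuous bF cF e0.
have Hd i : {d | 0 < d /\ forall d', 0 < d' <= d ->
    (L1norm setT (fun x => convol (G i) (moll d') x - G i x)%R <= e%:E)%E}.
  by apply: cid; have [d d0 H] := moll_L1_cvg (bG i) e0; exists d.
pose d := \big[Num.min/Num.min d1 e]_(i < n) sval (Hd i).
have d0 : 0 < d.
  rewrite /d; apply: (big_ind (fun t : R => 0 < t)) => [|a b ? ?|i _].
  - by rewrite lt_min d10.
  - by rewrite lt_min; apply/andP.
  - by have [] := svalP (Hd i).
have dd1 : d <= Num.min d1 e by exact: bigmin_le_id.
have ddi i : d <= sval (Hd i) by exact: bigmin_le_cond.
have de : d <= e by rewrite (le_trans dd1)// ge_min lexx orbT.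
have Sm := @smooth_moll R n d.
have E i : pderiv i (convol F (moll d)) = convol (G i) (moll d).
  rewrite conv_pderiv//; apply/funext => x; rewrite /convol.
  rewrite -[RHS]opprK -FG; last exact: smooth_reflect.
  rewrite -mulN1r -RintZ.
    apply: eq_Rintegral => y _; rewrite pderiv_reflect//.
    by rewrite mulrN mulN1r opprK.
  by apply: bmsM_smooth => //; apply: smooth_pderiv; exact: smooth_reflect.
exists (convol F (moll d)); split.
- by move=> k; exact: conv_Ck.
- move=> x; apply: conv_close => // y yx; apply: Hd1 => i.
  by rewrite (le_trans (yx i))// (le_trans dd1)// ge_min lexx.
- by move=> i M GM x; rewrite E; apply: conv_bounded.
- by move=> i; rewrite E; apply: (svalP (Hd i)).2; rewrite d0/=.
- move=> x Hx; apply: conv_support => // y yx; apply: Hx => i.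
  exact: le_trans (yx i) de.
Qed.

End mollification.

(** * Poincare inequality on cubes *)

Section slices.
Context (R : realType) (n : nat).

Lemma cons_rV_lift (p : R * 'rV[R]_n) j : cons_rV (p : measurableTypeR R * _) ord0 (lift ord0 j) = p.2 ord0 j.
Proof.
have -> : lift ord0 j = rshift 1 j :> 'I_n.+1 by exact: val_inj.
exact: cons_rVS.
Qed.

Lemma cons_rV_eq (x y : 'rV[R]_n.+1) : x ord0 ord0 = y ord0 ord0 ->
  (forall j : 'I_n, x ord0 (lift ord0 j) = y ord0 (lift ord0 j)) -> x = y.
Proof.
move=> h0 h1; apply/rowP => i; case: (unliftP ord0 i) => [j ->|->]; [exact: h1|exact: h0].
Qed.

Lemma cons_rV_line (t : R) (x : 'rV[R]_n) :
  cons_rV (t : measurableTypeR R, x) = t *: delta_mx ord0 ord0 + cons_rV (0 : measurableTypeR R, x).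
Proof.
apply: cons_rV_eq => [|j].
  by rewrite cons_rV0 2!mxE mxE cons_rV0 !eqxx mulr1 addr0.
rewrite cons_rV_lift 2!mxE mxE cons_rV_lift [lift _ _ == _]eq_sym.
by rewrite (negbTE (neq_lift _ _)) andbF mulr0 add0r.
Qed.

Lemma cons_rV_slice (t h : R) (x : 'rV[R]_n) i :
  cons_rV (t : measurableTypeR R, h *: delta_mx ord0 i + x) =
  h *: delta_mx ord0 (lift ord0 i) + cons_rV (t : measurableTypeR R, x).
Proof.
apply: cons_rV_eq => [|j].
  rewrite cons_rV0 2!mxE mxE cons_rV0 /=.
  by rewrite mulr0 add0r.
rewrite cons_rV_lift [RHS]mxE [X in _ = X + _]mxE cons_rV_lift 4!mxE.
by rewrite [_ == lift _ _](inj_eq lift_inj).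
Qed.

Lemma cons_rV_continuous_snd (t : R) :
  continuous (fun x : 'rV[R]_n => cons_rV (t : measurableTypeR R, x)).
Proof.
move=> x A /rV_nbhsP[e e0 eA]; apply/rV_nbhsP; exists e => // y yx; apply: eA => i.
case: (unliftP ord0 i) => [j ->|->]; first by rewrite !cons_rV_lift.
by rewrite !cons_rV0 subrr normr0.
Qed.

Lemma cons_rV_continuous_fst (x : 'rV[R]_n) :
  continuous (fun t : R => cons_rV (t : measurableTypeR R, x)).
Proof.
move=> t A /rV_nbhsP[e e0 eA]; apply/nbhs_ballP; exists e => // s /= ts; apply: eA => i.
case: (unliftP ord0 i) => [j ->|->]; first by rewrite !cons_rV_lift subrr normr0.
by rewrite !cons_rV0 distrC.
Qed.

Lemma L1norm_cons (c : 'rV[R]_n.+1) l (h : 'rV[R]_n.+1 -> R) : measurable_fun setT h ->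
  L1norm (hcube c l) h = (\int[@lebesgue_measure R]_(t in `[c ord0 ord0, (c ord0 ord0 + l)%R[)
    L1norm (hcube (rsubmx (c : 'rV[R]_(1 + n))) l) (fun x => h (cons_rV (t, x))))%E.
Proof.
move=> mh; rewrite /L1norm integral_mkcond leb_tonelli; last 2 first.
- have H : measurable_fun (hcube c l) (fun x => `|h x|%:E) by exact: measurable_norm_fin.
  exact: (measurable_restrictT _ (measurable_hcube c l)).1 H.
- by move=> x; rewrite erestrict_ge0.
rewrite [RHS]integral_mkcond; apply: eq_integral => t _.
rewrite patchE; case: ifPn => tI.
  rewrite [RHS]integral_mkcond; apply: eq_integral => x _; rewrite !patchE.
  congr (if _ then _ else _); apply/idP/idP => /set_mem H; apply/mem_set.
    by have [] := (hcube_cons _ _ _ _).1 H.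
  by apply/hcube_cons; split=> //; move: tI; rewrite inE/= in_itv.
apply: integral0_eq => x _; rewrite patchE memNset// => /hcube_cons[H _].
by move: tI; rewrite notin_setE; apply; rewrite /= in_itv.
Qed.

Lemma measurable_rsubmx : measurable_fun setT (fun x : 'rV[R]_n.+1 => rsubmx (x : 'rV[R]_(1 + n))).
Proof.
apply: measurable_fun_coorP => i.
rewrite (_ : (fun _ => _) = (fun x : 'rV[R]_n.+1 => x ord0 (rshift 1 i))).
  exact: measurable_coor.
by apply/funext => x; rewrite /= mxE.
Qed.

Lemma rsubmx_cons t (x : 'rV[R]_n) :
  rsubmx (cons_rV (t : measurableTypeR R, x) : 'rV[R]_(1 + n)) = x.
Proof. by have := cons_rVK (t : measurableTypeR R, x); rewrite /uncons_rV => -[_]. Qed.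

Lemma measurable_L1norm_slice (D : set 'rV[R]_n) (h : 'rV[R]_n.+1 -> R) : measurable D ->
  measurable_fun setT h ->
  measurable_fun setT (fun t : measurableTypeR R => L1norm D (fun x => h (cons_rV (t, x)))).
Proof.
move=> mD mh.
pose S : set 'rV[R]_n.+1 := (fun x : 'rV[R]_n.+1 => rsubmx (x : 'rV[R]_(1 + n))) @^-1` D.
have mS : measurable S by rewrite -[S]setTI; exact: measurable_rsubmx.
have mS' : measurable_fun setT ((fun z => `|h z|%:E) \_ S).
  by apply/(measurable_restrictT _ mS); exact: measurable_norm_fin.
rewrite (_ : (fun _ => _) = (fun t : measurableTypeR R => \int[leb R n]_x ((fun z => `|h z|%:E) \_ S) (cons_rV (t, x)))%E).
  by apply: measurable_leb_slice => // x; rewrite erestrict_ge0.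
apply/funext => t; rewrite /L1norm integral_mkcond; apply: eq_integral => x _.
rewrite !patchE; congr (if _ then _ else _).
by apply/idP/idP => /set_mem H; apply/mem_set; move: H; rewrite /S/= rsubmx_cons.
Qed.

End slices.

Section poincare.
Context (R : realType).

Lemma derive_increment_le (F G : R -> R) (a l s t : R) :
  (forall r : R, is_derive r 1 F (G r)) -> continuous G ->
  a <= s < a + l -> a <= t < a + l ->
  (`|F t - F s|%:E <= \int[@lebesgue_measure R]_(r in `[a, (a + l)%R[) `|G r|%:E)%E.
Proof.
move=> dF cG; wlog st : s t / s <= t.
  move=> H hs ht; have [/H|/ltW/H] := leP s t; first exact.
  by rewrite distrC; apply.
move=> /andP[as_ sl] /andP[at_ tl].
have mG : measurable_fun setT (G : measurableTypeR R -> R) by exact: continuous_measurable_fun.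
have mnG D : measurable_fun D (fun r : measurableTypeR R => `|G r|%:E).
  by apply: measurable_funTS; apply/measurable_EFinP; exact: measurableT_comp.
move: st; rewrite le_eqVlt => /predU1P[->|st].
  by rewrite subrr normr0 integral_ge0// => r _; rewrite lee_fin.
have cF := is_derive1_continuous dF.
have E : (\int[@lebesgue_measure R]_(r in `[s, t]) (G r)%:E = (F t - F s)%:E)%E.
  rewrite (@continuous_FTC2 R G F)//; first exact: continuous_subspaceT.
  - split; first by move=> r _; exact: (@ex_derive _ _ _ _ _ _ _ (dF r)).
    + by apply: cvg_at_right_filter; exact: cF.
    + by apply: cvg_at_left_filter; exact: cF.
  - by move=> r _; rewrite derive1E (@derive_val _ _ _ _ _ _ _ (dF r)).
rewrite -abse_EFin -E.
apply: (@le_trans _ _ (\int[@lebesgue_measure R]_(r in `[s, t]) `|G r|%:E)%E).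
  apply: le_abse_integral => //.
  by apply: measurable_funTS; exact/measurable_EFinP.
apply: ge0_subset_integral => //.
move=> r /=; rewrite !in_itv/= => /andP[h1 h2]; apply/andP; split.
  exact: le_trans h1.
exact: le_lt_trans tl.
Qed.

(** Otherwise [h >= b / l] on the whole interval. This selects a good slice in the Poincare
    inequality. *)
Lemma integral_lower_bound (h : R -> \bar R) (a l : R) (b : R) : 0 < l ->
  measurable_fun setT (h : measurableTypeR R -> \bar R) -> (forall t, 0 <= h t)%E ->
  (\int[@lebesgue_measure R]_(t in `[a, (a + l)%R[) h t < b%:E)%E ->
  exists2 t0, a <= t0 < a + l & (h t0 < (b / l)%:E)%E.
Proof.
move=> l0 mh h0 hb.
have b0 : 0 < b by rewrite -lte_fin (le_lt_trans _ hb)// integral_ge0.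
apply: contrapT => H; move: hb; apply/negP; rewrite -leNgt.
have -> : b%:E = (\int[@lebesgue_measure R]_(t in `[a, (a + l)%R[) (b / l)%:E)%E.
  rewrite integral_cst//= lebesgue_measure_itv/= lte_fin ltrDl l0 -EFinD -EFinM.
  by congr EFin; field; rewrite gt_eqF.
apply: ge0_le_integral => //.
- by move=> t _; rewrite lee_fin divr_ge0// ltW.
- by apply: measurable_funTS.
- move=> t /=; rewrite in_itv/= => tI; rewrite leNgt; apply/negP => hlt.
  by apply: H; exists t.
Qed.

Definition C1_partials n (f : 'rV[R]_n -> R) (g : 'I_n -> 'rV[R]_n -> R) :=
  [/\ continuous f, forall i, continuous (g i) &
      forall i x, is_derive x (delta_mx ord0 i) f (g i x)].

Lemma C1_partials_slice n (f : 'rV[R]_n.+1 -> R) g (t : R) : C1_partials f g ->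
  C1_partials (fun x => f (cons_rV (t, x))) (fun i x => g (lift ord0 i) (cons_rV (t, x))).
Proof.
move=> [cf cg dg]; split=> [x|i x|i x].
- apply: (@continuous_comp _ _ _ (fun x : 'rV[R]_n => cons_rV (t : measurableTypeR R, x))); last exact: cf.
  exact: cons_rV_continuous_snd.
- apply: (@continuous_comp _ _ _ (fun x : 'rV[R]_n => cons_rV (t : measurableTypeR R, x))); last exact: cg.
  exact: cons_rV_continuous_snd.
- have E : x = 0 *: delta_mx ord0 i + x by rewrite scale0r add0r.
  rewrite {1}E; apply/is_derive_lineP.
  rewrite (_ : (fun h => _) = (fun h : R => f (h *: delta_mx ord0 (lift ord0 i) + cons_rV (t : measurableTypeR R, x)))); last first.
    by apply/funext => h; rewrite cons_rV_slice.
  by apply/is_derive_lineP; rewrite scale0r add0r.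
Qed.

Lemma continuous_measurable_rVT n (f : 'rV[R]_n -> R) : continuous f -> measurable_fun setT f.
Proof. by move=> cf; apply: continuous_measurable_rV; [exact: openT|move=> x _; exact: cf]. Qed.

(** On each line in the first direction, the difference with the value at [t0] is at most the
    integral of the derivative over the full segment. This bound does not depend on [t], so
    integrating in [t] only produces the factor [l]. *)
Lemma slice_variation_le n (f : 'rV[R]_n.+1 -> R) g (c : 'rV[R]_n.+1) (l t0 : R) : 0 < l -> C1_partials f g ->
  c ord0 ord0 <= t0 < c ord0 ord0 + l ->
  (L1norm (hcube c l) (fun x => f x - f (cons_rV (t0 : measurableTypeR R, rsubmx (x : 'rV[R]_(1 + n)))))%R
   <= l%:E * L1norm (hcube c l) (g ord0))%E.
Proof.
move=> l0 fg ht0; have [cf cg dg] := fg.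
have mf := continuous_measurable_rVT cf.
have mg i := continuous_measurable_rVT (cg i).
set c' := rsubmx (c : 'rV[R]_(1 + n)).
have mQ' : measurable (hcube c' l) by exact: measurable_hcube.
have mQ : measurable (hcube c l) by exact: measurable_hcube.
have mfs : measurable_fun setT (fun x : 'rV[R]_n.+1 => f (cons_rV (t0 : measurableTypeR R, rsubmx (x : 'rV[R]_(1 + n))))).
  exact: (measurableT_comp (measurable_cons_slice t0 mf) (@measurable_rsubmx R n)).
rewrite L1norm_cons; last exact: measurable_funB.
pose K z : \bar R := ((fun z => `|g ord0 z|%:E) \_ (hcube c l)) z.
have mK : measurable_fun setT K.
  by apply/(measurable_restrictT _ mQ); exact: measurable_norm_fin.
have K0 z : (0 <= K z)%E by rewrite erestrict_ge0.
pose H (x : 'rV[R]_n) := (\int[@lebesgue_measure R]_s K (cons_rV (s, x)))%E.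
have mKc : measurable_fun setT (fun p : measurableTypeR R * 'rV[R]_n => K (cons_rV p)).
  exact: (measurableT_comp mK (@measurable_cons_rV R n)).
have K0c p : (0 <= K (cons_rV (n := n) p))%E by exact: K0.
have mH : measurable_fun setT H.
  exact: (measurable_fun_fubini_tonelli_G (m1 := @lebesgue_measure R) _ mKc K0c).
have H0 x : (0 <= H x)%E by apply: integral_ge0 => s _.
have EH : (\int[leb R n]_x H x = L1norm (hcube c l) (g ord0))%E.
  rewrite /H -(fubini_tonelli _ mKc K0c) -leb_tonelli//.
  by rewrite /L1norm [RHS]integral_mkcond.
have -> : (l%:E * L1norm (hcube c l) (g ord0) =
    \int[@lebesgue_measure R]_(t in `[c ord0 ord0, (c ord0 ord0 + l)%R[) \int[leb R n]_x H x)%E.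
  rewrite EH integral_cst//= lebesgue_measure_itv/= lte_fin ltrDl l0 -EFinD.
  by rewrite addrAC subrr add0r muleC.
apply: ge0_le_integral => //.
- by move=> t _; exact: L1norm_ge0.
- apply: measurable_funTS.
  by apply: (@measurable_L1norm_slice R n _ (fun x => f x - f (cons_rV (t0 : measurableTypeR R, rsubmx (x : 'rV[R]_(1 + n)))))) => //; exact: measurable_funB.
move=> t; rewrite /= in_itv/= => tI.
have mfst : measurable_fun setT (fun x : 'rV[R]_n => f (cons_rV (t : measurableTypeR R, x)) - f (cons_rV (t0 : measurableTypeR R, x))).
  by apply: measurable_funB; exact: (measurable_cons_slice _ mf).
rewrite (_ : (fun x => _) = (fun x : 'rV[R]_n => f (cons_rV (t : measurableTypeR R, x)) - f (cons_rV (t0 : measurableTypeR R, x)))); last first.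
  by apply/funext => x; rewrite rsubmx_cons.
rewrite /L1norm integral_mkcond; apply: ge0_le_integral => //.
- by move=> x _; rewrite erestrict_ge0.
- have H1 : measurable_fun (hcube c' l) (fun x : 'rV[R]_n => `|f (cons_rV (t : measurableTypeR R, x)) - f (cons_rV (t0 : measurableTypeR R, x))|%:E).
    exact: measurable_norm_fin.
  exact: (measurable_restrictT _ mQ').1 H1.
move=> x _; rewrite patchE; case: ifPn => // /set_mem xQ.
have := @derive_increment_le (fun s => f (cons_rV (s : measurableTypeR R, x)))
  (fun s => g ord0 (cons_rV (s : measurableTypeR R, x))) (c ord0 ord0) l t0 t.
have dF (r : R) : is_derive r 1 (fun s => f (cons_rV (s : measurableTypeR R, x))) (g ord0 (cons_rV (r : measurableTypeR R, x))).
  rewrite (_ : (fun s => _) = (fun s : R => f (s *: delta_mx ord0 ord0 + cons_rV (0 : measurableTypeR R, x)))); last first.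
    by apply/funext => s; rewrite cons_rV_line.
  by apply/is_derive_lineP; rewrite -cons_rV_line.
have cG : continuous (fun s : R => g ord0 (cons_rV (s : measurableTypeR R, x))).
  move=> s; apply: (@continuous_comp _ _ _ (fun s : R => cons_rV (s : measurableTypeR R, x))); last exact: cg.
  exact: cons_rV_continuous_fst.
move=> /(_ dF cG ht0 tI)/le_trans; apply.
rewrite integral_mkcond; apply: ge0_le_integral => //.
- by move=> s _; rewrite erestrict_ge0.
- have H1 : measurable_fun (`[c ord0 ord0, (c ord0 ord0 + l)%R[ : set (measurableTypeR R)) (fun s : measurableTypeR R => `|g ord0 (cons_rV (s, x))|%:E).
    apply: measurable_funTS; apply/measurable_EFinP; apply: measurableT_comp => //.
    exact: continuous_measurable_fun cG.
  by have := (measurable_restrictT _ _).1 H1; apply; exact: measurable_itv.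
- exact: (measurableT_comp mKc (@pair2_measurable _ _ (measurableTypeR R) 'rV[R]_n x)).
move=> s _; rewrite [X in (X <= _)%E]patchE; case: ifPn => [/set_mem sI|_]; last exact: K0.
rewrite /K patchE mem_set//; apply/hcube_cons; split=> //; move: sI; rewrite /= in_itv.
Qed.

(** Induction on the dimension: pick a slice [t0] on which the tangential gradient is not above its
    average, use the constant [a] of that slice, and compare the other slices with it in the first
    direction. The strict inequality in the hypothesis is what makes such a slice exist. *)
Lemma poincare_hcube n (f : 'rV[R]_n -> R) g (c : 'rV[R]_n) (l : R) : 0 < l -> C1_partials f g ->
  forall e : R, (l%:E * \sum_(i < n) L1norm (hcube c l) (g i) < e%:E)%E ->
  exists a : R, (L1norm (hcube c l) (fun x => f x - a)%R <= e%:E)%E.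
Proof.
elim: n f g c => [|n IH] f g c l0 fg e he.
  exists (f 0); rewrite /L1norm integral0_eq.
    by move: he; rewrite big_ord0 mule0 => /ltW.
  by move=> x _; rewrite (_ : x = 0) ?subrr ?normr0//; apply/rowP => -[].
have [cf cg dg] := fg.
have mf := continuous_measurable_rVT cf.
have mg i := continuous_measurable_rVT (cg i).
set c' := rsubmx (c : 'rV[R]_(1 + n)).
have mQ' : measurable (hcube c' l) by exact: measurable_hcube.
have mQ : measurable (hcube c l) by exact: measurable_hcube.
pose A := L1norm (hcube c l) (g ord0).
pose B := (\sum_(i < n) L1norm (hcube c l) (g (lift ord0 i)))%E.
have A0 : (0 <= A)%E by exact: L1norm_ge0.
have B0 : (0 <= B)%E by apply: sume_ge0 => i _; exact: L1norm_ge0.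
have heAB : (l%:E * (A + B) < e%:E)%E by move: he; rewrite big_ord_recl.
have ABfin : (A + B \is a fin_num)%E.
  case: (A + B)%E heAB (adde_ge0 A0 B0) => [r||]// + _.
  by rewrite gt0_muley ?lte_fin.
have [/fineK Af /fineK Bf] : A \is a fin_num /\ B \is a fin_num.
  by apply/andP; rewrite -fin_numD.
set al := fine A in Af; set be := fine B in Bf.
have hab : l * (al + be) < e by move: heAB; rewrite -Af -Bf -EFinD -EFinM lte_fin.
pose S (t : R) := (\sum_(i < n) L1norm (hcube c' l) (fun x => g (lift ord0 i) (cons_rV (t : measurableTypeR R, x))))%E.
(* The part of the budget [e / l] left by the derivative in the first direction. *)
pose b := e / l - al.
have hb : be < b by rewrite /b ltrBrDr ltr_pdivlMr// addrC mulrC.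
have mS : measurable_fun setT (S : measurableTypeR R -> \bar R).
  apply: emeasurable_sum => i; apply: measurable_L1norm_slice => //.
have SE : (\int[@lebesgue_measure R]_(t in `[c ord0 ord0, (c ord0 ord0 + l)%R[) S t = B)%E.
  rewrite /S ge0_integral_sum//.
  - by apply: eq_bigr => i _; rewrite L1norm_cons.
  - by move=> i; apply: measurable_funTS; exact: measurable_L1norm_slice.
  - by move=> i t _; exact: L1norm_ge0.
have S0 t : (0 <= S t)%E by apply: sume_ge0 => i _; exact: L1norm_ge0.
have SB : (\int[@lebesgue_measure R]_(t in `[c ord0 ord0, (c ord0 ord0 + l)%R[) S t < b%:E)%E.
  by rewrite SE -Bf lte_fin.
have [t0 ht0 St0] := integral_lower_bound l0 mS S0 SB.
have [|a Ha] := IH _ _ c' l0 (C1_partials_slice t0 fg) b.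
  by rewrite -lte_pdivlMl// -EFinM mulrC.
exists a.
pose f1 (x : 'rV[R]_n.+1) := f (cons_rV (t0 : measurableTypeR R, rsubmx (x : 'rV[R]_(1 + n)))).
have mf1 : measurable_fun setT f1.
  exact: (measurableT_comp (measurable_cons_slice t0 mf) (@measurable_rsubmx R n)).
rewrite (_ : (fun x => _) = (fun x => (f x - f1 x) + (f1 x - a))); last first.
  by apply/funext => x; rewrite addrA subrK.
rewrite (le_trans (L1norm_triangle _ _ _))//; [exact: measurable_funB|exact: measurable_funB|].
rewrite (_ : e = l * al + l * b); last by rewrite /b; field; rewrite gt_eqF.
rewrite EFinD leeD//.
  by rewrite EFinM Af; exact: slice_variation_le.
rewrite L1norm_cons; last exact: measurable_funB.
apply: (@le_trans _ _ (\int[@lebesgue_measure R]_(t in `[c ord0 ord0, (c ord0 ord0 + l)%R[) b%:E)%E).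
  apply: ge0_le_integral => //.
  - by move=> t _; exact: L1norm_ge0.
  - apply: measurable_funTS; apply: (@measurable_L1norm_slice R n _ (fun x => f1 x - a)) => //.
    exact: measurable_funB.
  - move=> t _; apply: le_trans Ha; rewrite /f1.
    by under [X in (L1norm _ X <= _)%E]eq_fun do rewrite rsubmx_cons.
by rewrite integral_cst//= lebesgue_measure_itv/= lte_fin ltrDl l0 -EFinD addrAC subrr add0r -EFinM mulrC.
Qed.

End poincare.

(** * Test functions and Sobolev competitors *)

Section continuous_fun.
Context (R : realType) (T : topologicalType).

Lemma continuous_fD (f g : T -> R) : continuous f -> continuous g ->
  continuous (fun x => f x + g x).
Proof. by move=> cf cg x; exact: (cvgD (cf x) (cg x)). Qed.

Lemma continuous_fM (f g : T -> R) : continuous f -> continuous g ->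
  continuous (fun x => f x * g x).
Proof. by move=> cf cg x; exact: (cvgM (cf x) (cg x)). Qed.

End continuous_fun.

Section Ck_functions.
Context (R : realType) (n : nat).
Implicit Types (f g : 'rV[R]_n -> R) (D : set 'rV[R]_n).

Lemma Ck_continuous k f : Ck k f -> continuous f.
Proof. by case: k => [|k] []. Qed.

Lemma CkS k f : Ck k.+1 f -> Ck k f.
Proof.
elim: k f => [|k IH] f [cf df]; split=> // i; have [d1 d2] := df i.
by split=> //; exact: IH.
Qed.

Lemma Ck_is_derive k f i x : Ck k.+1 f -> is_derive x (delta_mx ord0 i) f (pderiv i f x).
Proof. by move=> [_ /(_ i)[H _]]; exact: derivableP. Qed.

Lemma is_derive_pderiv f i x (d : R) : is_derive x (delta_mx ord0 i) f d -> pderiv i f x = d.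
Proof. by move=> H; exact: (@derive_val _ _ _ _ _ _ _ H). Qed.

Lemma CkD k f g : Ck k f -> Ck k g -> Ck k (fun x => f x + g x).
Proof.
elim: k f g => [|k IH] f g Cf Cg.
  by split=> //; exact: (continuous_fD (Ck_continuous Cf) (Ck_continuous Cg)).
split=> [|i]; first exact: (continuous_fD (Ck_continuous Cf) (Ck_continuous Cg)).
have Df x := is_derive_fD (Ck_is_derive i x Cf) (Ck_is_derive i x Cg).
split; first by move=> x; exact: (@ex_derive _ _ _ _ _ _ _ (Df x)).
rewrite (_ : pderiv i _ = fun x => pderiv i f x + pderiv i g x); last first.
  by apply/funext => x; exact: is_derive_pderiv.
by apply: IH; [have [_ /(_ i)[]] := Cf|have [_ /(_ i)[]] := Cg].
Qed.

Lemma CkM k f g : Ck k f -> Ck k g -> Ck k (fun x => f x * g x).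
Proof.
elim: k f g => [|k IH] f g Cf Cg.
  by split=> //; exact: (continuous_fM (Ck_continuous Cf) (Ck_continuous Cg)).
split=> [|i]; first exact: (continuous_fM (Ck_continuous Cf) (Ck_continuous Cg)).
have Df x := is_derive_fM (Ck_is_derive i x Cf) (Ck_is_derive i x Cg).
split; first by move=> x; exact: (@ex_derive _ _ _ _ _ _ _ (Df x)).
rewrite (_ : pderiv i _ = fun x => pderiv i f x * g x + f x * pderiv i g x); last first.
  by apply/funext => x; exact: is_derive_pderiv.
by apply: CkD; apply: IH; [have [_ /(_ i)[]] := Cf|exact: CkS|exact: CkS|have [_ /(_ i)[]] := Cg].
Qed.

Lemma pderivM f g i x : (forall k, Ck k f) -> (forall k, Ck k g) ->
  pderiv i (fun x => f x * g x) x = pderiv i f x * g x + f x * pderiv i g x.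
Proof.
move=> Cf Cg; apply: is_derive_pderiv.
exact: is_derive_fM (Ck_is_derive i x (Cf 1%N)) (Ck_is_derive i x (Cg 1%N)).
Qed.

Lemma Ck_pderiv f i : (forall k, Ck k f) -> forall k, Ck k (pderiv i f).
Proof. by move=> Cf k; have [_ /(_ i)[]] := Cf k.+1. Qed.

Lemma bms_continuous f : continuous f -> (exists M : R, forall x, M < `|x| -> f x = 0) -> bms f.
Proof.
move=> cf [M fM]; split.
  by apply: continuous_measurable_rV; [exact: openT|move=> x _; exact: cf].
pose N := Num.max 0 M.
have N0 : 0 <= N by rewrite le_max lexx.
pose K := [set x : 'rV[R]_n | forall i, x ord0 i \in `[- N, N]].
have cK : compact K.
  apply: (@rV_compact R n (fun=> `[- N, N]%classic)) => i.
  exact: segment_compact.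
have /compact_bounded[B [_ HB]] : compact (f @` K).
  by apply: continuous_compact => //; exact: continuous_subspaceT.
have HB' x : K x -> `|f x| <= `|B| + 1.
  move=> Kx; apply: (HB (`|B| + 1)); last by exists x.
  by rewrite (le_lt_trans (ler_norm B))// ltrDl.
exists (N + (`|B| + 1)); split=> [|x]; first by rewrite !addr_ge0.
have [xN|xN] := leP `|x| N.
  split.
    rewrite (le_trans (HB' x _))// ?lerDr// => i; rewrite in_itv/= -ler_norml.
    by move: xN => /(rV_norm_le x N0).
  by move=> H; exfalso; have := normr_ge0 B; lra.
rewrite fM ?normr0//; last by rewrite (le_lt_trans _ xN)// le_max lexx orbT.
by split=> //; rewrite !addr_ge0.
Qed.

Lemma compactly_contained_zero D f : compactly_contained [set x | f x != 0] D ->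
  forall x, ~ D x -> f x = 0.
Proof.
move=> [_ H] x Dx; apply: contrapT => /eqP fx; apply: Dx; apply: H.
exact: subset_closure.
Qed.

Lemma compact_support_bounded D f : compactly_contained [set x | f x != 0] D ->
  exists M : R, forall x, M < `|x| -> f x = 0.
Proof.
move=> [/compact_bounded[B [_ HB]] _]; exists (`|B| + 1) => x xB.
apply: contrapT => /eqP fx.
have := HB (`|B| + 1); rewrite (le_lt_trans (ler_norm B)) ?ltrDl// => /(_ isT x).
have xc : closure [set x | f x != 0] x by exact: subset_closure.
by move/(_ xc) => /=; lra.
Qed.

Lemma near_zero_pderiv f i x : (\forall y \near x, f y = 0) -> pderiv i f x = 0.
Proof.
move=> H; apply: is_derive_pderiv; apply: (@near_eq_is_derive _ _ _ (cst 0)).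
  by apply: filterS H => y ->.
Qed.

Lemma support_pderiv f i : [set x | pderiv i f x != 0] `<=` closure [set x | f x != 0].
Proof.
move=> x /= fx; apply: contrapT => Hx; move/negP: fx; apply; apply/eqP.
apply: near_zero_pderiv.
have : nbhs x (~` closure [set x | f x != 0]).
  by apply: open_nbhs_nbhs; split=> //; apply: closed_openC; exact: closed_closure.
apply: filterS => y Hy; apply: contrapT => /eqP fy; apply: Hy.
exact: subset_closure.
Qed.

Lemma compactly_containedS A B D : A `<=` closure B -> compactly_contained B D -> compactly_contained A D.
Proof.
move=> AB [cB BD].
have clAB : closure A `<=` closure B.
  have /closure_id -> := @closed_closure _ B.
  exact: closureS.
split; last exact: subset_trans BD.
by apply: (subclosed_compact _ cB) => //; exact: closed_closure.
Qed.

Lemma bms_Ck_support f k D : Ck k f -> compactly_contained [set x | f x != 0] D -> bms f.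
Proof.
move=> Cf cf; apply: bms_continuous; first exact: (Ck_continuous Cf).
exact: (compact_support_bounded cf).
Qed.

Lemma test_bms D f : test_function D f -> bms f.
Proof. by move=> [Cf cf]; exact: (bms_Ck_support (Cf 0%N) cf). Qed.

Lemma test_pderiv D f i : test_function D f -> test_function D (pderiv i f).
Proof.
move=> [Cf cf]; split; first exact: Ck_pderiv.
by apply: compactly_containedS cf; exact: support_pderiv.
Qed.

Lemma test_subset D1 D2 f : D1 `<=` D2 -> test_function D1 f -> test_function D2 f.
Proof. by move=> H [Cf [c1 c2]]; split=> //; split=> //; exact: subset_trans H. Qed.

Lemma testM D f g : test_function D f -> (forall k, Ck k g) -> test_function D (fun x => f x * g x).
Proof.
move=> [Cf cf] Cg; split; first by move=> k; exact: CkM.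
apply: compactly_containedS cf => x /= H; apply: subset_closure => /=.
by apply: contra H => /eqP ->; rewrite mul0r.
Qed.

End Ck_functions.

Section closed_boxes.
Context (R : realType) (n : nat).
Implicit Types (x y c : 'rV[R]_n) (D : set 'rV[R]_n).

Definition cbox c (r : R) := [set x : 'rV[R]_n | forall i, `|x ord0 i - c ord0 i| <= r].

Lemma cbox_compact c r : compact (cbox c r).
Proof.
rewrite (_ : cbox c r = [set x : 'rV[R]_n | forall i, `[c ord0 i - r, c ord0 i + r]%classic (x ord0 i)]).
  by apply: (@rV_compact R n (fun i => `[c ord0 i - r, c ord0 i + r]%classic)) => i; exact: segment_compact.
by apply/seteqP; split=> x H i; have := H i; rewrite /= in_itv/= ler_distl.
Qed.

Lemma cbox_closed c r : closed (cbox c r).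
Proof. by apply: compact_closed; [exact: norm_hausdorff|exact: cbox_compact]. Qed.

Lemma cbox_enlarge c r D : 0 <= r -> open D -> cbox c r `<=` D ->
  exists2 d : R, 0 < d & cbox c (r + d) `<=` D.
Proof.
move=> r0 oD cD.
pose P (d : R) x := forall y, (forall i, `|y ord0 i - x ord0 i| <= d) -> D y.
have H : \forall d \near 0^'+, cbox c r `<=` P d.
  move/compact_near_coveringP : (@cbox_compact c r); apply => x cx.
  have /rV_nbhsP[e e0 eD] : nbhs x D by move: oD; rewrite openE; apply; exact: cD.
  have e2 : 0 < e / 2 by rewrite divr_gt0.
  exists ([set y : 'rV[R]_n | forall i, `|y ord0 i - x ord0 i| < e / 2], [set d : R | d < e / 2]).
    split; first by apply/rV_nbhsP; exists (e / 2).
    exact: nbhs_right_lt.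
  move=> [x' d] /= [Hx' Hd] y Hy; apply: eD => i.
  have := ler_normD (y ord0 i - x' ord0 i) (x' ord0 i - x ord0 i).
  by rewrite addrA subrK; have := Hx' i; have := Hy i; lra.
have /filter_ex[d [d0 Hd]] : \forall d \near 0^'+, 0 < d /\ cbox c r `<=` P d.
  by near=> d; split; near: d; [exact: nbhs_right_gt|].
exists d => // y Hy.
(* The projection of [y] onto the box, at distance at most [d] from [y]. *)
pose x := \row_i Num.min (c ord0 i + r) (Num.max (c ord0 i - r) (y ord0 i)).
apply: (Hd x) => i; have := Hy i; rewrite !mxE ler_distl => /andP[h1 h2];
  rewrite /Num.min /Num.max; case: (ltP (c ord0 i - r) (y ord0 i)) => ?;
  case: ltP => ?; rewrite ler_distl; apply/andP; split; lra.
Unshelve. all: by end_near. Qed.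

End closed_boxes.

Section plateau.
Context (R : realType) (n : nat).
Variables (c : 'rV[R]_n) (a b : R).
Hypothesis ab : a < b.
Implicit Types (x : 'rV[R]_n).

Let w := b - a.
Let w0 : 0 < w. Proof. by rewrite subr_gt0. Qed.
Let wn0 : w != 0. Proof. by rewrite gt_eqF. Qed.

(** An ascending step across [[c - b, c - a]] times a descending one across [[c + a, c + b]]. *)
Definition plateau1 (i : 'I_n) (t : R) : R :=
  step ((b - a)^-1 * t + (b - c ord0 i) / (b - a)) * step (- (b - a)^-1 * t + (b + c ord0 i) / (b - a)).

Definition plateau x : R := \prod_(i < n) plateau1 i (x ord0 i).

Lemma smooth_plateau : smooth plateau.
Proof. by apply: smooth_prod => i; apply: smooth_mul; exact: smooth_step. Qed.

Lemma plateau1_01 i t : 0 <= plateau1 i t <= 1.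
Proof.
have /andP[h1 h2] := step_01 ((b - a)^-1 * t + (b - c ord0 i) / (b - a)).
have /andP[h3 h4] := step_01 (- (b - a)^-1 * t + (b + c ord0 i) / (b - a)).
by rewrite mulr_ge0//= mulr_ile1.
Qed.

Lemma plateau_01 x : 0 <= plateau x <= 1.
Proof.
apply/andP; split; first by apply: prodr_ge0 => i _; have /andP[] := plateau1_01 i (x ord0 i).
by apply: numdomain.Num.Theory.prodr_ile1 => i _; exact: plateau1_01.
Qed.

Let arg1 i t : (b - a)^-1 * t + (b - c ord0 i) / (b - a) = (t - c ord0 i + b) / w.
Proof. by rewrite /w; field. Qed.

Let arg2 i t : - (b - a)^-1 * t + (b + c ord0 i) / (b - a) = (b - (t - c ord0 i)) / w.
Proof. by rewrite /w; field. Qed.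

Lemma plateau1_1 i t : `|t - c ord0 i| <= a -> plateau1 i t = 1.
Proof.
rewrite ler_norml => /andP[h1 h2]; rewrite /plateau1 arg1 arg2 !step_ge1 ?mulr1//.
  by rewrite ler_pdivlMr// mul1r /w; lra.
by rewrite ler_pdivlMr// mul1r /w; lra.
Qed.

Lemma plateau_1 x : cbox c a x -> plateau x = 1.
Proof. by move=> H; apply: big1 => i _; exact: plateau1_1. Qed.

Lemma plateau_0 x : ~ cbox c b x -> plateau x = 0.
Proof.
move=> /existsNP[i /negP]; rewrite -ltNge => H; rewrite /plateau (bigD1 i)//=.
rewrite [plateau1 _ _](_ : _ = 0) ?mul0r// /plateau1 arg1 arg2.
move: H; rewrite lter_normr => /orP[] H.
  by rewrite [X in _ * X]step_le0 ?mulr0// ler_pdivrMr// mul0r; lra.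
by rewrite [X in X * _]step_le0 ?mul0r// ler_pdivrMr// mul0r; lra.
Qed.

Lemma plateau_support D : cbox c b `<=` D -> compactly_contained [set x | plateau x != 0] D.
Proof.
move=> cD.
have H : closure [set x | plateau x != 0] `<=` cbox c b.
  have /closure_id -> := @cbox_closed R n c b; apply: closureS => x /=.
  by apply: contraNP => /plateau_0 ->.
split; last exact: subset_trans cD.
by apply: subclosed_compact (@cbox_compact R n c b) _ => //; exact: closed_closure.
Qed.

Definition plateau1' (i : 'I_n) (t : R) : R :=
  (b - a)^-1 * (step' ((b - a)^-1 * t + (b - c ord0 i) / (b - a)) * step (- (b - a)^-1 * t + (b + c ord0 i) / (b - a))
  - step ((b - a)^-1 * t + (b - c ord0 i) / (b - a)) * step' (- (b - a)^-1 * t + (b + c ord0 i) / (b - a))).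

Lemma is_derive_plateau1 i (t : R) : is_derive t 1 (plateau1 i) (plateau1' i t).
Proof.
have daff (k h : R) : is_derive t 1 (fun t : R => k * t + h) k.
  rewrite -[X in is_derive _ _ _ X]addr0; apply: is_derive_fD.
  have := @is_derive_fM R R (cst k) id t 1 0 1.
  by rewrite mul0r add0r mulr1; apply.
have D1 := @is_derive_fcomp R R (@step R) _ t 1 _ _ (is_derive_step _) (daff (b - a)^-1 ((b - c ord0 i) / (b - a))).
have D2 := @is_derive_fcomp R R (@step R) _ t 1 _ _ (is_derive_step _) (daff (- (b - a)^-1) ((b + c ord0 i) / (b - a))).
by apply: (is_derive_eq (is_derive_fM D1 D2)); rewrite /plateau1'; ring.
Qed.

Lemma pderiv_plateau i x : pderiv i plateau x =
  plateau1' i (x ord0 i) * \prod_(j < n | j != i) plateau1 j (x ord0 j).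
Proof.
apply: is_derive_pderiv.
have E : x = 0 *: delta_mx ord0 i + x by rewrite scale0r add0r.
rewrite {1}E; apply/is_derive_lineP.
rewrite (_ : (fun t => _) = (fun t : R => plateau1 i (t + x ord0 i) * \prod_(j < n | j != i) plateau1 j (x ord0 j))).
  have D0 : is_derive (0 : R) 1 (fun t : R => t + x ord0 i) (1 + 0) by apply: is_derive_fD.
  have D1 : is_derive (0 : R) 1 (fun t : R => plateau1 i (t + x ord0 i)) (plateau1' i (x ord0 i) * (1 + 0)).
    apply: (@is_derive_fcomp R R (plateau1 i) (fun t : R => t + x ord0 i)).
    by rewrite add0r; exact: is_derive_plateau1.
  have := is_derive_fM D1 (is_derive_cst (\prod_(j < n | j != i) plateau1 j (x ord0 j)) (0 : R) (1 : R)).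
  by rewrite mulr0 addr0 addr0 mulr1.
apply/funext => t; rewrite /plateau (bigD1 i)//= !mxE !eqxx mulr1; congr (_ * _).
by apply: eq_bigr => j ji; rewrite !mxE (negbTE ji) andbF mulr0 add0r.
Qed.

Lemma pderiv_plateau_in i x : cbox c a x -> pderiv i plateau x = 0.
Proof.
move=> /(_ i); rewrite ler_norml => /andP[h1 h2].
rewrite pderiv_plateau /plateau1' arg1 arg2 !(@step'_out R) ?mul0r ?mulr0 ?subrr ?mulr0 ?mul0r//; right.
  by rewrite ler_pdivlMr// mul1r /w; lra.
by rewrite ler_pdivlMr// mul1r /w; lra.
Qed.

(** Up to the factor [1 / (b - a)], [plateau1'] is a difference of two numbers in [0, M], so no
    factor 2 is lost. *)
Lemma pderiv_plateau_bound (M : R) i x : (forall t : R, step' t <= M) ->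
  `|pderiv i plateau x| <= M / (b - a).
Proof.
move=> HM; have M0 : 0 <= M by apply: le_trans (HM 0); exact: step'_ge0.
rewrite pderiv_plateau normrM -[leRHS]mulr1; apply: ler_pM => //; last first.
  rewrite ger0_norm; first by apply: numdomain.Num.Theory.prodr_ile1 => j _; exact: plateau1_01.
  by apply: prodr_ge0 => j _; have /andP[] := plateau1_01 j (x ord0 j).
rewrite /plateau1' normrM normfV (ger0_norm (ltW w0)) mulrC.
rewrite ler_wpM2r ?invr_ge0 ?(ltW w0)//.
set A := step' _; set B := step _; set C := step _; set D := step' _.
have /andP[B0 B1] : 0 <= B <= 1 by exact: step_01.
have /andP[C0 C1] : 0 <= C <= 1 by exact: step_01.
have A0 : 0 <= A by exact: step'_ge0.
have D0 : 0 <= D by exact: step'_ge0.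
have AM : A <= M by exact: HM.
have DM : D <= M by exact: HM.
have h1 : A * B <= M by rewrite -[leRHS]mulr1 ler_pM.
have h2 : C * D <= M by rewrite -[leRHS]mul1r ler_pM.
have h3 : 0 <= A * B by exact: mulr_ge0.
have h4 : 0 <= C * D by exact: mulr_ge0.
by rewrite ler_norml; apply/andP; split; lra.
Qed.

End plateau.

(** * Smooth approximation of phases and phase separation *)

Section cutoff_approximation.
Context (R : realType) (n : nat).
Implicit Types (u f : 'rV[R]_n -> R) (g : 'rV[R]_n -> 'rV[R]_n) (Om D : set 'rV[R]_n) (x y : 'rV[R]_n).

(* A function of W^{1,oo}(Om) with values in [-1, 1], together with an
   everywhere bounded Borel representative of its gradient. *)
Record phase_field Om (L : R) u g : Prop := PhaseField {
  phase_measurable : measurable_fun setT u;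
  phase_bound : forall x, `|u x| <= 1;
  phase_continuous : forall x, Om x -> {for x, continuous u};
  grad_measurable : forall i, measurable_fun setT (fun x => g x ord0 i);
  grad_bound : forall x i, `|g x ord0 i| <= L;
  phase_grad : forall i f, test_function Om f ->
    \int[leb R n]_x (u x * pderiv i f x) = - \int[leb R n]_x (g x ord0 i * f x) }.

Definition cutoff Om f := smooth f /\ compactly_contained [set x | f x != 0] Om.

Lemma cutoff_test Om f : cutoff Om f -> test_function Om f.
Proof. by move=> [Sf cf]; split=> // k; exact: smooth_Ck. Qed.

Definition cut_grad u g f i x : R := g x ord0 i * f x + u x * pderiv i f x.

Section cut.
Variables (Om : set 'rV[R]_n) (L : R) (u : 'rV[R]_n -> R) (g : 'rV[R]_n -> 'rV[R]_n) (eta : 'rV[R]_n -> R).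
Hypothesis (Hu : phase_field Om L u g) (He : cutoff Om eta).

Let teta := cutoff_test He.

Lemma bms_phaseM D f : test_function D f -> bms (fun x => u x * f x).
Proof.
move=> tf; rewrite (_ : (fun _ => _) = fun x => f x * u x); last first.
  by apply/funext => x; rewrite mulrC.
apply: bmsM; [exact: test_bms tf|exact: phase_measurable Hu|].
by exists 1; exact: phase_bound Hu.
Qed.

Lemma bms_gradM D i f : test_function D f -> bms (fun x => g x ord0 i * f x).
Proof.
move=> tf; rewrite (_ : (fun _ => _) = fun x => f x * g x ord0 i); last first.
  by apply/funext => x; rewrite mulrC.
apply: bmsM; [exact: test_bms tf|exact: grad_measurable Hu i|].
by exists L => x; exact: grad_bound Hu x i.
Qed.

Lemma bms_cut : bms (fun x => u x * eta x).
Proof. exact: bms_phaseM teta. Qed.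

Lemma bms_cut_grad i : bms (cut_grad u g eta i).
Proof.
by apply: bmsD; [exact: bms_gradM teta|exact: bms_phaseM (test_pderiv i teta)].
Qed.

Lemma cut_continuous : open Om -> continuous (fun x => u x * eta x).
Proof.
move=> oOm x; have [_ cOm] := He.
have [xOm|xOm] := pselect (Om x).
  exact: (cvgM (phase_continuous Hu xOm) (smooth_continuous He.1 (x := x))).
have nx : ~ closure [set x | eta x != 0] x by move=> /cOm.2.
have H : \forall y \near x, u x * eta x = u y * eta y.
  have : nbhs x (~` closure [set x | eta x != 0]).
    by apply: open_nbhs_nbhs; split=> //; apply: closed_openC; exact: closed_closure.
  have e0 z : ~ closure [set x | eta x != 0] z -> eta z = 0.
    by move=> Hz; apply: contrapT => /eqP ez; apply: Hz; exact: subset_closure.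
  by apply: filterS => y Hy; rewrite (e0 x nx) (e0 y Hy) !mulr0.
by move=> A Ax; apply: filterS H => y /= <-; exact: nbhs_singleton Ax.
Qed.

(** Testing the weak gradient of [u] with [eta f] gives a weak gradient of [u eta] on the whole
    space, valid for all smooth [f], whatever their support. *)
Lemma cut_wgrad i f : (forall k, Ck k f) ->
  \int[leb R n]_x ((u x * eta x) * pderiv i f x) =
  - \int[leb R n]_x (cut_grad u g eta i x * f x).
Proof.
move=> Cf; have t1 := testM teta Cf.
have t2 := testM (test_pderiv i teta) Cf.
have t3 := testM teta (Ck_pderiv i Cf).
have := phase_grad Hu i t1.
have -> : (fun x => u x * pderiv i (fun x => eta x * f x) x) =
    (fun x => u x * (pderiv i eta x * f x) + u x * (eta x * pderiv i f x)).
  apply/funext => x; rewrite pderivM// ?mulrDr// => k; exact: smooth_Ck He.1.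
rewrite RintD; [|exact: bms_phaseM t2|exact: bms_phaseM t3] => E.
have -> : \int[leb R n]_x ((u x * eta x) * pderiv i f x) = \int[leb R n]_x (u x * (eta x * pderiv i f x)).
  by apply: eq_Rintegral => x _; rewrite mulrA.
have -> : \int[leb R n]_x (cut_grad u g eta i x * f x) =
    \int[leb R n]_x (g x ord0 i * (eta x * f x)) + \int[leb R n]_x (u x * (pderiv i eta x * f x)).
  rewrite -RintD; [|exact: bms_gradM t1|exact: bms_phaseM t2].
  by apply: eq_Rintegral => x _; rewrite /cut_grad mulrDl !mulrA.
by rewrite -[X in - (X + _)]opprK -E; ring.
Qed.

Lemma cut_approx : open Om -> forall e : R, 0 < e -> exists f : 'rV[R]_n -> R,
  [/\ forall k, Ck k f,
      forall x, `|f x - u x * eta x| <= e,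
      forall i M, (forall x, `|cut_grad u g eta i x| <= M) -> forall x, `|pderiv i f x| <= M,
      forall i, (L1norm setT (fun x => pderiv i f x - cut_grad u g eta i x)%R <= e%:E)%E &
      forall x, (forall y, (forall i, `|x ord0 i - y ord0 i| <= e) -> eta y = 0) -> f x = 0].
Proof.
move=> oOm e e0.
have [|f [H1 H2 H3 H4 H5]] := mollify bms_cut (cut_continuous oOm) bms_cut_grad _ e0.
  by move=> i Phi SPhi; apply: cut_wgrad => k; exact: smooth_Ck.
exists f; split=> // x Hx; apply: H5 => y /Hx ->; exact: mulr0.
Qed.

End cut.

(* On a cube where the two phases both occupy a sizeable volume, the gradient
   has to be large: compare the mollified phase, truncated between the levels
   -3/8 and -1/8, with its median value. *)
Lemma phase_separation : exists2 C : R, 0 < C &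
  forall Om L u g, open Om -> phase_field Om L u g ->
  forall (s : R), s = 1 \/ s = -1 ->
  forall (c : 'rV[R]_n) (l : R), 0 < l -> cbox (c + const_mx (l / 2)) (l / 2) `<=` Om ->
  forall h : 'rV[R]_n -> R, measurable_fun setT h -> (forall x, 0 <= h x) ->
  (forall x i, hcube c l x -> `|u x| <= 2^-1 -> `|g x ord0 i| <= h x) ->
  forall E : R, ((C * l)%:E * L1norm (hcube c l) h < E%:E)%E ->
  (leb R n ([set x | (0 < s * u x)%R] `&` hcube c l) <= E%:E)%E \/
  (leb R n ([set x | (s * u x <= - 2^-1)%R] `&` hcube c l) <= E%:E)%E.
Proof.
have [M M0 HM] := @step'_bound R.
exists (8 * M * n%:R + 1); first by rewrite ltr_wpDl// !mulr_ge0// ltW.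
move=> Om L u g oOm Hu s hs c l l0 cOm h mh h0 gh E hE.
have [d d0 cd] := cbox_enlarge (divr_ge0 (ltW l0) (ler0n _ 2)) oOm cOm.
set ctr := c + const_mx (l / 2) in cOm cd.
have ab : l / 2 + d / 2 < l / 2 + d by lra.
pose eta := plateau ctr (l / 2 + d / 2) (l / 2 + d).
have He : cutoff Om eta by split; [exact: smooth_plateau|exact: plateau_support].
have Qbox x : hcube c l x -> cbox ctr (l / 2 + d / 2) x.
  by move=> Hx i; have := Hx i; rewrite !mxE => /andP[? ?]; rewrite ler_norml; apply/andP; split; lra.
have eta1 x : hcube c l x -> eta x = 1 by move=> /Qbox; exact: plateau_1.
have deta x i : hcube c l x -> pderiv i eta x = 0 by move=> /Qbox; exact: pderiv_plateau_in.
set Q := hcube c l in hE gh Qbox eta1 deta *.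
have mQ : measurable Q by exact: measurable_hcube.
have Hn : 0 < 8 * M * n%:R + 1 by rewrite ltr_wpDl// !mulr_ge0// ltW.
have hfin : (L1norm Q h \is a fin_num)%E.
  case: (L1norm Q h) (L1norm_ge0 Q h) hE => [r||]// _.
  by rewrite gt0_muley ?lte_fin// mulr_gt0.
set I := fine (L1norm Q h).
have IE : L1norm Q h = I%:E by rewrite fineK.
have I0 : 0 <= I by rewrite -lee_fin -IE L1norm_ge0.
have hE' : (8 * M * n%:R + 1) * l * I < E by rewrite -lte_fin EFinM -IE.
(* Solves [(8 M n l + 1) e0 = E - 8 M n l I], so that an approximation error at most [e0] keeps the
   Poincare bound [4 M n l (I + e)] below [E / 2]. *)
pose e0 := (E - 8 * M * n%:R * l * I) / (8 * M * n%:R * l + 1).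
have D0 : 0 < 8 * M * n%:R * l + 1 by rewrite ltr_wpDl// !mulr_ge0// ltW.
have e00 : 0 < e0.
  rewrite divr_gt0// subr_gt0; apply: le_lt_trans hE'.
  have -> : (8 * M * n%:R + 1) * l * I = 8 * M * n%:R * l * I + l * I by ring.
  by rewrite lerDl mulr_ge0// ltW.
pose e := Num.min (1 / 8) e0.
have epos : 0 < e by rewrite lt_min e00 divr_gt0.
have e8 : e <= 1 / 8 by rewrite ge_min lexx.
have ee0 : e <= e0 by rewrite ge_min lexx orbT.
have [f [Cf fe _ fG _]] := cut_approx Hu He oOm epos.
have s1 : `|s| = 1 by case: hs => ->; rewrite ?normrN normr1.
have ss : s * s = 1 by case: hs => ->; ring.
(* As [f] is within 1/8 of [u] on the cube, [F] is 1 where [s u > 0], 0 where [s u <= - 1/2], and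
   its gradient vanishes unless [|u| <= 1/2], where [h] controls [g]. *)
pose F x := step (4 * s * f x + 3 / 2).
pose G i x := step' (4 * s * f x + 3 / 2) * (4 * s * pderiv i f x).
have cf : continuous f := Ck_continuous (Cf 0%N).
have daff (r : R) : is_derive r 1 (fun t : R => 4 * s * t + 3 / 2) (4 * s).
  rewrite -[X in is_derive _ _ _ X]addr0; apply: is_derive_fD.
  have := @is_derive_fM R R (cst (4 * s)) id r 1 0 1.
  by rewrite mul0r add0r mulr1; apply.
have caff : continuous (fun r : R => 4 * s * r + 3 / 2).
  exact: (@is_derive1_continuous R _ (fun=> 4 * s) daff).
have cF : continuous F.
  move=> x; apply: (@continuous_comp _ _ _ (fun x => 4 * s * f x + 3 / 2)).
    apply: (@continuous_comp _ _ _ f (fun r : R => 4 * s * r + 3 / 2)); [exact: cf|exact: caff].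
  exact: (is_derive1_continuous (@is_derive_step R)).
have cs' : continuous (fun x => step' (4 * s * f x + 3 / 2)).
  move=> x; apply: (@continuous_comp _ _ _ (fun x => 4 * s * f x + 3 / 2)).
    apply: (@continuous_comp _ _ _ f (fun r : R => 4 * s * r + 3 / 2)); [exact: cf|exact: caff].
  exact: step'_continuous.
have cG i : continuous (G i).
  apply: continuous_fM => //.
  apply: (@continuous_fM R _ (fun=> 4 * s)); first exact: cst_continuous.
  exact: (Ck_continuous (Ck_pderiv i Cf 0%N)).
have FG : C1_partials F G.
  split=> // i x.
  apply: (@is_derive_fcomp R _ (@step R) (fun x => 4 * s * f x + 3 / 2)); first exact: is_derive_step.
  apply: (@is_derive_fcomp R _ (fun r : R => 4 * s * r + 3 / 2) f).
  exact: (Ck_is_derive i x (Cf 1%N)).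
have mG i := continuous_measurable_rVT (cG i).
have mF := continuous_measurable_rVT cF.
have mcg i : measurable_fun setT (cut_grad u g eta i).
  exact: bms_measurable (bms_cut_grad Hu He i).
have mdf i : measurable_fun setT (pderiv i f).
  by apply: continuous_measurable_rVT; exact: (Ck_continuous (Ck_pderiv i Cf 0%N)).
have fu x : Q x -> `|s * f x - s * u x| <= 1 / 8.
  move=> Qx; rewrite -mulrBr normrM s1 mul1r.
  by have := fe x; rewrite eta1// mulr1; lra.
have GI i : (L1norm Q (G i) <= (4 * M * (I + e))%:E)%E.
  pose k x := 4 * M * (h x + `|pderiv i f x - cut_grad u g eta i x|).
  have mk0 : measurable_fun setT (fun x => `|pderiv i f x - cut_grad u g eta i x|).
    by apply: measurableT_comp => //; exact: measurable_funB.
  have mk : measurable_fun setT k.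
    by apply: measurable_funM => //; exact: measurable_funD.
  apply: (@le_trans _ _ (L1norm Q k)).
    apply: L1norm_le => // x Qx.
    have k0 : 0 <= k x by rewrite !mulr_ge0 ?addr_ge0// ltW.
    rewrite (ger0_norm k0) /G.
    have [H|H] := leP (4 * s * f x + 3 / 2) 0.
      by rewrite step'_out ?mul0r ?normr0//; left.
    have [H1|H1] := leP 1 (4 * s * f x + 3 / 2).
      by rewrite step'_out ?mul0r ?normr0//; right.
    have ux : `|u x| <= 2^-1.
      have -> : `|u x| = `|s * u x| by rewrite normrM s1 mul1r.
      have := fu x Qx; rewrite !ler_norml => /andP[? ?].
      by rewrite -mulrA in H H1; apply/andP; split; lra.
    have gx := gh x i Qx ux.
    rewrite normrM (ger0_norm (step'_ge0 _)) 2!normrM s1 mulr1 normr_nat /k.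
    rewrite mulrCA -[leRHS]mulrA ler_wpM2l//.
    apply: ler_pM => //; [exact: step'_ge0|].
    have -> : pderiv i f x = cut_grad u g eta i x + (pderiv i f x - cut_grad u g eta i x) by rewrite addrC subrK.
    rewrite (le_trans (ler_normD _ _))//.
    rewrite {1}/cut_grad eta1// deta// mulr1 mulr0 addr0 lerD//.
    by rewrite [X in _ <= `|X|](_ : _ = pderiv i f x - cut_grad u g eta i x)//; ring.
  rewrite L1normZ//; last exact: measurable_funD.
  rewrite ger0_norm; last by rewrite mulr_ge0// ltW.
  rewrite [leRHS]EFinM lee_wpmul2l//; first by rewrite lee_fin mulr_ge0// ltW.
  rewrite (le_trans (L1norm_triangle _ _ _))// EFinD leeD ?IE//.
  apply: le_trans (fG i); rewrite (_ : L1norm setT _ = L1norm setT (fun x => `|pderiv i f x - cut_grad u g eta i x|)).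
    exact: L1norm_subset.
  by apply: eq_integral => x _; rewrite normr_id.
have Hsum (e1 : R) : 4 * M * n%:R * l * (I + e) < e1 ->
    (l%:E * \sum_(i < n) L1norm Q (G i) < e1%:E)%E.
  move=> He1; apply: (@le_lt_trans _ _ (l%:E * \sum_(i < n) (4 * M * (I + e))%:E)%E).
    rewrite lee_wpmul2l//; first by rewrite lee_fin ltW.
    by apply: lee_sum => i _; exact: GI.
  rewrite sumEFin sumr_const card_ord -[_ *+ n]mulr_natl -EFinM lte_fin.
  by rewrite (_ : l * (n%:R * (4 * M * (I + e))) = 4 * M * n%:R * l * (I + e))//; ring.
have [|a Ha] := poincare_hcube l0 FG (e := E / 2) (Hsum _ _).
  have h1 : (8 * M * n%:R * l) * e <= (8 * M * n%:R * l) * e0.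
    by rewrite ler_wpM2l// !mulr_ge0// ltW.
  have h2 : (8 * M * n%:R * l + 1) * e0 = E - 8 * M * n%:R * l * I.
    by rewrite /e0 mulrC divfK// gt_eqF.
  have h3 : (4 * M * n%:R * l) * (I + e) = ((8 * M * n%:R * l) * I + (8 * M * n%:R * l) * e) / 2 by field.
  by rewrite h3; move: h2; rewrite mulrDl mul1r; lra.
have msu : measurable_fun setT (fun x => s * u x).
  by apply: measurable_funM => //; exact: phase_measurable Hu.
have mA : measurable [set x | (0 < s * u x)%R].
  have := msu measurableT `]0, +oo[%classic (measurable_itv _).
  by rewrite setTI; congr measurable; apply/seteqP; split=> x /=; rewrite in_itv/= andbT.
have mB : measurable [set x | (s * u x <= - 2^-1)%R].
  have := msu measurableT `]-oo, (- 2^-1)]%classic (measurable_itv _).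
  by rewrite setTI; congr measurable; apply/seteqP; split=> x /=; rewrite in_itv/=.
have key (A : set 'rV[R]_n) : measurable A -> (forall x, A x -> Q x -> 2^-1 <= `|F x - a|) ->
    (leb R n (A `&` Q) <= E%:E)%E.
  move=> mA' HA; rewrite -L1norm_indic//.
  apply: (@le_trans _ _ (L1norm Q (fun x => 2 * (F x - a))%R)).
    apply: L1norm_le => //; first by apply: measurable_funM => //; exact: measurable_funB.
    move=> x Qx; rewrite indicE ger0_norm//.
    case: (boolP (x \in A)) => [/set_mem Ax|_]; last exact: normr_ge0.
    by rewrite normrM normr_nat; have := HA x Ax Qx; rewrite /=; lra.
  rewrite L1normZ//; last exact: measurable_funB.
  rewrite normr_nat (_ : E = 2 * (E / 2)); last by field.
  by rewrite EFinM lee_wpmul2l.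
(* The Poincare constant [a] is at distance at least 1/2 from 1 or from 0; Chebyshev's inequality
   bounds the volume of the corresponding phase. *)
have [a2|a2] := leP a 2^-1; [left|right]; apply: key => // x /= ux Qx; have := fu x Qx; rewrite ler_norml => /andP[h1 h2].
  rewrite /F step_ge1; last by rewrite -mulrA; lra.
  by rewrite ger0_norm; lra.
rewrite /F step_le0; last by rewrite -mulrA; lra.
by rewrite sub0r normrN ger0_norm; lra.
Qed.

End cutoff_approximation.

(** * Subdivision of a cube into cells *)

Section tiling.
Context (R : realType) (n : nat).

Definition cell_corner (c : 'rV[R]_n) (l : R) N (z : {ffun 'I_n -> 'I_N}) : 'rV[R]_n :=
  \row_i (c ord0 i + l / N%:R * (z i)%:R).

Definition cell (c : 'rV[R]_n) l N (z : {ffun 'I_n -> 'I_N}) := hcube (cell_corner c l z) (l / N%:R).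

Lemma hcube_tiling (c : 'rV[R]_n) l N : 0 < l -> (0 < N)%N ->
  hcube c l = \big[setU/set0]_(z : {ffun 'I_n -> 'I_N}) cell c l z.
Proof.
move=> l0 N0; have N0' : 0 < N%:R :> R by rewrite ltr0n.
have d0 : 0 < l / N%:R by rewrite divr_gt0.
rewrite -bigcup_seq; apply/seteqP; split=> [x Hx|x [z _ Hx] i].
  have h i : (Num.truncn ((x ord0 i - c ord0 i) / (l / N%:R)) < N)%N.
    have /andP[h1 h2] := Hx i.
    rewrite -(ltr_nat R); apply: (@le_lt_trans _ _ ((x ord0 i - c ord0 i) / (l / N%:R))).
      by rewrite Num.Theory.truncn_le divr_ge0 ?subr_ge0// ltW.
    rewrite ltr_pdivrMr// mulrCA divff ?gt_eqF// mulr1; lra.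
  exists [ffun i => Ordinal (h i)]; first by rewrite /= mem_index_enum.
  move=> i; rewrite mxE ffunE /=.
  have /andP[h1 h2] := Hx i.
  set t := (x ord0 i - c ord0 i) / (l / N%:R).
  have t0 : 0 <= t by rewrite divr_ge0 ?subr_ge0// ltW.
  have /andP[h3 h4] := Num.Theory.truncn_itv t0.
  have E : x ord0 i = c ord0 i + l / N%:R * t by rewrite /t mulrC divfK ?gt_eqF// addrC subrK.
  rewrite E -addrA -[X in _ + (_ + X)]mulr1 -mulrDr lerD2l ltrD2l ler_pM2l// ltr_pM2l//.
  by rewrite h3 natr1.
have := Hx i; rewrite mxE => /andP[h1 h2].
have z1 : (z i)%:R + 1 <= N%:R :> R by rewrite natr1 ler_nat.
apply/andP; split.
  by apply: le_trans h1; rewrite lerDl mulr_ge0// ltW.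
apply: (lt_le_trans h2); rewrite -addrA lerD2l -[X in _ + X]mulr1 -mulrDr.
by rewrite -[leRHS](@divfK _ N%:R) ?gt_eqF// ler_wpM2l// ltW.
Qed.

Lemma trivIset_cell (c : 'rV[R]_n) l N (D : set {ffun 'I_n -> 'I_N}) : 0 < l -> trivIset D (@cell c l N).
Proof.
move=> l0; apply/trivIsetP => z1 z2 _ _ /eqP z12; rewrite -subset0 => x [H1 H2].
apply: z12; apply/ffunP => i; apply: val_inj => /=.
have := H1 i; have := H2 i; rewrite !mxE => /andP[a1 a2] /andP[b1 b2].
have N0 : (0 < N)%N by case: (N) (z1 i) => // -[].
have N0' : 0 < N%:R :> R by rewrite ltr0n.
have d0 : 0 < l / N%:R by rewrite divr_gt0.
have h1 : l / N%:R * (z1 i)%:R < l / N%:R * ((z2 i)%:R + 1) by rewrite mulrDr mulr1; lra.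
have h2 : l / N%:R * (z2 i)%:R < l / N%:R * ((z1 i)%:R + 1) by rewrite mulrDr mulr1; lra.
move: h1 h2; rewrite !ltr_pM2l// !natr1 !ltr_nat !ltnS => h1 h2.
by apply/eqP; rewrite eqn_leq h1 h2.
Qed.

Lemma measurable_cell c l N (z : {ffun 'I_n -> 'I_N}) : measurable (cell c l z).
Proof. exact: measurable_hcube. Qed.

Lemma L1norm_cells c l N (f : 'rV[R]_n -> R) : 0 < l -> (0 < N)%N -> measurable_fun setT f ->
  L1norm (hcube c l) f = (\sum_(z : {ffun 'I_n -> 'I_N}) L1norm (cell c l z) f)%E.
Proof.
move=> l0 N0 mf; rewrite /L1norm (hcube_tiling c l0 N0) ge0_integral_bigsetU//.
- by move=> z; exact: measurable_cell.
- exact: index_enum_uniq.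
- exact: trivIset_cell.
- exact: measurable_norm_fin.
Qed.

Lemma cell_subset c l N (z : {ffun 'I_n -> 'I_N}) : 0 < l -> (0 < N)%N -> cell c l z `<=` hcube c l.
Proof.
move=> l0 N0 x Hx; rewrite (hcube_tiling c l0 N0) -bigcup_seq; exists z => //.
by rewrite /= mem_index_enum.
Qed.

End tiling.

(** * Vanishing of the integral of a derivative *)

Section integral_divergence.
Context (R : realType).
Implicit Types (n : nat).

Definition posp (r : R) := Num.max r 0.
Definition negp (r : R) := Num.max (- r) 0.

Lemma posnegB r : r = posp r - negp r.
Proof. by rewrite /posp /negp /Num.max; case: ltP => ?; case: ltP => ?; lra. Qed.

Lemma posp_ge0 r : 0 <= posp r. Proof. by rewrite le_max lexx orbT. Qed.
Lemma negp_ge0 r : 0 <= negp r. Proof. by rewrite le_max lexx orbT. Qed.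

Lemma posp_le r : posp r <= `|r|.
Proof. by rewrite ge_max ler_norm normr_ge0. Qed.
Lemma negp_le r : negp r <= `|r|.
Proof. by rewrite ge_max normr_ge0 andbT -normrN ler_norm. Qed.

Lemma posp_measurable d (T : measurableType d) (f : T -> R) : measurable_fun setT f ->
  measurable_fun setT (fun x => posp (f x)).
Proof. by move=> mf; exact: measurable_maxr. Qed.

Lemma negp_measurable d (T : measurableType d) (f : T -> R) : measurable_fun setT f ->
  measurable_fun setT (fun x => negp (f x)).
Proof. by move=> mf; apply: measurable_maxr => //; exact: measurableT_comp. Qed.

(** The integral of the derivative of a function with bounded support vanishes. It is stated as an
    equality between the integrals of the positive and negative parts, so that only Tonelli's
    theorem for nonnegative functions is needed in higher dimension. *)
Lemma integral_derive_posneg (F G : R -> R) (M : R) :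
  (forall t : R, is_derive t 1 F (G t)) -> continuous G -> (forall t, M < `|t| -> F t = 0) ->
  (\int[@lebesgue_measure R]_t (posp (G t))%:E = \int[@lebesgue_measure R]_t (negp (G t))%:E)%E.
Proof.
move=> dF cG F0.
pose N : R := `|M| + 1.
have N0 : 0 < N by rewrite ltr_pwDr.
have MN : M < N by rewrite (le_lt_trans (ler_norm M))// ltrDl.
have G0 (t : R) : t <= - N \/ N <= t -> G t = 0.
  move=> ht; have tM : M < `|t|.
    by apply: (lt_le_trans MN); rewrite lter_normr; case: ht => h; apply/orP; [right|left]; lra.
  have Ht : \forall r \near `|t|, M < r by exact: lt_nbhsr.
  have Ft : \forall s \near t, cst (0 : R) s = F s.
    have Hn : nbhs t [set s | M < `|s|] by exact: (@norm_continuous R R t _ Ht).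
    by apply: (filterS _ Hn) => s /= /F0 ->.
  have D0 : is_derive t 1 F 0 by exact: (near_eq_is_derive Ft (is_derive_cst (0 : R) t 1)).
  by rewrite -(@derive_val _ _ _ _ _ _ _ (dF t)) (@derive_val _ _ _ _ _ _ _ D0).
have cF := is_derive1_continuous dF.
have NN : - N < N by lra.
have IG : (\int[@lebesgue_measure R]_(t in `[(- N)%R, N]) (G t)%:E = 0)%E.
  have F1 : F N = 0 by apply: F0; rewrite ger0_norm// ltW.
  have F2 : F (- N) = 0 by apply: F0; rewrite normrN ger0_norm// ltW.
  rewrite (@continuous_FTC2 R G F)//; first by rewrite F1 F2 sube0.
  - exact: continuous_subspaceT.
  - split; first by move=> r _; exact: (@ex_derive _ _ _ _ _ _ _ (dF r)).
    + by apply: cvg_at_right_filter; exact: cF.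
    + by apply: cvg_at_left_filter; exact: cF.
  - by move=> r _; rewrite derive1E (@derive_val _ _ _ _ _ _ _ (dF r)).
have iG : (@lebesgue_measure R).-integrable `[- N, N] (EFin \o G).
  by apply: continuous_compact_integrable; [exact: segment_compact|exact: continuous_subspaceT].
have mG : measurable_fun setT (G : measurableTypeR R -> R) by exact: continuous_measurable_fun.
have mI : measurable (`[- N, N]%classic : set (measurableTypeR R)) by exact: measurable_itv.
have ip : (@lebesgue_measure R).-integrable `[- N, N] (EFin \o (posp \o G)).
  apply: (le_integrable mI _ _ iG) => /=.
    by apply: measurable_funTS; apply/measurable_EFinP; exact: posp_measurable.
  by move=> t _ /=; rewrite lee_fin ger0_norm ?posp_ge0// posp_le.
have ineg : (@lebesgue_measure R).-integrable `[- N, N] (EFin \o (negp \o G)).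
  apply: (le_integrable mI _ _ iG) => /=.
    by apply: measurable_funTS; apply/measurable_EFinP; exact: negp_measurable.
  by move=> t _ /=; rewrite lee_fin ger0_norm ?negp_ge0// negp_le.
have restr (f : R -> R) : f 0 = 0 -> (\int[@lebesgue_measure R]_t (f (G t))%:E =
    \int[@lebesgue_measure R]_(t in `[(- N)%R, N]) (f (G t))%:E)%E.
  move=> f0; rewrite [RHS]integral_mkcond; apply: eq_integral => t _.
  rewrite patchE; case: ifPn => //; rewrite notin_setE/= in_itv/= => /negP.
  by rewrite negb_and -!ltNge => /orP[|] h; rewrite G0 ?f0//; [left|right]; exact: ltW.
rewrite !restr; [|by rewrite /negp oppr0 maxxx|by rewrite /posp maxxx].
have : (\int[@lebesgue_measure R]_(t in `[(- N)%R, N]) ((posp (G t))%:E - (negp (G t))%:E) = 0)%E.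
  by rewrite -[RHS]IG; apply: eq_integral => t _; rewrite [in RHS](posnegB (G t)).
rewrite integralB//= => /eqP.
rewrite sube_eq ?add0e; first by move=> /eqP.
- exact: (integrable_fin_num mI ip).
- by rewrite fin_num_adde_defr.
Qed.

(** A derivative in a later direction is treated slice by slice, by induction; for the first
    direction the order of integration is exchanged and the one-dimensional case applies on each
    line. *)
Lemma integral_pderiv_posneg n (f : 'rV[R]_n -> R) g (M : R) i : C1_partials f g ->
  (forall x, M < `|x| -> f x = 0) ->
  (\int[leb R n]_x (posp (g i x))%:E = \int[leb R n]_x (negp (g i x))%:E)%E.
Proof.
elim: n f g i => [|n IH] f g i; first by case: i.
move=> fg f0; have [cf cg dg] := fg.
have mg j := continuous_measurable_rVT (cg j).
have mp : measurable_fun setT (fun x => (posp (g i x))%:E).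
  by apply/measurable_EFinP; exact: posp_measurable.
have mn : measurable_fun setT (fun x => (negp (g i x))%:E).
  by apply/measurable_EFinP; exact: negp_measurable.
have p0 x : (0 <= (posp (g i x))%:E)%E by rewrite lee_fin posp_ge0.
have n0 x : (0 <= (negp (g i x))%:E)%E by rewrite lee_fin negp_ge0.
have normc t (x : 'rV[R]_n) : `|t| <= `|cons_rV (t : measurableTypeR R, x)| /\ `|x| <= `|cons_rV (t : measurableTypeR R, x)|.
  split.
    by have := rV_coord_norm (cons_rV (t : measurableTypeR R, x)) ord0; rewrite cons_rV0.
  apply/rV_norm_le => // j.
  by have := rV_coord_norm (cons_rV (t : measurableTypeR R, x)) (lift ord0 j); rewrite cons_rV_lift.
rewrite !leb_tonelli//.
case: (unliftP ord0 i) => [j Ei|Ei].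
  apply: eq_integral => t _; rewrite Ei.
  apply: (IH (fun x => f (cons_rV (t : measurableTypeR R, x)))
    (fun j x => g (lift ord0 j) (cons_rV (t, x))) j (C1_partials_slice t fg)).
  by move=> x Mx; apply: f0; apply: (lt_le_trans Mx); have [] := normc t x.
have mc (h : 'rV[R]_n.+1 -> \bar R) : measurable_fun setT h ->
    measurable_fun setT (fun p : measurableTypeR R * 'rV[R]_n => h (cons_rV p)).
  by move=> mh; exact: (measurableT_comp mh (@measurable_cons_rV R n)).
rewrite (fubini_tonelli _ (mc _ mp) (fun p => p0 (cons_rV p))).
rewrite (fubini_tonelli _ (mc _ mn) (fun p => n0 (cons_rV p))).
apply: eq_integral => x _; rewrite Ei.
apply: (@integral_derive_posneg (fun t => f (cons_rV (t : measurableTypeR R, x)))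
  (fun t => g ord0 (cons_rV (t : measurableTypeR R, x))) M).
- move=> r; rewrite (_ : (fun s => _) = (fun s : R => f (s *: delta_mx ord0 ord0 + cons_rV (0 : measurableTypeR R, x)))); last first.
    by apply/funext => s; rewrite cons_rV_line.
  by apply/is_derive_lineP; rewrite -cons_rV_line.
- move=> s; apply: (@continuous_comp _ _ _ (fun s : R => cons_rV (s : measurableTypeR R, x))); last exact: cg.
  exact: cons_rV_continuous_fst.
- by move=> t Mt; apply: f0; apply: (lt_le_trans Mt); have [] := normc t x.
Qed.

Lemma Rint_pderiv_test n (D : set 'rV[R]_n) (f : 'rV[R]_n -> R) i : test_function D f ->
  \int[leb R n]_x pderiv i f x = 0.
Proof.
move=> tf; have [Cf cf] := tf.
have fg : C1_partials f (fun i => pderiv i f).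
  split=> [|j|j x]; first exact: (Ck_continuous (Cf 0%N)).
    exact: (Ck_continuous (Ck_pderiv j Cf 0%N)).
  exact: (Ck_is_derive j x (Cf 1%N)).
have [M HM] := compact_support_bounded cf.
have E := integral_pderiv_posneg i fg HM.
have bd := test_bms (test_pderiv i tf).
have bpn (h : R -> R) : (forall r, 0 <= h r <= `|r|) -> measurable_fun setT (fun x => h (pderiv i f x)) -> bms (fun x => h (pderiv i f x)).
  move=> hr mh; have [_ [K [K0 HK]]] := bd; split=> //.
  exists K; split=> // x; have [h1 h2] := HK x; have /andP[h3 h4] := hr (pderiv i f x).
  split; first by rewrite ger0_norm// (le_trans h4).
  by move=> /h2 e; move: h3 h4; rewrite e normr0 => h3 h4; apply/eqP; rewrite eq_le h3 h4.
have bp : bms (fun x => posp (pderiv i f x)).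
  by apply: bpn => [r|]; [rewrite posp_ge0 posp_le|exact: posp_measurable (bms_measurable bd)].
have bn : bms (fun x => negp (pderiv i f x)).
  by apply: bpn => [r|]; [rewrite negp_ge0 negp_le|exact: negp_measurable (bms_measurable bd)].
have -> : (fun x => pderiv i f x) = (fun x => posp (pderiv i f x) - negp (pderiv i f x)).
  by apply/funext => x; rewrite -posnegB.
by rewrite RintB// /Rintegral E subrr.
Qed.

End integral_divergence.

Section nonmeasurable_monotonicity.
Local Open Scope ereal_scope.

(** The integral of a nonnegative function is a supremum over the simple functions below it, hence
    monotone without any measurability. This is how the two-sided bound on [E] passes to the
    integrals. *)
Lemma ge0_le_integral_nonmeasurable d (T : measurableType d) (R : realType)
    (mu : {measure set T -> \bar R}) (D : set T) (f g : T -> \bar R) :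
  (forall x, D x -> 0 <= f x) -> (forall x, D x -> f x <= g x) ->
  \int[mu]_(x in D) f x <= \int[mu]_(x in D) g x.
Proof.
move=> f0 fg; have g0 x : D x -> 0 <= g x by move=> Dx; exact: le_trans (f0 x Dx) (fg x Dx).
rewrite !ge0_integralE//; apply: le_ereal_sup => _ [h /= hf <-]; exists h => //= x.
apply: le_trans (hf x) _; rewrite !patchE; case: ifPn => // /set_mem; exact: fg.
Qed.

End nonmeasurable_monotonicity.

(** * Pointwise bounds on the energy density *)

Section pointwise_estimates.
Context (R : realType).
Implicit Types (p m t w : R).

Lemma powR_le p (x y : R) : 0 <= p -> 0 <= x -> x <= y -> x `^ p <= y `^ p.
Proof.
by move=> p0 x0 xy; apply: ge0_ler_powR; rewrite ?nnegrE//; exact: le_trans xy.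
Qed.

Lemma powRD_le p (x y : R) : 0 <= p -> 0 <= x -> 0 <= y ->
  (x + y) `^ p <= 2 `^ p * (x `^ p + y `^ p).
Proof.
move=> p0 x0 y0; wlog xy : x y x0 y0 / x <= y.
  by move=> H; have [/H|/ltW/H] := leP x y; [exact|rewrite addrC [_ `^ p + _]addrC; exact].
apply: (@le_trans _ _ ((2 * y) `^ p)); first by apply: powR_le => //; [exact: addr_ge0|lra].
by rewrite powRM// ler_wpM2l ?powR_ge0// lerDr powR_ge0.
Qed.

(** Compare [t^p] with [w^(m - p)]. If it is smaller, the product is at most [w^p w^(m - p) = w^m];
    otherwise [w <= t^(p / (m - p))], and [p^2 / (m - p) + p = p m / (m - p)]. *)
Lemma young_powR p m w t : 1 < p -> p < m -> 0 <= w -> 0 <= t ->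
  (w * t) `^ p <= w `^ m + t `^ (p * m / (m - p)).
Proof.
move=> p1 pm w0 t0; have mp : 0 < m - p by rewrite subr_gt0.
have p0 : 0 <= p by lra.
rewrite powRM//; have [H|H] := leP (t `^ p) (w `^ (m - p)).
  rewrite (@le_trans _ _ (w `^ m)) ?lerDl ?powR_ge0//.
  rewrite [X in _ <= _ `^ X](_ : m = p + (m - p)); last by ring.
  rewrite powRD ?ler_wpM2l ?powR_ge0//.
  by apply/implyP => /eqP; lra.
rewrite (@le_trans _ _ (t `^ (p * m / (m - p))))// ?lerDr ?powR_ge0//.
have wt : w <= t `^ (p / (m - p)).
  rewrite -[w]powRr1// -(@divff _ (m - p)) ?gt_eqF// powRrM powRrM.
  by apply: powR_le; rewrite ?powR_ge0 ?invr_ge0 ?ltW.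
rewrite [X in _ <= _ `^ X](_ : _ = (p / (m - p)) * p + p); last by field; rewrite gt_eqF.
have pp : 0 < p / (m - p) * p by rewrite !mulr_gt0 ?invr_gt0//; lra.
rewrite powRD; last by apply/implyP => /eqP; lra.
by rewrite ler_wpM2r ?powR_ge0// [leRHS]powRrM; apply: powR_le.
Qed.

Context (n : nat).
Implicit Types (x y : 'rV[R]_n).

Lemma sum_sqr_le (I : finType) (a : I -> R) : (forall i, 0 <= a i) ->
  \sum_i a i ^+ 2 <= (\sum_i a i) ^+ 2.
Proof.
move=> a0; rewrite [leRHS]expr2 mulr_suml; apply: ler_sum => i _.
rewrite expr2 ler_wpM2l// (bigD1 i)//= lerDl; exact: sumr_ge0.
Qed.

Lemma enorm_le_sum x : enorm x <= \sum_(i < n) `|x ord0 i|.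
Proof.
have S0 : 0 <= \sum_(i < n) `|x ord0 i| by exact: sumr_ge0.
rewrite -(ger0_norm S0) -sqrtr_sqr ler_sqrt ?sqr_ge0//.
apply: le_trans (sum_sqr_le (a := fun i => `|x ord0 i|) _); last by [].
by apply: ler_sum => i _; rewrite real_normK ?num_real.
Qed.

Lemma enorm_coord x i : `|x ord0 i| <= enorm x.
Proof.
rewrite -sqrtr_sqr ler_sqrt; last by apply: sumr_ge0 => j _; exact: sqr_ge0.
by rewrite (bigD1 i)//= lerDl sumr_ge0// => j _; exact: sqr_ge0.
Qed.

Lemma enorm_ge0 x : 0 <= enorm x.
Proof. exact: sqrtr_ge0. Qed.

Definition dens p m (e u : R) (g : 'rV[R]_n) : R := enorm (e *: g) `^ p + `|1 - u ^+ 2| `^ m.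

Lemma dens_ge0 p m e u g : 0 <= dens p m e u g.
Proof. by rewrite addr_ge0 ?powR_ge0. Qed.

Lemma dens_phase p m e s : s = 1 \/ s = -1 -> p != 0 -> m != 0 -> dens p m e s 0 = 0.
Proof.
move=> hs p0 m0; rewrite /dens.
have -> : 1 - s ^+ 2 = 0 by case: hs => ->; ring.
rewrite scaler0 normr0 powR0// (_ : enorm _ = 0) ?powR0 ?addr0//.
by rewrite /enorm big1 ?sqrtr0// => i _; rewrite mxE expr0n.
Qed.

(* The competitor u - eta (u + s), with gradient g - (g eta + (u + s) k). *)
Lemma dens_competitor p m (T : R) : 1 < p -> p < m -> 0 <= T -> exists2 C : R, 0 < C &
  forall (s u e eta t : R) (g k : 'rV[R]_n), s = 1 \/ s = -1 -> `|u| <= 1 -> 0 < e ->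
    0 <= eta <= 1 -> 0 <= t <= T -> (forall i, e * `|k ord0 i| <= t) ->
    dens p m e (u - (u * eta + s * eta))
      (g - \row_i (g ord0 i * eta + u * k ord0 i + s * k ord0 i))
    <= C * (dens p m e u g + (0 < s * u)%R%:R + t `^ (p * m / (m - p))).
Proof.
move=> p1 pm T0; have p0 : 0 <= p by lra. have m0 : 0 <= m by lra.
pose A := 2 `^ p * n%:R `^ p.
have A0 : 0 <= A by rewrite mulr_ge0 ?powR_ge0.
pose B := (2 * T) `^ p.
have B0 : 0 <= B by exact: powR_ge0.
exists (A * (1 + B) + 1 + 2 `^ m).
  by rewrite ltr_wpDr ?powR_ge0// ltr_wpDl// mulr_ge0// addr_ge0.
move=> s u e eta t g k hs u1 e0 /andP[eta0 eta1] /andP[t0 tT] kt.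
(* The distance from [u] to the well [- s]; it satisfies [1 - u^2 = w (2 - w)]. *)
pose w := 1 + s * u.
have su1 : `|s * u| <= 1 by rewrite normrM; case: hs => ->; rewrite ?normrN normr1 mul1r.
have [sum1 sup1] : -1 <= s * u /\ s * u <= 1 by apply/andP; rewrite -ler_norml.
have w0 : 0 <= w by rewrite /w; lra.
have w2 : w <= 2 by rewrite /w; lra.
have ss : s * s = 1 by case: hs => ->; ring.
have us : `|u + s| = w.
  rewrite -[RHS]ger0_norm// (_ : w = s * (u + s)); last by rewrite /w mulrDr ss addrC.
  by rewrite normrM; case: hs => ->; rewrite ?normrN normr1 mul1r.
have W0 : 0 <= 1 - u ^+ 2.
  by rewrite subr_ge0 -[leRHS](expr1n _ 2) -(real_normK (num_real u)) lerXn2r// nnegrE.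
have WE : 1 - u ^+ 2 = w * (2 - w) by rewrite /w; case: hs => ->; ring.
set chi : R := (0 < s * u)%R%:R.
have chi0 : 0 <= chi by rewrite ler0n.
set q := p * m / (m - p).
(* If [s u <= 0] then [w <= 1], so [w <= w (2 - w) = 1 - u^2] and Young's inequality applies.
   Otherwise only [w <= 2] and [t <= T] are available, whence the constant [B] in front of the
   indicator. *)
have wt : (w * t) `^ p <= B * chi + `|1 - u ^+ 2| `^ m + t `^ q.
  have tq0 : 0 <= t `^ q by exact: powR_ge0.
  have W00 : 0 <= `|1 - u ^+ 2| `^ m by exact: powR_ge0.
  rewrite /chi; case: (ltP 0 (s * u)) => su.
    rewrite mulr1 (@le_trans _ _ B)//; last by lra.
    by apply: powR_le => //; [exact: mulr_ge0|apply: ler_pM].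
  rewrite mulr0 add0r; apply: le_trans (young_powR p1 pm w0 t0) _.
  rewrite lerD2r; apply: powR_le => //; rewrite ger0_norm// WE.
  by rewrite ler_peMr//; rewrite /w; lra.
have pot : `|1 - (u - (u * eta + s * eta)) ^+ 2| `^ m <= chi + 2 `^ m * `|1 - u ^+ 2| `^ m.
  (* The distance from the competitor to the well [- s], at most [w]. *)
  pose w' := (1 - eta) * w.
  have w'0 : 0 <= w' by rewrite mulr_ge0// subr_ge0.
  have w'w : w' <= w by rewrite /w' ler_piMl// lerBlDr lerDl.
  have -> : 1 - (u - (u * eta + s * eta)) ^+ 2 = w' * (2 - w').
    by rewrite /w' /w; case: hs => ->; ring.
  have V0 : 0 <= w' * (2 - w') by rewrite mulr_ge0//; lra.
  rewrite (ger0_norm V0) /chi; case: (ltP 0 (s * u)) => su.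
    rewrite (@le_trans _ _ 1) ?lerDl ?mulr_ge0 ?powR_ge0//.
    rewrite -[leRHS](_ : 1 `^ m = 1); last by rewrite powR1.
    apply: powR_le => //; rewrite -subr_ge0 (_ : _ - _ = (1 - w') ^+ 2) ?sqr_ge0//; ring.
  rewrite add0r -powRM//; apply: powR_le => //; rewrite (ger0_norm W0) WE.
  apply: (@le_trans _ _ (w' * 2)).
    by rewrite ler_wpM2l//; lra.
  rewrite mulrC ler_pM2l// (le_trans w'w)// ler_peMr//; rewrite /w; lra.
have grd : enorm (e *: (g - \row_i (g ord0 i * eta + u * k ord0 i + s * k ord0 i))) `^ p <=
    A * (enorm (e *: g) `^ p + (w * t) `^ p).
  apply: (@le_trans _ _ ((n%:R * enorm (e *: g) + n%:R * (w * t)) `^ p)); last first.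
    rewrite -mulrDr powRM//; last by rewrite addr_ge0 ?enorm_ge0// mulr_ge0.
    rewrite /A -mulrA mulrCA ler_wpM2l ?powR_ge0// powRD_le ?enorm_ge0// mulr_ge0//.
  apply: powR_le; rewrite ?enorm_ge0//; apply: le_trans (enorm_le_sum _) _.
  rewrite -mulrDr (_ : n%:R * _ = \sum_(i < n) (enorm (e *: g) + w * t)); last first.
    by rewrite sumr_const card_ord mulr_natl.
  apply: ler_sum => i _; rewrite !mxE.
  rewrite (_ : _ * _ = (1 - eta) * (e * g ord0 i) - (u + s) * (e * k ord0 i)); last by ring.
  rewrite (le_trans (ler_normB _ _))// lerD//.
    have := enorm_coord (e *: g) i; rewrite mxE; apply: le_trans.
    by rewrite normrM ler_piMl// ger0_norm ?subr_ge0// lerBlDr lerDl.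
  rewrite normrM us ler_wpM2l// normrM (ger0_norm (ltW e0)).
  exact: kt.
rewrite {1}/dens; apply: (le_trans (lerD grd pot)).
apply: (@le_trans _ _ (A * (enorm (e *: g) `^ p + (B * chi + `|1 - u ^+ 2| `^ m + t `^ q)) + (chi + 2 `^ m * `|1 - u ^+ 2| `^ m))).
  by rewrite lerD2r ler_wpM2l// lerD2l.
rewrite /dens.
set X := enorm _ `^ p; set W := `|1 - u ^+ 2| `^ m; set Z := t `^ q; set D := 2 `^ m.
have X0 : 0 <= X by exact: powR_ge0.
have W00 : 0 <= W by exact: powR_ge0.
have Z0 : 0 <= Z by exact: powR_ge0.
have D0 : 0 <= D by exact: powR_ge0.
rewrite -subr_ge0.
have -> : (A * (1 + B) + 1 + D) * (X + W + chi + Z) - (A * (X + (B * chi + W + Z)) + (chi + D * W)) =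
  (A * B + 1 + D) * X + (A * B + 1) * W + (A + D) * chi + (A * B + 1 + D) * Z by ring.
have AB : 0 <= A * B by exact: mulr_ge0.
by rewrite !addr_ge0// mulr_ge0// !addr_ge0.
Qed.

End pointwise_estimates.

(** * Membership in Sobolev spaces *)

Section sobolev_facts.
Context (R : realType) (n : nat).
Implicit Types (D Om : set 'rV[R]_n) (h u f : 'rV[R]_n -> R) (p M e : R).

(** Since [|h|^p <= M^(p - 1) |h|], uniformly bounded functions that are small in L^1 are small in
    L^p. *)
Lemma Lp_norm_le D h p M e : measurable D -> measurable_fun D h -> 1 <= p -> 0 <= M -> 0 <= e ->
  {ae leb R n, forall x, D x -> `|h x| <= M} -> (\int[leb R n]_(x in D) `|h x|%:E <= e%:E)%E ->
  (Lp_norm D p%:E h <= ((M `^ (p - 1) * e) `^ p^-1)%:E)%E.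
Proof.
move=> mD mh p1 M0 e0 hM he; have p0 : 0 < p by lra.
rewrite /Lp_norm unlock -poweR_EFin.
have mnh : measurable_fun D (fun x => `|h x|%:E) by apply/measurable_EFinP; exact: measurableT_comp.
have E : (\int[leb R n]_x `|(EFin \o (h \_ D)) x| `^ p = \int[leb R n]_(x in D) (`|h x| `^ p)%:E)%E.
  rewrite [RHS]integral_mkcond; apply: eq_integral => x _.
  rewrite /= !patchE; case: ifPn => _; first by rewrite -poweR_EFin.
  have H0 : ((`|0 : R| `^ p)%:E = 0)%E by rewrite normr0 powR0// gt_eqF.
  exact: H0.
rewrite E gt0_ler_poweR ?invr_ge0 ?(ltW p0)//.
- by rewrite in_itv/= leey andbT integral_ge0// => x _; rewrite lee_fin powR_ge0.
- by rewrite in_itv/= leey andbT lee_fin mulr_ge0 ?powR_ge0.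
apply: (@le_trans _ _ (\int[leb R n]_(x in D) ((M `^ (p - 1))%:E * `|h x|%:E))%E).
  have m1 : measurable_fun D (fun x => (`|h x| `^ p)%:E).
    apply/measurable_EFinP; apply: (measurableT_comp (@measurable_powR R p)).
    exact: measurableT_comp.
  have m2 : measurable_fun D (fun x => (M `^ (p - 1))%:E * `|h x|%:E)%E.
    exact: measurable_funeM.
  apply: (ae_ge0_le_integral mD _ m1 _ m2).
  - by move=> x _; rewrite lee_fin powR_ge0.
  - by move=> x _; rewrite mule_ge0// lee_fin powR_ge0.
  - apply: filterS hM => x H Dx; rewrite -EFinM lee_fin -mulr_powRB1// mulrC.
    by rewrite ler_wpM2r//; apply: powR_le => //; [lra|exact: H].
rewrite ge0_integralZl//; last by rewrite lee_fin powR_ge0.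
by rewrite EFinM lee_wpmul2l// lee_fin powR_ge0.
Qed.

Lemma bounded_leb_fin D : measurable D -> bounded_set D -> (leb R n D < +oo)%E.
Proof.
move=> mD [M [_ HM]]; pose N := `|M| + 1.
have N0 : 0 <= N by rewrite addr_ge0.
apply: (@le_lt_trans _ _ (leb R n (hcube (const_mx (- N)) (N *+ 2 + 1)))).
  apply: le_measure; rewrite ?inE//; first exact: measurable_hcube.
  move=> x Dx; apply: norm_hcube => //; apply: HM => //.
  by rewrite (le_lt_trans (ler_norm M))// ltrDl.
by rewrite leb_hcube ?ltry// mulr2n; lra.
Qed.

Lemma in_Lp_bounded D h p M : measurable D -> bounded_set D -> 1 <= p -> 0 <= M ->
  measurable_fun D h -> {ae leb R n, forall x, D x -> `|h x| <= M} -> in_Lp D p%:E h.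
Proof.
move=> mD bD p1 M0 mh hM; split=> //.
have Dfin := bounded_leb_fin mD bD.
have Dn : (leb R n D \is a fin_num)%E by rewrite ge0_fin_numE.
have : (\int[leb R n]_(x in D) `|h x|%:E <= (M * fine (leb R n D))%:E)%E.
  have m1 : measurable_fun D (fun x => `|h x|%:E).
    by apply/measurable_EFinP; exact: measurableT_comp.
  rewrite EFinM fineK// -integral_cst//.
  apply: (ae_ge0_le_integral mD _ m1 _ (measurable_cst _)) => //.
move=> /(Lp_norm_le mD mh p1 M0 _ hM) H; apply: le_lt_trans (H _) _; last by rewrite ltry.
by rewrite mulr_ge0// fine_ge0.
Qed.

(** Transfers an integration by parts over the whole space, between functions with bounded support,
    to the extended-real integrals over [D]; the gradient may be changed on a null set. *)
Lemma weak_gradientI D u (du : 'rV[R]_n -> 'rV[R]_n) u' (du' : 'I_n -> 'rV[R]_n -> R) :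
  measurable D -> (forall x, D x -> u x = u' x) ->
  (forall i, measurable_fun D (fun x => du x ord0 i)) ->
  (forall i, measurable_fun setT (du' i)) ->
  (forall i, {ae leb R n, forall x, D x -> du x ord0 i = du' i x}) ->
  (forall i f, test_function D f -> [/\ bms (fun x => u' x * pderiv i f x),
    bms (fun x => du' i x * f x) &
    \int[leb R n]_x (u' x * pderiv i f x) = - \int[leb R n]_x (du' i x * f x)]) ->
  weak_gradient D u du.
Proof.
move=> mD uu mdu mdu' dudu H i f tf; have [b1 b2 E] := H i f tf.
have f0 := compactly_contained_zero tf.2.
have df0 := compactly_contained_zero (test_pderiv i tf).2.
have mf : measurable_fun setT f by exact: bms_measurable (test_bms tf).
have full (g : 'rV[R]_n -> R) : bms g -> (forall x, ~ D x -> g x = 0) ->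
    (\int[leb R n]_(x in D) (g x)%:E = (\int[leb R n]_x g x)%:E)%E.
  move=> bg g0; rewrite /Rintegral fineK; last first.
    by apply: (integrable_fin_num measurableT); exact: bms_integrable.
  rewrite [LHS]integral_mkcond; apply: eq_integral => x _; rewrite patchE.
  by case: ifPn => // xD; rewrite g0// => Dx; rewrite mem_set in xD.
transitivity (\int[leb R n]_(x in D) (u' x * pderiv i f x)%:E)%E.
  by apply: eq_integral => x /set_mem Dx; rewrite uu.
transitivity (- \int[leb R n]_(x in D) (du' i x * f x)%:E)%E.
  rewrite full//; last by move=> x /df0 ->; rewrite mulr0.
  by rewrite full// ?E ?EFinN// => x /f0 ->; rewrite mulr0.
have m1 : measurable_fun D (fun x => (du' i x * f x)%:E).
  by apply/measurable_EFinP/measurable_funTS; exact: measurable_funM.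
have m2 : measurable_fun D (fun x => (du x ord0 i * f x)%:E).
  by apply/measurable_EFinP; apply: measurable_funM => //; exact: measurable_funTS.
congr (- _)%E; apply: (ae_eq_integral _ _ mD m1 m2).
by apply: filterS (dudu i) => x H' Dx; rewrite H'.
Qed.

End sobolev_facts.

(** * The competitor *)

Section competitor.
Context (R : realType) (n : nat).
Implicit Types (D Om : set 'rV[R]_n) (h u f eta : 'rV[R]_n -> R) (g du : 'rV[R]_n -> 'rV[R]_n).

Definition obox (c : 'rV[R]_n) (r : R) := [set x : 'rV[R]_n | forall i, `|x ord0 i - c ord0 i| < r].

Lemma open_obox c r : open (obox c r).
Proof.
rewrite openE => x Hx; apply/rV_nbhsP.
have : \forall e \near (0 : R)^'+, forall i : 'I_n, `|x ord0 i - c ord0 i| + e < r.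
  apply: filter_forall => i; near=> e.
  suff : e < r - `|x ord0 i - c ord0 i| by lra.
  by near: e; apply: nbhs_right_lt; rewrite subr_gt0.
move=> /(filterI (nbhs_right_gt (0 : R)))/filter_ex[e [/= e0 He]]; exists e => // y Hy i.
have := ler_normD (y ord0 i - x ord0 i) (x ord0 i - c ord0 i).
by rewrite addrA subrK; have := He i; have := Hy i; lra.
Unshelve. all: by end_near. Qed.

Lemma obox_cbox c r : obox c r `<=` cbox c r.
Proof. by move=> x H i; exact: ltW. Qed.

Lemma cbox_obox (c : 'rV[R]_n) (r r' : R) : r < r' -> cbox c r `<=` obox c r'.
Proof. by move=> rr x H i; exact: le_lt_trans (H i) rr. Qed.

Lemma bounded_setS (A D : set 'rV[R]_n) : A `<=` D -> bounded_set D -> bounded_set A.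
Proof. by move=> AD [M [Mr H]]; exists M; split=> // y My x /AD; exact: H. Qed.

Lemma cbox_bounded (c : 'rV[R]_n) (r : R) : bounded_set (cbox c r).
Proof. exact: compact_bounded (@cbox_compact R n c r). Qed.

Lemma cbox_contained c r A D : A `<=` cbox c r -> cbox c r `<=` D -> compactly_contained A D.
Proof.
move=> Ac cD; have H : closure A `<=` cbox c r.
  by have /closure_id -> := @cbox_closed R n c r; exact: closureS.
split; last exact: subset_trans cD.
by apply: subclosed_compact (@cbox_compact R n c r) _ => //; exact: closed_closure.
Qed.

Lemma Lp_norm_small D (p M : R) : measurable D -> bounded_set D -> 1 <= p -> 0 <= M ->
  forall d : R, 0 < d -> exists2 e : R, 0 < e & forall h, measurable_fun D h ->
    (forall x, D x -> `|h x| <= M) -> (\int[leb R n]_(x in D) `|h x|%:E <= e%:E)%E ->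
    (Lp_norm D p%:E h <= d%:E)%E.
Proof.
move=> mD bD p1 M0 d d0; have p0 : 0 < p by lra.
have M1 : 0 < (M + 1) `^ (p - 1) by apply: powR_gt0; lra.
exists (d `^ p / (M + 1) `^ (p - 1)); first by rewrite divr_gt0// powR_gt0.
move=> h mh hM he.
apply: le_trans (Lp_norm_le (M := M + 1) mD mh p1 _ _ _ he) _.
- by lra.
- by rewrite divr_ge0 ?powR_ge0.
- by apply: aeW => x /hM; lra.
- by rewrite lee_fin mulrCA divff ?gt_eqF// mulr1 -powRrM divff ?gt_eqF// powRr1// ltW.
Qed.

Section fixed.
Variables (Om : set 'rV[R]_n) (L : R) (u : 'rV[R]_n -> R) (g : 'rV[R]_n -> 'rV[R]_n).
Hypotheses (oOm : open Om) (Hu : phase_field Om L u g).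
Variables (x0 : 'rV[R]_n) (a b r s : R).
Hypotheses (ab : a < b) (br : b < r) (rOm : cbox x0 r `<=` Om).

Let D := obox x0 r.
Let eta := plateau x0 a b.
Let bD : cbox x0 b `<=` D. Proof. exact: cbox_obox. Qed.
Let DOm : D `<=` Om. Proof. exact: subset_trans (@obox_cbox x0 r) rOm. Qed.
Let oD : open D. Proof. exact: open_obox. Qed.
Let mD : measurable D. Proof. exact: open_measurable_rV. Qed.
Let bdD : bounded_set D.
Proof. exact: bounded_setS (@obox_cbox x0 r) (@cbox_bounded x0 r). Qed.

Let Se : smooth eta. Proof. exact: smooth_plateau. Qed.
Let He : cutoff Om eta.
Proof. by split=> //; apply: plateau_support => //; exact: subset_trans DOm. Qed.

(** This is [eta (u + s)], the amount that the competitor subtracts from [u], so it is the function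
    that has to lie in W^{1,p}_0. *)
Definition shift_part x := u x * eta x + s * eta x.
Definition shift_grad i x := cut_grad u g eta i x + s * pderiv i eta x.

Let te := cutoff_test He.

Lemma bms_shift : bms shift_part.
Proof. by apply: bmsD; [exact: (bms_cut Hu He)|apply: bmsZ; exact: test_bms te]. Qed.

Lemma bms_shift_grad i : bms (shift_grad i).
Proof.
by apply: bmsD; [exact: (bms_cut_grad Hu He)|apply: bmsZ; exact: test_bms (test_pderiv i te)].
Qed.

(** For the summand [s eta] the identity says that the derivative of [eta f], which has compact
    support, has integral 0. *)
Lemma shift_weak i f : (forall k, Ck k f) ->
  \int[leb R n]_x (shift_part x * pderiv i f x) = - \int[leb R n]_x (shift_grad i x * f x).
Proof.
move=> Cf; have t1 := testM te Cf.
have t2 := testM (test_pderiv i te) Cf.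
have t3 := testM te (Ck_pderiv i Cf).
have b1 := bms_phaseM Hu t3; have b1' := bmsZ s (test_bms t3).
have b2 : bms (fun x => cut_grad u g eta i x * f x).
  rewrite (_ : (fun _ => _) = fun x => g x ord0 i * (eta x * f x) + u x * (pderiv i eta x * f x)).
    by apply: bmsD; [exact: (bms_gradM Hu i t1)|exact: (bms_phaseM Hu t2)].
  by apply/funext => x; rewrite /cut_grad mulrDl !mulrA.
have b2' := bmsZ s (test_bms t2).
have E1 : (fun x => shift_part x * pderiv i f x) =
    (fun x => u x * (eta x * pderiv i f x) + s * (eta x * pderiv i f x)).
  by apply/funext => x; rewrite /shift_part mulrDl !mulrA.
have E2 : (fun x => shift_grad i x * f x) =
    (fun x => cut_grad u g eta i x * f x + s * (pderiv i eta x * f x)).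
  by apply/funext => x; rewrite /shift_grad mulrDl !mulrA.
rewrite E1 E2 RintD// RintD// opprD; congr (_ + _).
  by rewrite -(cut_wgrad Hu He i Cf); apply: eq_Rintegral => x _; rewrite mulrA.
rewrite RintZ; last exact: test_bms t3.
rewrite RintZ; last exact: test_bms t2.
have := Rint_pderiv_test i t1.
have -> : pderiv i (fun x => eta x * f x) = (fun x => pderiv i eta x * f x + eta x * pderiv i f x).
  by apply/funext => x; rewrite pderivM// => k; exact: smooth_Ck.
rewrite RintD; [|exact: test_bms t2|exact: test_bms t3].
by move=> /eqP; rewrite addrC addr_eq0 => /eqP ->; rewrite mulrN.
Qed.

Lemma shift_W1p p : 1 <= p ->
  W1p D p%:E shift_part (fun x => \row_i shift_grad i x).
Proof.
move=> p1.
split.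
- have [ms _] := bms_shift; have [M HM] := bms_bounded bms_shift.
  have M0 : 0 <= M by apply: le_trans (HM 0).
  apply: (in_Lp_bounded mD bdD p1 M0); first exact: measurable_funTS.
  by apply: aeW => x _; exact: HM.
- move=> i; have [ms _] := bms_shift_grad i; have [M HM] := bms_bounded (bms_shift_grad i).
  have M0 : 0 <= M by apply: le_trans (HM 0).
  rewrite (_ : (fun x => _) = shift_grad i); last by apply/funext => x; rewrite mxE.
  apply: (in_Lp_bounded mD bdD p1 M0); first exact: measurable_funTS.
  by apply: aeW => x _; exact: HM.
- apply: (@weak_gradientI _ _ _ _ _ shift_part shift_grad mD) => //.
  + move=> i; rewrite (_ : (fun x => _) = shift_grad i); last by apply/funext => x; rewrite mxE.
    by apply: measurable_funTS; have [] := bms_shift_grad i.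
  + by move=> i; have [] := bms_shift_grad i.
  + by move=> i; apply: aeW => x _; rewrite mxE.
  + move=> i f tf; split; last exact: shift_weak tf.1.
    * by apply: bmsM; [exact: bms_shift|exact: bms_measurable (test_bms (test_pderiv i tf))|
        exact: bms_bounded (test_bms (test_pderiv i tf))].
    * by apply: bmsM; [exact: bms_shift_grad|exact: bms_measurable (test_bms tf)|
        exact: bms_bounded (test_bms tf)].
Qed.

(** Only [u eta] is mollified; [s eta] is a test function already and cancels in the difference. *)
Lemma shift_approx (p : R) (d : R) : 1 <= p -> 0 < d -> exists f,
  [/\ test_function D f, (Lp_norm D p%:E (fun x => shift_part x - f x)%R <= d%:E)%E &
   forall i, (Lp_norm D p%:E (fun x => shift_grad i x - pderiv i f x)%R <= d%:E)%E].
Proof.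
move=> p1 d0.
have /choice[Mi HMi] : forall i, exists M : R, forall x, `|cut_grad u g eta i x| <= M.
  by move=> i; exact: bms_bounded (bms_cut_grad Hu He i).
pose M : R := \sum_i `|Mi i|.
have M0 : 0 <= M by exact: sumr_ge0.
have HM i x : `|cut_grad u g eta i x| <= M.
  apply: le_trans (HMi i x) _; apply: le_trans (ler_norm _) _.
  by rewrite /M (bigD1 i)//= lerDl sumr_ge0.
have [e e0 He'] := Lp_norm_small mD bdD p1 (addr_ge0 (addr_ge0 M0 M0) ler01) d0.
have Dfin := bounded_leb_fin mD bdD.
have Dn : (leb R n D \is a fin_num)%E by rewrite ge0_fin_numE.
pose V := fine (leb R n D); have V0 : 0 <= V by exact: fine_ge0.
(* The bound 1 keeps the error bounded, [e] makes the gradient error small in L^1, [e / (V + 1)]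
   turns the uniform error into an L^1 one, and [(r - b) / 2] keeps the support inside [D]. *)
pose k := Num.min (Num.min 1 e) (Num.min (e / (V + 1)) ((r - b) / 2)).
have k0 : 0 < k by rewrite !lt_min ltr01 e0/= divr_gt0//= ?divr_gt0// ?subr_gt0//; lra.
have [k1 ke kV kr] : [/\ k <= 1, k <= e, k <= e / (V + 1) & k <= (r - b) / 2].
  have : k <= k by []. rewrite {2}/k !le_min => /andP[/andP[-> ->] /andP[-> ->]]; by [].
have [f [Cf Hf Hdf Hgf f0]] := cut_approx Hu He oOm k0.
have Ce j : Ck j eta by exact: smooth_Ck.
have Cse j : Ck j (fun x => s * eta x).
  by apply: smooth_Ck; apply: smooth_mul => //; exact: smooth_cst.
have Cphi j : Ck j (fun x => f x + s * eta x) by apply: CkD.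
have pE i x : pderiv i (fun x => f x + s * eta x) x = pderiv i f x + s * pderiv i eta x.
  apply: is_derive_pderiv; apply: is_derive_fD; first exact: (Ck_is_derive i x (Cf 1%N)).
  have := is_derive_fM (is_derive_cst s x (delta_mx ord0 i)) (Ck_is_derive i x (Ce 1%N)).
  by rewrite mul0r add0r.
have mf : measurable_fun setT f.
  by apply: continuous_measurable_rVT; exact: Ck_continuous (Cf 0%N).
have mdf i : measurable_fun setT (pderiv i f).
  by apply: continuous_measurable_rVT; exact: Ck_continuous (Ck_pderiv i Cf 0%N).
have mue := bms_measurable (bms_cut Hu He).
have mcg i := bms_measurable (bms_cut_grad Hu He i).
have eta0 y : ~ cbox x0 b y -> eta y = 0 by exact: plateau_0.
exists (fun x => f x + s * eta x); split.
- split => //; apply: (@cbox_contained x0 ((r + b) / 2)); last by apply: cbox_obox; lra.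
  move=> x /=; apply: contraNP => nx.
  rewrite (eta0 x); last first.
    by move=> H; apply: nx => i; apply: le_trans (H i) _; lra.
  rewrite mulr0 addr0 f0// => y Hy; apply: eta0 => cy; apply: nx => i.
  have := ler_normD (x ord0 i - y ord0 i) (y ord0 i - x0 ord0 i).
  by rewrite addrA subrK; have := Hy i; have := cy i; lra.
- rewrite (_ : (fun x => _) = fun x => u x * eta x - f x); last first.
    by apply/funext => x; rewrite /shift_part; ring.
  have B x : `|u x * eta x - f x| <= k by rewrite distrC.
  have mB : measurable_fun D (fun x => u x * eta x - f x).
    by apply: measurable_funTS; exact: measurable_funB.
  apply: He' => //.
    by move=> x _; apply: le_trans (B x) _; lra.
  apply: (@le_trans _ _ (\int[leb R n]_(x in D) (cst k%:E x))%E).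
    by apply: ge0_le_integral_nonmeasurable => x _; rewrite ?lee_fin.
  rewrite integral_cst//; apply: (@le_trans _ _ (k%:E * V%:E)%E); first by rewrite fineK.
  rewrite -EFinM lee_fin.
  apply: (@le_trans _ _ (k * (V + 1))); first by rewrite ler_wpM2l ?(ltW k0)//; lra.
  by rewrite -ler_pdivlMr//; lra.
- move=> i; rewrite (_ : (fun x => _) = fun x => cut_grad u g eta i x - pderiv i f x); last first.
    by apply/funext => x; rewrite pE /shift_grad; ring.
  have mB : measurable_fun setT (fun x => cut_grad u g eta i x - pderiv i f x).
    exact: measurable_funB.
  apply: He'; first exact: measurable_funTS.
    move=> x _; have := ler_normB (cut_grad u g eta i x) (pderiv i f x).
    by have := Hdf i M (HM i) x; have := HM i x; lra.
  have H1 : (\int[leb R n]_(x in D) `|cut_grad u g eta i x - pderiv i f x|%:E <= L1norm setT (fun x => pderiv i f x - cut_grad u g eta i x)%R)%E.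
    have -> : L1norm setT (fun x => pderiv i f x - cut_grad u g eta i x) =
        L1norm setT (fun x => cut_grad u g eta i x - pderiv i f x).
      by apply: eq_integral => x _; rewrite distrC.
    exact: (L1norm_subset measurableT mD mB (@subsetT _ _)).
  by apply: le_trans H1 _; apply: le_trans (Hgf i) _; rewrite lee_fin.
Qed.

Lemma shift_W1p0 (p : R) : 1 <= p ->
  W1p0 D p%:E shift_part (fun x => \row_i shift_grad i x).
Proof.
move=> p1; split; first exact: shift_W1p.
have /choice[f Hf] : forall k : nat, exists f,
  [/\ test_function D f, (Lp_norm D p%:E (fun x => shift_part x - f x)%R <= (k.+1%:R^-1)%:E)%E &
   forall i, (Lp_norm D p%:E (fun x => shift_grad i x - pderiv i f x)%R <= (k.+1%:R^-1)%:E)%E].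
  by move=> k; exact: shift_approx.
have cvg (F : nat -> \bar R) : (forall k, 0 <= F k <= (k.+1%:R^-1)%:E)%E -> (F @ \oo --> 0)%E.
  move=> HF; have := cvg_cst (0%E : \bar R) => /(_ nat \oo _) c0.
  apply: (squeeze_cvge _ c0); first by apply: nearW => k; exact: HF.
  by apply: cvg_EFin; [exact: nearW|exact: cvg_harmonic].
exists f; split=> [k||i]; first by have [] := Hf k.
- by apply: cvg => k; rewrite Lnorm_ge0/=; have [_ H _] := Hf k.
- apply: cvg => k; rewrite Lnorm_ge0/=; have [_ _ H] := Hf k.
  rewrite (_ : (fun x => _) = fun x => shift_grad i x - pderiv i (f k) x)//.
  by apply/funext => x; rewrite mxE.
Qed.

(** Here [u'] and [du] are the given minimum and its gradient, equal to [u] on [D] and to [g] almost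
    everywhere there. The competitor is built from them because minimality is stated for them. *)
Lemma competitor_W1p (p : R) u' (du : 'rV[R]_n -> 'rV[R]_n) : 1 <= p -> 0 <= L ->
  (forall x, D x -> u' x = u x) ->
  (forall i, measurable_fun D (fun x => du x ord0 i)) ->
  (forall i, {ae leb R n, forall x, D x -> du x ord0 i = g x ord0 i}) ->
  W1p D p%:E (fun x => u' x - shift_part x) (fun x => du x - \row_i shift_grad i x).
Proof.
move=> p1 L0 uu mdu dug.
have muv : measurable_fun setT (fun x => u x - shift_part x).
  by apply: measurable_funB; [exact: phase_measurable Hu|exact: bms_measurable bms_shift].
have cE i x : (du x - \row_i shift_grad i x) ord0 i = du x ord0 i - shift_grad i x by rewrite !mxE.
have mi i : measurable_fun D (fun x => (du x - \row_i shift_grad i x) ord0 i).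
  rewrite (_ : (fun x => _) = (fun x => du x ord0 i - shift_grad i x)); last exact/funext.
  by apply: measurable_funB => //; apply: measurable_funTS; exact: bms_measurable (bms_shift_grad i).
split.
- have [M HM] := bms_bounded bms_shift; have M0 : 0 <= M by apply: le_trans (HM 0).
  apply: (in_Lp_bounded mD bdD p1 (M := 1 + M)); first lra.
    apply: (eq_measurable_fun (fun x => u x - shift_part x)); last exact: measurable_funTS.
    by move=> x /set_mem Dx; rewrite uu.
  apply: aeW => x Dx; rewrite uu//; have := ler_normB (u x) (shift_part x).
  by have := phase_bound Hu x; have := HM x; lra.
- move=> i; have [M HM] := bms_bounded (bms_shift_grad i); have M0 : 0 <= M by apply: le_trans (HM 0).
  apply: (in_Lp_bounded mD bdD p1 (M := L + M)) => //; first lra.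
  apply: filterS (dug i) => x H Dx; rewrite cE H//; have := ler_normB (g x ord0 i) (shift_grad i x).
  by have := grad_bound Hu x i; have := HM x; lra.
- apply: (@weak_gradientI _ _ _ _ _ (fun x => u x - shift_part x)
      (fun i x => g x ord0 i - shift_grad i x) mD) => //.
  + by move=> x Dx; rewrite uu.
  + by move=> i; apply: measurable_funB; [exact: grad_measurable Hu i|exact: bms_measurable (bms_shift_grad i)].
  + by move=> i; apply: filterS (dug i) => x H Dx; rewrite cE H.
  + move=> i f tf; have tf' := test_subset DOm tf.
    have bdf := test_bms (test_pderiv i tf); have bf := test_bms tf.
    have b1 := bms_phaseM Hu (test_pderiv i tf').
    have b2 : bms (fun x => shift_part x * pderiv i f x).
      by apply: bmsM; [exact: bms_shift|exact: bms_measurable bdf|exact: bms_bounded bdf].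
    have b3 := bms_gradM Hu i tf'.
    have b4 : bms (fun x => shift_grad i x * f x).
      by apply: bmsM; [exact: bms_shift_grad|exact: bms_measurable bf|exact: bms_bounded bf].
    have E1 : (fun x => (u x - shift_part x) * pderiv i f x) =
      (fun x => u x * pderiv i f x - shift_part x * pderiv i f x) by apply/funext => x; ring.
    have E2 : (fun x => (g x ord0 i - shift_grad i x) * f x) =
      (fun x => g x ord0 i * f x - shift_grad i x * f x) by apply/funext => x; ring.
    rewrite E1 E2; split; [exact: bmsB|exact: bmsB|].
    by rewrite RintB// RintB// (phase_grad Hu i tf') (shift_weak _ tf.1) opprD.
Qed.

End fixed.
End competitor.

(** * Caccioppoli inequality *)

Section caccioppoli.
Context (R : realType) (n : nat).
Implicit Types (D Om : set 'rV[R]_n) (u f : 'rV[R]_n -> R) (g du : 'rV[R]_n -> 'rV[R]_n).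

Lemma measurable_dens D p m (e : R) u g : measurable D -> measurable_fun D u ->
  (forall i, measurable_fun D (fun x => g x ord0 i)) ->
  measurable_fun D (fun x => dens p m e (u x) (g x)).
Proof.
move=> mD mu mg; apply: measurable_funD.
  apply: (measurableT_comp (@measurable_powR R p)).
  apply: (@measurableT_comp _ _ _ _ _ _ (@Num.sqrt R)).
    by apply: continuous_measurable_fun; exact: sqrt_continuous.
  apply: measurable_sum => i; apply: measurable_funX.
  rewrite (_ : (fun x => _) = (fun x => e * g x ord0 i)); last first.
    by apply/funext => x; rewrite mxE.
  by apply: measurable_funM => //; exact: mg.
apply: (measurableT_comp (@measurable_powR R m)); apply: measurableT_comp => //.
apply: measurable_funB => //; exact: measurable_funX.
Qed.

Lemma L1norm_mul_indic S f : measurable S ->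
  L1norm setT (fun x => f x * \1_S x) = L1norm S f.
Proof.
move=> mS; rewrite /L1norm [RHS]integral_mkcond; apply: eq_integral => x _.
rewrite patchE indicE; case: ifPn => /= xS; rewrite ?mulr1//.
by rewrite mulr0 normr0.
Qed.

Lemma L1normD_ge0 D f (h : 'rV[R]_n -> R) : measurable D -> measurable_fun setT f -> measurable_fun setT h ->
  (forall x, 0 <= f x) -> (forall x, 0 <= h x) ->
  L1norm D (fun x => f x + h x) = (L1norm D f + L1norm D h)%E.
Proof.
move=> mD mf mh f0 h0; rewrite /L1norm -ge0_integralD//.
- by apply: eq_integral => x _; rewrite -EFinD !ger0_norm// addr_ge0.
- by apply: measurable_funTS; exact: measurable_norm_fin.
- by apply: measurable_funTS; exact: measurable_norm_fin.
Qed.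

Lemma measurable_gt f (c : R) : measurable_fun setT f -> measurable [set x | c < f x].
Proof.
move=> mf; rewrite (_ : [set x | _] = setT `&` f @^-1` `]c, +oo[%classic); last first.
  by rewrite setTI; apply/seteqP; split=> x /=; rewrite in_itv/= andbT.
exact: mf.
Qed.

Lemma measurable_bool_gt f (c : R) : measurable_fun setT f ->
  measurable_fun setT (fun x => (c < f x)%R%:R : R).
Proof.
move=> mf; rewrite (_ : (fun y => _) = \1_[set y | c < f y]).
  by apply: measurable_indic; exact: measurable_gt.
apply/funext => y; rewrite indicE; congr (_%:R); congr nat_of_bool.
by apply/idP/idP => [h|/set_mem//]; exact: mem_set.
Qed.

(** On the inner box the competitor is the constant [- s], whose density is 0; its energy is
    therefore carried by the shell alone. The condition [e <= b - a] bounds the parameter [t] of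
    [dens_competitor] by [2 M]. *)
Lemma caccioppoli (p m lam Lam Q : R) : 0 < lam -> 0 <= Lam -> 1 < p -> p < m -> 0 <= Q ->
  exists2 C : R, 0 < C & forall E : 'rV[R]_n -> R -> 'rV[R]_n -> R,
  (forall (x : 'rV[R]_n) (tau : R) (xi : 'rV[R]_n),
     lam * (enorm xi `^ p + `|1 - tau ^+ 2| `^ m) <= E x tau xi
       <= Lam * (enorm xi `^ p + `|1 - tau ^+ 2| `^ m)) ->
  forall (e L : R) Om u du u' g, 0 < e -> open Om -> 0 <= L ->
  Q_minimum p E Q e Om u du -> phase_field Om L u' g ->
  (forall x, Om x -> u x = u' x) ->
  (forall i, {ae leb R n, forall x, Om x -> du x ord0 i = g x ord0 i}) ->
  forall (s : R) (x : 'rV[R]_n) (a b : R), s = 1 \/ s = -1 -> 0 < a -> e <= b - a ->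
  cbox x b `<=` Om ->
  (L1norm (cbox x a) (fun y => dens p m e (u' y) (g y)) <=
   C%:E * L1norm (cbox x b `\` cbox x a) (fun y =>
     dens p m e (u' y) (g y) + (0 < s * u' y)%R%:R + (e / (b - a)) `^ (p * m / (m - p)))%R)%E.
Proof.
move=> lam0 Lam0 p1 pm Q0; have p0 : 0 < p by lra. have m0 : 0 < m by lra.
have [M M0 HM] := @step'_bound R.
have T0 : 0 <= 2 * M by rewrite mulr_ge0// ltW.
have [C1 C10 HC1] := dens_competitor n p1 pm T0.
set q := p * m / (m - p) in HC1 *.
pose C2 := C1 * (1 + (2 * M) `^ q).
have C20 : 0 < C2 by rewrite mulr_gt0// ltr_pwDl// powR_ge0.
exists (lam^-1 * (Q * Lam) * C2 + 1).
  have : 0 <= lam^-1 * (Q * Lam) * C2 by apply: mulr_ge0; [rewrite mulr_ge0 ?invr_ge0 ?mulr_ge0// ltW|exact: ltW].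
  by lra.
move=> E E_bnd e L Om u du u' g e0 oOm L0 [Wu uQ] Hu uu' dug s x a b hs a0 eab bOm.
have ab : a < b by lra.
(* The cutoff must vanish before reaching [b] in order to have compact support in the open box [D];
   halving the width doubles its slope, whence the constant [2 M]. *)
pose b' := (a + b) / 2.
have ab' : a < b' by rewrite /b'; lra.
have b'b : b' < b by rewrite /b'; lra.
pose D := obox x b; pose eta := plateau x a b'.
have oD : open D by exact: open_obox.
have DOm : D `<=` Om by exact: subset_trans (@obox_cbox _ _ x b) bOm.
have mD : measurable D by exact: open_measurable_rV.
have bdD : bounded_set D by exact: bounded_setS (@obox_cbox _ _ x b) (@cbox_bounded _ _ x b).
have cD : compactly_contained D Om by exact: (cbox_contained (@obox_cbox _ _ x b) bOm).
have mOm : measurable Om by exact: open_measurable_rV.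
have [_ Wdu _] := Wu.
have mdu i : measurable_fun D (fun x => du x ord0 i).
  by apply: measurable_funS (Wdu i).1.
have dugD i : {ae leb R n, forall x, D x -> du x ord0 i = g x ord0 i}.
  by apply: filterS (dug i) => y H Dy; apply: H; exact: DOm.
have uu'D y : D y -> u y = u' y by move=> /DOm; exact: uu'.
have W1 := competitor_W1p Hu s ab' b'b bOm (ltW p1) L0 uu'D mdu dugD.
have W0 := shift_W1p0 oOm Hu s ab' b'b bOm (ltW p1).
set sh := shift_part u' x a b' s in W1 W0.
set sg := shift_grad u' g x a b' s in W1 W0.
have [_ /(_ _ _ W1)] := uQ D oD bdD cD.
have -> : (fun y => u y - (u y - sh y)) = sh by apply/funext => y; ring.
have -> : (fun y => du y - (du y - \row_i sg i y)) = (fun y => \row_i sg i y).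
  by apply/funext => y; rewrite opprB addrC subrK.
move=> /(_ W0); rewrite /energy muleCA lee_pmul2l ?lte_fin ?invr_gt0// => Hen.
pose F y := dens p m e (u' y) (g y).
pose G y := dens p m e (u' y - sh y) (g y - \row_i sg i y).
have muh := phase_measurable Hu. have mgh := grad_measurable Hu.
(* The given [u] and [du] are compared with the Borel functions [u'] and [g] only inside integrals
   over [D]; [F] and [G] are the densities of the minimum and of the competitor for the latter. *)
have msh : measurable_fun setT sh by exact: bms_measurable (bms_shift Hu s ab' b'b bOm).
have msg i : measurable_fun setT (sg i) by exact: bms_measurable (bms_shift_grad Hu s ab' b'b bOm i).
have mF : measurable_fun setT F by exact: measurable_dens.
have mG : measurable_fun setT G.
  apply: measurable_dens => //; first exact: measurable_funB.
  move=> i; rewrite (_ : (fun x => _) = (fun x => g x ord0 i - sg i x)).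
    exact: measurable_funB.
  by apply/funext => y; rewrite !mxE.
have F0 y : 0 <= F y by exact: dens_ge0.
have G0 y : 0 <= G y by exact: dens_ge0.
have dugA : {ae leb R n, forall y, D y -> du y = g y}.
  apply: filterS (filter_forall _ dugD) => y H Dy; apply/rowP => i; exact: H.
have H1 : (lam%:E * L1norm D F <= \int[leb R n]_(y in D) (E y (u y) (e *: du y))%:E)%E.
  rewrite /L1norm -ge0_integralZl//; last 2 first.
  - by apply: measurable_funTS; exact: measurable_norm_fin.
  - by rewrite lee_fin ltW.
  have -> : (\int[leb R n]_(y in D) (lam%:E * `|F y|%:E))%E =
      (\int[leb R n]_(y in D) (lam * dens p m e (u y) (du y))%:E)%E.
    apply: (ae_eq_integral _ _ mD).
    - by apply/measurable_EFinP; apply: measurable_funM => //; apply: measurable_funTS; exact: measurableT_comp.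
    - apply/measurable_EFinP; apply: measurable_funM => //.
      apply: measurable_dens => //; apply: (eq_measurable_fun u').
        by move=> y /set_mem Dy; rewrite uu'D.
      exact: measurable_funTS.
    - by apply: filterS dugA => y H Dy; rewrite (H Dy) (uu'D _ Dy) -/(F y) (ger0_norm (F0 y)) EFinM.
  apply: ge0_le_integral_nonmeasurable => y _; first by rewrite lee_fin mulr_ge0 ?dens_ge0// ltW.
  by rewrite lee_fin; have /andP[] := E_bnd y (u y) (e *: du y).
have H2 : (\int[leb R n]_(y in D) (E y (u y - sh y)%R (e *: (du y - \row_i sg i y)))%:E <= Lam%:E * L1norm D G)%E.
  rewrite /L1norm -ge0_integralZl//; last first.
    by apply: measurable_funTS; exact: measurable_norm_fin.
  have -> : (\int[leb R n]_(y in D) (Lam%:E * `|G y|%:E))%E =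
      (\int[leb R n]_(y in D) (Lam * dens p m e (u y - sh y) (du y - \row_i sg i y))%:E)%E.
    apply: (ae_eq_integral _ _ mD).
    - by apply/measurable_EFinP; apply: measurable_funM => //; apply: measurable_funTS; exact: measurableT_comp.
    - apply/measurable_EFinP; apply: measurable_funM => //.
      apply: measurable_dens => //.
        apply: (eq_measurable_fun (fun y => u' y - sh y)).
          by move=> y /set_mem Dy; rewrite uu'D.
        by apply: measurable_funTS; exact: measurable_funB.
      move=> i; rewrite (_ : (fun x => _) = (fun x => du x ord0 i - sg i x)).
        by apply: measurable_funB => //; exact: measurable_funTS.
      by apply/funext => y; rewrite !mxE.
    - by apply: filterS dugA => y H Dy; rewrite (H Dy) (uu'D _ Dy) -/(G y) (ger0_norm (G0 y)) EFinM.
  apply: ge0_le_integral_nonmeasurable => y _.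
    rewrite lee_fin; apply: le_trans (proj1 (andP (E_bnd _ _ _))).
    by rewrite mulr_ge0 ?addr_ge0 ?powR_ge0// ltW.
  by rewrite lee_fin; have /andP[] := E_bnd y (u y - sh y) (e *: (du y - \row_i sg i y)).
pose S := cbox x b `\` cbox x a.
have ma : measurable (cbox x a) by apply: closed_measurable_rV; exact: cbox_closed.
have mb : measurable (cbox x b) by apply: closed_measurable_rV; exact: cbox_closed.
have mS : measurable S by exact: measurableD.
pose H y := F y + (0 < s * u' y)%R%:R + (e / (b - a)) `^ q.
have mH : measurable_fun setT H.
  apply: measurable_funD => //; apply: measurable_funD => //.
  by apply: measurable_bool_gt; exact: measurable_funM.
have H0 y : 0 <= H y by rewrite !addr_ge0 ?powR_ge0.
have GH y : D y -> G y <= C2 * (H y * \1_S y).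
  move=> Dy; rewrite indicE; have [ay|ay] := pselect (cbox x a y).
    suff -> : G y = 0 by apply: mulr_ge0; [exact: ltW|apply: mulr_ge0 => //; exact: H0].
    have e1 : eta y = 1 by exact: plateau_1.
    have de i : pderiv i eta y = 0 by exact: pderiv_plateau_in.
    rewrite /G (_ : u' y - sh y = - s); last by rewrite /sh /shift_part -/eta e1; ring.
    rewrite (_ : g y - _ = 0) ?dens_phase ?gt_eqF//; first by case: hs => ->; rewrite ?opprK; [right|left].
    by apply/rowP => i; rewrite !mxE /sg /shift_grad /cut_grad -/eta e1 de; ring.
  rewrite mem_set ?mulr1; last by split=> //; exact: obox_cbox.
  pose t := 2 * M * (e / (b - a)).
  have r0 : 0 <= e / (b - a) by rewrite divr_ge0// ltW//; lra.
  have r1 : e / (b - a) <= 1 by rewrite ler_pdivrMr; lra.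
  have t0 : 0 <= t by rewrite mulr_ge0.
  have t1 : t <= 2 * M by rewrite /t ler_piMr.
  have kt i : e * `|(\row_i pderiv i eta y) ord0 i| <= t.
    rewrite mxE; have := pderiv_plateau_bound x ab' i y HM.
    rewrite -(ler_pM2l e0) => /le_trans; apply.
    by rewrite /t /b' le_eqVlt; apply/orP; left; apply/eqP; field; lra.
  have := HC1 s (u' y) e (eta y) t (g y) (\row_i pderiv i eta y) hs (phase_bound Hu y) e0
    (plateau_01 _ _ _ _) _ kt; rewrite t0 t1 => /(_ isT).
  have -> : dens p m e (u' y - (u' y * eta y + s * eta y)) (g y - \row_i (g y ord0 i * eta y +
    u' y * (\row_i pderiv i eta y) ord0 i + s * (\row_i pderiv i eta y) ord0 i)) = G y.
    by rewrite /G; congr dens; apply/rowP => i; rewrite !mxE.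
  move=> /le_trans; apply; rewrite /C2 -mulrA ler_wpM2l ?(ltW C10)//.
  rewrite powRM// /H -/(F y).
  have A0 : 0 <= (2 * M) `^ q by exact: powR_ge0.
  have B0 : 0 <= (e / (b - a)) `^ q by exact: powR_ge0.
  have := F0 y; have : 0 <= (0 < s * u' y)%R%:R :> R by [].
  by nra.
have mH1 : measurable_fun setT (fun y => H y * \1_S y) by apply: measurable_funM => //; exact: measurable_indic.
have H3 : (L1norm D G <= C2%:E * L1norm S H)%E.
  apply: (@le_trans _ _ (L1norm D (fun y => C2 * (H y * \1_S y))%R)).
    apply: (L1norm_le mD mG (measurable_funM (measurable_cst C2) mH1)).
    by move=> y Dy; rewrite (ger0_norm (G0 y)) (ger0_norm (le_trans (G0 y) (GH y Dy))) GH.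
  rewrite (L1normZ _ mD mH1) (gtr0_norm C20); apply: lee_wpmul2l; first by rewrite lee_fin ltW.
  rewrite -(L1norm_mul_indic H mS); exact: (L1norm_subset measurableT mD mH1 (@subsetT _ _)).
have H4 : (L1norm (cbox x a) F <= L1norm D F)%E.
  exact: (L1norm_subset mD ma mF (cbox_obox ab)).
apply: (le_trans H4); rewrite -(@lee_pmul2l _ lam%:E)// ?lte_fin//.
apply: (le_trans H1); apply: (le_trans Hen).
apply: (@le_trans _ _ (Q%:E * (Lam%:E * (C2%:E * L1norm S H)))%E).
  rewrite lee_wpmul2l ?lee_fin//; apply: (le_trans H2); rewrite lee_wpmul2l ?lee_fin//.
rewrite !muleA -!EFinM lee_wpmul2r ?L1norm_ge0// lee_fin.
rewrite mulrDr mulr1 !mulrA divff ?gt_eqF// mul1r -/C2; lra.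
Qed.

End caccioppoli.

(** * Density estimate *)

Section initial_density.
Context (R : realType) (n : nat).
Implicit Types (D Om : set 'rV[R]_n) (u f : 'rV[R]_n -> R) (g : 'rV[R]_n -> 'rV[R]_n).

Lemma L1norm_lower D f (k : R) : measurable D -> 0 <= k -> (forall x, D x -> k <= `|f x|) ->
  (k%:E * leb R n D <= L1norm D f)%E.
Proof.
move=> mD k0 H; rewrite -integral_cst//.
by apply: ge0_le_integral_nonmeasurable => x Dx; rewrite lee_fin// H.
Qed.

Lemma measurable_cbox (c : 'rV[R]_n) (r : R) : measurable (cbox c r).
Proof. by apply: closed_measurable_rV; exact: cbox_closed. Qed.

Lemma hcube_sub_cbox (c : 'rV[R]_n) (r : R) :
  hcube (c - const_mx r) (r + r) `<=` cbox c r.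
Proof.
by move=> x H i; have := H i; rewrite !mxE ler_distl => /andP[h1 h2]; apply/andP; split; lra.
Qed.

(** The mollifications of [u eta], with [eta = 1] on the box of radius [e], have partial derivatives
    bounded by [L + M / e]. The contribution [M / e] of the cutoff is harmless because [L] will be
    of order [1 / e] as well. *)
Lemma phase_field_lipschitz (M L e : R) Om u g x : (forall t : R, step' t <= M) -> 0 < e ->
  open Om -> phase_field Om L u g -> cbox x (e + e) `<=` Om ->
  forall y, cbox x e y -> `|u y - u x| <= (L + M / e) * \sum_i `|y ord0 i - x ord0 i|.
Proof.
move=> HM e0 oOm Hu xOm y xy.
have ee : e < e + e by lra.
pose eta := plateau x e (e + e).
have He : cutoff Om eta by split; [exact: smooth_plateau|exact: plateau_support].
have xx : cbox x e x by move=> i; rewrite subrr normr0 ltW.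
have e1 z : cbox x e z -> eta z = 1 by exact: plateau_1.
have B i z : `|cut_grad u g eta i z| <= L + M / e.
  apply: le_trans (ler_normD _ _) _; rewrite !normrM; apply: lerD.
    rewrite -[leRHS]mulr1; apply: ler_pM => //; first exact: grad_bound Hu z i.
    by rewrite ger0_norm; have /andP[] := plateau_01 x e (e + e) z.
  rewrite -[leRHS]mul1r; apply: ler_pM => //; first exact: phase_bound Hu z.
  by have := pderiv_plateau_bound x ee i z HM; rewrite (_ : e + e - e = e)//; ring.
apply/ler_addgt0Pr => d d0.
have [f [Cf Hf Hdf _ _]] := cut_approx Hu He oOm (divr_gt0 d0 (ltr0n R 2)).
have fl := partial_lipschitz (fun i z => Ck_is_derive i z (Cf 1%N)) (fun i z => Hdf i _ (B i) z) y x.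
have h1 := Hf y; have h2 := Hf x; rewrite e1// mulr1 in h1; rewrite e1// mulr1 in h2.
rewrite (_ : u y - u x = (f y - f x) - (f y - u y) + (f x - u x)); last by ring.
apply: le_trans (ler_normD _ _) _.
have := ler_normB (f y - f x) (f y - u y).
by move: fl h1 h2; set S := _ * _; lra.
Qed.

Lemma initial_density (p m Lg Theta : R) : 0 <= Lg -> 0 <= m -> 0 < Theta < 1 ->
  exists2 c : R, 0 < c & forall e Om u g x, 0 < e -> open Om -> phase_field Om (Lg / e) u g ->
  cbox x (e + e) `<=` Om -> `|u x| <= Theta ->
  ((c * e ^+ n)%:E <= L1norm (cbox x e) (fun y => dens p m e (u y) (g y)))%E.
Proof.
move=> Lg0 m0 /andP[T0 T1]; have [M M0 HM] := @step'_bound R.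
pose La := (Lg + M) * n%:R + 1.
have La1 : 1 <= La by rewrite /La lerDr mulr_ge0// addr_ge0// ltW.
(* Chosen so that [u] varies by at most [(1 - Theta) / 2] in the box of radius [c0 e]; there
   [|u| <= th < 1]. *)
pose c0 := (1 - Theta) / (La + La).
have c00 : 0 < c0 by rewrite divr_gt0; lra.
have c01 : c0 <= 1 by rewrite ler_pdivrMr; lra.
have c0La : La * c0 = (1 - Theta) / 2 by rewrite /c0; field; lra.
pose th := (1 + Theta) / 2; pose k := (1 - th ^+ 2) `^ m.
have th1 : 0 < 1 - th ^+ 2 by rewrite /th; nra.
have k0 : 0 < k by exact: powR_gt0.
exists (k * (c0 + c0) ^+ n); first by rewrite mulr_gt0// exprn_gt0// addr_gt0.
move=> e Om u g x e0 oOm Hu xOm uT.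
have lip := phase_field_lipschitz HM e0 oOm Hu xOm.
have r0 : 0 < c0 * e by rewrite mulr_gt0.
have sub : cbox x (c0 * e) `<=` cbox x e by move=> y H i; apply: le_trans (H i) _; rewrite ler_piMl// ltW.
have mF : measurable_fun setT (fun y => dens p m e (u y) (g y)).
  by apply: measurable_dens => //; [exact: phase_measurable Hu|exact: grad_measurable Hu].
apply: le_trans (L1norm_subset (measurable_cbox x e) (measurable_cbox x (c0 * e)) mF sub).
apply: le_trans (L1norm_lower (measurable_cbox x (c0 * e)) (ltW k0) _); last first.
  move=> y Hy; rewrite (ger0_norm (dens_ge0 _ _ _ _ _)) /dens.
  have : `|u y| <= th.
    have := lip y (sub _ Hy).
    have S : \sum_i `|y ord0 i - x ord0 i| <= n%:R * (c0 * e).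
      apply: (@le_trans _ _ (\sum_(i < n) (c0 * e))); first by apply: ler_sum => i _; exact: Hy.
      by rewrite sumr_const card_ord mulr_natl.
    have : (Lg / e + M / e) * (\sum_i `|y ord0 i - x ord0 i|) <= (1 - Theta) / 2.
      apply: (@le_trans _ _ ((Lg / e + M / e) * (n%:R * (c0 * e)))).
        by rewrite ler_wpM2l// addr_ge0// divr_ge0// ltW.
      rewrite -c0La (_ : _ * _ = (Lg + M) * n%:R * c0); last by field; rewrite gt_eqF.
      by rewrite ler_wpM2r ?(ltW c00)// /La lerDl.
    have := ler_normD (u y - u x) (u x); rewrite subrK /th.
    by set S1 := _ * _; lra.
  rewrite ler_norml => /andP[h1 h2]; apply: (@le_trans _ _ (`|1 - u y ^+ 2| `^ m)).
    apply: powR_le => //; first exact: ltW.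
    by apply: le_trans (ler_norm _); nra.
  by rewrite lerDr powR_ge0.
rewrite -mulrA EFinM; apply: lee_wpmul2l; first by rewrite lee_fin ltW.
rewrite -exprMn mulrDl -(leb_hcube (x - const_mx (c0 * e)) (addr_ge0 (ltW r0) (ltW r0))).
apply: le_measure; rewrite ?inE; [exact: measurable_hcube|exact: measurable_cbox|exact: hcube_sub_cbox].
Qed.

End initial_density.

(** * Separation in terms of the energy density *)

Section separation.
Context (R : realType) (n : nat).
Implicit Types (D Om : set 'rV[R]_n) (u f : 'rV[R]_n -> R) (g : 'rV[R]_n -> 'rV[R]_n).

Lemma L1norm_bool_gt D f (c : R) : measurable D -> measurable_fun setT f ->
  L1norm D (fun x => (c < f x)%R%:R) = leb R n ([set x | c < f x] `&` D).
Proof.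
move=> mD mf; rewrite -L1norm_indic//; last exact: measurable_gt.
apply: eq_integral => x _; rewrite indicE; congr (`|_%:R|%:E); congr nat_of_bool.
by apply/idP/idP => [h|/set_mem//]; exact: mem_set.
Qed.

(** From [1 - v^2 >= 3 / 4]; this is the origin of the factors [(4 / 3)^m] below. *)
Lemma dens_half (p m e v : R) (g : 'rV[R]_n) : 0 <= m -> `|v| <= 2^-1 ->
  1 <= (4 / 3) `^ m * dens p m e v g.
Proof.
move=> m0; rewrite ler_norml => /andP[h1 h2].
have K : 3 / 4 <= `|1 - v ^+ 2| by rewrite ger0_norm; nra.
apply: (@le_trans _ _ ((4 / 3) `^ m * `|1 - v ^+ 2| `^ m)).
  rewrite -powRM//; apply: (@le_trans _ _ (1 `^ m)); first by rewrite powR1.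
  by apply: powR_le => //; lra.
by rewrite ler_wpM2l ?powR_ge0// /dens lerDr powR_ge0.
Qed.

(** If [e |g| <= 1] the potential alone suffices, by [dens_half]; otherwise [e |g| <= (e |g|)^p].
    Away from the wells the density thus controls the gradient linearly. *)
Lemma dens_grad_half (p m e v : R) (g : 'rV[R]_n) i : 1 <= p -> 0 <= m -> 0 < e -> `|v| <= 2^-1 ->
  `|g ord0 i| <= e^-1 * (2 * (4 / 3) `^ m) * dens p m e v g.
Proof.
move=> p1 m0 e0 hv; rewrite -mulrA -ler_pdivrMl ?invr_gt0// invrK.
apply: (@le_trans _ _ (enorm (e *: g))).
  by have := enorm_coord (e *: g) i; rewrite mxE normrM gtr0_norm.
have H := dens_half p e g m0 hv.
set X := dens p m e v g in H *.
have XE : enorm (e *: g) `^ p <= X by rewrite /X /dens lerDl powR_ge0.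
have A1 : 1 <= (4 / 3) `^ m :> R.
  by apply: (@le_trans _ _ (1 `^ m)); [rewrite powR1|apply: powR_le => //; lra].
have X0 : 0 <= X by exact: dens_ge0.
have [h|h] := leP (enorm (e *: g)) 1; first by nra.
have : enorm (e *: g) <= enorm (e *: g) `^ p by apply: le1r_powR => //; exact: ltW.
by nra.
Qed.

Lemma dens_occupied (p m e s v : R) (g : 'rV[R]_n) : s = 1 \/ s = -1 -> 0 <= m ->
  (- 2^-1 < s * v)%R%:R <= (4 / 3) `^ m * (dens p m e v g + (0 < s * v)%R%:R).
Proof.
move=> hs m0.
have A1 : 1 <= (4 / 3) `^ m :> R.
  by apply: (@le_trans _ _ (1 `^ m)); [rewrite powR1|apply: powR_le => //; lra].
have X0 : 0 <= dens p m e v g by exact: dens_ge0.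
have [h|h] := ltP 0 (s * v).
  apply: (@le_trans _ _ 1); first by case: (_ < _).
  by rewrite mulr1n; nra.
have [h2|h2] := ltP (- 2^-1) (s * v); last by rewrite mulr_ge0 ?addr_ge0 ?powR_ge0.
rewrite addr0; apply: dens_half => //.
have : `|s * v| <= 2^-1 by rewrite ler_norml; apply/andP; split; lra.
by rewrite normrM; case: hs => ->; rewrite ?normrN normr1 mul1r.
Qed.

(** This is [phase_separation] with [h] a multiple of the density divided by [e]. That lemma needs a
    real bound strictly above [X]: if both volumes exceeded [X], a real number between [X] and the
    two volumes would contradict it. *)
Lemma separation_alt (p m : R) : 1 <= p -> 0 <= m ->
  exists2 C : R, 0 < C & forall e Om L u g, 0 < e -> open Om -> phase_field Om L u g ->
  forall (s : R), s = 1 \/ s = -1 -> forall (c : 'rV[R]_n) (l : R), 0 < l ->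
  cbox (c + const_mx (l / 2)) (l / 2) `<=` Om ->
  let X := ((C * (l / e))%:E * L1norm (hcube c l) (fun y => dens p m e (u y) (g y)))%E in
  (leb R n ([set x | (0 < s * u x)%R] `&` hcube c l) <= X)%E \/
  (leb R n ([set x | (s * u x <= - 2^-1)%R] `&` hcube c l) <= X)%E.
Proof.
move=> p1 m0; have [C C0 HC] := @phase_separation R n.
have A0 : 0 < 2 * (4 / 3) `^ m :> R by rewrite mulr_gt0// powR_gt0; lra.
exists (C * (2 * (4 / 3) `^ m)); first by rewrite mulr_gt0.
move=> e Om L u g e0 oOm Hu s hs c l l0 cOm X.
have mu := phase_measurable Hu.
have mF : measurable_fun setT (fun y => dens p m e (u y) (g y)).
  by apply: measurable_dens => //; exact: grad_measurable Hu.
have mQ : measurable (hcube c l) by exact: measurable_hcube.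
pose h y := e^-1 * (2 * (4 / 3) `^ m) * dens p m e (u y) (g y).
have ih0 : 0 <= e^-1 * (2 * (4 / 3) `^ m) by rewrite mulr_ge0 ?invr_ge0 ?(ltW e0) ?(ltW A0).
have mh : measurable_fun setT h by exact: measurable_funM.
have h0 y : 0 <= h y by rewrite mulr_ge0 ?dens_ge0.
have gh y i : hcube c l y -> `|u y| <= 2^-1 -> `|g y ord0 i| <= h y.
  by move=> _ hy; exact: dens_grad_half.
have X0 : (0 <= X)%E.
  by apply: mule_ge0; [rewrite lee_fin !mulr_ge0 ?invr_ge0 ?(ltW C0) ?(ltW A0) ?(ltW l0) ?(ltW e0)|exact: L1norm_ge0].
have hX : ((C * l)%:E * L1norm (hcube c l) h = X)%E.
  rewrite L1normZ// muleA -EFinM ger0_norm//; congr (_%:E * _)%E; ring.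
have [XV|VX] := leP (leb R n ([set x | (0 < s * u x)%R] `&` hcube c l)) X; first by left.
have [XV'|VX'] := leP (leb R n ([set x | (s * u x <= - 2^-1)%R] `&` hcube c l)) X; first by right.
exfalso; clearbody X.
have Xf : (X \is a fin_num)%E by rewrite ge0_fin_numE// (lt_le_trans VX)// leey.
have Xlt (V : \bar R) : (X < V)%E -> exists2 r : R, (fine X < r) & (r%:E < V)%E.
  move=> XV; rewrite -(fineK Xf) in XV; case: V XV => [v||]// XV; first rewrite lte_fin in XV.
    by exists ((fine X + v) / 2); rewrite ?lte_fin; lra.
  by exists (fine X + 1); rewrite ?ltry//; lra.
have [r1 Xr1 r1V] := Xlt _ VX; have [r2 Xr2 r2V] := Xlt _ VX'.
have Xr : ((C * l)%:E * L1norm (hcube c l) h < (Num.min r1 r2)%:E)%E.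
  by rewrite hX -(fineK Xf) lte_fin lt_min Xr1 Xr2.
have [H|H] := HC Om L u g oOm Hu s hs c l l0 cOm h mh h0 gh _ Xr.
  suff : (r1%:E < r1%:E)%E by rewrite ltxx.
  by apply: (lt_le_trans r1V); apply: (le_trans H); rewrite lee_fin ge_min lexx.
suff : (r2%:E < r2%:E)%E by rewrite ltxx.
by apply: (lt_le_trans r2V); apply: (le_trans H); rewrite lee_fin ge_min lexx orbT.
Qed.

(** If [s u > - 1/2] on at most half of the cube, the opposite set fills at least half. When it is
    the opposite set that [separation_alt] bounds, the bound is at least half the volume of the
    cube, and so also bounds the phase [s]. *)
Lemma separation_dens (p m : R) : 1 <= p -> 0 <= m ->
  exists2 C : R, 0 < C & forall e Om L u g, 0 < e -> open Om -> phase_field Om L u g ->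
  forall (s : R), s = 1 \/ s = -1 -> forall (c : 'rV[R]_n) (l : R), 0 < l ->
  cbox (c + const_mx (l / 2)) (l / 2) `<=` Om ->
  (L1norm (hcube c l) (fun y => (- 2^-1 < s * u y)%R%:R) <= (l ^+ n / 2)%:E)%E ->
  (L1norm (hcube c l) (fun y => (0 < s * u y)%R%:R) <=
   (C * (l / e))%:E * L1norm (hcube c l) (fun y => dens p m e (u y) (g y)))%E.
Proof.
move=> p1 m0; have [C C0 HC] := separation_alt p1 m0.
exists C => // e Om L u g e0 oOm Hu s hs c l l0 cOm occ.
have mu := phase_measurable Hu.
have msu : measurable_fun setT (fun y => s * u y) by exact: measurable_funM.
have mQ : measurable (hcube c l) by exact: measurable_hcube.
have mp (k : R) : measurable_fun setT (fun y => (k < s * u y)%R%:R : R) by exact: measurable_bool_gt.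
have [|H] := HC e Om L u g e0 oOm Hu s hs c l l0 cOm; first by rewrite L1norm_bool_gt.
have Vo : (L1norm (hcube c l) (fun y => (0 < s * u y)%R%:R) <= (l ^+ n / 2)%:E)%E.
  apply: le_trans occ; apply: L1norm_le => // y _.
  have [h1|h1] := ltP 0 (s * u y); last by rewrite mulr0n normr0.
  by rewrite (_ : - 2^-1 < s * u y)//; lra.
apply: (le_trans Vo); apply: le_trans H.
have leQ : leb R n (hcube c l) = (l ^+ n)%:E by rewrite leb_hcube// ltW.
have S : (leb R n (hcube c l) = L1norm (hcube c l) (fun y => (- 2^-1 < s * u y)%R%:R) +
    leb R n ([set x | (s * u x <= - 2^-1)%R] `&` hcube c l))%E.
  rewrite L1norm_bool_gt// (measureDI _ mQ (measurable_gt (- 2^-1) msu)) setIC addeC.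
  congr (_ + leb R n _)%E; apply/seteqP; split=> y /=.
    by move=> [Qy /negP]; rewrite -leNgt.
  by move=> [h1 Qy]; split=> //; apply/negP; rewrite -leNgt.
move: S occ; rewrite leQ; case: (L1norm _ _) (L1norm_ge0 (hcube c l) (fun y => (- 2^-1 < s * u y)%R%:R)) => [a||]//.
case: (leb R n _) => [b||] _; [|by move=> _ _; exact: leey|by []].
by rewrite -EFinD => -[] E; rewrite !lee_fin; lra.
Qed.

End separation.

(** * One step of the growth recursion *)

Section density_growth.
Context (R : realType) (n : nat).
Implicit Types (D Om : set 'rV[R]_n) (u f : 'rV[R]_n -> R) (g : 'rV[R]_n -> 'rV[R]_n).

(** The only consequence of minimality used in the density argument. *)
Definition caccioppoli_bound (C q p m e : R) Om u g :=
  forall (s : R) (x : 'rV[R]_n) (a b : R), s = 1 \/ s = -1 -> 0 < a -> e <= b - a ->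
  cbox x b `<=` Om ->
  (L1norm (cbox x a) (fun y => dens p m e (u y) (g y)) <=
   C%:E * L1norm (cbox x b `\` cbox x a) (fun y =>
     dens p m e (u y) (g y) + (0 < s * u y)%R%:R + (e / (b - a)) `^ q)%R)%E.

Lemma exprB_le k (x y : R) : 0 <= y <= x -> x ^+ k - y ^+ k <= k%:R * (x - y) * x ^+ k.-1.
Proof.
move=> /andP[y0 yx]; rewrite subrXX (mulrC k%:R) -mulrA ler_wpM2l ?subr_ge0//.
apply: (@le_trans _ _ (\sum_(i < k) x ^+ k.-1)); last by rewrite sumr_const card_ord mulr_natl.
apply: ler_sum => i _; have ik : (i <= k.-1)%N by case: k i => [[]//|k] i; rewrite -ltnS.
have x0 : 0 <= x by exact: le_trans yx.
rewrite -[in leRHS](subnK ik) exprD ler_wpM2l ?exprn_ge0//.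
by rewrite lerXn2r ?nnegrE.
Qed.

Lemma cbox_sub_hcube (c : 'rV[R]_n) (r a : R) : r < a -> cbox c r `<=` hcube (c - const_mx a) (a + a).
Proof.
move=> ra x H i; have := H i; rewrite !mxE ler_distl => /andP[h1 h2]; apply/andP; split; lra.
Qed.

Lemma cbox_subset (c : 'rV[R]_n) (r a : R) : r <= a -> cbox c r `<=` cbox c a.
Proof. by move=> ra x H i; exact: le_trans (H i) ra. Qed.

(** The slack [d] is there because a closed box fits only in a larger half-open cube. *)
Lemma leb_shell (x : 'rV[R]_n) (a b d : R) : 0 < a -> a <= b -> 0 < d ->
  (leb R n (cbox x b `\` cbox x a) <= ((b + b + d) ^+ n - (a + a) ^+ n)%:E)%E.
Proof.
move=> a0 ab d0; pose H' := hcube (x - const_mx b) (b + b + d); pose H := hcube (x - const_mx a) (a + a).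
have HH : H `<=` H'.
  by move=> y h i; have := h i; rewrite !mxE => /andP[h1 h2]; apply/andP; split; lra.
have mH : measurable H by exact: measurable_hcube.
have mH' : measurable H' by exact: measurable_hcube.
have lH : leb R n H = ((a + a) ^+ n)%:E by rewrite leb_hcube// ltW// addr_gt0.
have lH' : leb R n H' = ((b + b + d) ^+ n)%:E by rewrite leb_hcube//; lra.
apply: (@le_trans _ _ (leb R n (H' `\` H))).
  apply: le_measure; rewrite ?inE; first by apply: measurableD; exact: measurable_cbox.
    exact: measurableD.
  move=> y [yb ya]; split; last by move=> /hcube_sub_cbox.
  by move=> i; have := yb i; rewrite !mxE ler_distl => /andP[h1 h2]; apply/andP; split; lra.
rewrite measureD//; last by rewrite [X in (X < _)%E]lH' ltry.
by rewrite (setIidr HH) [X in (X - _)%E]lH' [X in (_ - X)%E]lH.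
Qed.

Lemma L1norm_occupied (p m e s : R) D u g : s = 1 \/ s = -1 -> 0 <= m -> measurable D ->
  measurable_fun setT u -> (forall i, measurable_fun setT (fun x => g x ord0 i)) ->
  (L1norm D (fun y => (- 2^-1 < s * u y)%R%:R) <= ((4 / 3) `^ m)%:E *
   L1norm D (fun y => dens p m e (u y) (g y) + (0 < s * u y)%R%:R)%R)%E.
Proof.
move=> hs m0 mD mu mg.
have msu : measurable_fun setT (fun y => s * u y) by exact: measurable_funM.
have mp (c : R) : measurable_fun setT (fun y => (c < s * u y)%R%:R : R) by exact: measurable_bool_gt.
have mF : measurable_fun setT (fun y => dens p m e (u y) (g y)) by exact: measurable_dens.
have mW : measurable_fun setT (fun y => dens p m e (u y) (g y) + (0 < s * u y)%R%:R) by exact: measurable_funD.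
rewrite -{1}[(4 / 3) `^ m]ger0_norm ?powR_ge0// -(L1normZ _ mD mW).
apply: L1norm_le => //; first exact: measurable_funM.
move=> y _; rewrite ger0_norm// [leRHS]ger0_norm; first exact: dens_occupied.
by rewrite mulr_ge0 ?powR_ge0// addr_ge0 ?dens_ge0.
Qed.

(** The smallness of [W] makes the phase [s] a minority in every cell of side about [2 j e / T], so
    separation bounds its volume by [j / T] times the energy, and the Caccioppoli inequality bounds
    the energy by the shell. The error term is [(e / width)^q], of order [K^(-q)], times the shell
    volume, of order [j^(n-1) (K e)^n]. *)
Lemma density_step (p m q C : R) : (0 < n)%N -> 1 <= p -> 0 <= m -> 0 < C -> 0 <= q ->
  exists2 C1 : R, 0 < C1 & forall (T K j : nat), (0 < T)%N -> (1 < K)%N -> (0 < j)%N -> (T <= j)%N ->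
  forall (e L : R) Om u g, 0 < e -> open Om -> phase_field Om L u g ->
  caccioppoli_bound C q p m e Om u g ->
  forall (s : R) x, s = 1 \/ s = -1 -> let d := K%:R * e in
  let W y := dens p m e (u y) (g y) + (0 < s * u y)%R%:R in
  cbox x (j.+1%:R * d) `<=` Om ->
  (L1norm (cbox x (j.+1%:R * d)) W <= ((j.+1%:R * e / T%:R) ^+ n / (2 * (4 / 3) `^ m))%:E)%E ->
  (L1norm (cbox x (j%:R * d)) W <= (C1 * (j.+1%:R / T%:R))%:E *
    (L1norm (cbox x (j.+1%:R * d) `\` cbox x (j%:R * d)) W +
     (K%:R `^ (n%:R - q) * j.+1%:R ^+ n.-1 * e ^+ n)%:E))%E.
Proof.
move=> n0 p1 m0 C0 q0; have [C3 C30 HC3] := separation_dens n p1 m0.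
pose C5 := (4 / 3) `^ q * n%:R * 3 ^+ n.
have C50 : 0 <= C5 by rewrite !mulr_ge0 ?powR_ge0 ?exprn_ge0.
exists ((1 + 2 * C3) * C * (1 + C5)); first by rewrite !mulr_gt0; lra.
move=> T K j T0 K1 j0 Tj e L Om u g e0 oOm Hu cacc s x hs d W bOm small.
have K2 : 2 <= K%:R :> R by rewrite ler_nat.
have j1 : 1 <= j%:R :> R by rewrite ler1n.
have T1 : 1 <= T%:R :> R by rewrite ler1n.
have d0 : 0 < d by rewrite mulr_gt0//; lra.
have jS : j.+1%:R = j%:R + 1 :> R by rewrite -natr1.
(* The margin [d / 4] leaves room for a half-open cube between the closed boxes of radius [j d] and
   [a], while [b - a] stays comparable to [d]. *)
pose a := (j%:R + 4^-1) * d; pose b := j.+1%:R * d.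
have a0 : 0 < a by rewrite mulr_gt0//; lra.
have jda : j%:R * d < a by rewrite ltr_pM2r//; lra.
have baE : b - a = 3 / 4 * d by rewrite /b /a jS; field.
have ab : a < b by rewrite -subr_gt0 baE; lra.
have eba : e <= b - a by rewrite baE /d; nra.
(* With [K T] cells per side, [l / e] is [(2 j + 1/2) / T], independently of [K]. *)
pose N := (K * T)%N.
have N0 : (0 < N)%N by rewrite muln_gt0 T0 ltnW.
pose l := (a + a) / N%:R.
have NE : N%:R = K%:R * T%:R :> R by rewrite natrM.
have lE : l / e = (2 * j%:R + 2^-1) / T%:R.
  by rewrite /l NE /a /d; field; rewrite !gt_eqF//; lra.
have l0 : 0 < l by rewrite divr_gt0 ?addr_gt0// ltr0n.
have lN : l * N%:R = a + a by rewrite divfK// pnatr_eq0 -lt0n.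
have mu := phase_measurable Hu. have mg := grad_measurable Hu.
pose F y := dens p m e (u y) (g y).
pose chi y : R := (0 < s * u y)%R%:R.
have msu : measurable_fun setT (fun y => s * u y) by exact: measurable_funM.
have mF : measurable_fun setT F by exact: measurable_dens.
have mchi : measurable_fun setT chi by exact: measurable_bool_gt.
have mW : measurable_fun setT W by exact: measurable_funD.
have F0 y : 0 <= F y by exact: dens_ge0.
have chi0 y : 0 <= chi y by [].
pose H := hcube (x - const_mx a) (a + a).
have mH : measurable H by exact: measurable_hcube.
have Ha : H `<=` cbox x a by exact: hcube_sub_cbox.
have aOm : cbox x a `<=` Om by apply: subset_trans bOm; apply: cbox_subset; exact: ltW.
have Hchi : (L1norm H chi <= (2 * C3 * (j.+1%:R / T%:R))%:E * L1norm H F)%E.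
  rewrite /H (L1norm_cells _ (addr_gt0 a0 a0) N0 mchi) (L1norm_cells _ (addr_gt0 a0 a0) N0 mF).
  rewrite ge0_sume_distrr; last by move=> z _; exact: L1norm_ge0.
  apply: lee_sum => z _.
  have zH : cell (x - const_mx a) (a + a) z `<=` H by apply: cell_subset => //; exact: addr_gt0.
  have mz : measurable (cell (x - const_mx a) (a + a) z) by exact: measurable_cell.
  apply: (@le_trans _ _ ((C3 * (l / e))%:E * L1norm (cell (x - const_mx a) (a + a) z) F)%E).
    apply: (HC3 e Om L u g e0 oOm Hu s hs _ _ l0).
      apply: subset_trans aOm => y Hy i; have := Hy i; rewrite !mxE -/l !ler_norml => /andP[h1 h2].
      have zN : (z i)%:R + 1 <= N%:R :> R by rewrite natr1 ler_nat.
      have lz : l * ((z i)%:R + 1) <= a + a by rewrite -lN ler_wpM2l// ltW.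
      have lz0 : 0 <= l * (z i)%:R by rewrite mulr_ge0// ltW.
      by rewrite mulrDr mulr1 in lz; apply/andP; split; lra.
    (* As [2 j + 1/2 >= j + 1], a cell has side at least [(j + 1) e / T]; so the smallness
       hypothesis, with its factor [1 / (2 (4/3)^m)], bounds the occupied volume by half of the
       cell. *)
    apply: (le_trans (L1norm_occupied p e hs m0 mz mu mg)).
    have zb : cell (x - const_mx a) (a + a) z `<=` cbox x b.
      by apply: subset_trans zH _; apply: subset_trans Ha _; apply: cbox_subset; exact: ltW.
    have A0 : 0 < (4 / 3) `^ m :> R by apply: powR_gt0; lra.
    apply: (@le_trans _ _ (((4 / 3) `^ m)%:E * ((j.+1%:R * e / T%:R) ^+ n / (2 * (4 / 3) `^ m))%:E)%E).
      apply: lee_wpmul2l; first by rewrite lee_fin ltW.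
      apply: le_trans small; exact: (L1norm_subset (measurable_cbox x b) mz mW zb).
    have EE (A Y : R) : 0 < A -> A * (Y / (2 * A)) = Y / 2 by move=> ?; field; rewrite gt_eqF.
    rewrite -EFinM lee_fin EE//.
    rewrite ler_pM2r ?invr_gt0// lerXn2r ?nnegrE ?(ltW l0)//.
      by rewrite mulr_ge0 ?invr_ge0 ?mulr_ge0 ?(ltW e0)//; lra.
    have -> : l = (2 * j%:R + 2^-1) * e / T%:R by rewrite mulrAC -lE divfK// gt_eqF.
    rewrite ler_pM2r ?invr_gt0; last by lra.
    by rewrite ler_pM2r// jS; lra.
  apply: lee_wpmul2r; first exact: L1norm_ge0.
  rewrite lee_fin lE (_ : C3 * _ = C3 * (2 * j%:R + 2^-1) / T%:R); last by ring.
  rewrite mulrA ler_pM2r ?invr_gt0; last by lra.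
  by rewrite jS; nra.
(* At least 1 since [T <= j], so that it also absorbs the energy term, which appears without this
   factor. *)
pose t : R := j.+1%:R / T%:R.
have t1 : 1 <= t by rewrite ler_pdivlMr ?mul1r ?ler_nat ?(leqW Tj)//; lra.
have Alow : (L1norm (cbox x (j%:R * d)) W <= ((1 + 2 * C3) * t)%:E * L1norm (cbox x a) F)%E.
  rewrite (L1normD_ge0 (measurable_cbox _ _) mF mchi F0 chi0).
  apply: (@le_trans _ _ (L1norm (cbox x a) F + (2 * C3 * t)%:E * L1norm (cbox x a) F)%E).
    apply: leeD; first exact: (L1norm_subset (measurable_cbox x a) (measurable_cbox x _) mF (cbox_subset (ltW jda))).
    apply: (@le_trans _ _ (L1norm H chi)).
      exact: (L1norm_subset mH (measurable_cbox x _) mchi (cbox_sub_hcube jda)).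
    apply: (le_trans Hchi); apply: lee_wpmul2l; first by rewrite lee_fin !mulr_ge0//; lra.
    exact: (L1norm_subset (measurable_cbox x a) mH mF Ha).
  rewrite -{1}[L1norm (cbox x a) F]mul1e -ge0_muleDl//; last first.
    by rewrite lee_fin !mulr_ge0//; lra.
  apply: lee_wpmul2r; first exact: L1norm_ge0.
  by rewrite -EFinD lee_fin mulrDl mul1r; lra.
pose S := cbox x b `\` cbox x a.
have mS : measurable S by apply: measurableD; exact: measurable_cbox.
pose S' := cbox x b `\` cbox x (j%:R * d).
have mS' : measurable S' by apply: measurableD; exact: measurable_cbox.
have SS' : S `<=` S'.
  by move=> y [yb ya]; split=> // yj; apply: ya; exact: (cbox_subset (ltW jda)).
pose ka := (e / (b - a)) `^ q.
have ka0 : 0 <= ka by exact: powR_ge0.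
pose X := (K%:R `^ (n%:R - q) * j.+1%:R ^+ n.-1 * e ^+ n).
have X0 : 0 <= X by rewrite !mulr_ge0 ?powR_ge0 ?exprn_ge0// ltW.
have W0 y : 0 <= W y := addr_ge0 (F0 y) (chi0 y).
have Sk : (L1norm S (fun y => W y + ka)%R <= L1norm S' W + (C5 * X)%:E)%E.
  rewrite (L1normD_ge0 mS mW (measurable_cst ka) W0) => [|y]; last exact: ka0.
  apply: leeD; first exact: (L1norm_subset mS' mS mW SS').
  apply: (@le_trans _ _ (ka%:E * leb R n S)%E).
    by apply: L1norm_bound => // y _; rewrite ger0_norm.
  apply: (@le_trans _ _ (ka%:E * ((b + b + d) ^+ n - (a + a) ^+ n)%:E)%E).
    by apply: lee_wpmul2l => //; apply: leb_shell => //; exact: ltW.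
  rewrite -EFinM lee_fin.
  have kaE : ka = (4 / 3) `^ q * K%:R `^ (- q).
    rewrite /ka (_ : e / (b - a) = 4 / 3 * K%:R `^ (-1)).
      by rewrite powRM ?powR_ge0// -powRrM mulN1r.
    by rewrite baE powR_inv1// /d; field; rewrite !gt_eqF//; lra.
  have Kn : K%:R `^ (n%:R - q) = K%:R `^ (- q) * K%:R ^+ n.
    rewrite powRD; first by rewrite powR_mulrn// mulrC.
    by apply/implyP => _; rewrite gt_eqF//; lra.
  apply: (@le_trans _ _ (ka * (n%:R * (3 * d) * (3 * (j.+1%:R * d)) ^+ n.-1))).
    apply: ler_wpM2l => //; apply: le_trans (exprB_le n _) _.
      by apply/andP; split; [apply: addr_ge0; exact: ltW|lra].
    apply: ler_pM; [|apply: exprn_ge0| |].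
    - by apply: mulr_ge0 => //; lra.
    - by lra.
    - by apply: ler_wpM2l => //; rewrite /b /a jS; lra.
    - by apply: lerXn2r; rewrite ?nnegrE; rewrite /b jS; nra.
  rewrite le_eqVlt; apply/orP; left; apply/eqP.
  rewrite /X Kn kaE /C5 /d; case: n n0 => // k _ /=.
  by rewrite !exprMn !exprS; ring.
apply: (le_trans Alow).
apply: (@le_trans _ _ (((1 + 2 * C3) * t)%:E * (C%:E * (L1norm S' W + (C5 * X)%:E)))%E).
  apply: lee_wpmul2l; first by rewrite lee_fin !mulr_ge0//; lra.
  apply: (le_trans (cacc s x a b hs a0 eba bOm)); apply: lee_wpmul2l; first by rewrite lee_fin ltW.
  exact: Sk.
have LS := L1norm_ge0 S' W.
apply: (@le_trans _ _ (((1 + 2 * C3) * t)%:E * (C%:E * ((1 + C5)%:E * (L1norm S' W + X%:E))))%E).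
  apply: lee_wpmul2l; first by rewrite lee_fin !mulr_ge0//; lra.
  apply: lee_wpmul2l; first by rewrite lee_fin ltW.
  rewrite ge0_muleDr//; apply: leeD.
    by rewrite -[leLHS]mul1e; apply: lee_wpmul2r => //; rewrite lee_fin lerDl.
  by rewrite -EFinM lee_fin; nra.
rewrite !muleA -!EFinM; apply: lee_wpmul2r; first by rewrite adde_ge0.
by rewrite lee_fin -/t le_eqVlt; apply/orP; left; apply/eqP; ring.
Qed.

End density_growth.

Section density_estimate.
Context (R : realType) (n : nat).
Implicit Types (D Om : set 'rV[R]_n) (u f : 'rV[R]_n -> R) (g : 'rV[R]_n -> 'rV[R]_n).

Lemma measurable_occupied (p m e s : R) u g : measurable_fun setT u ->
  (forall i, measurable_fun setT (fun x => g x ord0 i)) ->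
  measurable_fun setT (fun y => dens p m e (u y) (g y) + (0 < s * u y)%R%:R).
Proof.
move=> mu mg; apply: measurable_funD; first exact: measurable_dens.
by apply: measurable_bool_gt; exact: measurable_funM.
Qed.

(* The occupied energy A_j in the box of radius j K e dominates c0 (j e)^n: if
   this failed first at j + 1, the Caccioppoli and separation inequalities would
   give A_j <= C (j / T) (A_{j+1} - A_j + small), hence a contradiction. *)
Lemma density_growth (p m q C cT : R) : (0 < n)%N -> 1 <= p -> 0 <= m -> 0 < C -> n%:R < q -> 0 < cT ->
  exists T K : nat, exists c0 : R, [/\ (0 < T)%N, (1 < K)%N, 0 < c0 &
  forall (e L : R) Om u g, 0 < e -> open Om -> phase_field Om L u g ->
  caccioppoli_bound C q p m e Om u g ->
  forall (s : R) x, s = 1 \/ s = -1 -> 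
  ((cT * e ^+ n)%:E <= L1norm (cbox x e) (fun y => dens p m e (u y) (g y)))%E ->
  forall j, (T <= j)%N -> cbox x (j%:R * (K%:R * e)) `<=` Om ->
  ((c0 * (j%:R * e) ^+ n)%:E <= L1norm (cbox x (j%:R * (K%:R * e)))
     (fun y => dens p m e (u y) (g y) + (0 < s * u y)%R%:R)%R)%E].
Proof.
move=> n0 p1 m0 C0 qn cT0; have q0 : 0 <= q by apply: le_trans (ltW qn); exact: ler0n.
have [C1 C10 HC1] := density_step n0 p1 m0 C0 q0.
have B0 : 0 <= C1 * (n%:R + 1) * 2 ^+ n by rewrite !mulr_ge0 ?exprn_ge0// ?(ltW C10)// addr_ge0.
(* In [n + 1], the [n] comes from the increment of [j^n] and the 1 from the error term; [2^n] comes
   from [(j + 1)^n <= 2^n j^n]. *)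
pose T := (Num.bound (C1 * (n%:R + 1) * 2 ^+ n)).+1.
have HT : C1 * (n%:R + 1) * 2 ^+ n < T%:R.
  by rewrite (lt_trans (Num.Theory.archi_boundP B0))// ltr_nat.
have T0 : (0 < T)%N by [].
have T1 : 0 < T%:R :> R by rewrite ltr0n.
clearbody T.
pose A := 2 * (4 / 3) `^ m : R.
have A0 : 0 < A by rewrite mulr_gt0// powR_gt0; lra.
(* The first bound starts the induction at [j = T]; the second one makes a failure at [j + 1] imply
   the smallness hypothesis of [density_step]. *)
pose c0 := Num.min (cT / T%:R ^+ n) ((A * T%:R ^+ n)^-1).
have c00 : 0 < c0 by rewrite lt_min divr_gt0 ?exprn_gt0//= invr_gt0 mulr_gt0 ?exprn_gt0.
have c0T : c0 * T%:R ^+ n <= cT.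
  by rewrite -ler_pdivlMr ?exprn_gt0// /c0 ge_min lexx.
have c0A : c0 <= (A * T%:R ^+ n)^-1 by rewrite /c0 ge_min lexx orbT.
clearbody c0.
have r0 : 0 < q - n%:R by rewrite subr_gt0.
(* For [K >= z] one has [K^(n - q) <= c0]; this is where [q > n] is used. *)
pose z := c0^-1 `^ (q - n%:R)^-1.
pose K := (Num.bound z).+2.
have zK : z <= K%:R.
  by rewrite ltW// (lt_trans (Num.Theory.archi_boundP (powR_ge0 _ _)))// ltr_nat.
have K1 : (1 < K)%N by [].
clearbody K.
have K0 : 0 < K%:R :> R by rewrite ltr0n ltnW.
have Kc0 : K%:R `^ (n%:R - q) <= c0.
  rewrite -opprB powRN -[leRHS]invrK lef_pV2 ?posrE ?invr_gt0 ?powR_gt0//.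
  rewrite -[leLHS]powRr1 ?invr_ge0 ?(ltW c00)// -[X in _ `^ X](@mulVf _ (q - n%:R)) ?gt_eqF//.
  by rewrite powRrM; apply: powR_le; rewrite ?powR_ge0// ltW.
exists T, K, c0; split=> // e L Om u g e0 oOm Hu cacc s x hs init.
have mu := phase_measurable Hu. have mg := grad_measurable Hu.
pose W y := dens p m e (u y) (g y) + (0 < s * u y)%R%:R.
have mW : measurable_fun setT W by exact: measurable_occupied.
have mF : measurable_fun setT (fun y => dens p m e (u y) (g y)) by exact: measurable_dens.
have W0 y : 0 <= W y by rewrite addr_ge0 ?dens_ge0.
have d0 : 0 < K%:R * e by rewrite mulr_gt0.
pose d := K%:R * e.
elim=> [|j IH]; first by rewrite leqn0 => /eqP T00; rewrite T00 in T0.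
rewrite leq_eqVlt => /orP[/eqP <- _|].
  apply: (@le_trans _ _ (cT * e ^+ n)%:E).
    by rewrite lee_fin exprMn mulrA ler_wpM2r// exprn_ge0// ltW.
  apply: (le_trans init); apply: (@le_trans _ _ (L1norm (cbox x e) W)).
    apply: (L1norm_le (measurable_cbox x e) mF mW) => y _.
    by rewrite (ger0_norm (dens_ge0 _ _ _ _ _)) (ger0_norm (W0 y)) /W lerDl.
  apply: (L1norm_subset (measurable_cbox _ _) (measurable_cbox x e) mW); apply: cbox_subset.
  rewrite mulrA ler_peMl ?(ltW e0)// -natrM ler1n muln_gt0 T0 ltnW//.
rewrite ltnS => Tj jOm; have j0 : (0 < j)%N by exact: leq_trans T0 Tj.
have j1 : 1 <= j%:R :> R by rewrite ler1n.
have jS : j.+1%:R = j%:R + 1 :> R by rewrite natr1.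
have jjd : j%:R * d <= j.+1%:R * d by rewrite ler_pM2r// ler_nat.
have sub := cbox_subset (c := x) jjd.
have {}IH := IH Tj (subset_trans sub jOm).
rewrite leNgt; apply/negP => lt.
have small : (L1norm (cbox x (j.+1%:R * d)) W <= ((j.+1%:R * e / T%:R) ^+ n / A)%:E)%E.
  apply: (le_trans (ltW lt)); rewrite lee_fin.
  apply: (@le_trans _ _ ((A * T%:R ^+ n)^-1 * (j.+1%:R * e) ^+ n)).
    by rewrite ler_wpM2r// exprn_ge0// mulr_ge0// ltW.
  by rewrite le_eqVlt; apply/orP; left; apply/eqP; rewrite invfM expr_div_n; ring.
have := HC1 T K j T0 K1 j0 Tj e L Om u g e0 oOm Hu cacc s x hs jOm small.
have mS : measurable (cbox x (j.+1%:R * d) `\` cbox x (j%:R * d)).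
  by apply: measurableD; exact: measurable_cbox.
have E : (L1norm (cbox x (j.+1%:R * d)) W = L1norm (cbox x (j%:R * d)) W +
    L1norm (cbox x (j.+1%:R * d) `\` cbox x (j%:R * d)) W)%E.
  rewrite -{1}(setDUK sub) {1}/L1norm ge0_integral_setU//.
  - exact: measurable_cbox.
  - by apply: measurable_funTS; exact: measurable_norm_fin.
  - by apply/disj_setPS => y [h1 [_]]; exact.
move: lt; rewrite -/d -/(W) E.
move: (L1norm_ge0 (cbox x (j%:R * d)) W) (L1norm_ge0 (cbox x (j.+1%:R * d) `\` cbox x (j%:R * d)) W) IH.
rewrite -/d.
case: (L1norm (cbox x (j%:R * d)) W) => [al||]//; case: (L1norm (_ `\` _) W) => [si||]//.
rewrite -EFinD -!EFinM !lee_fin lte_fin => al0 si0 IH lt.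
move=> H.
have en0 : 0 < e ^+ n by exact: exprn_gt0.
pose J := j.+1%:R ^+ n.-1 : R.
have J0 : 0 < J by rewrite exprn_gt0// ltr0n.
have JE : j.+1%:R ^+ n = j.+1%:R * J by rewrite /J -exprS prednK.
have D1 : j.+1%:R ^+ n - j%:R ^+ n <= n%:R * J :> R.
  have := exprB_le n (x := j.+1%:R) (y := j%:R : R); rewrite ler0n ler_nat leqnSn => /(_ isT).
  by rewrite (_ : j.+1%:R - j%:R = 1 :> R) ?mulr1// jS addrAC subrr add0r.
have D2 : j.+1%:R ^+ n <= 2 ^+ n * j%:R ^+ n :> R.
  by rewrite -exprMn lerXn2r ?nnegrE// jS; lra.
rewrite !exprMn in IH lt.
(* The lower bound at [j] and its failure at [j + 1] leave to the shell only an increment of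
   [c0 (j e)^n]. *)
have S1 : si < c0 * (n%:R * J) * e ^+ n.
  apply: (@lt_le_trans _ _ (c0 * (j.+1%:R ^+ n - j%:R ^+ n) * e ^+ n)); first lra.
  by rewrite ler_pM2r// ler_pM2l.
have S2 : si + K%:R `^ (n%:R - q) * J * e ^+ n < c0 * (n%:R + 1) * J * e ^+ n.
  have : K%:R `^ (n%:R - q) * J * e ^+ n <= c0 * J * e ^+ n by rewrite !ler_pM2r.
  by lra.
have S3 : al < C1 * (j.+1%:R / T%:R) * (c0 * (n%:R + 1) * J * e ^+ n).
  by apply: (le_lt_trans H); rewrite ltr_pM2l// mulr_gt0// divr_gt0// ltr0n.
have S4 : C1 * (j.+1%:R / T%:R) * (c0 * (n%:R + 1) * J * e ^+ n) =
    c0 * (C1 * (n%:R + 1) / T%:R) * j.+1%:R ^+ n * e ^+ n by rewrite JE; ring.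
have S5 : c0 * (C1 * (n%:R + 1) / T%:R) * j.+1%:R ^+ n * e ^+ n <= c0 * (j%:R ^+ n * e ^+ n).
  rewrite [leRHS]mulrA ler_pM2r// -mulrA ler_pM2l//.
  apply: (@le_trans _ _ (C1 * (n%:R + 1) / T%:R * (2 ^+ n * j%:R ^+ n))).
    by rewrite ler_wpM2l// divr_ge0// mulr_ge0 ?(ltW C10)// addr_ge0.
  rewrite mulrA ler_piMl ?exprn_ge0// mulrAC ler_pdivrMr// mul1r; exact: ltW.
by move: S3 IH; rewrite S4 mulrA; lra.
Qed.

(** Apply the growth to the largest [j] with [j K e <= r]; then [j K e >= r / 2], so the occupied
    energy is at least [k]. The energy itself is at most [CE e <= k / 2], and the rest is the volume
    of the phase. *)
Lemma density_estimate (p m q C Lg Theta CE r : R) : (0 < n)%N -> 1 <= p -> 0 <= m -> 0 < C ->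
  n%:R < q -> 0 <= Lg -> 0 < Theta < 1 -> 0 <= CE -> 0 < r ->
  exists k e1 : R, [/\ 0 < k, 0 < e1 &
  forall (e : R) Om u g, 0 < e < e1 -> open Om -> phase_field Om (Lg / e) u g ->
  caccioppoli_bound C q p m e Om u g ->
  (L1norm Om (fun y => dens p m e (u y) (g y)) <= (CE * e)%:E)%E ->
  forall (s : R) x, s = 1 \/ s = -1 -> cbox x r `<=` Om -> `|u x| <= Theta ->
  (k%:E <= leb R n ([set y | (0 < s * u y)%R] `&` cbox x r))%E].
Proof.
move=> n0 p1 m0 C0 qn Lg0 T01 CE0 r0.
have [cT cT0 HcT] := initial_density n p Lg0 m0 T01.
have [T [K [c0 [T0 K1 c00 HG]]]] := density_growth n0 p1 m0 C0 qn cT0.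
have K0 : 0 < K%:R :> R by rewrite ltr0n ltnW.
have K1' : 1 <= K%:R :> R by rewrite ler1n ltnW.
pose k := c0 * (r / (2 * K%:R)) ^+ n.
have k0 : 0 < k by rewrite mulr_gt0// exprn_gt0// divr_gt0// mulr_gt0.
(* The first bound guarantees [j >= T], the second that the energy is at most [k / 2]. *)
pose e1 := Num.min (r / (2 * K%:R * T.+1%:R)) (k / (2 * (CE + 1))).
have TS : 1 <= T.+1%:R :> R by rewrite ler1n.
have e10 : 0 < e1 by rewrite lt_min !divr_gt0//= ?mulr_gt0//; lra.
exists (k / 2), e1; split=> //; first by rewrite divr_gt0.
move=> e Om u g /andP[e0 ee1] oOm Hu cacc HE s x hs rOm uT.
have eT : e * (2 * K%:R * T.+1%:R) < r.
  rewrite -ltr_pdivlMr; last by rewrite !mulr_gt0//; lra.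
  by apply: lt_le_trans ee1 _; rewrite ge_min lexx.
have ek : CE * e <= k / 2.
  have : e * (2 * (CE + 1)) < k.
    rewrite -ltr_pdivlMr; last by lra.
    by apply: lt_le_trans ee1 _; rewrite ge_min lexx orbT.
  by nra.
have d0 : 0 < K%:R * e by rewrite mulr_gt0.
pose j := Num.truncn (r / (K%:R * e)).
have /andP[j1 j2] : j%:R <= r / (K%:R * e) < j.+1%:R.
  by apply: Num.Theory.truncn_itv; rewrite divr_ge0 ?ltW.
rewrite ler_pdivlMr// in j1; rewrite ltr_pdivrMr// in j2.
have jS : j.+1%:R = j%:R + 1 :> R by rewrite natr1.
have Ke : K%:R * e * 2 <= r.
  apply: le_trans (ltW eT); rewrite (_ : e * _ = K%:R * e * 2 * T.+1%:R); last by ring.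
  by rewrite ler_peMr// mulr_ge0// ltW.
have Tj : (T <= j)%N.
  rewrite -ltnS -(ltr_nat R) -(ltr_pM2r d0); apply: le_lt_trans j2.
  apply: le_trans (ltW eT); rewrite (_ : e * _ = 2 * (T.+1%:R * (K%:R * e))); last by ring.
  have : T%:R <= T.+1%:R :> R by rewrite ler_nat.
  by rewrite -(ler_pM2r d0); nra.
have jr : r / 2 <= j%:R * (K%:R * e) by rewrite jS mulrDl mul1r in j2; lra.
have mu := phase_measurable Hu. have mg := grad_measurable Hu.
have mF : measurable_fun setT (fun y => dens p m e (u y) (g y)) by exact: measurable_dens.
have mchi : measurable_fun setT (fun y => (0 < s * u y)%R%:R : R).
  by apply: measurable_bool_gt; exact: measurable_funM.
have eeOm : cbox x (e + e) `<=` Om.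
  by apply: subset_trans rOm; apply: cbox_subset; nra.
have sub : cbox x (j%:R * (K%:R * e)) `<=` cbox x r by exact: cbox_subset.
have subOm := subset_trans sub rOm.
have := HG e _ Om u g e0 oOm Hu cacc s x hs (HcT e Om u g x e0 oOm Hu eeOm uT) j Tj subOm.
rewrite (L1normD_ge0 (measurable_cbox _ _) mF mchi (fun y => dens_ge0 _ _ _ _ _)) => [H|y]; last by [].
have {}H : (k%:E <= (CE * e)%:E + leb R n ([set y | (0 < s * u y)%R] `&` cbox x r))%E.
  apply: (@le_trans _ _ (c0 * (j%:R * e) ^+ n)%:E).
    rewrite lee_fin ler_pM2l// lerXn2r ?nnegrE//.
    - by rewrite divr_ge0 ?mulr_ge0// ltW.
    - by rewrite mulr_ge0// ltW.
    - by rewrite ler_pdivrMr ?mulr_gt0//; lra.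
  apply: (le_trans H); apply: leeD.
    apply: le_trans HE; apply: L1norm_subset => //; [exact: open_measurable_rV|exact: measurable_cbox].
  rewrite -L1norm_bool_gt; [|exact: measurable_cbox|exact: measurable_funM].
  by apply: L1norm_subset => //; exact: measurable_cbox.
move: H; case: (leb R n _) (measure_ge0 (leb R n) ([set y | (0 < s * u y)%R] `&` cbox x r)) => [v||]//.
  by rewrite -EFinD !lee_fin => _; lra.
by move=> _ _; exact: leey.
Qed.

End density_estimate.

(** * Compactness *)

Section cell_minority.
Context (R : realType) (n : nat).
Implicit Types (D Om K : set 'rV[R]_n) (u v f : 'rV[R]_n -> R) (g : 'rV[R]_n -> 'rV[R]_n).

Definition phase_ind u (y : 'rV[R]_n) : R := (0 < u y)%R%:R.

Lemma measurable_phase_ind u : measurable_fun setT u -> measurable_fun setT (phase_ind u).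
Proof. exact: measurable_bool_gt. Qed.

Lemma phase_ind01 u y : 0 <= phase_ind u y <= 1.
Proof. by rewrite /phase_ind; case: (0 < u y); rewrite /= ?lexx ler01. Qed.

(** Separation bounds the volume of [u > 0] or that of [u <= - 1/2]; the values between [- 1/2] and
    0 are paid for by the energy, whence the summand 1 in [l / e + 1]. Whichever of the two
    complementary volumes is bounded, the smaller one is bounded too. *)
Lemma cell_minority (p m : R) : 1 <= p -> 0 <= m ->
  exists2 C : R, 0 < C & forall e Om L u g, 0 < e -> open Om -> phase_field Om L u g ->
  forall (c : 'rV[R]_n) (l : R), 0 < l -> cbox (c + const_mx (l / 2)) (l / 2) `<=` Om ->
  let Z := ((C * (l / e + 1))%:E * L1norm (hcube c l) (fun y => dens p m e (u y) (g y)))%E in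
  ((L1norm (hcube c l) (phase_ind u) <= (l ^+ n / 2)%:E)%E ->
    (L1norm (hcube c l) (phase_ind u) <= Z)%E) /\
  (~~ (L1norm (hcube c l) (phase_ind u) <= (l ^+ n / 2)%:E)%E ->
    (L1norm (hcube c l) (fun y => 1 - phase_ind u y)%R <= Z)%E).
Proof.
move=> p1 m0; have [C C0 HC] := separation_alt n p1 m0.
have A0 : 0 < (4 / 3) `^ m :> R by rewrite powR_gt0; lra.
exists (C + (4 / 3) `^ m); first by rewrite addr_gt0.
move=> e Om L u g e0 oOm Hu c l l0 cOm; set Q := hcube c l => Z.
have mu := phase_measurable Hu.
have mQ : measurable Q by exact: measurable_hcube.
have mF : measurable_fun setT (fun y => dens p m e (u y) (g y)).
  by apply: measurable_dens => //; exact: grad_measurable Hu.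
have ma := measurable_phase_ind mu.
have mb : measurable_fun setT (fun y => 1 - phase_ind u y) by exact: measurable_funB.
have le0 : 0 < l / e by rewrite divr_gt0.
pose X := ((C * (l / e))%:E * L1norm Q (fun y => dens p m e (u y) (g y)))%E.
pose Y := (((4 / 3) `^ m)%:E * L1norm Q (fun y => dens p m e (u y) (g y)))%E.
have F0 := L1norm_ge0 Q (fun y => dens p m e (u y) (g y)).
have XY : (X + Y <= Z)%E.
  rewrite /X /Y -ge0_muleDl ?lee_fin ?(ltW A0)//; last by rewrite mulr_ge0// ltW.
  by apply: lee_wpmul2r => //; rewrite -EFinD lee_fin; nra.
have Y0 : (0 <= Y)%E by rewrite mule_ge0// lee_fin ltW.
have XZ : (X <= Z)%E by apply: le_trans XY; rewrite leeDl.
pose V' := leb R n ([set x | (u x <= - 2^-1)%R] `&` Q).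
have mV : measurable [set x | u x <= - 2^-1].
  rewrite (_ : [set x | _] = ~` [set x | - 2^-1 < u x]).
    by apply: measurableC; exact: measurable_gt.
  by apply/seteqP; split=> y /=; [move=> h /lt_geF; rewrite h|move/negP; rewrite -leNgt].
have bV : (L1norm Q (fun y => 1 - phase_ind u y)%R <= V' + Y)%E.
  rewrite /V' -(L1norm_indic mQ mV) /Y -{1}(ger0_norm (ltW A0)) -(L1normZ _ mQ mF).
  have mi : measurable_fun setT (\1_[set x | u x <= - 2^-1] : 'rV[R]_n -> R) by exact: measurable_indic.
  have mz : measurable_fun setT (fun y => (4 / 3) `^ m * dens p m e (u y) (g y)) by exact: measurable_funM.
  have z0 y : 0 <= (4 / 3) `^ m * dens p m e (u y) (g y) by rewrite mulr_ge0 ?dens_ge0// ltW.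
  have i0 y : 0 <= \1_[set x | u x <= - 2^-1] y :> R by rewrite indicE.
  rewrite -(L1normD_ge0 mQ mi mz i0 z0); apply: L1norm_le => //; first exact: measurable_funD.
  move=> y _; have /andP[h0 h1] := phase_ind01 u y.
  rewrite ger0_norm ?subr_ge0// ger0_norm ?addr_ge0//.
  have [uy|uy] := leP (u y) (- 2^-1).
    by rewrite indicE mem_set//=; have := z0 y; lra.
  rewrite /phase_ind; have [uy0|uy0] := ltP 0 (u y); first by rewrite subrr addr_ge0.
  rewrite subr0; apply: (@le_trans _ _ ((4 / 3) `^ m * dens p m e (u y) (g y))); last by rewrite lerDr.
  by apply: dens_half => //; rewrite ler_norml; apply/andP; split; lra.
have S : (L1norm Q (phase_ind u) + L1norm Q (fun y => 1 - phase_ind u y)%R = (l ^+ n)%:E)%E.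
  rewrite -(L1normD_ge0 mQ ma mb) => [|y|y]; last 2 first.
  - by have /andP[] := phase_ind01 u y.
  - by have /andP[] := phase_ind01 u y; rewrite subr_ge0.
  rewrite (_ : (fun _ => _) = cst 1); last by apply/funext => y; rewrite addrC subrK.
  rewrite /L1norm (eq_integral (cst 1%:E)); last by move=> y _; rewrite normr1.
  by rewrite integral_cst// mul1e [LHS](leb_hcube c (ltW l0)).
have bf : (L1norm Q (fun y => 1 - phase_ind u y)%R \is a fin_num)%E.
  rewrite ge0_fin_numE ?L1norm_ge0// (@le_lt_trans _ _ (l ^+ n)%:E) ?ltry//.
  by rewrite -S leeDr ?L1norm_ge0.
have af : (L1norm Q (phase_ind u) \is a fin_num)%E.
  rewrite ge0_fin_numE ?L1norm_ge0// (@le_lt_trans _ _ (l ^+ n)%:E) ?ltry//.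
  by rewrite -S leeDl ?L1norm_ge0.
have [half half'] : ((L1norm Q (phase_ind u) <= (l ^+ n / 2)%:E)%E ->
    (L1norm Q (phase_ind u) <= L1norm Q (fun y => 1 - phase_ind u y)%R)%E) /\
  (~~ (L1norm Q (phase_ind u) <= (l ^+ n / 2)%:E)%E ->
    (L1norm Q (fun y => 1 - phase_ind u y)%R <= L1norm Q (phase_ind u))%E).
  move: S; rewrite -(fineK bf) -(fineK af) -EFinD => -[] S.
  by rewrite -ltNge !lee_fin lte_fin; split=> h; lra.
have [H|H] : (L1norm Q (phase_ind u) <= Z)%E \/ (L1norm Q (fun y => 1 - phase_ind u y)%R <= Z)%E.
- have [H|H] := HC e Om L u g e0 oOm Hu 1 (or_introl erefl) c l l0 cOm.
    left; apply: le_trans XZ; apply: le_trans H; rewrite L1norm_bool_gt//.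
    by under [X in (_ <= leb R n (X `&` _))%E]eq_set do rewrite mul1r.
  right; apply: (le_trans bV); apply: le_trans XY; apply: leeD => //.
  by apply: le_trans H; under [X in (_ <= leb R n (X `&` _))%E]eq_set do rewrite mul1r.
- by split=> [//|h]; exact: le_trans (half' h) H.
- by split=> [h|//]; exact: le_trans (half h) H.
Qed.

Definition inner_cell Om (c0 : 'rV[R]_n) (l0 : R) N (z : {ffun 'I_n -> 'I_N}) :=
  cbox (cell_corner c0 l0 z + const_mx (l0 / N%:R / 2)) (l0 / N%:R / 2) `<=` Om.

(** True when the positive phase is the minority of the cell, ties included. *)
Definition phase_bit u (c0 : 'rV[R]_n) (l0 : R) N (z : {ffun 'I_n -> 'I_N}) : bool :=
  (L1norm (cell c0 l0 z) (phase_ind u) <= ((l0 / N%:R) ^+ n / 2)%:E)%E.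

(** In a cell with equal bits both indicators are close to the same constant, 0 or 1. Summed over
    the cells, the error [C (l / e + 1)] times the energy [CE e] is [C CE (l + e)], with no negative
    power of [e] left. *)
Lemma same_bits (p m CE : R) : 1 <= p -> 0 <= m -> 0 <= CE ->
  exists2 C : R, 0 < C & forall (e e' L L' : R) Om u g v h c0 l0 N K,
  0 < e -> 0 < e' -> open Om -> phase_field Om L u g -> phase_field Om L' v h ->
  (L1norm Om (fun y => dens p m e (u y) (g y)) <= (CE * e)%:E)%E ->
  (L1norm Om (fun y => dens p m e' (v y) (h y)) <= (CE * e')%:E)%E ->
  0 < l0 -> (0 < N)%N -> Om `<=` hcube c0 l0 -> measurable K -> K `<=` Om ->
  (forall (z : {ffun 'I_n -> 'I_N}) x, cell c0 l0 z x -> K x -> inner_cell Om c0 l0 z) ->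
  (forall z : {ffun 'I_n -> 'I_N}, phase_bit u c0 l0 z = phase_bit v c0 l0 z) ->
  (L1norm K (fun y => phase_ind u y - phase_ind v y)%R <= (C * (l0 / N%:R + e + e'))%:E)%E.
Proof.
move=> p1 m0 CE0; have [C C0 HC] := cell_minority p1 m0.
exists (2 * C * CE + 1); first by rewrite ltr_wpDl// !mulr_ge0// ltW.
move=> e e' L L' Om u g v h c0 l0 N K e0 e'0 oOm Hu Hv Eu Ev l00 N0 OmQ mK KOm inn bits.
have mOm : measurable Om by exact: open_measurable_rV.
have N0' : 0 < N%:R :> R by rewrite ltr0n.
pose l := l0 / N%:R; have lp : 0 < l by rewrite divr_gt0.
have mu := measurable_phase_ind (phase_measurable Hu).
have mv := measurable_phase_ind (phase_measurable Hv).
pose d y := phase_ind u y - phase_ind v y.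
have md : measurable_fun setT d by exact: measurable_funB.
have mFu : measurable_fun setT (fun y => dens p m e (u y) (g y)).
  by apply: measurable_dens => //; [exact: phase_measurable Hu|exact: grad_measurable Hu].
have mFv : measurable_fun setT (fun y => dens p m e' (v y) (h y)).
  by apply: measurable_dens => //; [exact: phase_measurable Hv|exact: grad_measurable Hv].
(* The sum runs over all the cells of a cube larger than [Om], but the energy is controlled in [Om]
   only. *)
pose Fu y := dens p m e (u y) (g y) * \1_Om y.
pose Fv y := dens p m e' (v y) (h y) * \1_Om y.
have mi : measurable_fun setT (\1_Om : 'rV[R]_n -> R) by exact: measurable_indic.
have mFu' : measurable_fun setT Fu by exact: measurable_funM.
have mFv' : measurable_fun setT Fv by exact: measurable_funM.
have mik : measurable_fun setT (\1_K : 'rV[R]_n -> R) by exact: measurable_indic.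
have mdk : measurable_fun setT (fun y => d y * \1_K y) by exact: measurable_funM.
have mQ : measurable (hcube c0 l0) by exact: measurable_hcube.
have cellZ (z : {ffun 'I_n -> 'I_N}) : (L1norm (cell c0 l0 z) (fun y => d y * \1_K y)%R <=
    (C * (l / e + 1))%:E * L1norm (cell c0 l0 z) Fu + (C * (l / e' + 1))%:E * L1norm (cell c0 l0 z) Fv)%E.
  have mz : measurable (cell c0 l0 z) by exact: measurable_cell.
  have a0 (a : R) : 0 < a -> (0 <= (C * (l / a + 1))%:E)%E.
    by move=> ap; rewrite lee_fin mulr_ge0 ?addr_ge0 ?divr_ge0// ltW.
  have [[x [zx Kx]]|nK] := pselect (exists x, cell c0 l0 z x /\ K x); last first.
    rewrite [X in (X <= _)%E](_ : _ = 0%E).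
      by rewrite adde_ge0// mule_ge0 ?a0 ?L1norm_ge0.
    rewrite /L1norm integral0_eq// => y zy; rewrite indicE memNset ?mulr0 ?normr0// => Ky.
    by apply: nK; exists y.
  have zOm := inn z x zx Kx.
  have cOm : cell c0 l0 z `<=` Om.
    apply: subset_trans zOm => y Hy i; have := Hy i; rewrite !mxE ler_norml => /andP[h1 h2].
    by apply/andP; split; lra.
  have Eq (F : 'rV[R]_n -> R) : L1norm (cell c0 l0 z) (fun y => F y * \1_Om y) = L1norm (cell c0 l0 z) F.
    by apply: eq_integral => y /set_mem /cOm yOm; rewrite indicE mem_set// mulr1.
  rewrite !Eq; apply: (@le_trans _ _ (L1norm (cell c0 l0 z) d)).
    apply: L1norm_le => // y _; rewrite normrM ler_piMr// indicE.
    by case: (y \in K); rewrite ?normr1 ?normr0 ?ler01.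
  have [Hu1 Hu2] := HC e Om L u g e0 oOm Hu _ _ lp zOm.
  have [Hv1 Hv2] := HC e' Om L' v h e'0 oOm Hv _ _ lp zOm.
  have bz := bits z; rewrite /phase_bit -/l /cell -/l in bz.
  case: (boolP (L1norm (hcube (cell_corner c0 l0 z) l) (phase_ind v) <= (l ^+ n / 2)%:E)%E) => bv.
    have H1 := Hv1 bv; have H2 := Hu1 (etrans bz bv).
    apply: le_trans (leeD H2 H1).
    have := @L1norm_triangle _ _ (hcube (cell_corner c0 l0 z) l) (phase_ind u) (fun y => - 1 * phase_ind v y) (measurable_hcube _ _) mu (measurable_funM (measurable_cst _) mv).
    rewrite (L1normZ _ (measurable_hcube _ _) mv) normrN normr1 mul1e.
    by under [X in L1norm _ X]eq_fun do rewrite mulN1r.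
  have H1 := Hv2 bv; have H2 := Hu2 (eq_ind_r (fun b : bool => ~~ b) bv bz).
  rewrite addeC; apply: le_trans (leeD H1 H2).
  have m1u : measurable_fun setT (fun y => 1 - phase_ind u y) by exact: measurable_funB.
  have m1v : measurable_fun setT (fun y => 1 - phase_ind v y) by exact: measurable_funB.
  have := @L1norm_triangle _ _ (hcube (cell_corner c0 l0 z) l) (fun y => 1 - phase_ind v y) (fun y => - 1 * (1 - phase_ind u y)) (measurable_hcube _ _) m1v (measurable_funM (measurable_cst _) m1u).
  rewrite (L1normZ _ (measurable_hcube _ _) m1u) normrN normr1 mul1e.
  rewrite (_ : (fun y => _ + _) = d)//; apply/funext => y; rewrite /d; ring.
rewrite -(L1norm_mul_indic d mK).
have -> : L1norm setT (fun y => d y * \1_K y) = L1norm (hcube c0 l0) (fun y => d y * \1_K y).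
  rewrite -[RHS]L1norm_mul_indic//; apply: eq_integral => y _.
  rewrite !indicE; case: (boolP (y \in K)) => [/set_mem /KOm /OmQ yQ|_]; last by rewrite !mulr0 mul0r.
  by rewrite [y \in hcube _ _]mem_set// !mulr1.
have EQ (F : 'rV[R]_n -> R) : measurable_fun setT F ->
    (L1norm (hcube c0 l0) (fun y => F y * \1_Om y)%R <= L1norm Om F)%E.
  by move=> mF; rewrite -(L1norm_mul_indic F mOm); apply: L1norm_subset => //; exact: measurable_funM.
rewrite (L1norm_cells _ l00 N0 mdk).
apply: le_trans (lee_sum _ (fun z _ => cellZ z)) _.
rewrite big_split /= -!ge0_sume_distrr; [|by move=> z _; exact: L1norm_ge0|by move=> z _; exact: L1norm_ge0].
rewrite -(L1norm_cells _ l00 N0 mFu') -(L1norm_cells _ l00 N0 mFv').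
have B (a : R) (F : 'rV[R]_n -> R) : 0 < a -> measurable_fun setT F -> (L1norm Om F <= (CE * a)%:E)%E ->
    ((C * (l / a + 1))%:E * L1norm (hcube c0 l0) (fun y => F y * \1_Om y)%R <= (C * CE * (l + a))%:E)%E.
  move=> ap mF EF; apply: (@le_trans _ _ ((C * (l / a + 1))%:E * (CE * a)%:E)%E).
    apply: lee_wpmul2l; last exact: le_trans (EQ _ mF) EF.
    by rewrite lee_fin mulr_ge0 ?addr_ge0 ?divr_ge0// ltW.
  rewrite -EFinM lee_fin le_eqVlt; apply/orP; left; apply/eqP; field; exact/lt0r_neq0.
apply: le_trans (leeD (B e _ e0 mFu Eu) (B e' _ e'0 mFv Ev)) _.
rewrite -EFinD lee_fin -/l.
have CC : 0 <= C * CE by rewrite mulr_ge0// ltW.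
by nra.
Qed.

End cell_minority.

Section compactness.
Context (R : realType) (n : nat).
Implicit Types (D Om K : set 'rV[R]_n) (f : 'rV[R]_n -> R).

Lemma compact_margin K D : compact K -> open D -> K `<=` D ->
  exists2 d : R, 0 < d & forall x, K x -> cbox x d `<=` D.
Proof.
move=> cK oD KD.
have H : \forall d \near (0 : R)^'+, K `<=` (fun x => cbox x d `<=` D).
  move/compact_near_coveringP : cK; apply => x Kx.
  have /rV_nbhsP[e e0 eD] : nbhs x D by move: oD; rewrite openE; apply; exact: KD.
  have e2 : 0 < e / 2 by rewrite divr_gt0.
  exists ([set y : 'rV[R]_n | forall i, `|y ord0 i - x ord0 i| < e / 2], [set d : R | d < e / 2]).
    split; first by apply/rV_nbhsP; exists (e / 2).
    exact: nbhs_right_lt.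
  move=> [x' d] /= [Hx' Hd] y Hy; apply: eD => i.
  have := ler_normD (y ord0 i - x' ord0 i) (x' ord0 i - x ord0 i).
  by rewrite addrA subrK; have := Hx' i; have := Hy i; lra.
have [d [/= d0 Hd]] := filter_ex (filterI (nbhs_right_gt (0 : R)) H).
by exists d.
Qed.

Lemma leb_geometric K (D : nat -> set 'rV[R]_n) (c : R) : measurable K ->
  (forall k, measurable (D k)) -> 0 <= c ->
  (forall k, leb R n (K `&` D k) <= (c / 2 ^+ k)%:E)%E ->
  (leb R n (K `&` \bigcup_k D k) <= (2 * c)%:E)%E.
Proof.
move=> mK mD c0 HD.
have mKD k : measurable (K `&` D k) by exact: measurableI.
have := @measure_sigma_subadditive _ _ _ (leb R n) (K `&` \bigcup_k D k) _ mKD.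
have mb : measurable (K `&` \bigcup_k D k) by apply: measurableI => //; exact: bigcupT_measurable.
have sub : K `&` \bigcup_k D k `<=` \bigcup_k (K `&` D k) by move=> x [Kx [k _ Dx]]; exists k.
move=> /(_ mb sub) /le_trans; apply.
apply: lime_le; first by apply: is_cvg_nneseries => k _ _; exact: measure_ge0.
apply: nearW => N; apply: (@le_trans _ _ (\sum_(0 <= k < N) (c / 2 ^+ k)%:E)%E).
  by apply: lee_sum => k _; exact: HD.
rewrite sumEFin lee_fin.
have -> : \sum_(0 <= k < N) c / 2 ^+ k = 2 * c - 2 * c / 2 ^+ N.
  elim: N => [|N IH]; first by rewrite big_nil expr0 divr1 subrr.
  rewrite big_nat_recr//= IH exprS; field; exact/lt0r_neq0/exprn_gt0.
by rewrite gerBl divr_ge0 ?exprn_ge0// mulr_ge0.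
Qed.

Variables (Om : set 'rV[R]_n) (p m CE Lg : R) (e : nat -> R).
Variables (u : nat -> 'rV[R]_n -> R) (g : nat -> 'rV[R]_n -> 'rV[R]_n).
Hypotheses (oOm : open Om) (bOm : bounded_set Om) (p1 : 1 <= p) (m0 : 0 <= m) (CE0 : 0 <= CE).
Hypotheses (e0 : forall k, 0 < e k) (ecvg : forall d : R, 0 < d -> \forall k \near \oo, e k <= d).
Hypothesis Hu : forall k, phase_field Om (Lg / e k) (u k) (g k).
Hypothesis Eu : forall k,
  (L1norm Om (fun y => dens p m (e k) (u k y) (g k y)) <= (CE * e k)%:E)%E.

(** An ultrafilter finer than [\oo] assigns a limit value to every bit at once, replacing a diagonal
    extraction. Finitely many bits and one smallness condition hold simultaneously on a set of the
    ultrafilter, which contains arbitrarily large indices. *)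
Lemma subsequence_bits (bit : forall k N, {ffun 'I_n -> 'I_N} -> bool) :
  exists phi : nat -> nat, [/\ {homo phi : i j / (i < j)%N},
    forall i, e (phi i) <= 2 ^- i &
    forall i z, bit (phi i) (2 ^ i)%N z = bit (phi i.+1) (2 ^ i)%N z].
Proof.
have [U [UU sU]] := ultraFilterLemma (@eventually_filter).
have PU : ProperFilter U by exact: ultra_proper.
pose b N (z : {ffun 'I_n -> 'I_N}) := `[< U [set k | bit k N z] >].
have Ub N z : U [set k | bit k N z = b N z].
  rewrite /b; case: asboolP => H; first by apply: filterS H => k /= ->.
  have [//|H'] := in_ultra_setVsetC [set k | bit k N z] UU.
  by apply: filterS H' => k /= /negP /negbTE.
(* Limit values are required at the previous scale too, because [phi i] and [phi i.+1] are to be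
   compared at scale [2 ^ i]. *)
pose P i k := [/\ e k <= 2 ^- i, forall z, bit k (2 ^ i)%N z = b (2 ^ i)%N z &
  forall z, bit k (2 ^ i.-1)%N z = b (2 ^ i.-1)%N z].
have UP i : U [set k | P i k].
  have U1 : U [set k | e k <= 2 ^- i] by apply: sU; apply: ecvg; rewrite invr_gt0 exprn_gt0.
  have U2 N : U [set k | forall z, bit k N z = b N z] by apply: filter_forall => z; exact: Ub.
  by apply: filterS3 U1 (U2 (2 ^ i)%N) (U2 (2 ^ i.-1)%N) => k h1 h2 h3.
have ex i N : exists k, (N < k)%N /\ P i k.
  have UN : U [set k | (N < k)%N] by apply: sU; exists N.+1.
  by have [k [h1 h2]] := filter_ex (filterI UN (UP i)); exists k.
have /choice[f Hf] : forall a : nat * nat, exists k, (a.2 < k)%N /\ P a.1 k by case=> i N; exact: ex.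
pose phi := fix phi i := if i is j.+1 then f (i, phi j) else f (0%N, 0%N).
have phiP i : P i (phi i) by case: i => [|i]; [have [] := Hf (0%N, 0%N)|have [] := Hf (i.+1, phi i)].
exists phi; split=> [|i|i z].
- apply: homo_ltn => [|i]; first exact: ltn_trans.
  by have [] := Hf (i.+1, phi i).
- by have [] := phiP i.
- by have [_ -> _] := phiP i; have [_ _ ->] := phiP i.+1.
Qed.

(** Consecutive phases differ on [K] in measure by a constant times [2 ^- i]. The union of the
    differences from rank [i] on is thus small, and off this union the phase is constant from rank
    [i] on, so it agrees with [E1]. *)
Lemma phase_compactness : exists (E1 : set 'rV[R]_n) (phi : nat -> nat),
  [/\ measurable E1, {homo phi : i j / (i < j)%N} &
   forall K, compact K -> K `<=` Om -> forall d : R, 0 < d -> exists N, forall i, (N <= i)%N ->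
   (L1norm K (fun y => phase_ind (u (phi i)) y - \1_E1 y)%R <= d%:E)%E].
Proof.
have [c0 [l0 [l00 OmQ]]] : exists (c0 : 'rV[R]_n) (l0 : R), 0 < l0 /\ Om `<=` hcube c0 l0.
  have [M [_ HM]] := bOm; pose N := `|M| + 1.
  have N0 : 0 <= N by rewrite addr_ge0.
  exists (const_mx (- N)), (N *+ 2 + 1); split; first by rewrite mulr2n; lra.
  move=> x Dx; apply: norm_hcube => //; apply: HM => //.
  by rewrite (le_lt_trans (ler_norm M))// ltrDl.
have [phi [phiI phie phib]] := subsequence_bits (fun k N z => phase_bit (u k) c0 l0 z).
have [C C0 HC] := same_bits n p1 m0 CE0.
pose a i := phase_ind (u (phi i)).
have mu i := measurable_phase_ind (phase_measurable (Hu (phi i))).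
pose B i := [set x | 0 < u (phi i) x].
have mB i : measurable (B i) by apply: measurable_gt; exact: phase_measurable (Hu (phi i)).
(* The lower limit of the positive phases; it does not depend on the compact set [K]. *)
pose E1 := \bigcup_j \bigcap_(i in [set i | (j <= i)%N]) B i.
have mE1 : measurable E1.
  apply: bigcupT_measurable => j; apply: bigcap_measurable; first by exists j => /=.
  by move=> i _; exact: mB.
exists E1, phi; split=> // K cK KOm d d0.
have mK : measurable K by apply: closed_measurable_rV; apply: compact_closed => //; exact: norm_hausdorff.
have [r r0 rK] := compact_margin cK oOm KOm.
(* At rank [j] the cell size is [l0 / 2^j], and the two values of [e] are at most [2 ^- j] each. *)
pose c := C * (l0 + 2).
have c0' : 0 < c by rewrite mulr_gt0// addr_gt0.
have tends (t : R) : 0 < t -> exists N, forall i, (N <= i)%N -> t / 2 ^+ i <= Num.min r (d / 2).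
  move=> t0; set mm := Num.min _ _; have mm0 : 0 < mm by rewrite lt_min r0 divr_gt0.
  exists (Num.bound (t / mm)) => i Ni; rewrite ler_pdivrMr ?exprn_gt0// mulrC -ler_pdivrMr//.
  have /Num.Theory.archi_boundP h : 0 <= t / mm by rewrite divr_ge0// ltW.
  apply: (le_trans (ltW h)); rewrite -natrX ler_nat (leq_trans Ni)// ltnW// ltn_expl//.
have [j0 Hj0] := tends l0 l00; have [j1 Hj1] := tends c c0'.
exists (maxn j0 j1) => i; rewrite geq_max => /andP[ji0 ji1].
pose D k := (B (i + k)%N `\` B (i + k).+1) `|` (B (i + k).+1 `\` B (i + k)%N).
have mD k : measurable (D k) by apply: measurableU; exact: measurableD.
have DE k x : (x \in D k) = (a (i + k)%N x != a (i + k).+1 x).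
  apply/idP/idP; rewrite inE /D /B /a /phase_ind /=.
    by move=> [[-> /negP/negbTE ->]|[-> /negP/negbTE ->]] /=; rewrite ?oner_eq0// eq_sym oner_eq0.
  by case: (0 < _); case: (0 < _); rewrite /= ?eqxx// => _; [left|right].
have diff k : (leb R n (K `&` D k) <= ((c / 2 ^+ i) / 2 ^+ k)%:E)%E.
  have -> : leb R n (K `&` D k) = L1norm K (fun y => a (i + k)%N y - a (i + k).+1 y).
    rewrite setIC -L1norm_indic//; apply: eq_integral => y _.
    rewrite indicE DE /a /phase_ind.
    by case: (0 < _); case: (0 < _); rewrite /= ?mulr1n ?mulr0n ?subrr ?subr0 ?sub0r ?eqxx ?oner_eq0 ?normrN ?normr1 ?normr0// eq_sym oner_eq0 normr1.
  pose j := (i + k)%N.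
  have inn (z : {ffun 'I_n -> 'I_(2 ^ j)}) x : cell c0 l0 z x -> K x -> inner_cell Om c0 l0 z.
    move=> zx Kx; apply: subset_trans (rK x Kx) => y Hy h; have := Hy h; have := zx h; rewrite !mxE.
    have : l0 / (2 ^ j)%:R <= r.
      by rewrite natrX; apply: le_trans (Hj0 j _) _; [exact: leq_trans (leq_addr _ _)|rewrite ge_min lexx].
    rewrite !ler_norml => ? /andP[? ?] /andP[? ?]; apply/andP; split; lra.
  have := HC _ _ _ _ Om _ _ _ _ c0 l0 (2 ^ j)%N K (e0 _) (e0 _) oOm (Hu (phi j)) (Hu (phi j.+1)) (Eu _) (Eu _)
    l00 _ OmQ mK KOm inn (phib j); rewrite expn_gt0/= => /(_ isT) /le_trans; apply.
  rewrite lee_fin natrX -mulrA -invfM -exprD -/j.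
  have h1 := phie j; have h2 := phie j.+1.
  have h3 : 2 ^- j.+1 <= 2 ^- j :> R by rewrite lef_pV2 ?posrE ?exprn_gt0// ler_eXn2l// ltr1n.
  rewrite /c -mulrA ler_pM2l// mulrDl; lra.
have c2 : 0 <= c / 2 ^+ i by rewrite divr_ge0 ?exprn_ge0// ltW.
apply: (@le_trans _ _ (leb R n (K `&` \bigcup_k D k))); last first.
  apply: (le_trans (leb_geometric mK mD c2 diff)).
  rewrite lee_fin; have := Hj1 i ji1; rewrite le_min => /andP[_]; lra.
have mU : measurable (\bigcup_k D k) by exact: bigcupT_measurable.
rewrite setIC -L1norm_indic//; apply: L1norm_le => //.
  by apply: measurable_funB; [exact: mu|exact: measurable_indic].
move=> x Kx; rewrite !indicE.
have [xD|nD] := boolP (x \in \bigcup_k D k).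
  have /andP[h0 h1] := phase_ind01 (u (phi i)) x; rewrite normr1 ler_norml.
  by case: (x \in E1) => /=; apply/andP; split; lra.
have st k : a (i + k)%N x = a i x.
  elim: k => [|k IH]; first by rewrite addn0.
  rewrite -IH addnS; apply/esym/eqP; apply: contraNT nD => h; rewrite inE; exists k => //.
  by move: h; rewrite -DE inE.
rewrite -/(a i x); have -> : a i x = (x \in E1)%:R; last by rewrite subrr normr0.
congr (_%:R); congr nat_of_bool; apply/idP/idP.
  move=> ux; rewrite inE; exists i => // j /= ij.
  by have := st (j - i)%N; rewrite subnKC// /a /phase_ind ux => /eqP; rewrite eqr_nat /B /=; case: (0 < _).
rewrite inE => -[j _ Hj].
have /Hj : (j <= i + j)%N by rewrite leq_addl.
have := st j; rewrite /a /phase_ind /B /= => + h; rewrite h => /eqP; rewrite eqr_nat.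
by case: (0 < _).
Qed.

End compactness.

(** * From the hypotheses to phase fields *)

Section reduction.
Context (R : realType) (n : nat).
Implicit Types (D Om K : set 'rV[R]_n) (u f : 'rV[R]_n -> R) (g du : 'rV[R]_n -> 'rV[R]_n).

(** Needed to read the norm of exponent [+oo] as an essential supremum. *)
Lemma leb_setT_gt0 : (0 < leb R n setT)%E.
Proof.
apply: (@lt_le_trans _ _ (leb R n (hcube 0 1))); first by rewrite leb_hcube// expr1n lte_fin.
by apply: le_measure; rewrite ?inE//; exact: measurable_hcube.
Qed.

Lemma Lp_norm_oo_ae D f (S : R) : (Lp_norm D +oo%E f <= S%:E)%E ->
  {ae leb R n, forall x, D x -> `|f x| <= S}.
Proof.
rewrite /Lp_norm unlock leb_setT_gt0 => /ess_supP; apply: filterS => x + Dx.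
by rewrite /= patchE mem_set// lee_fin.
Qed.

Lemma restrict_in D f x : D x -> (f \_ D) x = f x.
Proof. by move=> Dx; rewrite patchE mem_set. Qed.

Lemma restrict_out D f x : ~ D x -> (f \_ D) x = 0.
Proof. by move=> Dx; rewrite patchE memNset. Qed.

Lemma Rint_restrict D f h : (forall x, D x -> f x = h x) -> (forall x, ~ D x -> h x = 0) ->
  \int[leb R n]_x h x = fine (\int[leb R n]_(x in D) (f x)%:E)%E.
Proof.
move=> fh h0; rewrite /Rintegral [in RHS]integral_mkcond; congr fine; apply: eq_integral => x _.
rewrite patchE; case: (boolP (x \in D)) => [/set_mem Dx|/negP xD]; first by rewrite fh.
by rewrite h0// => Dx; apply: xD; exact: mem_set.
Qed.

(** Extend [u] and its gradient by 0 outside [Om], and set to 0 every component of the gradient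
    where it exceeds [S]; in [Om] the latter happens on a null set only. *)
Lemma W1oo_phase_field Om u du (S : R) : open Om -> 0 <= S -> W1p Om +oo%E u du ->
  {within Om, continuous u} -> (forall x, Om x -> -1 <= u x <= 1) ->
  (Lp_norm Om +oo%E (fun x => enorm (du x)) <= S%:E)%E ->
  exists u' g, [/\ phase_field Om S u' g, forall x, Om x -> u x = u' x &
    forall i, {ae leb R n, forall x, Om x -> du x ord0 i = g x ord0 i}].
Proof.
move=> oOm S0 [_ Wdu Ww] cu ub HS; have mOm : measurable Om by exact: open_measurable_rV.
have uc x : Om x -> {for x, continuous u}.
  by rewrite continuous_open_subspace// in cu => Ox; apply: cu; exact: mem_set.
have mu : measurable_fun Om u by exact: continuous_measurable_rV.
pose w i := (fun x => du x ord0 i) \_ Om.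
have mw i : measurable_fun setT (w i) by apply/(measurable_restrictT _ mOm); have [] := Wdu i.
pose gi i x := w i x * \1_[set x | `|w i x| <= S] x.
have mle i : measurable [set x | `|w i x| <= S].
  rewrite (_ : [set x | _] = ~` [set x | S < `|w i x|]).
    apply: measurableC; apply: measurable_gt.
    exact: (measurableT_comp (@normr_measurable R setT) (mw i)).
  by apply/seteqP; split=> y /=; [move=> h /lt_geF; rewrite h|move/negP; rewrite -leNgt].
have mg i : measurable_fun setT (gi i).
  by apply: measurable_funM; [exact: mw|apply: measurable_indic; exact: mle].
have gE i x : (\row_i gi i x) ord0 i = gi i x by rewrite mxE.
have ae i : {ae leb R n, forall x, Om x -> du x ord0 i = gi i x}.
  apply: filterS (Lp_norm_oo_ae HS) => x H Ox.
  rewrite /gi indicE mem_set ?mulr1; first by rewrite /w restrict_in.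
  rewrite /= /w restrict_in//; apply: le_trans (enorm_coord _ _) _.
  by apply: le_trans (H Ox); exact: ler_norm.
exists (u \_ Om), (fun x => \row_i gi i x); split; last 2 first.
- by move=> x Ox; rewrite restrict_in.
- by move=> i; apply: filterS (ae i) => x H Ox; rewrite gE H.
split.
- by apply/(measurable_restrictT _ mOm).
- move=> x; have [Ox|Ox] := pselect (Om x); last by rewrite restrict_out// normr0.
  by rewrite restrict_in// ler_norml; exact: ub.
- move=> x Ox; have nOm : \forall y \near x, Om y by move: oOm; rewrite openE; apply.
  have H : \forall y \near x, u y = (u \_ Om) y by apply: filterS nOm => y Oy; rewrite restrict_in.
  move=> A; rewrite restrict_in// => /(uc x Ox) Ax.
  by apply: filterS2 H Ax => y /= <-.
- move=> i; have -> : (fun x => (\row_i gi i x) ord0 i) = gi i by apply/funext => x; exact: gE.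
  exact: mg.
- move=> x i; rewrite gE /gi indicE; case: (boolP (x \in _)) => [/set_mem h|_].
    by rewrite mulr1.
  by rewrite mulr0 normr0.
- move=> i f tf; have f0 := compactly_contained_zero tf.2.
  have df0 := compactly_contained_zero (test_pderiv i tf).2.
  rewrite (@Rint_restrict Om (fun x => u x * pderiv i f x)); last 2 first.
  + by move=> x Ox; rewrite restrict_in.
  + by move=> x /df0 ->; rewrite mulr0.
  rewrite (@Rint_restrict Om (fun x => gi i x * f x)); last 2 first.
  + by move=> x Ox; rewrite gE.
  + by move=> x /f0 ->; rewrite mulr0.
  rewrite (Ww i f tf) fineN; congr (- fine _).
  have mf : measurable_fun setT f by exact: bms_measurable (test_bms tf).
  have m1 : measurable_fun Om (fun x => (du x ord0 i * f x)%:E).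
    apply/measurable_EFinP; apply: measurable_funM; first by have [] := Wdu i.
    exact: measurable_funTS.
  have m2 : measurable_fun Om (fun x => (gi i x * f x)%:E).
    by apply/measurable_EFinP; apply: measurable_funTS; exact: measurable_funM.
  apply: (ae_eq_integral _ _ mOm m1 m2).
  by apply: filterS (ae i) => x H Ox; rewrite (H Ox).
Qed.

Lemma energy_dens (p m lam : R) (E : 'rV[R]_n -> R -> 'rV[R]_n -> R) (e S : R) Om u du u' g :
  0 < lam -> 0 < e -> measurable Om ->
  (forall (x : 'rV[R]_n) (tau : R) (xi : 'rV[R]_n),
     lam * (enorm xi `^ p + `|1 - tau ^+ 2| `^ m) <= E x tau xi) ->
  measurable_fun Om u -> (forall i, measurable_fun Om (fun x => du x ord0 i)) ->
  measurable_fun setT u' -> (forall i, measurable_fun setT (fun x => g x ord0 i)) ->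
  (forall x, Om x -> u x = u' x) ->
  (forall i, {ae leb R n, forall x, Om x -> du x ord0 i = g x ord0 i}) ->
  (energy E e Om u du <= S%:E)%E ->
  (L1norm Om (fun y => dens p m e (u' y) (g y)) <= (S / lam * e)%:E)%E.
Proof.
move=> lam0 e0 mOm E_bnd mu mdu mu' mg uu' dug HS.
have dugA : {ae leb R n, forall y, Om y -> du y = g y}.
  apply: filterS (filter_forall _ dug) => y H Dy; apply/rowP => i; exact: H.
have mF : measurable_fun setT (fun y => dens p m e (u' y) (g y)) by exact: measurable_dens.
have H1 : (lam%:E * L1norm Om (fun y => dens p m e (u' y) (g y)) <=
    \int[leb R n]_(y in Om) (E y (u y) (e *: du y))%:E)%E.
  rewrite /L1norm -ge0_integralZl//; last 2 first.
  - by apply: measurable_funTS; exact: measurable_norm_fin.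
  - by rewrite lee_fin ltW.
  have -> : (\int[leb R n]_(y in Om) (lam%:E * `|dens p m e (u' y) (g y)|%:E))%E =
      (\int[leb R n]_(y in Om) (lam * dens p m e (u y) (du y))%:E)%E.
    apply: (ae_eq_integral _ _ mOm).
    - by apply/measurable_EFinP; apply: measurable_funM => //; apply: measurable_funTS; exact: measurableT_comp.
    - by apply/measurable_EFinP; apply: measurable_funM => //; exact: measurable_dens.
    - by apply: filterS dugA => y H Dy; rewrite (H Dy) (uu' _ Dy) (ger0_norm (dens_ge0 _ _ _ _ _)) EFinM.
  apply: ge0_le_integral_nonmeasurable => y _; first by rewrite lee_fin mulr_ge0 ?dens_ge0// ltW.
  by rewrite lee_fin; exact: E_bnd.
have lf : 0 < e^-1 by rewrite invr_gt0.
rewrite -(@lee_pmul2l _ lam%:E)// ?lte_fin//; apply: (le_trans H1).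
rewrite -(@lee_pmul2l _ (e^-1)%:E)// ?lte_fin//; apply: (le_trans HS).
by rewrite -!EFinM lee_fin le_eqVlt; apply/orP; left; apply/eqP; field; rewrite !gt_eqF.
Qed.

(** Where [|1 - u^2|] exceeds [t] it is at most [t^(1 - m)] times its power [m], hence controlled by
    the energy; elsewhere it is at most [t], and [Om] has finite measure. *)
Lemma phase_defect (p m CE : R) Om (d : R) : 1 < m -> 0 <= CE -> measurable Om -> bounded_set Om -> 0 < d ->
  exists2 e1 : R, 0 < e1 & forall e u g, e <= e1 -> measurable_fun setT u ->
  (forall i, measurable_fun setT (fun x => g x ord0 i)) ->
  (L1norm Om (fun y => dens p m e (u y) (g y)) <= (CE * e)%:E)%E ->
  (L1norm Om (fun y => 1 - u y ^+ 2)%R <= d%:E)%E.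
Proof.
move=> m1 CE0 mOm bOm d0; have Vf := bounded_leb_fin mOm bOm.
have Vn : (leb R n Om \is a fin_num)%E by rewrite ge0_fin_numE.
pose V := fine (leb R n Om); have V0 : 0 <= V by exact: fine_ge0.
pose t := d / (2 * (V + 1)).
have t0 : 0 < t by rewrite divr_gt0// mulr_gt0//; lra.
have T0 : 0 < t `^ (m - 1) by exact: powR_gt0.
exists (t `^ (m - 1) * d / (2 * (CE + 1))); first by rewrite divr_gt0 ?mulr_gt0//; lra.
move=> e u g ee mu mg HE.
have mF : measurable_fun setT (fun y => dens p m e (u y) (g y)) by exact: measurable_dens.
have mw : measurable_fun setT (fun y => 1 - u y ^+ 2).
  by apply: measurable_funB => //; exact: measurable_funX.
have mF' : measurable_fun setT (fun y => (t `^ (m - 1))^-1 * dens p m e (u y) (g y)) by exact: measurable_funM.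
have F0 y : 0 <= (t `^ (m - 1))^-1 * dens p m e (u y) (g y) by rewrite mulr_ge0 ?invr_ge0 ?powR_ge0 ?dens_ge0.
apply: (@le_trans _ _ (L1norm Om (fun y => t + (t `^ (m - 1))^-1 * dens p m e (u y) (g y))%R)).
  apply: L1norm_le => //; first exact: measurable_funD.
  move=> y _; rewrite [leRHS]ger0_norm; last by rewrite addr_ge0// ltW.
  set v := `|1 - u y ^+ 2|; have v0 : 0 <= v by rewrite normr_ge0.
  have [vt|tv] := leP v t; first by rewrite ler_wpDr.
  apply: (@le_trans _ _ ((t `^ (m - 1))^-1 * v `^ m)).
    rewrite -ler_pdivrMl ?invr_gt0// invrK -(mulr_powRB1 v0); last by lra.
    by rewrite mulrC ler_wpM2l//; apply: powR_le; lra.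
  rewrite ler_wpDl ?(ltW t0)// ler_pM2l ?invr_gt0// /dens lerDr powR_ge0//.
rewrite (L1normD_ge0 mOm (measurable_cst t) mF') => [|y|//]; last exact: ltW.
apply: (@le_trans _ _ ((t * V)%:E + ((t `^ (m - 1))^-1 * (CE * e))%:E)%E).
  apply: leeD.
    rewrite EFinM /V fineK//; apply: L1norm_bound => //; first exact: ltW.
    by move=> y _; rewrite gtr0_norm.
  rewrite L1normZ// ger0_norm ?invr_ge0 ?powR_ge0// EFinM; apply: lee_wpmul2l => //.
  by rewrite lee_fin invr_ge0 powR_ge0.
rewrite -EFinD lee_fin.
have A : t * V <= d / 2.
  have -> : d / 2 = t * (V + 1) by rewrite /t; field; lra.
  by rewrite ler_pM2l//; lra.
have B : (t `^ (m - 1))^-1 * (CE * e) <= d / 2.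
  rewrite ler_pdivrMl//; apply: (@le_trans _ _ (CE * (t `^ (m - 1) * d / (2 * (CE + 1))))).
    by rewrite ler_wpM2l.
  rewrite (_ : CE * _ = t `^ (m - 1) * (d / 2) * (CE / (CE + 1))); last by field; lra.
  by rewrite ler_piMr ?mulr_ge0 ?divr_ge0 ?(ltW d0) ?powR_ge0// ler_pdivrMr; lra.
lra.
Qed.

End reduction.

(** * Normalised representative and conclusion *)

Section normalization.
Context (R : realType) (n : nat).
Implicit Types (x y : 'rV[R]_n) (A B D Om K X Y Z : set 'rV[R]_n).

Lemma obox_eball x (r : R) : 0 < r -> obox x (r / n.+1%:R) `<=` eball x r.
Proof.
move=> r0 y Hy; apply: le_lt_trans (enorm_le_sum _) _.
apply: (@le_lt_trans _ _ (\sum_(i < n) r / n.+1%:R)).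
  by apply: ler_sum => i _; rewrite !mxE ltW.
by rewrite sumr_const card_ord -[X in X < _]mulr_natl mulrA ltr_pdivrMr ?ltr0n// mulrC ltr_pM2l// ltr_nat ltnSn.
Qed.

Lemma eball_obox x (r : R) : eball x r `<=` obox x r.
Proof. by move=> y Hy i; have := enorm_coord (y - x) i; rewrite !mxE => /le_lt_trans; exact. Qed.

Lemma measurable_obox x (r : R) : measurable (obox x r).
Proof. by apply: open_measurable_rV; exact: open_obox. Qed.

Lemma measurable_eball x (r : R) : measurable (eball x r).
Proof.
have mf : measurable_fun setT (fun y : 'rV[R]_n => - enorm (y - x)).
  apply: measurableT_comp => //.
  apply: (@measurableT_comp _ _ _ _ _ _ (@Num.sqrt R)).
    by apply: continuous_measurable_fun; exact: sqrt_continuous.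
  apply: measurable_sum => i; apply: measurable_funX.
  rewrite (_ : (fun y => _) = (fun y => y ord0 i - x ord0 i)); last by apply/funext => y; rewrite !mxE.
  by apply: measurable_funB => //; exact: measurable_coor.
rewrite (_ : eball x r = [set y | - r < - enorm (y - x)]); first exact: measurable_gt.
by apply/seteqP; split=> y; rewrite /eball /= ltrN2.
Qed.

Lemma leb_obox_gt0 x (r : R) : 0 < r -> (0 < leb R n (obox x r))%E.
Proof.
move=> r0; apply: (@lt_le_trans _ _ (leb R n (hcube x (r / 2)))).
  by rewrite leb_hcube ?divr_ge0 ?(ltW r0)// lte_fin exprn_gt0// divr_gt0.
apply: le_measure; rewrite ?inE; [exact: measurable_hcube|exact: measurable_obox|].
by move=> y Hy i; have /andP[h1 h2] := Hy i; rewrite ltr_norml; apply/andP; split; lra.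
Qed.

Lemma leb_null_le X Y Z : measurable X -> measurable Y -> measurable Z ->
  X `<=` Y `|` Z -> leb R n Z = 0%E -> (leb R n X <= leb R n Y)%E.
Proof.
move=> mX mY mZ XYZ Z0; apply: (@le_trans _ _ (leb R n (Y `|` Z))).
  by apply: le_measure; rewrite ?inE//; exact: measurableU.
by apply: le_trans (measureU2 _ mY mZ) _; rewrite [X in (_ + X)%E]Z0 adde0.
Qed.

Lemma leb_sub_null X Y : measurable X -> measurable Y -> X `<=` Y -> leb R n Y = 0%E -> leb R n X = 0%E.
Proof.
move=> mX mY XY Y0; apply/eqP; rewrite -measure_le0 -Y0.
by apply: le_measure; rewrite ?inE.
Qed.

(** The complement in [Om] of the essential support of [A]. *)
Definition null_points Om A := [set x | Om x /\ exists2 r : R, 0 < r & leb R n (obox x r `&` A) = 0%E].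

Lemma open_null_points Om A : open Om -> measurable A -> open (null_points Om A).
Proof.
move=> oOm mA; rewrite openE => x [Ox [r r0 Hr]].
have n1 : nbhs x Om by move: oOm; rewrite openE; apply.
have n2 : nbhs x [set y | forall i, `|y ord0 i - x ord0 i| < r / 2].
  by apply/rV_nbhsP; exists (r / 2); rewrite ?divr_gt0.
apply: filterS (filterI n1 n2) => y [Oy Hy]; split=> //; exists (r / 2); first by rewrite divr_gt0.
apply: leb_sub_null Hr; try by apply: measurableI => //; exact: measurable_obox.
move=> z [Hz Az]; split=> // i.
have := ler_normD (z ord0 i - y ord0 i) (y ord0 i - x ord0 i); rewrite addrA subrK.
by have := Hz i; have := Hy i; lra.
Qed.

(** A Lindelof argument: every such point lies in a dyadic cube in which [A] is null, and the dyadic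
    cubes are countably many. *)
Lemma leb_null_points Om A : open Om -> measurable A -> leb R n (null_points Om A `&` A) = 0%E.
Proof.
move=> oOm mA; pose T : countType := (nat * {ffun 'I_n -> int})%type.
pose Q (t : T) : set 'rV[R]_n := hcube (\row_i ((t.2 i)%:~R / 2 ^+ t.1)) (2 ^- t.1).
pose F k := if unpickle k is Some t then if leb R n (Q t `&` A) == 0%E then Q t `&` A else set0 else set0.
have mQ t : measurable (Q t) by exact: measurable_hcube.
have mF k : measurable (F k).
  rewrite /F; case: unpickle => [t|]; last exact: measurable0.
  by case: ifPn => _; [exact: measurableI|exact: measurable0].
have F0 k : leb R n (F k) = 0%E.
  rewrite /F; case: unpickle => [t|]; last exact: measure0.
  by case: ifPn => [/eqP//|_]; exact: measure0.
have mN : measurable (null_points Om A `&` A).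
  by apply: measurableI => //; apply: open_measurable_rV; exact: open_null_points.
have := @measure_sigma_subadditive _ _ _ (leb R n) (null_points Om A `&` A) _ mF mN.
suff sub : null_points Om A `&` A `<=` \bigcup_k F k.
  move=> /(_ sub) H; apply/eqP; rewrite -measure_le0; apply: (le_trans H).
  by rewrite eseries0// => k _ _; exact: F0.
move=> x [[_ [r r0 Hr]] Ax].
have [N HN] : exists N : nat, 2 ^- N < r.
  have /Num.Theory.archi_boundP h : 0 <= r^-1 by rewrite invr_ge0 ltW.
  exists (Num.bound r^-1); rewrite -[ltRHS]invrK ltf_pV2 ?posrE ?exprn_gt0 ?invr_gt0//.
  by apply: (lt_trans h); rewrite -natrX ltr_nat ltn_expl.
have p0 : 0 < 2 ^+ N :> R by rewrite exprn_gt0.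
pose t : T := (N, [ffun i => Num.floor (x ord0 i * 2 ^+ N)]).
have xQ : Q t x.
  move=> i; rewrite mxE ffunE /=.
  have /andP[h1 h2] := Num.Theory.floor_itv (x ord0 i * 2 ^+ N).
  rewrite ler_pdivrMr// h1/=; move: h2; rewrite intrD -ltr_pdivlMr// mulrDl mul1r; exact.
have Qr : Q t `<=` obox x r.
  move=> y Hy i; have := Hy i; have := xQ i; rewrite !mxE ffunE /= => /andP[h1 h2] /andP[h3 h4].
  by rewrite ltr_norml; apply/andP; split; lra.
have Q0 : leb R n (Q t `&` A) = 0%E.
  apply: leb_sub_null Hr; [exact: measurableI|by apply: measurableI => //; exact: measurable_obox|].
  by move=> y [/Qr].
by exists (pickle t) => //; rewrite /F pickleK Q0 eqxx.
Qed.

Section representative.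
Variables (Om E1 : set 'rV[R]_n).
Hypotheses (oOm : open Om) (mE1 : measurable E1).

Let N1 := null_points Om (~` E1).
Let N0 := null_points Om E1.
(** The points around which [E1] has full measure are added and those around which it is null are
    removed. Both changes are null, and in [Om] only essential boundary points remain in the
    topological boundary. *)
Definition representative := ((E1 `|` N1) `\` N0) `&` Om.
Local Notation E0 := representative.

Let mOm : measurable Om. Proof. exact: open_measurable_rV. Qed.
Let oN1 : open N1. Proof. by apply: open_null_points => //; exact: measurableC. Qed.
Let oN0 : open N0. Proof. exact: open_null_points. Qed.
Let mN1 : measurable N1. Proof. exact: open_measurable_rV. Qed.
Let mN0 : measurable N0. Proof. exact: open_measurable_rV. Qed.

Lemma measurable_representative : measurable E0.
Proof. by apply: measurableI => //; apply: measurableD => //; exact: measurableU. Qed.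

Let z1 : leb R n (N1 `&` ~` E1) = 0%E.
Proof. by apply: leb_null_points => //; exact: measurableC. Qed.
Let z0 : leb R n (N0 `&` E1) = 0%E. Proof. exact: leb_null_points. Qed.

Let mz1 : measurable (N1 `&` ~` E1). Proof. by apply: measurableI => //; exact: measurableC. Qed.
Let mz0 : measurable (N0 `&` E1). Proof. exact: measurableI. Qed.

Lemma leb_representative B : measurable B -> B `<=` Om -> leb R n (E0 `&` B) = leb R n (E1 `&` B).
Proof.
move=> mB BOm; have mE0B : measurable (E0 `&` B) by apply: measurableI => //; exact: measurable_representative.
have mE1B : measurable (E1 `&` B) by exact: measurableI.
apply/eqP; rewrite eq_le; apply/andP; split.
  apply: (leb_null_le mE0B mE1B mz1) => // x [[[Ex Nx] Ox] Bx].
  by have [E|E] := pselect (E1 x); [left|right; split=> //; case: Ex].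
apply: (leb_null_le mE1B mE0B mz0) => // x [Ex Bx].
have [N|N] := pselect (N0 x); [by right|left; split=> //; split; [split=> //; by left|exact: BOm]].
Qed.

Lemma leb_representativeC B : measurable B -> B `<=` Om -> leb R n (~` E0 `&` B) = leb R n (~` E1 `&` B).
Proof.
move=> mB BOm; have mE0 := measurable_representative.
have mE0B : measurable (~` E0 `&` B) by apply: measurableI => //; exact: measurableC.
have mE1B : measurable (~` E1 `&` B) by apply: measurableI => //; exact: measurableC.
apply/eqP; rewrite eq_le; apply/andP; split.
  apply: (leb_null_le mE0B mE1B mz0) => // x [Ex Bx].
  have [E|E] := pselect (E1 x); [right; split=> //|by left].
  by apply: contrapT => N; apply: Ex; split; [split=> //; left|exact: BOm].
apply: (leb_null_le mE1B mE0B mz1) => // x [Ex Bx].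
have [N|N] := pselect (N1 x); [by right|left; split=> // -[[[//|//] _] _]].
Qed.

Lemma null_points_disjoint x : N1 x -> ~ N0 x.
Proof.
move=> [_ [r r0 Hr]] [_ [r' r'0 Hr']].
pose s := Num.min r r'.
have s0 : 0 < s by rewrite lt_min r0.
have : (0 < leb R n (obox x s))%E by exact: leb_obox_gt0.
have mo q := measurable_obox x q.
have sub q : s <= q -> obox x s `<=` obox x q by move=> sq y Hy i; exact: lt_le_trans (Hy i) sq.
have d1 : leb R n (obox x s `\` E1) = 0%E.
  apply: leb_sub_null Hr.
  - exact: measurableD.
  - by apply: measurableI => //; exact: measurableC.
  - by move=> y [/(sub r) h1 h2]; split=> //; apply: h1; rewrite ge_min lexx.
have d2 : leb R n (obox x s `&` E1) = 0%E.
  apply: leb_sub_null Hr'; [exact: measurableI|exact: measurableI|].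
  by move=> y [/(sub r') h1 h2]; split=> //; apply: h1; rewrite ge_min lexx orbT.
by rewrite (measureDI _ (mo s) mE1) [X in (X + _)%E]d1 [X in (_ + X)%E]d2 adde0 ltxx.
Qed.

(** [N1] is an open part of [E0] and [N0] an open part of its complement. Off both, every small box
    meets [E0] and its complement in positive measure. *)
Lemma boundary_representative x : Om x -> boundary E0 x <-> ~ N1 x /\ ~ N0 x.
Proof.
move=> Ox; have nOm : nbhs x Om by move: oOm; rewrite openE; apply.
have mE0 := measurable_representative.
have fit (A : set 'rV[R]_n) : nbhs x A -> exists2 r : R, 0 < r & obox x r `<=` A `&` Om.
  by move=> nA; have /rV_nbhsP[r r0 H] : nbhs x (A `&` Om) by [exact: filterI]; exists r.
have pos (A : set 'rV[R]_n) r : measurable A -> ~ (leb R n (A `&` obox x r) = 0%E) -> exists y, A y /\ obox x r y.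
  move=> mA H; apply: contrapT => H'; apply: H; rewrite (_ : _ `&` _ = set0) ?measure0//.
  by apply/seteqP; split=> // y h; apply: H'; exists y.
split=> [[cl ni]|[n1 n0]].
  split=> [N|N].
    apply: ni; have : nbhs x N1 by move: oN1; rewrite openE; apply.
    apply: filterS => y Ny; split; last by case: Ny.
    by split; [right|exact: null_points_disjoint].
  have : nbhs x N0 by move: oN0; rewrite openE; apply.
  by move=> /cl [y [[[_ h] _] Ny]].
split=> [A /fit[r r0 H]|/fit[r r0 H]].
  have [|y [E0y oy]] := pos E0 r mE0; last by exists y; split=> //; have [] := H y oy.
  rewrite leb_representative; [|exact: measurable_obox|by move=> y /H []].
  by move=> h; apply: n0; split=> //; exists r; rewrite // setIC.
have [|y [E0y oy]] := pos (~` E0) r (measurableC mE0); last by apply: E0y; have [] := H y oy.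
rewrite leb_representativeC; [|exact: measurable_obox|by move=> y /H []].
by move=> h; apply: n1; split=> //; exists r; rewrite // setIC.
Qed.

(** The criterion for the boundary is in terms of boxes and passes to balls by inclusion. As balls
    have finite measure, a complement of positive measure amounts to the strict inequality of the
    definition. *)
Lemma representative_normalized : normalized_in Om E0.
Proof.
move=> x Ox; rewrite boundary_representative//.
have mE0 := measurable_representative.
have nOm : nbhs x Om by move: oOm; rewrite openE; apply.
have /rV_nbhsP[d d0 Hd] := nOm.
have bf r : (leb R n (eball x r) < +oo)%E.
  apply: bounded_leb_fin; first exact: measurable_eball.
  by apply: bounded_setS (@cbox_bounded _ _ x r) => y /eball_obox /obox_cbox.
have me := measurable_eball x. have mo := measurable_obox x.
have split r : leb R n (eball x r) = (leb R n (~` E0 `&` eball x r) + leb R n (E0 `&` eball x r))%E.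
  by rewrite (measureDI _ (me r) mE0) setDE setIC [X in (_ + leb R n X)%E]setIC.
split=> [[n1 n0] r r0|H].
  pose s := Num.min d (r / n.+1%:R).
  have s0 : 0 < s by rewrite lt_min d0 divr_gt0.
  have sOm : obox x s `<=` Om.
    by move=> y Hy; apply: Hd => i; apply: lt_le_trans (Hy i) _; rewrite ge_min lexx.
  have sr : obox x s `<=` eball x r.
    move=> y Hy; apply: (obox_eball r0) => i.
    by apply: lt_le_trans (Hy i) _; rewrite ge_min lexx orbT.
  have pos A : measurable A -> ~ (leb R n (A `&` obox x s) = 0%E) -> (0 < leb R n (A `&` eball x r))%E.
    move=> mA H; apply: (@lt_le_trans _ _ (leb R n (A `&` obox x s))).
      by rewrite lt0e measure_ge0 andbT; apply/eqP.
    apply: le_measure; rewrite ?inE; [exact: measurableI|exact: measurableI|].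
    by move=> y [Ay /sr].
  have p0 : (0 < leb R n (E0 `&` eball x r))%E.
    apply: pos => //; rewrite leb_representative// => h; apply: n0; split=> //.
    by exists s; rewrite // setIC.
  have p1 : (0 < leb R n (~` E0 `&` eball x r))%E.
    apply: pos; first exact: measurableC.
    rewrite leb_representativeC// => h; apply: n1; split=> //.
    by exists s; rewrite // setIC.
  rewrite p0/=; have := bf r; rewrite split.
  move: p0 p1; case: (leb R n (E0 `&` _)) => [a||]//; case: (leb R n (~` E0 `&` _)) => [b||]//.
  by rewrite -EFinD !lte_fin => *; lra.
have small r : 0 < r -> exists2 t : R, 0 < t & eball x t `<=` obox x r `&` Om.
  move=> r0; exists (Num.min d r); first by rewrite lt_min d0.
  move=> y /eball_obox Hy; split=> [i|].
    by apply: lt_le_trans (Hy i) _; rewrite ge_min lexx orbT.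
  by apply: Hd => i; apply: lt_le_trans (Hy i) _; rewrite ge_min lexx.
split=> -[_ [r r0 Hr]]; have [t t0 tr] := small r r0; have /andP[h1 h2] := H t t0.
  have : leb R n (~` E0 `&` eball x t) = 0%E.
    rewrite leb_representativeC//; last by move=> y /tr [].
    apply: leb_sub_null Hr; try by apply: measurableI => //; exact: measurableC.
    by move=> y [Ey /tr [? _]].
  by move=> e0; move: h2; rewrite split e0 add0e ltxx.
have : leb R n (E0 `&` eball x t) = 0%E.
  rewrite leb_representative//; last by move=> y /tr [].
  apply: leb_sub_null Hr; try exact: measurableI.
  by move=> y [Ey /tr [? _]].
by move=> e0; move: h1; rewrite e0 ltxx.
Qed.

(** Every point of [K] belongs to [N1] or [N0] and has its own radius; compactness makes the radius
    uniform. *)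
Lemma clear_radius K : compact K -> K `<=` Om -> (forall x, K x -> ~ boundary E0 x) ->
  exists2 r : R, 0 < r & forall x, K x ->
    leb R n (E1 `&` cbox x r) = 0%E \/ leb R n (~` E1 `&` cbox x r) = 0%E.
Proof.
move=> cK KOm Kb.
pose P (d : R) x := leb R n (E1 `&` cbox x d) = 0%E \/ leb R n (~` E1 `&` cbox x d) = 0%E.
suff H : \forall d \near (0 : R)^'+, K `<=` P d.
  by have [d [/= d0 Hd]] := filter_ex (filterI (nbhs_right_gt (0 : R)) H); exists d.
move/compact_near_coveringP : cK; apply => x Kx.
have [r r0 Hr] : exists2 r : R, 0 < r & leb R n (E1 `&` obox x r) = 0%E \/ leb R n (~` E1 `&` obox x r) = 0%E.
  have [[_ [r r0 Hr]]|n1] := pselect (N1 x); first by exists r => //; right; rewrite setIC.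
  have [[_ [r r0 Hr]]|n0] := pselect (N0 x); first by exists r => //; left; rewrite setIC.
  by exfalso; apply: (Kb x Kx); apply/boundary_representative; [exact: KOm|].
have r2 : 0 < r / 2 by rewrite divr_gt0.
exists ([set y : 'rV[R]_n | forall i, `|y ord0 i - x ord0 i| < r / 2], [set d : R | d < r / 2]).
  split; first by apply/rV_nbhsP; exists (r / 2).
  exact: nbhs_right_lt.
move=> [x' d] /= [Hx' Hd].
have sub : cbox x' d `<=` obox x r.
  move=> y Hy i; have := ler_normD (y ord0 i - x' ord0 i) (x' ord0 i - x ord0 i).
  by rewrite addrA subrK; have := Hx' i; have := Hy i; lra.
have mc := measurable_cbox x' d. have mo := measurable_obox x r.
case: Hr => Hr; [left|right]; apply: leb_sub_null Hr;
  try (by apply: measurableI => //; exact: measurableC); by move=> y [? /sub].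
Qed.

End representative.
End normalization.

(** * Convergence and inclusion of the level sets *)

Section clearing.
Context (R : realType) (n : nat).
Implicit Types (K D Om : set 'rV[R]_n).

Lemma ereal_sup_real (f : nat -> \bar R) : (ereal_sup (range f) < +oo)%E ->
  exists2 S : R, 0 <= S & forall k, (f k <= S%:E)%E.
Proof.
move=> H; exists `|fine (ereal_sup (range f))| => // k.
have : (f k <= ereal_sup (range f))%E by apply: ereal_sup_ubound; exists k.
case: (ereal_sup _) H => [r||]//= _; last by rewrite leeNy_eq => /eqP ->; exact: leNye.
by move=> /le_trans; apply; rewrite lee_fin ler_norm.
Qed.

Lemma cvge0_le (f : nat -> \bar R) : (forall k, 0 <= f k)%E ->
  (forall d : R, 0 < d -> exists N, forall k, (N <= k)%N -> (f k <= d%:E)%E) ->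
  (f @ \oo --> 0)%E.
Proof.
move=> f0 H; apply/fine_cvgP; split.
  have [N HN] := H 1 ltr01; exists N => // k /= /HN fk.
  by rewrite ge0_fin_numE// (le_lt_trans fk)// ltry.
apply/cvgrPdist_le => d d0; have [N HN] := H d d0; exists N => // k /= /HN fk.
rewrite sub0r normrN ger0_norm ?fine_ge0//.
have fin : (f k \is a fin_num)%E by rewrite ge0_fin_numE// (le_lt_trans fk)// ltry.
by rewrite -lee_fin fineK.
Qed.

(** Turns a threshold on the index into one on the value: the finitely many terms before [N] have a
    positive lower bound. The sequence is not assumed monotone. *)
Lemma pos_lower_bound (f : nat -> R) N : (forall k, 0 < f k) ->
  exists2 e : R, 0 < e & forall k, f k < e -> (N <= k)%N.
Proof.
move=> f0; elim: N => [|N [e e0 He]]; first by exists 1.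
exists (Num.min e (f N)); first by rewrite lt_min e0 f0.
move=> k; rewrite lt_min => /andP[/He Nk fk]; rewrite ltn_neqAle Nk andbT.
by apply: contraTneq fk => <-; rewrite ltxx.
Qed.

(** L^1 convergence is known on compact sets only, so the boxes around all points of [K] have to fit
    in a single one. *)
Lemma compact_thicken K D : compact K -> open D -> K `<=` D ->
  exists2 r : R, 0 < r & exists2 K2, compact K2 /\ K2 `<=` D & forall x, K x -> cbox x r `<=` K2.
Proof.
move=> cK oD KD; have [d d0 Hd] := compact_margin cK oD KD.
have d2 : 0 < d / 2 by rewrite divr_gt0.
pose T := [set z : 'rV[R]_n | exists2 x, K x & cbox x (d / 2) z].
exists (d / 2) => //; exists (closure T); last first.
  by move=> x Kx z xz; apply: subset_closure; exists x.
split.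
  have [M [_ HM]] := compact_bounded cK; pose N := `|M| + 1.
  have N0 : 0 <= N by rewrite addr_ge0.
  apply: (subclosed_compact (@closed_closure _ T) (@cbox_compact R n 0 (N + d / 2))).
  have /closure_id -> := @cbox_closed R n 0 (N + d / 2); apply: closureS => z [x Kx xz] i.
  have : `|x| <= N by apply: HM => //; rewrite (le_lt_trans (ler_norm M))// ltrDl.
  move=> /(rV_norm_le _ N0)/(_ i); have := xz i; rewrite mxE subr0.
  by have := ler_normD (z ord0 i - x ord0 i) (x ord0 i); rewrite subrK; lra.
move=> z Hz.
have : nbhs z (obox z (d / 2)) by apply/rV_nbhsP; exists (d / 2).
move=> /Hz[w [[x Kx xw] zw]]; apply: (Hd x Kx) => i.
have := ler_normD (z ord0 i - w ord0 i) (w ord0 i - x ord0 i); rewrite addrA subrK.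
by have := xw i; have := zw i; rewrite (distrC (w ord0 i)); lra.
Qed.

Lemma L1norm_representative Om E1 K : open Om -> measurable E1 -> measurable K -> K `<=` Om ->
  L1norm K (fun y => \1_E1 y - \1_(representative Om E1) y : R) = 0%E.
Proof.
move=> oOm mE1 mK KOm; set E0 := representative Om E1.
have mE0 : measurable E0 by exact: measurable_representative.
have mEK (A : set 'rV[R]_n) : measurable A -> measurable (A `&` K) by move=> ?; exact: measurableI.
have m1 : measurable (~` E0 `&` K `&` E1) by apply: measurableI => //; apply: mEK; exact: measurableC.
have m2 : measurable (E0 `&` (~` E1 `&` K)) by apply: measurableI => //; apply: mEK; exact: measurableC.
have s1 : leb R n (~` E0 `&` K `&` E1) = 0%E.
  have := @leb_representative R n Om E1 oOm mE1 (~` E0 `&` K `&` E1) m1.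
  rewrite -/E0 (_ : E0 `&` (~` E0 `&` K `&` E1) = set0) ?measure0; last first.
    by apply/seteqP; split=> // y [h [[h' _] _]].
  rewrite (_ : E1 `&` _ = ~` E0 `&` K `&` E1); last by apply/seteqP; split=> y [? ?].
  by move=> <- // y [[_ /KOm]].
have s2 : leb R n (E0 `&` (~` E1 `&` K)) = 0%E.
  rewrite leb_representative//; last by move=> y [_ /KOm].
    rewrite (_ : E1 `&` (~` E1 `&` K) = set0) ?measure0//.
    by apply/seteqP; split=> // y [h [h' _]].
  by apply: mEK; exact: measurableC.
have -> : L1norm K (fun y => \1_E1 y - \1_E0 y : R) = L1norm K (\1_((~` E0 `&` K `&` E1) `|` (E0 `&` (~` E1 `&` K)))).
  apply: eq_integral => y /set_mem Ky; rewrite !indicE; congr (_%:E).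
  have [h1|h1] := pselect (E1 y); have [h2|h2] := pselect (E0 y).
  - by rewrite !(mem_set h1, mem_set h2) memNset ?subrr// => -[[[]]|[_ []]].
  - by rewrite (mem_set h1) (memNset h2) mem_set ?subr0//; left.
  - by rewrite (memNset h1) (mem_set h2) mem_set ?sub0r ?normrN//; right.
  - by rewrite !(memNset h1, memNset h2) memNset ?subrr// => -[[_ /h1]|[/h2]].
rewrite L1norm_indic//; last exact: measurableU.
apply/eqP; rewrite -measure_le0; apply: (@le_trans _ _ (leb R n ((~` E0 `&` K `&` E1) `|` (E0 `&` (~` E1 `&` K))))).
  apply: le_measure; rewrite ?inE; [by apply: mEK; exact: measurableU|exact: measurableU|by move=> y []].
by apply: le_trans (measureU2 _ m1 m2) _; rewrite [X in (X + _)%E]s1 [X in (_ + X)%E]s2 adde0.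
Qed.

(** With the right sign, [1 - |v| <= 1 - v^2]; with the wrong one, the distance is at most 2, which
    the second term pays for. *)
Lemma phase_sign_le (v : R) (b : bool) : `|v| <= 1 ->
  `|v - (b%:R - (~~ b)%:R)| <= `|1 - v ^+ 2| + 2 * `|(0 < v)%R%:R - b%:R|.
Proof.
rewrite ler_norml => /andP[h1 h2].
have h3 : 0 <= 1 - v ^+ 2 by nra.
rewrite (ger0_norm h3); have [v0|v0] := ltP 0 v; case: b => /=.
- by rewrite mulr1n mulr0n subr0 subrr normr0 distrC ger0_norm; nra.
- by rewrite mulr1n mulr0n sub0r opprK subr0 normr1 ger0_norm; nra.
- by rewrite mulr1n mulr0n subr0 sub0r normrN normr1 distrC ger0_norm; nra.
- by rewrite mulr1n mulr0n sub0r opprK subrr normr0 ger0_norm; nra.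
Qed.

Lemma occupied_le (v : R) (s : R) (A : set 'rV[R]_n) y : s = 1 \/ s = -1 ->
  (0 < s * v)%R%:R <= `|(0 < v)%R%:R - \1_A y| + \1_(if s == 1 then A else ~` A) y :> R.
Proof.
have ne : (-1 == 1 :> R) = false by apply/negbTE; rewrite lt_eqF//; lra.
case=> ->; rewrite ?eqxx ?ne ?mul1r ?mulN1r ?oppr_gt0 !indicE.
  rewrite -[leLHS](subrK (y \in A)%:R) lerD2r; exact: ler_norm.
rewrite in_setC; have [v0|v0|v0] := ltgtP v 0; case: (y \in A); rewrite /= ?mulr1n ?mulr0n ?subrr ?subr0 ?sub0r ?normrN ?normr1 ?normr0; lra.
Qed.

End clearing.

Theorem corollary1p10 (R : realType) (n : nat) (n_ge1 : (1 <= n)%N)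
  (Om : set 'rV[R]_n) (Om_open : open Om) (Om_bounded : bounded_set Om)
  (lam Lam p m : R)
  (lam_bnd : 0 < lam <= 1) (Lam_bnd : 1 <= Lam) (p_gt1 : 1 < p) (m_gtp : p < m)
  (E : 'rV[R]_n -> R -> 'rV[R]_n -> R)
  (E_bnd : forall (x : 'rV[R]_n) (tau : R) (xi : 'rV[R]_n),
     lam * (enorm xi `^ p + `|1 - tau ^+ 2| `^ m) <= E x tau xi
       <= Lam * (enorm xi `^ p + `|1 - tau ^+ 2| `^ m))
  (pm_gtn : n%:R < p * m / (m - p))
  (Q : R) (Q_ge1 : 1 <= Q)
  (eps : nat -> R) (eps_gt0 : forall k, 0 < eps k) (eps_cvg0 : eps @ \oo --> 0)
  (E_wd : forall k, energy_well_defined p E (eps k) Om)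
  (u : nat -> 'rV[R]_n -> R) (du : nat -> 'rV[R]_n -> 'rV[R]_n)
  (u_W1oo : forall k, W1p Om +oo%E (u k) (du k))
  (* the continuous representative of a function in W^{1,oo} *)
  (u_cont : forall k, {within Om, continuous (u k)})
  (u_bnd : forall k x, Om x -> -1 <= u k x <= 1)
  (u_Qmin : forall k, Q_minimum p E Q (eps k) Om (u k) (du k))
  (du_sup : (ereal_sup (range (fun k =>
     (eps k)%:E * Lp_norm Om +oo (fun x => enorm (du k x)))) < +oo)%E)
  (energy_sup :
     (ereal_sup (range (fun k => energy E (eps k) Om (u k) (du k))) < +oo)%E) :
  exists (E0 : set 'rV[R]_n) (phi : nat -> nat),
    [/\ measurable E0 /\ E0 `<=` Om,
        normalized_in Om E0,
        {homo phi : i j / (i < j)%N},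
        cvg_L1loc Om (fun k => u (phi k)) (fun x => \1_E0 x - \1_(~` E0) x) &
        forall Theta : R, 0 < Theta < 1 ->
        forall delta Rad : R, 0 < delta -> 0 < Rad ->
          compactly_contained (eball 0 Rad) Om ->
          exists2 eps0 : R, 0 < eps0 &
            forall k, eps (phi k) < eps0 ->
              [set x | Om x /\ `|u (phi k) x| <= Theta] `&` eball 0 Rad
                `<=` \bigcup_(x in boundary E0) eball x delta].
Proof.
have [lam0 _] := andP lam_bnd.
have m1 : 1 < m by lra. have m0 : 0 <= m by lra. have p1 : 1 <= p by lra.
have mOm : measurable Om by exact: open_measurable_rV.
have [Lg Lg0 HLg] := ereal_sup_real du_sup.
have [SE SE0 HSE] := ereal_sup_real energy_sup.
pose CE := SE / lam; have CE0 : 0 <= CE by rewrite divr_ge0// ltW.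
have /choice[ug Hug] : forall k, exists ug : ('rV[R]_n -> R) * ('rV[R]_n -> 'rV[R]_n),
    [/\ phase_field Om (Lg / eps k) ug.1 ug.2, forall x, Om x -> u k x = ug.1 x &
      forall i, {ae leb R n, forall x, Om x -> du k x ord0 i = ug.2 x ord0 i}].
  move=> k; have [|v [g H]] := W1oo_phase_field Om_open (divr_ge0 Lg0 (ltW (eps_gt0 k))) (u_W1oo k) (u_cont k) (u_bnd k).
    rewrite -(@lee_pmul2l _ (eps k)%:E)// ?lte_fin//; apply: (le_trans (HLg k)).
    by rewrite -EFinM mulrC divfK// gt_eqF.
  by exists (v, g).
pose v k := (ug k).1; pose g k := (ug k).2.
have Hv k : phase_field Om (Lg / eps k) (v k) (g k) by have [] := Hug k.
have uv k x : Om x -> u k x = v k x by have [_ H _] := Hug k; exact: H.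
have dug k i : {ae leb R n, forall x, Om x -> du k x ord0 i = g k x ord0 i} by have [_ _ H] := Hug k; exact: H.
have Ev k : (L1norm Om (fun y => dens p m (eps k) (v k y) (g k y)) <= (CE * eps k)%:E)%E.
  have [[mu _] Wdu _] := u_W1oo k.
  apply: (@energy_dens _ _ p m lam E (eps k) SE Om (u k) (du k)) => //.
  - by move=> x tau xi; have /andP[] := E_bnd x tau xi.
  - by move=> i; have [] := Wdu i.
  - exact: phase_measurable (Hv k).
  - exact: grad_measurable (Hv k).
  - exact: uv.
have Q0 : 0 <= Q by lra. have Lam0 : 0 <= Lam by lra.
have [C C0 HC] := caccioppoli n lam0 Lam0 p_gt1 m_gtp Q0.
have cacc k : caccioppoli_bound C (p * m / (m - p)) p m (eps k) Om (v k) (g k).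
  move=> s x a b hs a0 eab bOm.
  exact: (HC E E_bnd (eps k) (Lg / eps k) Om (u k) (du k) (v k) (g k) (eps_gt0 k) Om_open
    (divr_ge0 Lg0 (ltW (eps_gt0 k))) (u_Qmin k) (Hv k) (uv k) (dug k) s x a b hs a0 eab bOm).
have ecvg (d : R) : 0 < d -> \forall k \near \oo, eps k <= d.
  move=> d0; move/cvgrPdist_le : eps_cvg0 => /(_ d d0); apply: filterS => k.
  by rewrite sub0r normrN ger0_norm// ltW.
have [E1 [phi [mE1 phiI Hphi]]] := phase_compactness Om_open Om_bounded p1 m0 CE0 eps_gt0 ecvg Hv Ev.
pose E0 := representative Om E1.
have mE0 : measurable E0 by exact: measurable_representative.
have mv k := phase_measurable (Hv k). have mg k := grad_measurable (Hv k).
have mi (A : set 'rV[R]_n) : measurable A -> measurable_fun setT (\1_A : 'rV[R]_n -> R) by move=> ?; exact: measurable_indic.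
have ma k := measurable_phase_ind (mv k).
have compact_meas (K : set 'rV[R]_n) : compact K -> measurable K.
  by move=> cK; apply: closed_measurable_rV; apply: compact_closed => //; exact: norm_hausdorff.
exists E0, phi; split=> //.
- by split=> // x [].
- exact: representative_normalized.
- move=> K cK KOm; have mK := compact_meas K cK.
  apply: cvge0_le => [k|d d0]; first by apply: integral_ge0.
  have d4 : 0 < d / 4 by rewrite divr_gt0.
  have [e1 e10 He1] := phase_defect p m1 CE0 mOm Om_bounded d4.
  have [N HN] := Hphi K cK KOm _ d4.
  have [N' _ HN'] := ecvg e1 e10.
  exists (maxn N N') => k; rewrite geq_max => /andP[Nk N'k].
  have phik : (k <= phi k)%N.
    elim: k {Nk N'k} => // k IH; exact: leq_ltn_trans IH (phiI _ _ (ltnSn k)).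
  have D1 := He1 _ _ _ (HN' _ (leq_trans N'k phik)) (mv (phi k)) (mg (phi k)) (Ev (phi k)).
  pose w y := 1 - v (phi k) y ^+ 2.
  have mw : measurable_fun setT w by apply: measurable_funB => //; exact: measurable_funX.
  pose a y := phase_ind (v (phi k)) y - \1_E1 y.
  have maE : measurable_fun setT a by apply: measurable_funB; [exact: ma|exact: mi].
  pose b y : R := \1_E1 y - \1_E0 y.
  have mb : measurable_fun setT b by apply: measurable_funB; exact: mi.
  have nm (f : 'rV[R]_n -> R) : measurable_fun setT f -> measurable_fun setT (fun y => `|f y|).
    by move=> mf; exact: (measurableT_comp (@normr_measurable R setT) mf).
  (* The error splits into the defect [w], twice the phase error [a] and twice the change [b] from
     [E1] to [E0], which is null. With [d / 4] for the first two, the total is [3 d / 4]. *)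
  apply: (@le_trans _ _ (L1norm K (fun y => `|w y| + (2 * `|a y| + 2 * `|b y|))%R)).
    apply: (@le_trans _ _ (L1norm K (fun y => v (phi k) y - (\1_E0 y - \1_(~` E0) y))%R)).
      by rewrite le_eqVlt; apply/orP; left; apply/eqP; apply: eq_integral => y /set_mem /KOm /uv ->.
    apply: L1norm_le => //.
    + by apply: measurable_funB => //; apply: measurable_funB; apply: mi => //; exact: measurableC.
    + apply: measurable_funD; first exact: nm.
      by apply: measurable_funD; apply: measurable_funM => //; exact: nm.
    + move=> y _; rewrite [leRHS]ger0_norm; last by rewrite !addr_ge0.
      have := @phase_sign_le _ (v (phi k) y) (y \in E0) (phase_bound (Hv (phi k)) y).
      have := ler_normD (a y) (b y).
      rewrite /a /b /w !indicE in_setC addrA subrK /phase_ind; lra.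
  have nw := nm _ mw. have na := nm _ maE. have nb := nm _ mb.
  have m2a : measurable_fun setT (fun y => 2 * `|a y|) by exact: measurable_funM.
  have m2b : measurable_fun setT (fun y => 2 * `|b y|) by exact: measurable_funM.
  have nL (f : 'rV[R]_n -> R) (B : set 'rV[R]_n) : L1norm B (fun y => `|f y|) = L1norm B f.
    by apply: eq_integral => y _; rewrite normr_id.
  rewrite (L1normD_ge0 mK nw) => [|||y]; last 3 first.
  + exact: measurable_funD.
  + by [].
  + by rewrite addr_ge0.
  rewrite (L1normD_ge0 mK m2a m2b) => [|y|y]; last 2 first.
  + by rewrite mulr_ge0.
  + by rewrite mulr_ge0.
  rewrite (L1normZ _ mK na) (L1normZ _ mK nb) !nL (L1norm_representative Om_open mE1 mK KOm) mule0 adde0.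
  rewrite ger0_norm//; apply: (@le_trans _ _ ((d / 4)%:E + 2%:E * (d / 4)%:E)%E).
    apply: leeD; last by apply: lee_wpmul2l => //; exact: HN.
    apply: le_trans D1; exact: (L1norm_subset mOm mK mw KOm).
  by rewrite -EFinM -EFinD lee_fin; lra.
- move=> Theta T01 delta Rad delta0 Rad0 [cB BOm].
  have dn0 : 0 < delta / n.+1%:R by rewrite divr_gt0.
  (* Boxes of this radius lie in the Euclidean balls of radius [delta], and their union is open. *)
  pose U := \bigcup_(x in boundary E0) obox x (delta / n.+1%:R).
  have oU : open U by apply: bigcup_open => x _; exact: open_obox.
  (* Contains every point of the ball that could violate the inclusion, and avoids the boundary of
     [E0], so that one radius and one compact neighbourhood serve all of them. *)
  pose K := closure (eball 0 Rad) `&` ~` U.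
  have cK : compact K by apply: compact_closedI => //; exact: open_closedC.
  have KOm : K `<=` Om by move=> x [/BOm].
  have Kb x : K x -> ~ boundary E0 x.
    by move=> [_ nU] bx; apply: nU; exists x => // i; rewrite subrr normr0.
  have [r1 r10 Hr1] := clear_radius Om_open mE1 cK KOm Kb.
  have [r2 r20 [K2 [cK2 K2Om] Hr2]] := compact_thicken cK Om_open KOm.
  pose r := Num.min r1 r2; have r0 : 0 < r by rewrite lt_min r10.
  have [ka [e1 [ka0 e10 Hd]]] := density_estimate n_ge1 p1 m0 C0 pm_gtn Lg0 T01 CE0 r0.
  have ka2 : 0 < ka / 2 by rewrite divr_gt0.
  have [N HN] := Hphi K2 cK2 K2Om _ ka2.
  have [e2 e20 He2] := pos_lower_bound N (fun k => eps_gt0 (phi k)).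
  exists (Num.min e1 e2); first by rewrite lt_min e10.
  move=> k; rewrite lt_min => /andP[ke1 /He2 Nk] x [[Ox uT] xB].
  apply: contrapT => nx.
  have Kx : K x.
    split; first exact: subset_closure.
    by move=> [z bz xz]; apply: nx; exists z => //; exact: obox_eball.
  have cr1 : cbox x r `<=` cbox x r1 by apply: cbox_subset; rewrite ge_min lexx.
  have cr2 : cbox x r `<=` K2 by apply: subset_trans (Hr2 x Kx); apply: cbox_subset; rewrite ge_min lexx orbT.
  have mr := measurable_cbox x r. have mr1 := measurable_cbox x r1.
  rewrite uv// in uT.
  have ek : 0 < eps (phi k) < e1 by rewrite eps_gt0.
  have {}Hd s (hs : s = 1 \/ s = -1) :=
    Hd (eps (phi k)) Om (v (phi k)) (g (phi k)) ek Om_open (Hv _) (cacc _) (Ev _) s x hs (subset_trans cr2 K2Om) uT.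
  (* [s] is the phase that is absent from the limit near [x]. The density estimate gives it volume
     at least [ka] in the box, whereas the L^1 closeness on [K2] allows at most [ka / 2]. *)
  suff [s hs Z] : exists2 s : R, s = 1 \/ s = -1 & leb R n ((if s == 1 then E1 else ~` E1) `&` cbox x r) = 0%E.
    have msv : measurable_fun setT (fun y => s * v (phi k) y) by exact: measurable_funM.
    have mZ : measurable (if s == 1 then E1 else ~` E1) by case: ifP => // _; exact: measurableC.
    have maE : measurable_fun setT (fun y => phase_ind (v (phi k)) y - \1_E1 y).
      by apply: measurable_funB; [exact: ma|exact: mi].
    have nmaE := measurableT_comp (@normr_measurable R setT) maE.
    have : (ka%:E <= (ka / 2)%:E)%E; last by rewrite lee_fin; lra.
    apply: (le_trans (Hd s hs)); rewrite -(L1norm_bool_gt 0 mr msv).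
    apply: (@le_trans _ _ (L1norm (cbox x r) (fun y => `|phase_ind (v (phi k)) y - \1_E1 y| + \1_(if s == 1 then E1 else ~` E1) y)%R)).
      apply: L1norm_le => //; [exact: measurable_bool_gt|by apply: measurable_funD => //; exact: mi|].
      move=> y _; rewrite ger0_norm// [leRHS]ger0_norm ?addr_ge0//.
      exact: occupied_le.
    rewrite (L1normD_ge0 mr nmaE (mi _ mZ)) => [|y|y]; [|by rewrite /= normr_ge0|by rewrite indicE].
    rewrite (L1norm_indic mr mZ) Z adde0.
    have -> : L1norm (cbox x r) (fun y => `|phase_ind (v (phi k)) y - \1_E1 y|) =
        L1norm (cbox x r) (fun y => phase_ind (v (phi k)) y - \1_E1 y).
      by apply: eq_integral => y _; rewrite normr_id.
    exact: le_trans (L1norm_subset (compact_meas _ cK2) mr maE cr2) (HN k Nk).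
  have ne : (-1 == 1 :> R) = false by apply/negbTE; rewrite lt_eqF//; lra.
  have [H|H] := Hr1 x Kx.
    exists 1; [by left|rewrite eqxx; apply: leb_sub_null H; try exact: measurableI].
    by move=> y [Ey /cr1].
  exists (-1); [by right|rewrite ne; apply: leb_sub_null H].
  + by apply: measurableI => //; exact: measurableC.
  + by apply: measurableI => //; exact: measurableC.
  + by move=> y [Ey /cr1].
Qed.
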